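(* Let $X:\mathbb{D}\to\mathbb{S}^3$ be a smooth conformal immersion, and $\Phi$ (respectively $Z$) its representation in $\mathbb{R}^3$ (respectively $\mathbb{H}^3$) through $\pi$ (respectively $\tilde\pi$). Assume that $X$ (or equivalently $\Phi$ or $Z$) has no umbilic point. Then one of the representations of $X$ (among $\Phi$, $X$, $Z$) is conformally CMC in its ambient space if and only if $\mathcal{Q}$ is holomorphic and $X$ is isothermic. More precisely, $\left(\mathcal{W}_{\mathbb{S}^3}(X)\right)^2-\overline{\omega}^2e^{-4\Lambda}\mathcal{Q}$ is then necessarily real, and: (1) $\Phi$ is conformally CMC (respectively minimal) in $\mathbb{R}^3$ if and only if $\left(\mathcal{W}_{\mathbb{S}^3}(X)\right)^2-\overline{\omega}^2e^{-4\Lambda}\mathcal{Q}=0$; (2) $X$ is conformally CMC (respectively minimal) in $\mathbb{S}^3$ if and only if $\left(\mathcal{W}_{\mathbb{S}^3}(X)\right)^2-\overline{\omega}^2e^{-4\Lambda}\mathcal{Q}<0$; (3) $Z$ is conformally CMC (respectively minimal) in $\mathbb{H}^3$ if and only if $\left(\mathcal{W}_{\mathbb{S}^3}(X)\right)^2-\overline{\omega}^2e^{-4\Lambda}\mathcal{Q}>0$. In particular, conformally minimal immersions satisfy $\mathcal{W}_{\mathbb{S}^3}(X)=0$.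
   Context: $\mathbb{D}$ is the unit disk with complex coordinate $z=x+iy$; scalar products are extended complex-bilinearly. $\mathbb{R}^{m,1}$ is $\mathbb{R}^{m+1}$ with $\langle u,v\rangle=\sum_{i=1}^m u_iv_i-u_{m+1}v_{m+1}$. For the conformal immersion $X$ into $\mathbb{S}^3\subset\mathbb{R}^4$: $|X_z|^2=\langle X_z,X_{\bar z}\rangle$; $\Lambda=\frac12\log(2|X_z|^2)$ is the conformal factor; $\vec N$ is the Gauss map, such that $(X,e^{-\Lambda}X_x,e^{-\Lambda}X_y,\vec N)$ is a direct orthonormal basis of $\mathbb{R}^4$; $h=\left\langle\frac{X_{z\bar z}}{|X_z|^2},\vec N\right\rangle$ is the mean curvature; $\omega=2\langle X_{zz},\vec N\rangle$ is the tracefree curvature; umbilic points are the zeros of $\omega$. Set $\mathcal{W}_{\mathbb{S}^3}(X)=h_{z\bar z}+\frac{|\omega|^2e^{-2\Lambda}}{2}h$. The conformal Gauss map is $Y=h\begin{pmatrix}X\\1\end{pmatrix}+\begin{pmatrix}\vec N\\0\end{pmatrix}\in\mathbb{R}^{4,1}$, and Bryant's functional is $\mathcal{Q}=\langle Y_{zz},Y_{zz}\rangle$. $X$ is isothermic if around each point of $\mathbb{D}$ there exists a local conformal reparametrization in which the tracefree curvature $\omega$ is real. Representations: $X=\pi^{-1}\circ\Phi=\frac{1}{1+|\Phi|^2}(2\Phi,|\Phi|^2-1)$, where $\pi(x,y,z,t)=\frac{1}{1-t}(x,y,z)$ is the stereographic projection from the north pole. $Z=\tilde\pi^{-1}\circ\Phi=\frac{1}{1-|\Phi|^2}(2\Phi,|\Phi|^2+1)\in\mathbb{H}^3=\{(x,y,z,t)\in\mathbb{R}^{3,1}: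 x^2+y^2+z^2-t^2+1=0,\ t\ge0\}$, where $\tilde\pi:\mathbb{H}^3\to B_1(0)$, $\tilde\pi(x,y,z,t)=\frac{1}{1+t}(x,y,z)$, and $B_1(0)$ is the unit ball of $\mathbb{R}^3$; $Z$ is considered whenever $\Phi(\mathbb{D})\subset B_1(0)$. Definition: $\Phi$ (respectively $X$, $Z$) is conformally CMC (respectively minimal) if and only if there exists a conformal diffeomorphism $\varphi$ of $\mathbb{R}^3\cup\{\infty\}$ (respectively of $\mathbb{S}^3$, of $\mathbb{H}^3$) such that $\varphi\circ\Phi$ (respectively $\varphi\circ X$, $\varphi\circ Z$) has constant mean curvature (respectively is minimal, i.e. has zero mean curvature) in $\mathbb{R}^3$ (respectively $\mathbb{S}^3$, $\mathbb{H}^3$).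
   Formalization: For H^3 the conformal diffeomorphism is one of R^3∪{∞} carrying Φ into the ball model, as those of H^3 itself are only isometries; in (1)–(3) ''respectively minimal'' means the stated sign condition together with W_{S^3}(X)=0; the literal readings are false. *)

(* Defs.v *)
From HB Require Import structures.
From mathcomp Require Import all_boot all_order all_algebra.
From mathcomp Require Import all_classical all_reals all_analysis.
From mathcomp.real_closed Require Import complex.
From mathcomp Require Import ring.
Set Implicit Arguments.
Unset Strict Implicit.
Unset Printing Implicit Defensive.
Import Order.TTheory GRing.Theory Num.Theory.
Import numFieldNormedType.Exports.
Local Open Scope classical_set_scope.
Local Open Scope ring_scope.
Local Open Scope complex_scope.

(* Bilinear scalar product with Gram matrix J: J = 1 is the Euclidean one and
   J = minkowski_gram m is the one of R^{m,1}. *)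
Definition sprod (K : comNzRingType) (n : nat) (J : 'M[K]_n) (u v : 'rV[K]_n) : K :=
  (u *m J *m v^T) 0 0.

Definition minkowski_gram (K : comNzRingType) (m : nat) : 'M[K]_(m + 1) :=
  block_mx 1%:M 0 0 (- 1%:M).

Section Smoothness.
Variables (R : realType) (V W : normedModType R).

Fixpoint Ck (k : nat) (U : set V) (f : V -> W) : Prop :=
  match k with
  | 0 => forall p, U p -> {for p, continuous f}
  | k'.+1 => (forall p, U p -> differentiable f p) /\
             (forall v : V, Ck k' U (fun p => 'D_v f p))
  end.

Definition smooth (U : set V) (f : V -> W) : Prop := forall k, Ck k U f.

End Smoothness.

Section Surfaces.
Variable R : realType.
Local Notation C := R[i].
Local Notation plane := 'rV[R]_2.

(* The point p stands for the complex number z = p_0 + i p_1. *)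
Definition unit_disk : set plane := [set p | p 0 0 ^+ 2 + p 0 1 ^+ 2 < 1].

Definition of_plane (p : plane) : C := p 0 0 +i* p 0 1.
Definition to_plane (z : C) : plane :=
  \row_j (if j == 0 then complex.Re z else complex.Im z).

Definition ex : plane := delta_mx 0 0.
Definition ey : plane := delta_mx 0 1.

Definition cdiff (v : plane) (f : plane -> C) (p : plane) : C :=
  ('D_v (fun q => complex.Re (f q)) p) +i* ('D_v (fun q => complex.Im (f q)) p).

Definition dz (f : plane -> C) (p : plane) : C :=
  (cdiff ex f p - 'i * cdiff ey f p) / 2.
Definition dzbar (f : plane -> C) (p : plane) : C :=
  (cdiff ex f p + 'i * cdiff ey f p) / 2.

Definition dzv (n : nat) (f : plane -> 'rV[C]_n) (p : plane) : 'rV[C]_n :=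
  \row_j dz (fun q => f q 0 j) p.
Definition dzbarv (n : nat) (f : plane -> 'rV[C]_n) (p : plane) : 'rV[C]_n :=
  \row_j dzbar (fun q => f q 0 j) p.

Definition cplx (n : nat) (f : plane -> 'rV[R]_n) (p : plane) : 'rV[C]_n :=
  map_mx (real_complex R) (f p).

(* Complex-bilinear extension of the real scalar product J. *)
Definition csprod (n : nat) (J : 'M[R]_n) (u v : 'rV[C]_n) : C :=
  sprod (map_mx (real_complex R) J) u v.

(* Complex differentiability on U, the plane being identified with C; the
   derivative in the direction 1 is taken over the field C. *)
Definition holomorphic_on (U : set plane) (f : plane -> C) : Prop :=
  forall p, U p ->
    derivable ((fun z : C => f (to_plane z)) : C^o -> C^o) (of_plane p) 1.

Definition conformal_immersion (n : nat) (J : 'M[R]_n) (U : set plane)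
    (f : plane -> 'rV[R]_n) : Prop :=
  smooth U f /\
  forall p, U p ->
    [/\ 0 < sprod J ('D_ex f p) ('D_ex f p),
        sprod J ('D_ex f p) ('D_ex f p) = sprod J ('D_ey f p) ('D_ey f p) &
        sprod J ('D_ex f p) ('D_ey f p) = 0].

(* |f_z|^2 = <f_z, f_zbar> *)
Definition sqnorm_dz (n : nat) (J : 'M[R]_n) (f : plane -> 'rV[R]_n) (p : plane) : C :=
  csprod J (dzv (cplx f) p) (dzbarv (cplx f) p).

Definition conformal_factor (n : nat) (J : 'M[R]_n) (f : plane -> 'rV[R]_n)
    (p : plane) : R :=
  ln (2 * complex.Re (sqnorm_dz J f p)) / 2.

(* <f_{z zbar} / |f_z|^2, N>; for a conformal immersion into R^3 (J = 1, n = 3),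
   S^3 (J = 1, n = 4) or H^3 (J = minkowski_gram 3) with unit normal N, this is half
   the trace of the second fundamental form. *)
Definition mean_curvature (n : nat) (J : 'M[R]_n) (f N : plane -> 'rV[R]_n)
    (p : plane) : C :=
  csprod J ((sqnorm_dz J f p)^-1 *: dzbarv (dzv (cplx f)) p) (cplx N p).

(* e^{-Lambda} times the derivative in the direction v *)
Definition unit_tangent (n : nat) (J : 'M[R]_n) (f : plane -> 'rV[R]_n)
    (v p : plane) : 'rV[R]_n :=
  expR (- conformal_factor J f p) *: 'D_v f p.

(* The rows of F form a direct basis with Gram matrix J. *)
Definition direct_frame (n : nat) (J F : 'M[R]_n) : Prop :=
  F *m J *m F^T = J /\ \det F = 1.

Definition gauss_map_R3 (f N : plane -> 'rV[R]_3) : Prop :=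
  forall p, unit_disk p ->
    direct_frame 1%:M
      (\matrix_(i < 3) nth 0 [:: unit_tangent 1%:M f ex p;
                                 unit_tangent 1%:M f ey p; N p] i).

Definition gauss_map_S3 (X N : plane -> 'rV[R]_4) : Prop :=
  forall p, unit_disk p ->
    direct_frame 1%:M
      (\matrix_(i < 4) nth 0 [:: X p; unit_tangent 1%:M X ex p;
                                 unit_tangent 1%:M X ey p; N p] i).

(* The timelike vector Z comes last, so that the Gram matrix is minkowski_gram 3. *)
Definition gauss_map_H3 (Z N : plane -> 'rV[R]_4) : Prop :=
  forall p, unit_disk p ->
    direct_frame (minkowski_gram R 3)
      (\matrix_(i < 4) nth 0 [:: unit_tangent (minkowski_gram R 3) Z ex p;
                                 unit_tangent (minkowski_gram R 3) Z ey p;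
                                 N p; Z p] i).

Definition has_mean_curvature (n : nat) (J : 'M[R]_n)
    (gauss : (plane -> 'rV[R]_n) -> (plane -> 'rV[R]_n) -> Prop)
    (f : plane -> 'rV[R]_n) (c : R) : Prop :=
  exists2 N, gauss f N &
    forall p, unit_disk p -> mean_curvature J f N p = c%:C.

Definition cmc_R3 := has_mean_curvature 1%:M gauss_map_R3.
Definition cmc_S3 := has_mean_curvature 1%:M gauss_map_S3.
Definition cmc_H3 := has_mean_curvature (minkowski_gram R 3) gauss_map_H3.

Definition S3 : set 'rV[R]_4 := [set x | sprod 1%:M x x = 1].
Definition H3 : set 'rV[R]_4 :=
  [set x | sprod (minkowski_gram R 3) x x + 1 = 0 /\ 0 <= x 0 ord_max].

(* Extension of a map on S^3 to R^4 minus the origin, constant along rays: it is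
   smooth iff the map is, and it has the same differential on tangent vectors. *)
Definition radial (f : 'rV[R]_4 -> 'rV[R]_4) (x : 'rV[R]_4) : 'rV[R]_4 :=
  f ((Num.sqrt (sprod 1%:M x x))^-1 *: x).

Definition smooth_S3 (f : 'rV[R]_4 -> 'rV[R]_4) : Prop :=
  smooth (~` [set 0]) (radial f).

Definition conformal_diffeo_S3 (f : 'rV[R]_4 -> 'rV[R]_4) : Prop :=
  (exists g, [/\ smooth_S3 f, smooth_S3 g,
     forall x, S3 x -> S3 (f x) /\ g (f x) = x &
     forall x, S3 x -> S3 (g x) /\ f (g x) = x]) /\
  (forall x, S3 x -> exists2 lambda : R, 0 < lambda &
     forall u v : 'rV[R]_4, sprod 1%:M u x = 0 -> sprod 1%:M v x = 0 ->
       sprod 1%:M ('D_u (radial f) x) ('D_v (radial f) x)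
       = lambda * sprod 1%:M u v).

(* R^3 with a point at infinity is option 'rV_3, infinity being None; it is
   identified with S^3 by the stereographic projection from the north pole,
   which also carries its smooth and conformal structures. *)
Definition stereo (x : 'rV[R]_4) : option 'rV[R]_3 :=
  if x 0 ord_max == 1 then None
  else Some ((1 - x 0 ord_max)^-1 *: lsubmx (x : 'rV[R]_(3 + 1))).

Definition stereo_inv (u : option 'rV[R]_3) : 'rV[R]_4 :=
  match u with
  | None => row_mx (0 : 'rV[R]_3) (1%:M : 'rV[R]_1)
  | Some y => (1 + sprod 1%:M y y)^-1 *:
      row_mx (2 *: y) ((sprod 1%:M y y - 1)%:M : 'rV[R]_1)
  end.

Definition conformal_diffeo_R3hat (phi : option 'rV[R]_3 -> option 'rV[R]_3) : Prop :=
  conformal_diffeo_S3 (fun x => stereo_inv (phi (stereo x))).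

Definition hstereo (x : 'rV[R]_4) : 'rV[R]_3 :=
  (1 + x 0 ord_max)^-1 *: lsubmx (x : 'rV[R]_(3 + 1)).

Definition hstereo_inv (y : 'rV[R]_3) : 'rV[R]_4 :=
  (1 - sprod 1%:M y y)^-1 *:
    row_mx (2 *: y) ((sprod 1%:M y y + 1)%:M : 'rV[R]_1).

Definition conformally_cmc_R3 (Phi : plane -> option 'rV[R]_3) (c : R) : Prop :=
  exists phi Psi, [/\ conformal_diffeo_R3hat phi,
    forall p, unit_disk p -> phi (Phi p) = Some (Psi p) & cmc_R3 Psi c].

Definition conformally_cmc_S3 (X : plane -> 'rV[R]_4) (c : R) : Prop :=
  exists2 phi, conformal_diffeo_S3 phi & cmc_S3 (fun p => phi (X p)) c.

(* The conformal transformations of H^3 are understood, as for R^3, as those of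
   its conformal compactification: H^3 sits in R^3 with infinity through the ball
   model, i.e. through hstereo. The conformal diffeomorphisms of the open manifold
   H^3 onto itself are only its isometries. A transformation phi maps Z to W
   when phi (hstereo Z) = hstereo W, where hstereo Z = Phi; see
   conformally_cmc_H3E. *)
Definition conformally_cmc_H3 (Phi : plane -> option 'rV[R]_3) (c : R) : Prop :=
  exists phi W, [/\ conformal_diffeo_R3hat phi,
    forall p, unit_disk p -> H3 (W p) /\ phi (Phi p) = Some (hstereo (W p)) &
    cmc_H3 W c].

Definition conformally_CMC_R3 Phi := exists c, conformally_cmc_R3 Phi c.
Definition conformally_CMC_S3 X := exists c, conformally_cmc_S3 X c.
Definition conformally_CMC_H3 Phi := exists c, conformally_cmc_H3 Phi c.
Definition conformally_minimal_R3 Phi := conformally_cmc_R3 Phi 0.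
Definition conformally_minimal_S3 X := conformally_cmc_S3 X 0.
Definition conformally_minimal_H3 Phi := conformally_cmc_H3 Phi 0.

Section SphereInvariants.
Variables X N : plane -> 'rV[R]_4.

Definition tracefree_curvature (p : plane) : C :=
  2 * csprod 1%:M (dzv (dzv (cplx X)) p) (cplx N p).

(* e^{k Lambda} *)
Definition exp_factor (k : R) (p : plane) : C :=
  (expR (k * conformal_factor 1%:M X p))%:C.

Definition willmore (p : plane) : C :=
  dzbar (dz (mean_curvature 1%:M X N)) p
  + `|tracefree_curvature p| ^+ 2 * exp_factor (- 2) p / 2
    * mean_curvature 1%:M X N p.

Definition conformal_gauss_map (p : plane) : 'rV[C]_(4 + 1) :=
  mean_curvature 1%:M X N p *: row_mx (cplx X p) (1%:M : 'rV[C]_1)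
  + row_mx (cplx N p) (0 : 'rV[C]_1).

Definition bryant (p : plane) : C :=
  sprod (minkowski_gram C 4) (dzv (dzv conformal_gauss_map) p)
                        (dzv (dzv conformal_gauss_map) p).

Definition bryant_discriminant (p : plane) : C :=
  willmore p ^+ 2
  - conjc (tracefree_curvature p) ^+ 2 * exp_factor (- 4) p * bryant p.

End SphereInvariants.

(* Reparametrizations of either orientation are allowed; for the reversing ones
   the Gauss map is - N \o psi, which does not affect the realness of omega. *)
Definition isothermic (X N : plane -> 'rV[R]_4) : Prop :=
  forall p, unit_disk p -> exists (U : set plane) (psi : plane -> plane),
    [/\ open U, conformal_immersion 1%:M U psi, {in U &, injective psi},
        psi @` U `<=` unit_disk /\ (psi @` U) p &
        forall q, U q ->
          tracefree_curvature (X \o psi) (N \o psi) q \is Num.real].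

Lemma hstereo_invK (y : 'rV[R]_3) :
  sprod 1%:M y y < 1 -> hstereo (hstereo_inv y) = y.
Proof.
set s := sprod _ _ _ => s1.
have s1N : 1 - s != 0 by rewrite subr_eq0 eq_sym lt_eqF.
have Emax : (ord_max : 'I_4) = rshift 3 (0 : 'I_1) by apply: val_inj.
have El : hstereo_inv y 0 ord_max = (1 - s)^-1 * (s + 1).
  by rewrite /hstereo_inv Emax mxE row_mxEr mxE eqxx mulr1n.
rewrite /hstereo El /hstereo_inv linearZ /= row_mxKl !scalerA -/s.
have -> : 1 + (1 - s)^-1 * (s + 1) = 2 / (1 - s) by field.
have -> : (2 / (1 - s))^-1 * ((1 - s)^-1 * 2) = 1 by field.
by rewrite scale1r.
Qed.

(* When Phi takes its values in the unit ball, so that Z = hstereo_inv \o Phi is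
   defined, conformally_cmc_H3 is a property of Z. *)
Lemma conformally_cmc_H3E (Phi : plane -> 'rV[R]_3) (Z : plane -> 'rV[R]_4) (c : R) :
  (forall p, unit_disk p -> sprod 1%:M (Phi p) (Phi p) < 1) ->
  (forall p, unit_disk p -> Z p = hstereo_inv (Phi p)) ->
  conformally_cmc_H3 (fun p => Some (Phi p)) c <->
  exists phi W, [/\ conformal_diffeo_R3hat phi,
    forall p, unit_disk p ->
      H3 (W p) /\ phi (Some (hstereo (Z p))) = Some (hstereo (W p)) &
    cmc_H3 W c].
Proof.
move=> Phi1 ZE; have E p : unit_disk p -> hstereo (Z p) = Phi p.
  by move=> Dp; rewrite ZE// hstereo_invK//; exact: Phi1.
split=> -[phi [W [cphi phiW Wc]]]; exists phi, W; split=> // p Dp.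
  by rewrite E//; exact: phiW.
by rewrite -E//; exact: phiW.
Qed.

End Surfaces.

(* Main.v *)
Require Import Defs.
From HB Require Import structures.
From mathcomp Require Import all_boot all_order all_algebra perm.
From mathcomp Require Import all_classical all_reals all_analysis.
From mathcomp.real_closed Require Import complex.
From mathcomp Require Import ring lra.
Set Implicit Arguments.
Unset Strict Implicit.
Unset Printing Implicit Defensive.
Import Order.TTheory GRing.Theory Num.Theory.
Import numFieldNormedType.Exports.
Local Open Scope classical_set_scope.
Local Open Scope ring_scope.
Local Open Scope complex_scope.

(** The space forms R^3, S^3 and H^3 are the sections of the light cone of R^{4,1} by the affine hyperplanes
    [<., v> = -1], with v null, timelike or spacelike.  By Liouville's theorem conformal diffeomorphisms are
    Lorentz transformations, and the mean curvature of the surface in the section of v is [- <Y, v>] up to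
    orientation.  So X is conformally CMC in some space form if and only if [<Y, v>] is a constant H for some
    constant vector [v <> 0] of the right causal type, with [H = 0] in the minimal case.

    Put [tau = <(X, 1), v>], [E = |X_z|^2] and [u = omega / (2 E)].  Constancy of [<Y, v>] and the structure
    equations give that tau has no zero, that [tau / omega] is holomorphic, [W tau = E |u|^2 H], and
    [tau^2 (W^2 - ubar^2 Q) = (E |u|^2)^2 <v, v>].  Hence Q is holomorphic, the discriminant has the sign of
    [<v, v>], W vanishes exactly when H does, and a primitive of [(omega / tau)^(1/2)] is a chart in which
    omega is real.

    Conversely, the relations above determine the direction of v from the surface: [theta = conj(omega)_z /
    conj(omega)] is the logarithmic derivative of tau.  If Q is holomorphic and X is isothermic (so that
    [theta_zbar] is real), the candidate V0 is real and satisfies [V0_z = - theta V0], so its direction is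
    constant on the disk. *)

(** * Smooth maps and Wirtinger derivatives *)

(** Normalized by tau = 1, the relations satisfied by v fix its components: theta and conj theta
    along the tangent directions, kappa - h along N, where kappa = W / (E |u|^2) stands for H / tau,
    and the value of tau_{z zbar} fixes the last coordinate. The structure equations then only show
    that V0_z + theta V0 is a multiple of the null vector (X, 1); the equality of the mixed
    derivatives of V0, where the realness of theta_zbar enters again, makes that multiple vanish.

    In Liouville's theorem the conformal map becomes an isometric lift of flat R^3 to the light
    cone. The Gauss equation and the existence of a third index force its second derivatives to be
    constant, so the lift is a quadratic polynomial, which is linear in the standard lift.

    The normal built in the cone need not complete a direct frame. Curvatures and heights are
    therefore compared through their squares, and a smooth function of constant square is constant
    on the disk. Such global statements are all reduced to rays from the origin. *)

Section CkCalculus.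
Variables (R : realType) (V : normedModType R).
Implicit Types (U : set V).

(** The expansion of [f] at [x] only involves nearby values, so it holds for [g] too, and
    [diff_unique] identifies its linear part with the differential of [g]. *)
Lemma near_eq_differentiable (W : normedModType R) (f g : V -> W) (x : V) :
  (\near x, f x = g x) -> differentiable f x -> differentiable g x.
Proof.
move=> fg df.
have gx : g \o shift x = cst (g x) + 'd f x +o_ 0 id.
  apply/eqaddoP => _/posnumP[e].
  have /diff_locally/eqaddoP/(_ e%:num)/(_ [gt0 of e%:num]) := df.
  rewrite -!nbhs_nearE.
  have /= fgx : \forall h \near (0 : V), f (h + x) = g (h + x).
    by move: fg; rewrite (near_shift (0 : V) x) subr0.
  apply: filter_app; near=> h.
  rewrite /= -![(_ + _ : _ -> _) _]/(_ + _) -![(- _ : _ -> _) _]/(- _) /=.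
  have -> : f (h + x) = g (h + x) by exact: (near fgx h).
  by have -> : (cst (f x) + 'd f x : V -> W) h = (cst (g x) + 'd f x : V -> W) h by rewrite /cst /= (nbhs_singleton fg).
have E : 'd g x = 'd f x :> (V -> W) by apply: diff_unique => //; exact: diff_continuous.
by apply/diff_locallyP; rewrite E; split=> //; exact: diff_continuous.
Unshelve. all: by end_near. Qed.

Lemma open_near U p : open U -> U p -> \forall q \near p, U q.
Proof. by move=> oU Up; exact: open_nbhs_nbhs. Qed.

Lemma eq_near_open (T : Type) (f g : V -> T) U p : open U -> U p ->
  (forall q, U q -> f q = g q) -> \near p, f p = g p.
Proof. by move=> oU Up fg; near=> q; apply: fg; near: q; exact: open_near. Unshelve. all: by end_near. Qed.

Lemma eq_derive_open (W : normedModType R) (f g : V -> W) U p v : open U -> U p ->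
  (forall q, U q -> f q = g q) -> 'D_v f p = 'D_v g p.
Proof. by move=> oU Up fg; apply: near_eq_derive; exact: eq_near_open fg. Qed.

Lemma eq_Ck (W : normedModType R) k U (f g : V -> W) : open U ->
  (forall p, U p -> f p = g p) -> Ck k U f -> Ck k U g.
Proof.
elim: k f g => [|k IH] f g oU fg /=.
  move=> cf p Up; suff : g @ p --> g p by []. rewrite -(fg _ Up).
  apply: cvg_trans (cf p Up); apply: near_eq_cvg.
  have := eq_near_open oU Up fg.
  by apply: filterS => q ->.
move=> [df ckf]; split=> [p Up|v].
  by apply: near_eq_differentiable (df p Up); exact: eq_near_open fg.
by apply: IH (ckf v) => // p Up; exact: eq_derive_open fg.
Qed.

Lemma CkW (W : normedModType R) k U (f : V -> W) : Ck k.+1 U f -> Ck k U f.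
Proof.
elim: k f => [|k IH] f /=.
  by move=> [df _] p Up; exact/differentiable_continuous/df.
by move=> [df ckf]; split=> // v; apply: IH (ckf v).
Qed.

Lemma Ck_cst (W : normedModType R) k U (a : W) : open U -> Ck k U (fun=> a).
Proof.
elim: k a => [|k IH] a oU /=; first by move=> p _; exact: cst_continuous.
split=> [p _|v]; first exact: differentiable_cst.
apply: eq_Ck (IH 0 oU) => // p _; by rewrite derive_cst.
Qed.

Implicit Types f g : V -> R.

Lemma Ck_add k U f g : open U -> Ck k U f -> Ck k U g -> Ck k U (fun p => f p + g p).
Proof.
move=> oU; elim: k f g => [|k IH] f g /=.
  by move=> cf cg p Up; apply: continuousD; [exact: cf|exact: cg].
move=> [df cf] [dg cg]; split=> [p Up|v].
  by apply: differentiableD; [exact: df|exact: dg].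
apply: eq_Ck (IH _ _ (cf v) (cg v)) => // p Up.
by rewrite [RHS](@deriveD _ _ _ f g)//; apply: diff_derivable; [exact: df|exact: dg].
Qed.

Lemma Ck_opp k U f : open U -> Ck k U f -> Ck k U (fun p => - f p).
Proof.
move=> oU; elim: k f => [|k IH] f /=.
  by move=> cf p Up; apply: continuousN; exact: cf.
move=> [df cf]; split=> [p Up|v].
  by apply: differentiableN; exact: df.
apply: eq_Ck (IH _ (cf v)) => // p Up.
by rewrite [RHS](@deriveN _ _ _ f)//; apply: diff_derivable; exact: df.
Qed.

Lemma Ck_mul k U f g : open U -> Ck k U f -> Ck k U g -> Ck k U (fun p => f p * g p).
Proof.
move=> oU; elim: k f g => [|k IH] f g.
  by move=> cf cg p Up; apply: continuousM; [exact: cf|exact: cg].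
move=> cf cg; have cf' := CkW cf; have cg' := CkW cg.
move: cf cg => [df cf] [dg cg]; split=> [p Up|v].
  by apply: differentiableM; [exact: df|exact: dg].
have := Ck_add oU (IH _ _ cf' (cg v)) (IH _ _ cg' (cf v)).
apply: eq_Ck => // p Up; rewrite [RHS](@deriveM _ _ f g)//.
- exact/diff_derivable/df.
- exact/diff_derivable/dg.
Qed.

(** The derivative of the inverse contains the inverse itself, so the induction on [k] feeds on its
    own conclusion one order lower. [Ck_sqrt] works in the same way. *)
Lemma Ck_inv k U f : open U -> (forall p, U p -> f p != 0) ->
  Ck k U f -> Ck k U (fun p => (f p)^-1).
Proof.
move=> oU f0; elim: k => [|k IH].
  by move=> cf p Up; apply: continuousV; [exact: f0|exact: cf].
move=> cf; have cf' := CkW cf; have IHf := IH cf'.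
move: cf => [df cf]; split=> [p Up|v].
  by apply: differentiableV; [exact: df|exact: f0].
have := Ck_opp oU (Ck_mul oU (Ck_mul oU IHf IHf) (cf v)).
apply: eq_Ck => // p Up; rewrite [RHS](@deriveV _ _ f)//.
- by rewrite /GRing.scale /= expr2 invfM mulNr.
- exact: f0.
- exact/diff_derivable/df.
Qed.

Lemma derive_comp1 (h : R -> R) f p v (dh : R) : differentiable f p ->
  is_derive (f p) 1 h dh -> 'D_v (h \o f) p = dh * 'D_v f p.
Proof.
move=> df [dh1 dhE].
have dh2 : differentiable h (f p) by exact/derivable1_diffP.
rewrite deriveE; last exact: differentiable_comp.
rewrite diff_comp// /= deriveE//.
have hE (y : R) : 'd h (f p) y = y * 'd h (f p) 1.
  by rewrite -{1}[y]mulr1 -[y * 1]/(y *: 1) linearZ.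
by rewrite hE -[X in _ * X = _]deriveE// dhE -deriveE// mulrC.
Qed.

Lemma differentiable_comp1 (h : R -> R) f p (dh : R) : differentiable f p ->
  is_derive (f p) 1 h dh -> differentiable (h \o f) p.
Proof.
by move=> df [dh1 _]; apply: differentiable_comp => //; exact/derivable1_diffP.
Qed.

Lemma Ck_sqrt k U f : open U -> (forall p, U p -> 0 < f p) ->
  Ck k U f -> Ck k U (fun p => Num.sqrt (f p)).
Proof.
move=> oU f0; elim: k => [|k IH].
  move=> cf p Up; apply: (@continuous_comp _ _ _ f (@Num.sqrt R)); first exact: cf.
  exact: sqrt_continuous.
move=> cf; have cf' := CkW cf; have IHf := IH cf'.
move: cf => [df cf]; split=> [p Up|v].
  by apply: (differentiable_comp1 (df p Up) (is_derive1_sqrt (f0 _ Up))).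
have sf0 p : U p -> 2 * Num.sqrt (f p) != 0.
  by move=> Up; rewrite mulf_neq0// sqrtr_eq0 -ltNge f0.
have c2 : Ck k U (fun=> 2 : R) by exact: Ck_cst.
have := Ck_mul oU (Ck_inv oU sf0 (Ck_mul oU c2 IHf)) (cf v).
apply: eq_Ck => // p Up.
by rewrite [RHS](derive_comp1 v (df p Up) (is_derive1_sqrt (f0 _ Up))).
Qed.

End CkCalculus.

Section VectorCalculus.
Variables (R : realType) (V : normedModType R).
Implicit Types (U : set V).

Lemma derive_coord n (f : V -> 'rV[R]_n) p v j : differentiable f p ->
  'D_v (fun q => f q 0 j) p = 'D_v f p 0 j.
Proof. by move=> df; rewrite derive_mx ?mxE//; exact: diff_derivable. Qed.

Lemma differentiable_coord_comp n (f : V -> 'rV[R]_n) p j : differentiable f p ->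
  differentiable (fun q => f q 0 j) p.
Proof.
move=> df; apply: (@differentiable_comp _ _ _ _ f (fun M : 'rV[R]_n => M 0 j)) => //.
exact: differentiable_coord.
Qed.

Lemma differentiable_row n (f : V -> 'rV[R]_n) p :
  (forall j, differentiable (fun q => f q 0 j) p) -> differentiable f p.
Proof.
move=> df.
have -> : f = \sum_(j < n) (fun q => f q 0 j *: (delta_mx 0 j : 'rV[R]_n)).
  by apply/funext => q; rewrite fct_sumE [LHS]row_sum_delta.
by apply: differentiable_sum => j; exact: differentiableZl.
Qed.

Lemma Ck_coord n k U (f : V -> 'rV[R]_n) j : open U ->
  Ck k U f -> Ck k U (fun q => f q 0 j).
Proof.
move=> oU; elim: k f => [|k IH] f /=.
  move=> cf p Up; apply: (@continuous_comp _ _ _ f (fun M : 'rV[R]_n => M 0 j)).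
    exact: cf.
  exact: coord_continuous.
move=> [df cf]; split=> [p Up|v].
  by apply: differentiable_coord_comp; exact: df.
by apply: eq_Ck (IH _ (cf v)) => // p Up; rewrite derive_coord//; exact: df.
Qed.

Lemma Ck_row n k U (f : V -> 'rV[R]_n) : open U ->
  (forall j, Ck k U (fun q => f q 0 j)) -> Ck k U f.
Proof.
move=> oU; elim: k f => [|k IH] f /=.
  move=> cf p Up.
  have -> : f = \sum_(j < n) (fun q => f q 0 j *: (delta_mx 0 j : 'rV[R]_n)).
    by apply/funext => q; rewrite fct_sumE [LHS]row_sum_delta.
  elim/big_ind : _ => [|g h cg ch|j _].
  - exact: cst_continuous.
  - exact: continuousD.
  - by apply: continuousZr_tmp; exact: cf.
move=> cf; have df p : U p -> differentiable f p.
  by move=> Up; apply: differentiable_row => j; case: (cf j) => + _; exact.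
split=> [//|v]; apply: IH => j; case: (cf j) => _ /(_ v).
by apply: eq_Ck => // p Up; rewrite derive_coord//; exact: df.
Qed.

Lemma Ck_sum (I : Type) (r : seq I) (P : pred I) k U (f : I -> V -> R) : open U ->
  (forall i, P i -> Ck k U (f i)) -> Ck k U (fun p => \sum_(i <- r | P i) f i p).
Proof.
move=> oU cf; elim: r => [|i r IH].
  by apply: eq_Ck (Ck_cst k (0 : R) oU) => // p _; rewrite big_nil.
case: (boolP (P i)) => Pi.
  by apply: eq_Ck (Ck_add oU (cf _ Pi) IH) => // p _; rewrite big_cons Pi.
by apply: eq_Ck IH => // p _; rewrite big_cons (negbTE Pi).
Qed.

Lemma Ck_prod (I : Type) (r : seq I) (P : pred I) k U (f : I -> V -> R) : open U ->
  (forall i, P i -> Ck k U (f i)) -> Ck k U (fun p => \prod_(i <- r | P i) f i p).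
Proof.
move=> oU cf; elim: r => [|i r IH].
  by apply: eq_Ck (Ck_cst k (1 : R) oU) => // p _; rewrite big_nil.
case: (boolP (P i)) => Pi.
  by apply: eq_Ck (Ck_mul oU (cf _ Pi) IH) => // p _; rewrite big_cons Pi.
by apply: eq_Ck IH => // p _; rewrite big_cons (negbTE Pi).
Qed.

Lemma derive_row n (W : normedModType R) (f : 'rV[R]_n -> W) p v : differentiable f p ->
  'D_v f p = \sum_(j < n) v 0 j *: 'D_(delta_mx 0 j) f p.
Proof.
move=> df; rewrite deriveE// {1}[v]row_sum_delta linear_sum.
by apply: eq_bigr => j _; rewrite linearZ deriveE.
Qed.

Lemma derive_comp (V' W : normedModType R) (f : V -> V') (g : V' -> W) p v :
  differentiable f p -> differentiable g (f p) ->
  'D_v (g \o f) p = 'D_('D_v f p) g (f p).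
Proof.
move=> df dg; rewrite deriveE; last exact: differentiable_comp.
by rewrite diff_comp// /= !deriveE.
Qed.

(** By [derive_row] the derivative of [g \o f] is a sum of products of coordinates of ['D_v f] with
    partial derivatives of [g] composed with [f]; the latter are again compositions, of one order
    less. *)
Lemma Ck_comp n k U (W : set 'rV[R]_n) (f : V -> 'rV[R]_n) (g : 'rV[R]_n -> R) :
  open U -> open W -> (forall p, U p -> W (f p)) ->
  Ck k U f -> Ck k W g -> Ck k U (g \o f).
Proof.
move=> oU oW fUW; elim: k f g fUW => [|k IH] f g fUW.
  move=> cf cg p Up; apply: continuous_comp; first exact: cf.
  by apply: cg; exact: fUW.
move=> cf; have cf' := CkW cf; move: cf => [df cf] [dg cg]; split=> [p Up|v].
  by apply: differentiable_comp; [exact: df|apply: dg; exact: fUW].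
have : Ck k U (fun p => \sum_(j < n) 'D_v f p 0 j * 'D_(delta_mx 0 j) g (f p)).
  apply: Ck_sum => // j _; apply: Ck_mul => //; first exact: Ck_coord (cf v).
  exact: (IH f ('D_(delta_mx 0 j) g) fUW cf' (cg _)).
apply: eq_Ck => // p Up.
have dgp := dg _ (fUW _ Up); have dfp := df _ Up.
by rewrite (derive_comp v dfp dgp) (derive_row _ dgp).
Qed.

Lemma is_derive_line (W : normedModType R) (f : V -> W) a v t :
  differentiable f (a + t *: v) ->
  is_derive t 1 (fun t : R => f (a + t *: v)) ('D_v f (a + t *: v)).
Proof.
move=> /(@diff_derivable _ _ _ _ _ v) df.
have E : (fun h : R => h^-1 *: (((fun t : R => f (a + t *: v)) \o shift t) (h *: (1 : R)) - f (a + t *: v)))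
   = (fun h : R => h^-1 *: ((f \o shift (a + t *: v)) (h *: v) - f (a + t *: v))).
  apply/funext => h /=; congr (_ *: (f _ - _)).
  by rewrite -[h *: 1]/(h * 1) mulr1 scalerDl addrCA.
split; first by rewrite /derivable E.
by rewrite /derive E.
Qed.

Lemma MVT_line (f : V -> R) a v s : 0 < s ->
  (forall t, 0 <= t <= s -> differentiable f (a + t *: v)) ->
  exists2 c, 0 < c < s & f (a + s *: v) - f a = s * 'D_v f (a + c *: v).
Proof.
move=> s0 df.
have [||c] := @MVT R (fun t => f (a + t *: v)) (fun t => 'D_v f (a + t *: v)) 0 s s0.
- move=> x; rewrite in_itv/= => /andP[x0 xs]; apply: is_derive_line; apply: df.
  by rewrite !ltW.
- apply: derivable_within_continuous => x; rewrite in_itv/= => xs.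
  by have [] := is_derive_line (df x xs).
- rewrite in_itv/= => cs; rewrite scale0r addr0 subr0 => ->; exists c => //.
  by rewrite mulrC.
Qed.

Lemma near_line2 (P : set V) p u v : (\forall q \near p, P q) ->
  exists2 s : R, 0 < s & forall a b, 0 <= a <= s -> 0 <= b <= s ->
    P (p + a *: u + b *: v).
Proof.
move=> /nbhs_ballP[r /= r0 rP].
(* The summand 1 keeps the denominator positive when [u = v = 0] and makes the final inequality
   strict. *)
exists (r / (`|u| + `|v| + 1)) => [|a b /andP[a0 ar] /andP[b0 br]].
  by rewrite divr_gt0// ltr_wpDl// addr_ge0.
apply: rP; rewrite -ball_normE /= opprD addrA opprD addrA subrr sub0r.
rewrite -opprD normrN (le_lt_trans (ler_normD _ _))// !normrZ !ger0_norm//.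
have N0 : 0 < `|u| + `|v| + 1 by rewrite ltr_wpDl// addr_ge0.
rewrite (@le_lt_trans _ _ (r / (`|u| + `|v| + 1) * (`|u| + `|v|)))//.
  by rewrite mulrDr lerD// ler_wpM2r.
rewrite mulrAC ltr_pdivrMr// ltr_pM2l//; by rewrite ltrDl.
Qed.

(** The second difference of [f] over the parallelogram with sides [s *: u] and [s *: v] is
    symmetric in [u] and [v]. Two applications of the mean value theorem write it as the square of
    [s] times either mixed derivative, at two possibly different points; continuity of both at [p]
    does the rest. *)
Lemma derive_sym U (f : V -> R) p u v : open U -> U p -> Ck 2 U f ->
  'D_u ('D_v f) p = 'D_v ('D_u f) p.
Proof.
move=> oU Up [df ck1].
have d1 w q : U q -> differentiable ('D_w f) q by move=> Uq; case: (ck1 w) => + _; exact.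
have c2 w w' : {for p, continuous ('D_w' ('D_w f))}.
  by have [_ /(_ w') /=] := ck1 w; exact.
suff H e : 0 < e -> `|'D_u ('D_v f) p - 'D_v ('D_u f) p| <= e.
  apply/eqP; rewrite -subr_eq0 -normr_eq0 eq_le normr_ge0 andbT.
  by apply/ler_addgt0Pl => e e0; rewrite addr0 H.
move=> e0.
have e2 : 0 < e / 2 by rewrite divr_gt0.
have nUV : \forall q \near p, [/\ U q,
    `|'D_u ('D_v f) p - 'D_u ('D_v f) q| < e / 2 &
    `|'D_v ('D_u f) p - 'D_v ('D_u f) q| < e / 2].
  have h0 := open_near oU Up.
  have /cvgrPdist_lt/(_ _ e2) h1 := c2 v u.
  have /cvgrPdist_lt/(_ _ e2) h2 := c2 u v.
  by near=> q; split; [exact: (near h0 q)|exact: (near h1 q)|exact: (near h2 q)].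
have [s s0 Hs] := near_line2 u v nUV.
have key w z : (forall a b, 0 <= a <= s -> 0 <= b <= s -> U (p + a *: w + b *: z)) ->
    exists a b, [/\ 0 <= a <= s, 0 <= b <= s &
     f (p + s *: w + s *: z) - f (p + s *: w) - (f (p + s *: z) - f p) =
     s * (s * 'D_w ('D_z f) (p + a *: w + b *: z))].
  move=> UH.
  have s00 : 0 <= (0 : R) <= s by rewrite lexx ltW.
  have ss : 0 <= s <= s by rewrite lexx ltW.
  have inn c : 0 < c < s -> 0 <= c <= s by move=> /andP[? ?]; rewrite !ltW.
  (* [g] is the difference in the direction [w]. The mean value theorem is applied to [g] along [z],
     then to ['D_z f] along [w]. *)
  pose g (q : V) := f (q + s *: w) - f q.
  have dg t : 0 <= t <= s -> is_derive (p + t *: z) z g ('D_z f (p + s *: w + t *: z) - 'D_z f (p + t *: z)).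
    move=> ts; apply: is_deriveB.
      have df1 : differentiable f ((p + t *: z) + s *: w).
        by apply: df; rewrite addrAC; exact: UH.
      rewrite addrAC; split.
        have -> : (fun q => f (q + s *: w)) = f \o shift (s *: w) by [].
        apply/diff_derivable/differentiable_comp => //=.
      change ('D_z (f \o shift (s *: w)) (p + t *: z) = 'D_z f (p + t *: z + s *: w)).
      rewrite derive_comp//=.
      have -> // : 'D_z (shift (s *: w)) (p + t *: z) = z.
      have -> : shift (s *: w) = id + cst (s *: w) :> (V -> V) by [].
      by rewrite deriveD// derive_id derive_cst addr0.
    split=> //; apply/diff_derivable/df.
    by have := UH 0 t s00 ts; rewrite scale0r addr0.
  have dg' t : 0 <= t <= s -> differentiable g (p + t *: z).
    move=> ts; apply: differentiableB.
      apply: (@differentiable_comp _ _ _ _ (shift (s *: w)) f) => //=.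
      by apply: df; rewrite addrAC; exact: UH.
    by apply: df; have := UH 0 t s00 ts; rewrite scale0r addr0.
  have [b bs Eb] := MVT_line s0 dg'.
  have bs' := inn _ bs.
  have [|a as_ Ea] := @MVT_line ('D_z f) (p + b *: z) w s s0.
    by move=> t ts; apply: d1; rewrite addrAC; exact: UH.
  exists a, b; split=> //; first exact: inn.
  move: Eb; rewrite (@derive_val _ _ _ _ _ _ _ (dg b bs')).
  rewrite (addrAC p (s *: w) (b *: z)) Ea => Eb.
  rewrite (addrAC p (a *: w)) -Eb /g (addrAC p (s *: z)); ring.
have [a [b [as_ bs E1]]] := key u v (fun a b ha hb => let: And3 h _ _ := Hs a b ha hb in h).
have [|c [d [cs ds E2]]] := key v u.
  by move=> x y hx hy; rewrite addrAC; have [] := Hs y x hy hx.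
have EE : 'D_u ('D_v f) (p + a *: u + b *: v) = 'D_v ('D_u f) (p + c *: v + d *: u).
  have sn0 : s != 0 by rewrite gt_eqF.
  move: E1 E2; rewrite (addrAC p (s *: v)).
  move: ('D_u _ (_ + _ + _)) ('D_v _ (_ + _ + _)) (f _) (f _) (f _) (f _) => A B x1 x2 x3 x4 E1 E2.
  have E3 : s * (s * A) = s * (s * B) by rewrite -E1 -E2; ring.
  exact: (mulfI sn0 (mulfI sn0 E3)).
have [_ H1 _] := Hs a b as_ bs.
have [_ _ ] := Hs d c ds cs.
rewrite [p + d *: u + _]addrAC -EE => H2.
move: H1 H2; move: ('D_u ('D_v f) p) ('D_v ('D_u f) p) ('D_u ('D_v f) (p + a *: u + b *: v)) => A B C H1 H2.
apply: le_trans (ler_distD C A B) _; rewrite (splitr e); apply: lerD; apply: ltW => //.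
by rewrite distrC.
Unshelve. all: by end_near. Qed.

(** Constancy on a star-shaped domain: on the disk it takes the place of a connectedness
    argument. *)
Lemma derive0_ray (f : V -> R) (p : V) :
  (forall t : R, 0 <= t <= 1 -> differentiable f (t *: p)) ->
  (forall t : R, 0 <= t <= 1 -> 'D_p f (t *: p) = 0) -> f p = f 0.
Proof.
move=> df Df; have [|c /andP[c0 c1]] := @MVT_line f 0 p 1 ltr01.
  by move=> t t01; rewrite add0r; exact: df.
rewrite !add0r !scale1r Df ?mulr0 ?(ltW c0) ?(ltW c1)// => /eqP.
by rewrite subr_eq0 => /eqP.
Qed.

(** Gronwall's argument: with [A] the maximum of the coefficient on the segment, the square of [f]
    multiplied by [exp (- 2 A t)] is nonnegative, nonincreasing and starts at 0. *)
Lemma linear_ode_ray (f a : V -> R) (p : V) :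
  (forall t : R, 0 <= t <= 1 -> differentiable f (t *: p)) ->
  (forall t : R, 0 <= t <= 1 -> {for t *: p, continuous a}) ->
  (forall t : R, 0 <= t <= 1 -> 'D_p f (t *: p) = a (t *: p) * f (t *: p)) ->
  f 0 = 0 -> f p = 0.
Proof.
move=> df ca Df f0.
have line (t : R) : 0 <= t <= 1 -> is_derive t 1 (fun t : R => f (t *: p)) (a (t *: p) * f (t *: p)).
  move=> t01; have := @is_derive_line _ f 0 p t; rewrite add0r => /(_ (df t t01)).
  rewrite (Df t t01); under eq_fun do rewrite add0r; by [].
have ac : {within `[0, 1], continuous (fun t : R => a (t *: p))}.
  apply: continuous_in_subspaceT => t; rewrite inE/= in_itv/= => t01.
  apply: (@continuous_comp _ _ _ (fun t : R => t *: p) a); last exact: ca.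
  exact: scalel_continuous.
have [c _ cmax] := EVT_max ler01 ac.
pose A := a (c *: p).
pose g (t : R) := (f (t *: p)) ^+ 2 * expR (- (2 * A) * t).
have dg (t : R) : 0 <= t <= 1 -> is_derive t 1 g
   (2 * (a (t *: p) - A) * (f (t *: p)) ^+ 2 * expR (- (2 * A) * t)).
  move=> t01; have H := line t t01.
  have He : is_derive t 1 (fun t => expR (- (2 * A) * t)) (expR (- (2 * A) * t) * (- (2 * A))).
    have Hl : is_derive t 1 (fun t : R => - (2 * A) * t) (- (2 * A)).
      have := is_deriveZ (- (2 * A)) (is_derive_id t (1 : R)).
      by rewrite -[X in is_derive _ _ _ X]/(- (2 * A) * 1) mulr1.
    exact: (is_derive1_comp (is_derive_expR _) Hl).
  apply: is_derive_eq.
  rewrite /GRing.scale/=; ring.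
have g1 : g 1 <= g 0.
  apply: (@ler0_derive1_le_cc _ g 0 1) => //.
  - move=> x; rewrite in_itv/= => /andP[x0 x1].
    by have [|] := dg x; rewrite ?(ltW x0) ?(ltW x1).
  - move=> x; rewrite in_itv/= => /andP[x0 x1].
    have x01 : 0 <= x <= 1 by rewrite !ltW.
    rewrite derive1E (@derive_val _ _ _ _ _ _ _ (dg x x01)).
    rewrite mulr_le0_ge0 ?expR_ge0// mulr_le0_ge0 ?sqr_ge0//.
    rewrite pmulr_rle0// subr_le0; apply: cmax.
    by rewrite in_itv.
  - apply: derivable_within_continuous => x; rewrite in_itv/= => x01.
    by have [] := dg x x01.
  - by rewrite in_itv/= ler01 lexx.
  - by rewrite in_itv/= ler01 lexx.
move: g1; rewrite /g scale0r f0 expr0n mul0r scale1r mulr1 => g1.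
apply/eqP; rewrite -sqrf_eq0 eq_le sqr_ge0 andbT.
by move: g1; rewrite pmulr_lle0// expR_gt0.
Qed.

End VectorCalculus.

Section SmoothReal.
Variables (R : realType) (V : normedModType R).
Implicit Types (U : set V) (f g : V -> R).

Lemma smooth_add U f g : open U -> smooth U f -> smooth U g -> smooth U (fun p => f p + g p).
Proof. by move=> oU sf sg k; exact: Ck_add. Qed.

Lemma smooth_opp U f : open U -> smooth U f -> smooth U (fun p => - f p).
Proof. by move=> oU sf k; exact: Ck_opp. Qed.

Lemma smooth_mul U f g : open U -> smooth U f -> smooth U g -> smooth U (fun p => f p * g p).
Proof. by move=> oU sf sg k; exact: Ck_mul. Qed.

Lemma smooth_inv U f : open U -> (forall p, U p -> f p != 0) ->
  smooth U f -> smooth U (fun p => (f p)^-1).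
Proof. by move=> oU f0 sf k; exact: Ck_inv. Qed.

Lemma smooth_sqrt U f : open U -> (forall p, U p -> 0 < f p) ->
  smooth U f -> smooth U (fun p => Num.sqrt (f p)).
Proof. by move=> oU f0 sf k; exact: Ck_sqrt. Qed.

Lemma smooth_cst (W : normedModType R) U (a : W) : open U -> smooth U (fun=> a).
Proof. by move=> oU k; exact: Ck_cst. Qed.

Lemma eq_smooth (W : normedModType R) U (f g : V -> W) : open U ->
  (forall p, U p -> f p = g p) -> smooth U f -> smooth U g.
Proof. by move=> oU fg sf k; exact: eq_Ck (sf k). Qed.

Lemma smooth_derive (W : normedModType R) U (f : V -> W) v : smooth U f -> smooth U ('D_v f).
Proof. by move=> sf k; have [_] := sf k.+1; exact. Qed.

Lemma smooth_differentiable (W : normedModType R) U (f : V -> W) p : smooth U f -> U p -> differentiable f p.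
Proof. by move=> sf Up; have [+ _] := sf 1; exact. Qed.

Lemma smooth_continuous (W : normedModType R) U (f : V -> W) p : smooth U f -> U p -> {for p, continuous f}.
Proof. by move=> sf Up; exact: sf 0 p Up. Qed.

Lemma smooth_coord n U (f : V -> 'rV[R]_n) j : open U -> smooth U f -> smooth U (fun q => f q 0 j).
Proof. by move=> oU sf k; exact: Ck_coord. Qed.

Lemma smooth_row n U (f : V -> 'rV[R]_n) : open U -> (forall j, smooth U (fun q => f q 0 j)) -> smooth U f.
Proof. by move=> oU sf k; apply: Ck_row => // j; exact: sf. Qed.

Lemma smooth_sum (I : Type) (r : seq I) (P : pred I) U (f : I -> V -> R) : open U ->
  (forall i, P i -> smooth U (f i)) -> smooth U (fun p => \sum_(i <- r | P i) f i p).
Proof. by move=> oU sf k; apply: Ck_sum => // i Pi; exact: sf. Qed.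

Lemma smooth_comp n U (W : set 'rV[R]_n) (f : V -> 'rV[R]_n) (g : 'rV[R]_n -> R) :
  open U -> open W -> (forall p, U p -> W (f p)) ->
  smooth U f -> smooth W g -> smooth U (g \o f).
Proof. by move=> oU oW UW sf sg k; exact: Ck_comp (sf k) (sg k). Qed.

Lemma smoothW (W : normedModType R) U U' (f : V -> W) : U' `<=` U -> smooth U f -> smooth U' f.
Proof.
move=> UU sf k; elim: k f sf => [|k IH] f sf /=.
  by move=> p /UU; exact: sf 0 p.
split=> [p /UU|v]; first by have [+ _] := sf 1; exact.
by apply: IH; exact: smooth_derive.
Qed.

End SmoothReal.

(** * Smooth complex-valued maps on the plane *)

Section ComplexCalculus.
Variable R : realType.
Local Notation C := R[i].
Local Notation plane := 'rV[R]_2.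
Implicit Types (U : set plane) (f g : plane -> C).

(** A type class, so that the smoothness conditions of the derivation rules are found by instance
    search. Openness of [U] is included because two functions that agree on [U] have the same
    derivatives there only if [U] is open. *)
Class csmooth U f : Prop := Csmooth {
  csmooth_open : open U;
  csmooth_re : smooth U (fun q => complex.Re (f q));
  csmooth_im : smooth U (fun q => complex.Im (f q)) }.

Lemma ReD (x y : C) : complex.Re (x + y) = complex.Re x + complex.Re y.
Proof. by case: x y => [? ?] [? ?]. Qed.
Lemma ImD (x y : C) : complex.Im (x + y) = complex.Im x + complex.Im y.
Proof. by case: x y => [? ?] [? ?]. Qed.
Lemma ReN (x : C) : complex.Re (- x) = - complex.Re x. Proof. by case: x. Qed.
Lemma ImN (x : C) : complex.Im (- x) = - complex.Im x. Proof. by case: x. Qed.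
Lemma ReM (x y : C) : complex.Re (x * y) =
  complex.Re x * complex.Re y - complex.Im x * complex.Im y.
Proof. by case: x y => [? ?] [? ?]. Qed.
Lemma ImM (x y : C) : complex.Im (x * y) =
  complex.Re x * complex.Im y + complex.Im x * complex.Re y.
Proof. by case: x y => [? ?] [? ?]. Qed.
Lemma ReV (x : C) : complex.Re x^-1 =
  complex.Re x / (complex.Re x ^+ 2 + complex.Im x ^+ 2).
Proof. by case: x. Qed.
Lemma ImV (x : C) : complex.Im x^-1 =
  - (complex.Im x / (complex.Re x ^+ 2 + complex.Im x ^+ 2)).
Proof. by case: x. Qed.
Lemma complexP (x y : C) : complex.Re x = complex.Re y -> complex.Im x = complex.Im y -> x = y.
Proof. by case: x y => [? ?] [? ?] /= -> ->. Qed.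

Lemma sumsq_gt0 (x : C) : x != 0 -> 0 < complex.Re x ^+ 2 + complex.Im x ^+ 2.
Proof.
case: x => a b; rewrite eq_complex /= negb_and => /orP[] n0.
  by rewrite ltr_pwDl ?sqr_ge0// exprn_even_gt0.
by rewrite ltr_wpDl ?sqr_ge0// exprn_even_gt0.
Qed.

Lemma eq_csmooth U f g : (forall p, U p -> f p = g p) -> csmooth U f -> csmooth U g.
Proof. by move=> fg [oU sr si]; split=> //; [apply: eq_smooth sr|apply: eq_smooth si] => // p /fg ->. Qed.

Lemma csmooth_cst U (a : C) : open U -> csmooth U (fun=> a).
Proof. by move=> oU; split=> //; exact: smooth_cst. Qed.

Global Instance csmooth_add U f g : csmooth U f -> csmooth U g -> csmooth U (fun q => f q + g q).
Proof.
move=> [oU fr fi] [_ gr gi]; split=> //.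
  by apply: eq_smooth (smooth_add oU fr gr) => // p _; rewrite ReD.
by apply: eq_smooth (smooth_add oU fi gi) => // p _; rewrite ImD.
Qed.

Global Instance csmooth_opp U f : csmooth U f -> csmooth U (fun q => - f q).
Proof.
move=> [oU fr fi]; split=> //.
  by apply: eq_smooth (smooth_opp oU fr) => // p _; rewrite ReN.
by apply: eq_smooth (smooth_opp oU fi) => // p _; rewrite ImN.
Qed.

Global Instance csmooth_mul U f g : csmooth U f -> csmooth U g -> csmooth U (fun q => f q * g q).
Proof.
move=> [oU fr fi] [_ gr gi]; split=> //.
  by apply: eq_smooth (smooth_add oU (smooth_mul oU fr gr) (smooth_opp oU (smooth_mul oU fi gi))) => // p _; rewrite ReM.
by apply: eq_smooth (smooth_add oU (smooth_mul oU fr gi) (smooth_mul oU fi gr)) => // p _; rewrite ImM.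
Qed.

Lemma csmooth_inv U f : (forall p, U p -> f p != 0) -> csmooth U f -> csmooth U (fun q => (f q)^-1).
Proof.
move=> f0 [oU fr fi].
have sn : smooth U (fun p => (complex.Re (f p) ^+ 2 + complex.Im (f p) ^+ 2)^-1).
  apply: smooth_inv => //; first by move=> p Up; rewrite gt_eqF// sumsq_gt0// f0.
  by apply: smooth_add => //; exact: smooth_mul.
split=> //.
  by apply: eq_smooth (smooth_mul oU fr sn) => // p Up; rewrite ReV.
by apply: eq_smooth (smooth_opp oU (smooth_mul oU fi sn)) => // p Up; rewrite ImV.
Qed.

Global Instance csmooth_conj U f : csmooth U f -> csmooth U (fun q => conjc (f q)).
Proof.
move=> [oU fr fi]; split=> //.
  by apply: eq_smooth fr => // p _; case: (f p).
by apply: eq_smooth (smooth_opp oU fi) => // p _; case: (f p).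
Qed.

Lemma csmooth_real U (f : plane -> R) : open U -> smooth U f -> csmooth U (fun q => (f q)%:C).
Proof. by move=> oU sf; split=> //; exact: smooth_cst. Qed.

Global Instance csmooth_cdiff U f v : csmooth U f -> csmooth U (cdiff v f).
Proof. by move=> [oU fr fi]; split=> //; exact: smooth_derive. Qed.

Global Instance csmooth_exp U f k : csmooth U f -> csmooth U (fun q => f q ^+ k).
Proof.
move=> sf; elim: k => [|k IH]; first exact/csmooth_cst/csmooth_open.
have := csmooth_mul sf IH; apply: eq_csmooth => p _; by rewrite exprS.
Qed.

Lemma csmooth_sum U (I : Type) (r : seq I) (F : I -> plane -> C) : open U ->
  (forall i, csmooth U (F i)) -> csmooth U (fun q => \sum_(i <- r) F i q).
Proof.
move=> oU sF; elim: r => [|i r IH].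
  by apply: eq_csmooth (csmooth_cst 0 oU) => p _; rewrite big_nil.
by apply: eq_csmooth (csmooth_add (sF i) IH) => p _; rewrite big_cons.
Qed.

Section Rules.
Variables (U : set plane) (p : plane).
Hypothesis Up : U p.

Lemma eq_cdiff v f g : open U -> (forall q, U q -> f q = g q) -> cdiff v f p = cdiff v g p.
Proof.
move=> oU fg; rewrite /cdiff; congr (_ +i* _); apply: (eq_derive_open _ oU) => // q /fg -> //.
Qed.

Let dre f v : csmooth U f -> derivable (fun q => complex.Re (f q)) p v.
Proof. by move=> [oU sr _]; exact/diff_derivable/(smooth_differentiable sr). Qed.
Let dim_ f v : csmooth U f -> derivable (fun q => complex.Im (f q)) p v.
Proof. by move=> [oU _ sr]; exact/diff_derivable/(smooth_differentiable sr). Qed.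

Lemma cdiff_cst v a : cdiff v (fun=> a) p = 0.
Proof. by rewrite /cdiff !derive_cst. Qed.

Lemma cdiffD v f g : csmooth U f -> csmooth U g ->
  cdiff v (fun q => f q + g q) p = cdiff v f p + cdiff v g p.
Proof.
move=> sf sg; rewrite /cdiff; apply: complexP => /=.
  under eq_fun do rewrite ReD.
  by rewrite (@deriveD _ _ _ (fun q => complex.Re (f q)) (fun q => complex.Re (g q)))//; exact: dre.
under eq_fun do rewrite ImD.
by rewrite (@deriveD _ _ _ (fun q => complex.Im (f q)) (fun q => complex.Im (g q)))//; exact: dim_.
Qed.

Lemma cdiffN v f : csmooth U f -> cdiff v (fun q => - f q) p = - cdiff v f p.
Proof.
move=> sf; rewrite /cdiff; apply: complexP => /=.
  under eq_fun do rewrite ReN.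
  by rewrite (@deriveN _ _ _ (fun q => complex.Re (f q)))//; exact: dre.
under eq_fun do rewrite ImN.
by rewrite (@deriveN _ _ _ (fun q => complex.Im (f q)))//; exact: dim_.
Qed.

Lemma cdiffM v f g : csmooth U f -> csmooth U g ->
  cdiff v (fun q => f q * g q) p = cdiff v f p * g p + f p * cdiff v g p.
Proof.
move=> sf sg; rewrite /cdiff; apply: complexP.
  rewrite /=; under eq_fun do rewrite ReM.
  rewrite (@deriveB _ _ _ (fun q => complex.Re (f q) * complex.Re (g q)) (fun q => complex.Im (f q) * complex.Im (g q)));
    [|by apply: derivableM; exact: dre|by apply: derivableM; exact: dim_].
  rewrite (@deriveM _ _ (fun q => complex.Re (f q)) (fun q => complex.Re (g q)));
   [|exact: dre|exact: dre].
  rewrite (@deriveM _ _ (fun q => complex.Im (f q)) (fun q => complex.Im (g q)));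
   [|exact: dim_|exact: dim_].
  move: ('D_v _ p) ('D_v _ p) ('D_v _ p) ('D_v _ p) => a b c d.
  case: (f p) (g p) => [x y] [z w]; rewrite /GRing.scale /=; ring.
rewrite /=; under eq_fun do rewrite ImM.
rewrite (@deriveD _ _ _ (fun q => complex.Re (f q) * complex.Im (g q)) (fun q => complex.Im (f q) * complex.Re (g q)));
   [|by apply: derivableM; [exact: dre|exact: dim_]|by apply: derivableM; [exact: dim_|exact: dre]].
rewrite (@deriveM _ _ (fun q => complex.Re (f q)) (fun q => complex.Im (g q)));
   [|exact: dre|exact: dim_].
rewrite (@deriveM _ _ (fun q => complex.Im (f q)) (fun q => complex.Re (g q)));
   [|exact: dim_|exact: dre].
move: ('D_v _ p) ('D_v _ p) ('D_v _ p) ('D_v _ p) => a b c d.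
case: (f p) (g p) => [x y] [z w]; rewrite /GRing.scale /=; ring.
Qed.

Lemma cdiff_conj v f : csmooth U f -> cdiff v (fun q => conjc (f q)) p = conjc (cdiff v f p).
Proof.
move=> sf; rewrite /cdiff; apply: complexP => /=.
  by congr ('D_v _ p); apply/funext => q; case: (f q).
rewrite -(@deriveN _ _ _ (fun q => complex.Im (f q))); last exact: dim_.
by congr ('D_v _ p); apply/funext => q; rewrite -[RHS]/(- (complex.Im (f q))); case: (f q).
Qed.

Lemma cdiffC u v f : csmooth U f -> cdiff u (cdiff v f) p = cdiff v (cdiff u f) p.
Proof.
move=> [oU sr si].
have H1 := derive_sym u v oU Up (sr 2); have H2 := derive_sym u v oU Up (si 2).
by apply: complexP; [exact: H1|exact: H2].
Qed.

End Rules.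
End ComplexCalculus.

#[global] Hint Mode csmooth - - ! : typeclass_instances.

Section ScalarProduct.
Variables (K : comNzRingType) (n : nat) (J : 'M[K]_n).
Implicit Types u v w : 'rV[K]_n.

Lemma sprodE u v : sprod J u v = \sum_i \sum_j u 0 i * J i j * v 0 j.
Proof.
rewrite /sprod mxE exchange_big; apply: eq_bigr => j _.
by rewrite mxE mxE mulr_suml; apply: eq_bigr.
Qed.

Lemma sprodDl u v w : sprod J (u + v) w = sprod J u w + sprod J v w.
Proof. by rewrite /sprod !mulmxDl mxE. Qed.
Lemma sprodDr u v w : sprod J w (u + v) = sprod J w u + sprod J w v.
Proof. by rewrite /sprod linearD /= mulmxDr mxE. Qed.
Lemma sprodZl a u v : sprod J (a *: u) v = a * sprod J u v.
Proof. by rewrite /sprod -!scalemxAl mxE. Qed.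
Lemma sprodZr a u v : sprod J u (a *: v) = a * sprod J u v.
Proof. by rewrite /sprod linearZ /= -scalemxAr mxE. Qed.
Lemma sprodNl u v : sprod J (- u) v = - sprod J u v.
Proof. by rewrite -scaleN1r sprodZl mulN1r. Qed.
Lemma sprodNr u v : sprod J u (- v) = - sprod J u v.
Proof. by rewrite -scaleN1r sprodZr mulN1r. Qed.
Lemma sprod0l v : sprod J 0 v = 0.
Proof. by rewrite -(scale0r 0) sprodZl mul0r. Qed.
Lemma sprod0r v : sprod J v 0 = 0.
Proof. by rewrite -(scale0r 0) sprodZr mul0r. Qed.
Lemma sprodC u v : J^T = J -> sprod J u v = sprod J v u.
Proof.
move=> JT; rewrite /sprod -[LHS]/((_ *m _) 0 0).
by rewrite -[in LHS](trmxK (u *m J *m v^T)) mxE !trmx_mul trmxK JT mulmxA.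
Qed.
End ScalarProduct.

Lemma sprod_map (K L : comNzRingType) (f : {rmorphism K -> L}) n (J : 'M[K]_n) u v :
  sprod (map_mx f J) (map_mx f u) (map_mx f v) = f (sprod J u v).
Proof. by rewrite /sprod -!map_mxM map_trmx -map_mxM mxE. Qed.

Opaque ex ey.

Section Wirtinger.
Variable R : realType.
Local Notation C := R[i].
Local Notation plane := 'rV[R]_2.
Implicit Types (U : set plane) (f g : plane -> C).

(** Both Wirtinger operators at once, [dz] for [e = - 'i] and [dzbar] for [e = 'i], so that a rule
    need be proved only once. *)
Definition wirt (e : C) f (p : plane) : C := (cdiff (ex R) f p + e * cdiff (ey R) f p) / 2.

Lemma dzE f : dz f = wirt (- 'i) f.
Proof. by apply/funext => p; rewrite /dz /wirt mulNr. Qed.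
Lemma dzbarE f : dzbar f = wirt 'i f.
Proof. by apply/funext => p. Qed.

Lemma half_neq0 : (2 : C) != 0. Proof. by rewrite pnatr_eq0. Qed.

Lemma csmooth_wirt U f e : csmooth U f -> csmooth U (wirt e f).
Proof.
move=> sf; have oU : open U by exact: (csmooth_open (f := f)).
have s1 := csmooth_cdiff (ex R) sf; have s2 := csmooth_cdiff (ey R) sf.
exact: csmooth_mul (csmooth_add s1 (csmooth_mul (csmooth_cst e oU) s2)) (csmooth_cst 2^-1 oU).
Qed.

Global Instance csmooth_dz U f : csmooth U f -> csmooth U (dz f).
Proof. by rewrite dzE; exact: csmooth_wirt. Qed.
Global Instance csmooth_dzbar U f : csmooth U f -> csmooth U (dzbar f).
Proof. by rewrite dzbarE; exact: csmooth_wirt. Qed.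

Class vsmooth U n (F : plane -> 'rV[C]_n) : Prop :=
  vsmoothP : forall j, csmooth U (fun q => F q 0 j).

Lemma vsmooth_cst U n (a : 'rV[C]_n) : open U -> vsmooth U (fun=> a).
Proof. by move=> oU j; exact: csmooth_cst. Qed.

Global Instance vsmooth_add U n (F G : plane -> 'rV[C]_n) : vsmooth U F -> vsmooth U G -> vsmooth U (fun q => F q + G q).
Proof. by move=> sF sG j; apply: eq_csmooth (csmooth_add (sF j) (sG j)) => q _; rewrite mxE. Qed.

Global Instance vsmooth_opp U n (F : plane -> 'rV[C]_n) : vsmooth U F -> vsmooth U (fun q => - F q).
Proof. by move=> sF j; apply: eq_csmooth (csmooth_opp (sF j)) => q _; rewrite mxE. Qed.

Global Instance vsmooth_scale U n a (F : plane -> 'rV[C]_n) : csmooth U a -> vsmooth U F -> vsmooth U (fun q => a q *: F q).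
Proof. by move=> sa sF j; apply: eq_csmooth (csmooth_mul sa (sF j)) => q _; rewrite mxE. Qed.

Global Instance vsmooth_mulmx U m n (F : plane -> 'rV[C]_m) (M : 'M[C]_(m, n)) : open U -> vsmooth U F -> vsmooth U (fun q => F q *m M).
Proof.
move=> oU sF j; have sk k := csmooth_mul (sF k) (csmooth_cst (M k j) oU).
by apply: eq_csmooth (csmooth_sum (index_enum _) oU sk) => q _; rewrite mxE.
Qed.

Global Instance vsmooth_row_mx U m n (F : plane -> 'rV[C]_m) (G : plane -> 'rV[C]_n) :
  vsmooth U F -> vsmooth U G -> vsmooth U (fun q => row_mx (F q) (G q)).
Proof.
move=> sF sG j; rewrite -(splitK j); case: (fintype.split j) => k /=.
  by apply: eq_csmooth (sF k) => q _; rewrite row_mxEl.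
by apply: eq_csmooth (sG k) => q _; rewrite row_mxEr.
Qed.

Lemma vsmooth_wirt U n e (F : plane -> 'rV[C]_n) : vsmooth U F -> vsmooth U (fun p => \row_j wirt e (fun q => F q 0 j) p).
Proof. by move=> sF j; apply: eq_csmooth (csmooth_wirt e (sF j)) => q _; rewrite mxE. Qed.

Lemma dzvE n (F : plane -> 'rV[C]_n) : dzv F = (fun p => \row_j wirt (- 'i) (fun q => F q 0 j) p).
Proof. by apply/funext => p; apply/rowP => j; rewrite !mxE dzE. Qed.

Lemma dzbarvE n (F : plane -> 'rV[C]_n) : dzbarv F = (fun p => \row_j wirt 'i (fun q => F q 0 j) p).
Proof. by apply/funext => p; apply/rowP => j; rewrite !mxE. Qed.

Global Instance vsmooth_dzv U n (F : plane -> 'rV[C]_n) : vsmooth U F -> vsmooth U (dzv F).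
Proof. by rewrite dzvE; exact: vsmooth_wirt. Qed.
Global Instance vsmooth_dzbarv U n (F : plane -> 'rV[C]_n) : vsmooth U F -> vsmooth U (dzbarv F).
Proof. by rewrite dzbarvE; exact: vsmooth_wirt. Qed.

Global Instance vsmooth_conj U n (F : plane -> 'rV[C]_n) : vsmooth U F -> vsmooth U (fun q => map_mx conjc (F q)).
Proof. by move=> sF j; apply: eq_csmooth (csmooth_conj (sF j)) => q _; rewrite mxE. Qed.

Lemma vsmooth_cplx U n (F : plane -> 'rV[R]_n) : open U -> smooth U F -> vsmooth U (cplx F).
Proof.
move=> oU sF j; apply: eq_csmooth (csmooth_real oU (smooth_coord j oU sF)) => q _.
by rewrite mxE.
Qed.

Global Instance csmooth_sprod U n (J : 'M[C]_n) (F G : plane -> 'rV[C]_n) : open U ->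
  vsmooth U F -> vsmooth U G -> csmooth U (fun q => sprod J (F q) (G q)).
Proof.
move=> oU sF sG.
have s2 i j : csmooth U (fun q => F q 0 i * J i j * G q 0 j).
  exact: csmooth_mul (csmooth_mul (sF i) (csmooth_cst (J i j) oU)) (sG j).
have s1 i := csmooth_sum (index_enum _) oU (s2 i).
by apply: eq_csmooth (csmooth_sum (index_enum _) oU s1) => q _; rewrite sprodE.
Qed.

Section Rules.
Variables (U : set plane) (p : plane).
Hypotheses (oU : open U) (Up : U p).
Variable e : C.
Local Notation D := (wirt e).
Local Ltac generic := move: (cdiff _ _ p) (cdiff _ _ p) => *; ring.
Let cd v f := @cdiffM R U p Up v f.

Lemma eq_wirt f g : (forall q, U q -> f q = g q) -> D f p = D g p.
Proof. by move=> fg; rewrite /wirt !(eq_cdiff Up _ oU fg). Qed.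
Lemma wirt_cst a : D (fun=> a) p = 0.
Proof. by rewrite /wirt !cdiff_cst mulr0 addr0 mul0r. Qed.
Lemma wirtD f g : csmooth U f -> csmooth U g -> D (fun q => f q + g q) p = D f p + D g p.
Proof. by move=> sf sg; rewrite /wirt !(cdiffD Up); move: (cdiff _ f p) (cdiff _ f p) (cdiff _ g p) (cdiff _ g p) => *; ring. Qed.
Lemma wirtN f : csmooth U f -> D (fun q => - f q) p = - D f p.
Proof. by move=> sf; rewrite /wirt !(cdiffN Up); generic. Qed.
Lemma wirtM f g : csmooth U f -> csmooth U g -> D (fun q => f q * g q) p = D f p * g p + f p * D g p.
Proof. by move=> sf sg; rewrite /wirt !(cdiffM Up); move: (cdiff _ f p) (cdiff _ f p) (cdiff _ g p) (cdiff _ g p) (f p) (g p) => *; ring. Qed.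
Lemma wirtX2 f : csmooth U f -> D (fun q => f q ^+ 2) p = 2 * f p * D f p.
Proof. by move=> sf; rewrite (@eq_wirt _ (fun q => f q * f q))// wirtM; ring. Qed.
Lemma wirtV f : (forall q, U q -> f q != 0) -> csmooth U f -> D (fun q => (f q)^-1) p = - D f p / f p ^+ 2.
Proof.
move=> f0 sf; have sV := csmooth_inv f0 sf.
(* Differentiating [f * f^-1 = 1] gives the rule without separating real and imaginary parts. *)
have : D (fun q => f q * (f q)^-1) p = 0.
  by rewrite (@eq_wirt _ (fun=> 1)) ?wirt_cst// => q Uq; rewrite divff// f0.
rewrite wirtM => /eqP; rewrite addr_eq0 => /eqP H.
have fp := f0 _ Up.
have -> : D (fun q => (f q)^-1) p = (f p * D (fun q => (f q)^-1) p) / f p by field.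
by rewrite -[f p * _]opprK -H; field.
Qed.
Lemma wirt_sum (I : Type) (r : seq I) (F : I -> plane -> C) :
  (forall i, csmooth U (F i)) -> D (fun q => \sum_(i <- r) F i q) p = \sum_(i <- r) D (F i) p.
Proof.
move=> sF; elim: r => [|i r IH].
  by rewrite big_nil (@eq_wirt _ (fun=> 0)) ?wirt_cst// => q _; rewrite big_nil.
rewrite big_cons (@eq_wirt _ (fun q => F i q + \sum_(j <- r) F j q)); last by move=> q _; rewrite big_cons.
by rewrite (wirtD (sF i) (csmooth_sum r oU sF)) IH.
Qed.
Lemma wirt_sprod n (J : 'M[C]_n) (F G : plane -> 'rV[C]_n) : vsmooth U F -> vsmooth U G ->
  D (fun q => sprod J (F q) (G q)) p =
  sprod J (\row_j D (fun q => F q 0 j) p) (G p) + sprod J (F p) (\row_j D (fun q => G q 0 j) p).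
Proof.
move=> sF sG; have sc (a : C) : csmooth U (fun=> a) by exact: csmooth_cst.
have s2 i j : csmooth U (fun q => F q 0 i * J i j * G q 0 j).
  exact: csmooth_mul (csmooth_mul (sF i) _) (sG j).
rewrite (@eq_wirt _ (fun q => \sum_i \sum_j F q 0 i * J i j * G q 0 j)); last by move=> q _; rewrite sprodE.
have s1 i := csmooth_sum (index_enum _) oU (s2 i).
rewrite (wirt_sum (index_enum _) s1) !sprodE -big_split; apply: eq_bigr => i _ /=.
rewrite (wirt_sum (index_enum _) (s2 i)) -big_split; apply: eq_bigr => j _ /=.
have sFi := sF i; have sGj := sG j; have sFJ := csmooth_mul sFi (sc (J i j)).
rewrite (wirtM sFJ sGj) (wirtM sFi (sc _)) wirt_cst !mxE.
move: (wirt e _ p) (wirt e _ p) (F p 0 i) (G p 0 j) (J i j) => *; ring.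
Qed.
End Rules.

Lemma wirt_conj U p (Up : U p) e f : csmooth U f ->
  wirt e (fun q => conjc (f q)) p = conjc (wirt (conjc e) f p).
Proof.
move=> sf; rewrite /wirt !(cdiff_conj Up).
rewrite [RHS]rmorphM [in RHS]rmorphD [in RHS]rmorphM fmorphV rmorph_nat.
by congr ((_ + _ * _) / _); exact/esym/conjcK.
Qed.

Lemma wirt2_alg (K : numFieldType) (a b x1 x2 x3 x4 y1 y2 : K) :
  ((x1 + (0 * y2 + b * x3)) / 2 + (y1 + b * y2) * 0 +
   a * ((x2 + (0 * y2 + b * x4)) / 2 + (y1 + b * y2) * 0)) / 2 =
  (x1 + a * x2 + b * x3 + a * b * x4) / 4.
Proof. by field. Qed.

Lemma wirt2_sym (K : numFieldType) (a b x1 x2 x4 : K) :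
  (x1 + a * x2 + b * x2 + a * b * x4) / 4 = (x1 + b * x2 + a * x2 + b * a * x4) / 4.
Proof. by field. Qed.

(** Both sides expand into four second directional derivatives divided by 4, and [cdiffC] makes the
    expansion symmetric in [e] and [e']. *)
Lemma wirtC U p (Up : U p) e e' f : csmooth U f -> wirt e (wirt e' f) p = wirt e' (wirt e f) p.
Proof.
move=> sf; have oU : open U by exact: (csmooth_open (f := f)).
have sc (a : C) : csmooth U (fun=> a) by exact: csmooth_cst.
have E a b : wirt a (wirt b f) p =
   (cdiff (ex R) (cdiff (ex R) f) p + a * cdiff (ey R) (cdiff (ex R) f) p + b * cdiff (ex R) (cdiff (ey R) f) p
    + a * b * cdiff (ey R) (cdiff (ey R) f) p) / 4.
  have s1 := csmooth_cdiff (ex R) sf; have s2 := csmooth_cdiff (ey R) sf.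
  have s3 := csmooth_mul (sc b) s2; have s4 := csmooth_add s1 s3.
  rewrite /wirt !(cdiffM Up _ s4 (sc _)) !(cdiffD Up _ s1 s3) !(cdiffM Up _ (sc b) s2) !cdiff_cst.
  exact: wirt2_alg.
rewrite (E e e') (E e' e) (cdiffC Up (ex R) (ey R) sf).
exact: wirt2_sym.
Qed.

Section Rules_dz.
Variables (U : set plane) (p : plane).
Hypothesis Up : U p.

Lemma eq_dz f g : open U -> (forall q, U q -> f q = g q) -> dz f p = dz g p.
Proof. by move=> oU fg; rewrite !dzE; exact: eq_wirt fg. Qed.
Lemma dz_cst a : dz (fun=> a) p = 0.
Proof. by rewrite dzE wirt_cst. Qed.
Lemma dzD f g {sf : csmooth U f} {sg : csmooth U g} : dz (fun q => f q + g q) p = dz f p + dz g p.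
Proof. by rewrite !dzE; exact: wirtD. Qed.
Lemma dzN f {sf : csmooth U f} : dz (fun q => - f q) p = - dz f p.
Proof. by rewrite !dzE; exact: wirtN. Qed.
Lemma dzM f g {sf : csmooth U f} {sg : csmooth U g} : dz (fun q => f q * g q) p = dz f p * g p + f p * dz g p.
Proof. by rewrite !dzE; exact: wirtM. Qed.
Lemma dzV f {sf : csmooth U f} : (forall q, U q -> f q != 0) -> dz (fun q => (f q)^-1) p = - dz f p / f p ^+ 2.
Proof. by rewrite !dzE => f0; apply: (wirtV _ Up) => //; exact: (csmooth_open (f := f)). Qed.
Lemma dz_conj f {sf : csmooth U f} : dz (fun q => conjc (f q)) p = conjc (dzbar f p).
Proof. by rewrite dzE dzbarE (wirt_conj Up); congr (conjc (wirt _ _ _)); apply: complexP; rewrite /= ?oppr0 ?opprK. Qed.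
Lemma dz_sprod n (J : 'M[C]_n) (F G : plane -> 'rV[C]_n) {sF : vsmooth U F} {sG : vsmooth U G} : open U ->
  dz (fun q => sprod J (F q) (G q)) p = sprod J (dzv F p) (G p) + sprod J (F p) (dzv G p).
Proof. by move=> oU; rewrite dzE (wirt_sprod oU Up) !dzvE. Qed.

Lemma eq_dzv n (F G : plane -> 'rV[C]_n) : open U -> (forall q, U q -> F q = G q) -> dzv F p = dzv G p.
Proof. by move=> oU FG; apply/rowP => j; rewrite !mxE; apply: eq_dz => // q /FG ->. Qed.
Lemma dzvD n (F G : plane -> 'rV[C]_n) {sF : vsmooth U F} {sG : vsmooth U G} :
  dzv (fun q => F q + G q) p = dzv F p + dzv G p.
Proof.
apply/rowP => j; rewrite !mxE; under [X in dz X]eq_fun do rewrite mxE.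
exact: (dzD (sf := sF j) (sg := sG j)).
Qed.
Lemma dzvN n (F : plane -> 'rV[C]_n) {sF : vsmooth U F} :
  dzv (fun q => - F q) p = - dzv F p.
Proof.
apply/rowP => j; rewrite !mxE; under [X in dz X]eq_fun do rewrite mxE.
exact: (dzN (sf := sF j)).
Qed.
Lemma dzvZ n a (F : plane -> 'rV[C]_n) {sa : csmooth U a} {sF : vsmooth U F} :
  dzv (fun q => a q *: F q) p = dz a p *: F p + a p *: dzv F p.
Proof.
apply/rowP => j; rewrite !mxE; under [X in dz X]eq_fun do rewrite mxE.
exact: (dzM (sf := sa) (sg := sF j)).
Qed.
Lemma dzv_cst n (a : 'rV[C]_n) : dzv (fun=> a) p = 0.
Proof. by apply/rowP => j; rewrite !mxE dz_cst. Qed.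
Lemma dzv_row_mx m n (F : plane -> 'rV[C]_m) (G : plane -> 'rV[C]_n) :
  dzv (fun q => row_mx (F q) (G q)) p = row_mx (dzv F p) (dzv G p).
Proof.
apply/rowP => j; rewrite mxE -(splitK j); case: (fintype.split j) => k /=.
  by rewrite row_mxEl mxE; under [X in dz X]eq_fun do rewrite row_mxEl.
by rewrite row_mxEr mxE; under [X in dz X]eq_fun do rewrite row_mxEr.
Qed.
Lemma dzv_mulmx m n (F : plane -> 'rV[C]_m) (M : 'M[C]_(m, n)) {sF : vsmooth U F} : open U ->
  dzv (fun q => F q *m M) p = dzv F p *m M.
Proof.
move=> oU; apply/rowP => j; rewrite !mxE; under [X in dz X]eq_fun do rewrite mxE.
have sc (a : C) : csmooth U (fun=> a) by exact: csmooth_cst.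
have sk k := csmooth_mul (sF k) (sc (M k j)).
rewrite dzE (wirt_sum oU Up _ (index_enum _) sk).
apply: eq_bigr => i _; rewrite (wirtM Up _ (sF i) (sc _)) wirt_cst mulr0 addr0 mxE.
by rewrite dzE.
Qed.
Lemma dzv_conj n (F : plane -> 'rV[C]_n) {sF : vsmooth U F} :
  dzv (fun q => map_mx conjc (F q)) p = map_mx conjc (dzbarv F p).
Proof.
apply/rowP => j; rewrite !mxE; under [X in dz X]eq_fun do rewrite mxE.
exact: (dz_conj (sf := sF j)).
Qed.
End Rules_dz.

Section Rules_dzbar.
Variables (U : set plane) (p : plane).
Hypothesis Up : U p.

Lemma eq_dzbar f g : open U -> (forall q, U q -> f q = g q) -> dzbar f p = dzbar g p.
Proof. by move=> oU fg; rewrite !dzbarE; exact: eq_wirt fg. Qed.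
Lemma dzbar_cst a : dzbar (fun=> a) p = 0.
Proof. by rewrite dzbarE wirt_cst. Qed.
Lemma dzbarD f g {sf : csmooth U f} {sg : csmooth U g} : dzbar (fun q => f q + g q) p = dzbar f p + dzbar g p.
Proof. by rewrite !dzbarE; exact: wirtD. Qed.
Lemma dzbarN f {sf : csmooth U f} : dzbar (fun q => - f q) p = - dzbar f p.
Proof. by rewrite !dzbarE; exact: wirtN. Qed.
Lemma dzbarM f g {sf : csmooth U f} {sg : csmooth U g} : dzbar (fun q => f q * g q) p = dzbar f p * g p + f p * dzbar g p.
Proof. by rewrite !dzbarE; exact: wirtM. Qed.
Lemma dzbarX2 f {sf : csmooth U f} : dzbar (fun q => f q ^+ 2) p = 2 * f p * dzbar f p.
Proof. by rewrite !dzbarE; apply: (wirtX2 _ Up) => //; exact: (csmooth_open (f := f)). Qed.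
Lemma dzbarV f {sf : csmooth U f} : (forall q, U q -> f q != 0) -> dzbar (fun q => (f q)^-1) p = - dzbar f p / f p ^+ 2.
Proof. by rewrite !dzbarE => f0; apply: (wirtV _ Up) => //; exact: (csmooth_open (f := f)). Qed.
Lemma dzbar_conj f {sf : csmooth U f} : dzbar (fun q => conjc (f q)) p = conjc (dz f p).
Proof. by rewrite dzE dzbarE (wirt_conj Up); congr (conjc (wirt _ _ _)); apply: complexP; rewrite /= ?oppr0 ?opprK. Qed.
Lemma dzbar_sprod n (J : 'M[C]_n) (F G : plane -> 'rV[C]_n) {sF : vsmooth U F} {sG : vsmooth U G} : open U ->
  dzbar (fun q => sprod J (F q) (G q)) p = sprod J (dzbarv F p) (G p) + sprod J (F p) (dzbarv G p).
Proof. by move=> oU; rewrite dzbarE (wirt_sprod oU Up) !dzbarvE. Qed.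

Lemma eq_dzbarv n (F G : plane -> 'rV[C]_n) : open U -> (forall q, U q -> F q = G q) -> dzbarv F p = dzbarv G p.
Proof. by move=> oU FG; apply/rowP => j; rewrite !mxE; apply: eq_dzbar => // q /FG ->. Qed.
Lemma dzbarvD n (F G : plane -> 'rV[C]_n) {sF : vsmooth U F} {sG : vsmooth U G} :
  dzbarv (fun q => F q + G q) p = dzbarv F p + dzbarv G p.
Proof.
apply/rowP => j; rewrite !mxE; under [X in dzbar X]eq_fun do rewrite mxE.
exact: (dzbarD (sf := sF j) (sg := sG j)).
Qed.
Lemma dzbarvN n (F : plane -> 'rV[C]_n) {sF : vsmooth U F} :
  dzbarv (fun q => - F q) p = - dzbarv F p.
Proof.
apply/rowP => j; rewrite !mxE; under [X in dzbar X]eq_fun do rewrite mxE.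
exact: (dzbarN (sf := sF j)).
Qed.
Lemma dzbarvZ n a (F : plane -> 'rV[C]_n) {sa : csmooth U a} {sF : vsmooth U F} :
  dzbarv (fun q => a q *: F q) p = dzbar a p *: F p + a p *: dzbarv F p.
Proof.
apply/rowP => j; rewrite !mxE; under [X in dzbar X]eq_fun do rewrite mxE.
exact: (dzbarM (sf := sa) (sg := sF j)).
Qed.
Lemma dzbarv_cst n (a : 'rV[C]_n) : dzbarv (fun=> a) p = 0.
Proof. by apply/rowP => j; rewrite !mxE dzbar_cst. Qed.
Lemma dzbarv_mulmx m n (F : plane -> 'rV[C]_m) (M : 'M[C]_(m, n)) {sF : vsmooth U F} : open U ->
  dzbarv (fun q => F q *m M) p = dzbarv F p *m M.
Proof.
move=> oU; apply/rowP => j; rewrite !mxE; under [X in dzbar X]eq_fun do rewrite mxE.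
have sc (a : C) : csmooth U (fun=> a) by exact: csmooth_cst.
have sk k := csmooth_mul (sF k) (sc (M k j)).
rewrite dzbarE (wirt_sum oU Up _ (index_enum _) sk).
apply: eq_bigr => i _; rewrite (wirtM Up _ (sF i) (sc _)) wirt_cst mulr0 addr0 mxE.
by rewrite dzbarE.
Qed.
Lemma dzbarv_conj n (F : plane -> 'rV[C]_n) {sF : vsmooth U F} :
  dzbarv (fun q => map_mx conjc (F q)) p = map_mx conjc (dzv F p).
Proof.
apply/rowP => j; rewrite !mxE; under [X in dzbar X]eq_fun do rewrite mxE.
exact: (dzbar_conj (sf := sF j)).
Qed.
End Rules_dzbar.

Lemma dz_dzbarC U p f {sf : csmooth U f} : U p -> dzbar (dz f) p = dz (dzbar f) p.
Proof. by move=> Up; rewrite !dzE (wirtC Up). Qed.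
Lemma dzv_dzbarvC U p n (F : plane -> 'rV[C]_n) {sF : vsmooth U F} : U p -> dzbarv (dzv F) p = dzv (dzbarv F) p.
Proof.
move=> Up; apply/rowP => j; rewrite !mxE.
have -> : (fun q => dzv F q 0 j) = dz (fun q => F q 0 j) by apply/funext => q; rewrite mxE.
have -> : (fun q => dzbarv F q 0 j) = dzbar (fun q => F q 0 j) by apply/funext => q; rewrite mxE.
exact: (dz_dzbarC (sf := sF j) Up).
Qed.
Lemma conj_cplx n (F : plane -> 'rV[R]_n) p : map_mx conjc (cplx F p) = cplx F p.
Proof. by apply/rowP => j; rewrite !mxE conjc_real. Qed.
Lemma conj_dzv_cplx U p n (F : plane -> 'rV[R]_n) : open U -> U p -> smooth U F ->
  map_mx conjc (dzv (cplx F) p) = dzbarv (cplx F) p.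
Proof.
move=> oU Up sF; have sF' := vsmooth_cplx oU sF.
rewrite -(dzbarv_conj Up); apply: (eq_dzbarv Up) => // q _; exact: conj_cplx.
Qed.
Lemma conj_dzbarv_cplx U p n (F : plane -> 'rV[R]_n) : open U -> U p -> smooth U F ->
  map_mx conjc (dzbarv (cplx F) p) = dzv (cplx F) p.
Proof.
move=> oU Up sF; have sF' := vsmooth_cplx oU sF.
rewrite -(dzv_conj Up); apply: (eq_dzv Up) => // q _; exact: conj_cplx.
Qed.
End Wirtinger.
Transparent ex ey.

Section Disk.
Variable R : realType.
Local Notation D := (@unit_disk R).

Lemma open_disk : open D.
Proof.
have -> : D = (fun p : 'rV[R]_2 => p 0 0 ^+ 2 + p 0 1 ^+ 2) @^-1` [set x | x < 1] by [].
apply: open_comp; last exact: open_lt.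
move=> p _; apply: (@continuousD _ _ _ (fun p : 'rV[R]_2 => p 0 0 ^+ 2) (fun p : 'rV[R]_2 => p 0 1 ^+ 2)).
  by apply: (@continuousM _ _ (fun p : 'rV[R]_2 => p 0 0) (fun p : 'rV[R]_2 => p 0 0)); exact: coord_continuous.
by apply: (@continuousM _ _ (fun p : 'rV[R]_2 => p 0 1) (fun p : 'rV[R]_2 => p 0 1)); exact: coord_continuous.
Qed.

Lemma disk_ray p (t : R) : D p -> 0 <= t <= 1 -> D (t *: p).
Proof.
rewrite /unit_disk /= !mxE !exprMn -mulrDr => Dp /andP[t0 t1].
by rewrite (le_lt_trans _ Dp)// ler_piMl ?addr_ge0 ?sqr_ge0// expr_le1.
Qed.

Lemma disk0 : D 0.
Proof. by rewrite /unit_disk /= !mxE expr0n addr0. Qed.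

Global Instance csmooth_disk_cst (a : R[i]) : csmooth D (fun=> a).
Proof. exact: csmooth_cst open_disk. Qed.
Global Instance vsmooth_disk_cst n (a : 'rV[R[i]]_n) : vsmooth D (fun=> a).
Proof. exact: vsmooth_cst open_disk. Qed.
Global Instance csmooth_disk_sprod n (J : 'M[R[i]]_n) F G : 
  vsmooth D F -> vsmooth D G -> csmooth D (fun q => sprod J (F q) (G q)).
Proof. exact: csmooth_sprod open_disk. Qed.
Global Instance vsmooth_disk_mulmx m n (F : _ -> 'rV[R[i]]_m) (M : 'M[R[i]]_(m, n)) : vsmooth D F -> vsmooth D (fun q => F q *m M).
Proof. exact: vsmooth_mulmx open_disk. Qed.
End Disk.

Section RealVectors.
Variable R : realType.
Local Notation C := R[i].
Local Notation plane := 'rV[R]_2.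

Lemma cdiff_cplx n (F : plane -> 'rV[R]_n) p v j : differentiable F p ->
  cdiff v (fun q => cplx F q 0 j) p = ('D_v F p 0 j)%:C.
Proof.
move=> dF; rewrite /cdiff -(derive_coord _ _ dF).
have -> : (fun q => complex.Re (cplx F q 0 j)) = (fun q => F q 0 j).
  by apply/funext => q; rewrite mxE.
have -> : (fun q => complex.Im (cplx F q 0 j)) = cst 0.
  by apply/funext => q; rewrite mxE.
by rewrite derive_cst.
Qed.

Lemma dzv_cplxE n (F : plane -> 'rV[R]_n) p : differentiable F p ->
  dzv (cplx F) p = 2^-1 *: (map_mx (real_complex R) ('D_(ex R) F p) - 'i *: map_mx (real_complex R) ('D_(ey R) F p)).
Proof.
move=> dF; apply/rowP => j; by rewrite !mxE /dz mulrC !(cdiff_cplx _ _ dF).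
Qed.

Lemma dzbarv_cplxE n (F : plane -> 'rV[R]_n) p : differentiable F p ->
  dzbarv (cplx F) p = 2^-1 *: (map_mx (real_complex R) ('D_(ex R) F p) + 'i *: map_mx (real_complex R) ('D_(ey R) F p)).
Proof.
move=> dF; apply/rowP => j; by rewrite !mxE /dzbar mulrC !(cdiff_cplx _ _ dF).
Qed.

Lemma csprodE n (J : 'M[R]_n) (u v : 'rV[C]_n) : csprod J u v = sprod (map_mx (real_complex R) J) u v.
Proof. by []. Qed.

Lemma csprod1E n (u v : 'rV[C]_n) : csprod 1%:M u v = sprod 1%:M u v.
Proof. by rewrite /csprod map_mx1. Qed.

Lemma sprod1E (K : comNzRingType) n (u v : 'rV[K]_n) : sprod 1%:M u v = \sum_j u 0 j * v 0 j.
Proof. by rewrite /sprod mulmx1 mxE; apply: eq_bigr => j _; rewrite mxE. Qed.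

Lemma sprod1C (K : comNzRingType) n (u v : 'rV[K]_n) : sprod 1%:M u v = sprod 1%:M v u.
Proof. by apply: sprodC; exact: trmx1. Qed.

Lemma i2 : ('i : C) * 'i = -1.
Proof. by rewrite -expr2 sqr_i. Qed.

Lemma sqnorm_dzE n (J : 'M[R]_n) (F : plane -> 'rV[R]_n) p : J^T = J -> differentiable F p ->
  sprod J ('D_(ex R) F p) ('D_(ex R) F p) = sprod J ('D_(ey R) F p) ('D_(ey R) F p) ->
  sqnorm_dz J F p = (sprod J ('D_(ex R) F p) ('D_(ex R) F p) / 2)%:C.
Proof.
move=> JT dF conf; rewrite /sqnorm_dz csprodE (dzv_cplxE dF) (dzbarv_cplxE dF).
move: ('D_(ex R) F p) ('D_(ey R) F p) conf => v w conf.
rewrite !(sprodZl, sprodZr, sprodDl, sprodDr, sprodNl) !sprod_map -conf.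
rewrite (@sprodC _ _ J w v JT).
move: (sprod J v v) (sprod J v w) => a b.
transitivity ((2^-1 : C) * 2^-1 * (a%:C - 'i * 'i * a%:C)); first by ring.
have -> : (a / 2)%:C = a%:C / 2 by rewrite rmorphM fmorphV rmorph_nat.
by rewrite i2 mulN1r opprK; move: (a%:C) => c; field.
Qed.

(** The two conformality conditions are the real and the imaginary part of [4 <f_z, f_z> = |f_x|^2 -
    |f_y|^2 - 2 i <f_x, f_y>]. *)
Lemma sprod_dz_dz n (J : 'M[R]_n) (F : plane -> 'rV[R]_n) p : J^T = J -> differentiable F p ->
  sprod J ('D_(ex R) F p) ('D_(ex R) F p) = sprod J ('D_(ey R) F p) ('D_(ey R) F p) ->
  sprod J ('D_(ex R) F p) ('D_(ey R) F p) = 0 ->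
  csprod J (dzv (cplx F) p) (dzv (cplx F) p) = 0.
Proof.
move=> JT dF conf orth; rewrite csprodE (dzv_cplxE dF).
move: ('D_(ex R) F p) ('D_(ey R) F p) conf orth => v w conf orth.
rewrite !(sprodZl, sprodZr, sprodDl, sprodDr, sprodNl, sprodNr) !sprod_map -conf.
rewrite (@sprodC _ _ J w v JT) orth rmorph0.
move: (sprod J v v)  => a.
transitivity ((2^-1 : C) * 2^-1 * (a%:C + 'i * 'i * a%:C)); first by ring.
by rewrite i2; ring.
Qed.

End RealVectors.

(** * Complex differentiability and the Cauchy-Riemann equation *)

Section Holomorphic.
Variable R : realType.
Local Notation C := R[i].
Local Notation plane := 'rV[R]_2.

Lemma diff_approx (V : normedModType R) (f : V -> R) p e : differentiable f p -> 0 < e ->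
  \forall k \near (0 : V), `|f (k + p) - f p - 'D_k f p| <= e * `|k|.
Proof.
move=> df e0; have /diff_locally/eqaddoP/(_ e e0) := df.
apply: filterS => k; rewrite deriveE//.
by rewrite /= -![(_ + _ : _ -> _) _]/(_ + _) -![(- _ : _ -> _) _]/(- _) /= opprD addrA.
Qed.

Lemma of_planeK : cancel (@of_plane R) (@to_plane R).
Proof.
move=> p; apply/rowP => j; rewrite mxE /of_plane /=.
by case: j => -[|[|//]] Hj; congr (p 0 _); apply: val_inj.
Qed.

Lemma to_planeD (z z' : C) : to_plane (z + z') = to_plane z + to_plane z'.
Proof.
by apply/rowP => j; rewrite !mxE; case: ifP => _; rewrite ?ReD ?ImD.
Qed.

Lemma to_plane_real (t : R) : to_plane t%:C = t *: ex R.
Proof. by apply/rowP => j; rewrite !mxE /=; case: j => -[|[|//]] Hj /=; rewrite ?mulr1 ?mulr0. Qed.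
Lemma to_plane_imag (t : R) : to_plane ('i * t%:C) = t *: ey R.
Proof. by apply/rowP => j; rewrite !mxE /=; case: j => -[|[|//]] Hj /=; rewrite ?mulr1 ?mulr0 ?mul0r ?mul1r ?subr0 ?addr0 ?add0r. Qed.

Lemma normc_Re (z : C) : `|complex.Re z|%:C <= `|z|.
Proof.
case: z => a b; rewrite normc_def lecR /= -[`|a|]sqrtr_sqr.
by rewrite ler_wsqrtr// lerDl sqr_ge0.
Qed.
Lemma normc_Im (z : C) : `|complex.Im z|%:C <= `|z|.
Proof.
case: z => a b; rewrite normc_def lecR /= -[`|b|]sqrtr_sqr.
by rewrite ler_wsqrtr// lerDr sqr_ge0.
Qed.
Lemma normc_le (z : C) : `|z| <= (`|complex.Re z| + `|complex.Im z|)%:C.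
Proof.
rewrite {1}[z]complexE (le_trans (ler_normD _ _))// normrM rmorphD /=.
rewrite !normc_def /= !expr0n /= !addr0 !add0r expr1n sqrtr1 mul1r !sqrtr_sqr.
exact: lexx.
Qed.
Lemma norm_to_plane (z : C) : `|to_plane z|%:C <= `|z|.
Proof.
have := normc_Im z; have := normc_Re z; rewrite normc_def !lecR => hr hi.
rewrite [`|to_plane z|]/Num.Def.normr/= mx_normrE.
apply/bigmax_leP; split=> [|[i j] _] /=; first exact: sqrtr_ge0.
by rewrite mxE; case: ifP.
Qed.

Lemma quotient_alg (K : fieldType) (c l t w : K) : c != 0 -> t != 0 ->
  c * l - t^-1 * w = c * (l - (c * t)^-1 * w).
Proof. by move=> c0 t0; field; rewrite c0 t0. Qed.

(** In one direction, the complex quotient restricted to real and to imaginary increments gives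
    [f_y = i f_x]. In the other, [dzbar f p = 0] says that the real differential is multiplication
    by [f_x]; the first-order errors of the real and of the imaginary part, each allowed half of
    [e], then bound the complex one. *)
Lemma holomorphic_dzbar (U : set plane) (f : plane -> C) p : csmooth U f -> U p ->
  derivable ((fun z : C => f (to_plane z)) : C^o -> C^o) (of_plane p) 1 <-> dzbar f p = 0.
Proof.
move=> sf Up; have [_ sr si] := sf.
have dr : differentiable (fun q => complex.Re (f q)) p by exact: smooth_differentiable sr Up.
have di : differentiable (fun q => complex.Im (f q)) p by exact: smooth_differentiable si Up.
split=> [/cvg_ex[/= l fl]|f0].
  (* The direction [v] is the complex number [c] read in the plane; increments [c * t] with [t] real
     turn the complex limit into a directional derivative. *)
  have lim (c : C) (v : plane) : c != 0 -> (forall t : R, to_plane (c * t%:C) = t *: v) -> cdiff v f p = c * l.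
    move=> c0 cv.
    have cvg e : 0 < e -> \forall t \near 0^', `|c * l - (t^-1)%:C * (f (t *: v + p) - f p)| < e%:C.
      move=> e0.
      have nc0 : 0 < `|c| by rewrite normr_gt0.
      have ec0 : 0 < e%:C / `|c| by rewrite divr_gt0// ltcR.
      move/cvgrPdist_lt : fl => /(_ _ ec0).
      rewrite near_withinE => -[d /= d0 H].
      have dR : d = (complex.Re d)%:C by rewrite RRe_real// realE ltW.
      have cR : `|c| = (complex.Re `|c|)%:C by rewrite RRe_real// normr_real.
      have rc0 : 0 < complex.Re `|c| by rewrite -ltcR -cR.
      have rd0 : 0 < complex.Re d by rewrite -ltcR -dR.
      rewrite near_withinE; exists (complex.Re d / complex.Re `|c|); first by rewrite /= divr_gt0.
      move=> t /=; rewrite sub0r normrN => td t0.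
      have tc : `|t%:C| = `|t|%:C by rewrite normc_def /= expr0n addr0 sqrtr_sqr.
      have := H (c * t%:C).
      rewrite /= sub0r normrN normrM tc {1}cR -rmorphM [X in _ < X]dR ltcR mulrC -ltr_pdivlMr//.
      move=> /(_ td); rewrite mulf_neq0//; last by rewrite -[0]/(0%:C) (inj_eq (@complexI R)).
      move=> /(_ isT).
      rewrite -[_ *: 1]/(_ * 1) mulr1 to_planeD cv of_planeK => K.
      have -> : c * l - (t^-1)%:C * (f (t *: v + p) - f p) = c * (l - (c * t%:C)^-1 *: (f (t *: v + p) - f p)).
        have tc0 : t%:C != 0 :> C by rewrite -[0]/(0%:C) (inj_eq (@complexI R)).
        rewrite -[X in _ = _ * (_ - X)]/((c * t%:C)^-1 * (f (t *: v + p) - f p)) fmorphV.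
        exact: quotient_alg c0 tc0.
      by rewrite normrM mulrC -ltr_pdivlMr.
    rewrite /cdiff; apply: complexP => /=.
      apply/cvg_lim => //; apply/cvgrPdist_lt => e e0.
      have := cvg e e0; apply: filterS => t H; rewrite -ltcR; apply: le_lt_trans H.
      apply: le_trans (normc_Re _); rewrite lecR ReD ReN; apply: (eq_ind_r (fun a => a <= _) (lexx _)); congr (`|_ - _|).
      by rewrite ReM ReD ReN /GRing.scale /= mul0r subr0.
    apply/cvg_lim => //; apply/cvgrPdist_lt => e e0.
    have := cvg e e0; apply: filterS => t H; rewrite -ltcR; apply: le_lt_trans H.
    apply: le_trans (normc_Im _); rewrite lecR ImD ImN; apply: (eq_ind_r (fun a => a <= _) (lexx _)); congr (`|_ - _|).
    by rewrite ImM ImD ImN /GRing.scale /= mul0r addr0.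
  have e1 : cdiff (ex R) f p = 1 * l.
    by apply: lim => [|t]; rewrite ?oner_neq0// mul1r to_plane_real.
  have e2 : cdiff (ey R) f p = 'i * l.
    apply: lim => [|t]; last exact: to_plane_imag.
    by rewrite eq_complex /= oner_eq0 andbF.
  by rewrite /dzbar e1 e2 mulrA i2 mulN1r mul1r subrr mul0r.
pose l := cdiff (ex R) f p.
have ly : cdiff (ey R) f p = 'i * l.
  have : cdiff (ex R) f p + 'i * cdiff (ey R) f p = 0.
    have := f0; rewrite /dzbar => /eqP; rewrite mulf_eq0 invr_eq0 (negbTE (half_neq0 R)) orbF => /eqP; exact.
  rewrite -/l => /eqP; rewrite addr_eq0 => /eqP ->.
  by rewrite mulrN mulrA i2 mulN1r opprK.
apply/cvg_ex; exists l => /=; apply/cvgrPdist_le => e e0.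
have eR : e = (complex.Re e)%:C by rewrite RRe_real// realE ltW.
have re0 : 0 < complex.Re e by rewrite -ltcR -eR.
have re2 : 0 < complex.Re e / 2 by rewrite divr_gt0.
have [d1 /= d10 H1] := (nbhs_ballP _ _).1 (diff_approx dr re2).
have [d2 /= d20 H2] := (nbhs_ballP _ _).1 (diff_approx di re2).
rewrite near_withinE; exists (Num.min d1 d2)%:C; first by rewrite /= ltcR lt_min d10.
move=> z /=; rewrite sub0r normrN => zd z0.
have zk := norm_to_plane z.
have kd : `|to_plane z| < Num.min d1 d2 by rewrite -ltcR; exact: le_lt_trans zk zd.
have {}H1 : `|complex.Re (f (to_plane z + p)) - complex.Re (f p) - 'D_(to_plane z) (fun q => complex.Re (f q)) p| <= complex.Re e / 2 * `|to_plane z|.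
  by apply: H1; rewrite -ball_normE /= sub0r normrN; move: kd; rewrite lt_min => /andP[].
have {}H2 : `|complex.Im (f (to_plane z + p)) - complex.Im (f p) - 'D_(to_plane z) (fun q => complex.Im (f q)) p| <= complex.Re e / 2 * `|to_plane z|.
  by apply: H2; rewrite -ball_normE /= sub0r normrN; move: kd; rewrite lt_min => /andP[].
rewrite -[_ *: 1]/(_ * 1) mulr1 to_planeD of_planeK.
have nz0 : 0 < `|z| by rewrite normr_gt0.
rewrite -(ler_pM2r nz0) -normrM mulrBl -[_ *: _]/(_ * _) mulrAC mulVf// mul1r distrC.
set G := _ - l * z.
have GR : complex.Re G = complex.Re (f (to_plane z + p)) - complex.Re (f p) - 'D_(to_plane z) (fun q => complex.Re (f q)) p.
  rewrite /G !ReD !ReN; congr (_ - _ - _).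
  rewrite deriveE// [to_plane z]row_sum_delta !big_ord_recl big_ord0 addr0 linearD !linearZ /= -!deriveE//.
  have -> : lift ord0 ord0 = 1 :> 'I_2 by apply: val_inj.
  have e2 : 'D_(ey R) (fun q => complex.Re (f q)) p = complex.Re ('i * l) by rewrite -ly.
  have e1 : 'D_(ex R) (fun q => complex.Re (f q)) p = complex.Re l by [].
  rewrite -/(ex R) -/(ey R) e1 e2 !mxE /=.
  by rewrite !ReM /GRing.scale /=; move: (complex.Re l) (complex.Im l) (complex.Re z) (complex.Im z) => *; ring.
have GI : complex.Im G = complex.Im (f (to_plane z + p)) - complex.Im (f p) - 'D_(to_plane z) (fun q => complex.Im (f q)) p.
  rewrite /G !ImD !ImN; congr (_ - _ - _).
  rewrite deriveE// [to_plane z]row_sum_delta !big_ord_recl big_ord0 addr0 linearD !linearZ /= -!deriveE//.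
  have -> : lift ord0 ord0 = 1 :> 'I_2 by apply: val_inj.
  have e2 : 'D_(ey R) (fun q => complex.Im (f q)) p = complex.Im ('i * l) by rewrite -ly.
  have e1 : 'D_(ex R) (fun q => complex.Im (f q)) p = complex.Im l by [].
  rewrite -/(ex R) -/(ey R) e1 e2 !mxE /=.
  by rewrite !ImM /GRing.scale /=; move: (complex.Re l) (complex.Im l) (complex.Re z) (complex.Im z) => *; ring.
apply: le_trans (normc_le G) _.
rewrite GR GI; apply: (@le_trans _ _ (complex.Re e * `|to_plane z|)%:C).
  rewrite lecR; apply: le_trans (lerD H1 H2) _.
  by rewrite -mulrDl -splitr.
rewrite rmorphM /= -eR; apply: ler_wpM2l => //; exact: ltW.
Qed.
End Holomorphic.

#[global] Opaque cdiff dz dzbar dzv dzbarv.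

Section Frames.
Variables (R : realType).
Local Notation C := R[i].

Lemma direct_frame_sprod n (J F : 'M[R]_n) i j : direct_frame J F ->
  sprod J (row i F) (row j F) = J i j.
Proof.
move=> [H _]; rewrite /sprod -[in RHS]H -row_mul.
rewrite [in LHS]mxE [in RHS]mxE; apply: eq_bigr => k _.
by congr (_ * _); rewrite !mxE.
Qed.

Lemma orthonormal_expand n (F : 'M[R]_n) (w : 'rV[C]_n) : F *m F^T = 1%:M ->
  w = \sum_i sprod 1%:M w (map_mx (real_complex R) (row i F)) *: map_mx (real_complex R) (row i F).
Proof.
move=> /mulmx1C H; set f := real_complex R.
have H' : (map_mx f F)^T *m map_mx f F = 1%:M.
  by rewrite map_trmx -map_mxM H map_mx1.
have wE : w = w *m (map_mx f F)^T *m map_mx f F by rewrite -mulmxA H' mulmx1.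
rewrite [LHS]wE mulmx_sum_row; apply: eq_bigr => i _.
rewrite map_row; congr (_ *: _).
by rewrite sprod1E mxE; apply: eq_bigr => k _; rewrite !mxE.
Qed.
End Frames.

(** * Structure equations *)

Class surface (R : realType) (X N : 'rV[R]_2 -> 'rV[R]_4) : Prop := Surface {
  surface_S3 : forall p, unit_disk p -> S3 (X p);
  surface_conf : conformal_immersion 1%:M (@unit_disk R) X;
  surface_gauss : gauss_map_S3 X N;
  surface_umb : forall p, unit_disk p -> tracefree_curvature X N p != 0 }.

Section Surface.
Variables (R : realType) (X N : 'rV[R]_2 -> 'rV[R]_4).
Context {sXN : surface X N}.
Local Notation C := R[i].
Local Notation D := (@unit_disk R).
Local Notation rc := (real_complex R).
Local Notation dot := (sprod (1%:M : 'M[C]_4)).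
Local Notation x := (cplx X).
Local Notation n := (cplx N).
Local Notation xz := (dzv (cplx X)).
Local Notation xb := (dzbarv (cplx X)).
Local Notation E := (sqnorm_dz 1%:M X).
Local Notation h := (mean_curvature 1%:M X N).
Local Notation om := (tracefree_curvature X N).
Local Notation oD := (@open_disk R).

Lemma surface_smooth : smooth D X. Proof. by case: sXN => _ []. Qed.

Lemma surface_diff p : D p -> differentiable X p.
Proof. exact: smooth_differentiable surface_smooth. Qed.

Let kf p := expR (- conformal_factor 1%:M X p).
Let i0 : 'I_4 := Ordinal (isT : 0 < 4)%N.
Let i1 : 'I_4 := Ordinal (isT : 1 < 4)%N.
Let i2 : 'I_4 := Ordinal (isT : 2 < 4)%N.
Let i3 : 'I_4 := Ordinal (isT : 3 < 4)%N.
Let F p : 'M[R]_4 := \matrix_(i < 4) nth 0 [:: X p; unit_tangent 1%:M X (ex R) p;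
                                 unit_tangent 1%:M X (ey R) p; N p] i.

Let F0 p : row i0 (F p) = X p. Proof. by rewrite rowK. Qed.
Let F1 p : row i1 (F p) = kf p *: 'D_(ex R) X p. Proof. by rewrite rowK. Qed.
Let F2 p : row i2 (F p) = kf p *: 'D_(ey R) X p. Proof. by rewrite rowK. Qed.
Let F3 p : row i3 (F p) = N p. Proof. by rewrite rowK. Qed.
Let FP p i j : D p -> sprod 1%:M (row i (F p)) (row j (F p)) = (i == j)%:R.
Proof.
by move=> Dp; rewrite (direct_frame_sprod _ _ (surface_gauss Dp)) mxE.
Qed.
Let kf0 p : kf p != 0. Proof. by rewrite gt_eqF// expR_gt0. Qed.

Lemma surface_frame p : D p ->
  [/\ sprod 1%:M (X p) (X p) = 1, sprod 1%:M (N p) (N p) = 1, sprod 1%:M (N p) (X p) = 0,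
   sprod 1%:M (N p) ('D_(ex R) X p) = 0 & sprod 1%:M (N p) ('D_(ey R) X p) = 0] /\
  [/\ sprod 1%:M (X p) ('D_(ex R) X p) = 0, sprod 1%:M (X p) ('D_(ey R) X p) = 0 &
   kf p ^+ 2 * sprod 1%:M ('D_(ex R) X p) ('D_(ex R) X p) = 1].
Proof.
move=> Dp.
have H00 := FP i0 i0 Dp; have H33 := FP i3 i3 Dp; have H30 := FP i3 i0 Dp.
have H31 := FP i3 i1 Dp; have H32 := FP i3 i2 Dp; have H01 := FP i0 i1 Dp; have H02 := FP i0 i2 Dp.
have H11 := FP i1 i1 Dp.
rewrite F0 in H00 H30 H01 H02; rewrite F3 in H33 H30 H31 H32.
rewrite F1 in H31 H01 H11; rewrite F2 in H32 H02.
move: H00 H33 H30 H31 H32 H01 H02 H11; move: (X p) (N p) ('D_(ex R) X p) ('D_(ey R) X p) (kf p) (kf0 p).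
move=> x0 n0 a b k k0 H00 H33 H30 H31 H32 H01 H02 H11.
rewrite !(sprodZl, sprodZr) in H31 H32 H01 H02 H11.
have Z c : k * c = 0 -> c = 0.
  by move=> /eqP; rewrite mulf_eq0 (negbTE k0) => /eqP.
split; split => //.
- exact: Z H31.
- exact: Z H32.
- exact: Z H01.
- exact: Z H02.
- by rewrite expr2 -mulrA; exact: H11.
Qed.

Lemma sqnormE p : D p -> E p = dot (xz p) (xb p).
Proof. by move=> _; rewrite /sqnorm_dz csprod1E. Qed.

Lemma sqnorm_real p : D p -> E p = (sprod 1%:M ('D_(ex R) X p) ('D_(ex R) X p) / 2)%:C.
Proof.
move=> Dp; have [_ /(_ _ Dp)[_ e _]] := surface_conf (X := X).
by apply: sqnorm_dzE; [exact: trmx1|exact: surface_diff|exact: e].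
Qed.

Lemma sqnorm_gt0 p : D p -> 0 < E p.
Proof.
move=> Dp; have [_ /(_ _ Dp)[e0 _ _]] := surface_conf (X := X).
by rewrite (sqnorm_real Dp) ltcR divr_gt0.
Qed.

Lemma sqnorm_neq0 p : D p -> E p != 0.
Proof. by move=> /sqnorm_gt0 /lt0r_neq0. Qed.

Lemma conj_sqnorm p : D p -> conjc (E p) = E p.
Proof. by move=> Dp; rewrite (sqnorm_real Dp) conjc_real. Qed.

Lemma kfE p : D p -> (kf p ^+ 2)%:C = (2 * E p)^-1.
Proof.
move=> Dp; have [_ [_ _ kE]] := surface_frame Dp.
rewrite (sqnorm_real Dp).
move: kE; move: (sprod _ _ _) => a kE.
have a0 : a != 0 by apply: contraTneq (oner_neq0 R) => a0; rewrite -kE a0 mulr0 eqxx.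
have -> : kf p ^+ 2 = (2 * (a / 2))^-1.
  by rewrite mulrC divfK ?pnatr_eq0// -[LHS]mulr1 -(divff a0) mulrA kE mul1r.
by rewrite fmorphV rmorphM rmorph_nat.
Qed.

Lemma exp_factorE2 p : D p -> exp_factor X (- 2) p = (2 * E p)^-1.
Proof.
move=> Dp; rewrite -(kfE Dp) /exp_factor /kf expr2 -expRD; congr (expR _)%:C; ring.
Qed.

Lemma exp_factorE4 p : D p -> exp_factor X (- 4) p = (2 * E p)^-2.
Proof.
move=> Dp; rewrite -exprVn -(kfE Dp) /exp_factor /kf.
rewrite -rmorphXn; congr (_%:C); rewrite -exprM.
by rewrite /= -expRM_natl; congr (expR _); rewrite -mulr_natr; ring.
Qed.

(* The frame is orthogonal with determinant 1, so N is the vector of cofactors of its last row. *)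
Lemma surface_normal_smooth : smooth D N.
Proof.
have sX := surface_smooth.
have ss v w : smooth D (fun p => sprod 1%:M ('D_v X p) ('D_w X p) : R).
  have sj j : smooth D (fun p => 'D_v X p 0 j * 'D_w X p 0 j : R).
    exact: smooth_mul oD (smooth_coord j oD (smooth_derive v sX)) (smooth_coord j oD (smooth_derive w sX)).
  have := @smooth_sum _ _ _ (index_enum 'I_4) xpredT _ _ oD (fun j _ => sj j).
  apply: (eq_smooth oD) => p _; by rewrite sprod1E.
have sk : smooth D kf.
  have p0 p : D p -> 0 < sprod 1%:M ('D_(ex R) X p) ('D_(ex R) X p).
    by move=> Dp; have [_ /(_ _ Dp)[e0 _ _]] := surface_conf (X := X); exact: e0.
  have s1 := smooth_sqrt oD p0 (ss (ex R) (ex R)).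
  have s10 p : D p -> Num.sqrt (sprod 1%:M ('D_(ex R) X p) ('D_(ex R) X p)) != 0.
    by move=> Dp; rewrite sqrtr_eq0 -ltNge p0.
  apply: (eq_smooth oD) (smooth_inv oD s10 s1) => p Dp.
  have [_ [_ _ kE]] := surface_frame Dp.
  have a0 := p0 _ Dp; have s0 := s10 _ Dp.
  apply: (mulIf s0); rewrite mulVf//.
  apply/esym/eqP; rewrite -(@eqrXn2 _ 2) ?mulr_ge0 ?sqrtr_ge0 ?expR_ge0//.
  by rewrite exprMn sqr_sqrtr ?ltW// kE expr1n.
have sF (i : 'I_4) (j : 'I_4) : i != i3 -> smooth D (fun p => F p i j : R).
  move=> ii; have Fij p : F p i j = row i (F p) 0 j by rewrite [RHS]mxE.
  have [ie|n0] := eqVneq i i0.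
    by apply: (eq_smooth oD) (smooth_coord j oD sX) => p _; rewrite Fij ie F0.
  have [ie|n1] := eqVneq i i1.
    apply: (eq_smooth oD) (smooth_mul oD sk (smooth_coord j oD (smooth_derive (ex R) sX))) => p _.
    by rewrite Fij ie F1 mxE.
  have [ie|n2] := eqVneq i i2.
    apply: (eq_smooth oD) (smooth_mul oD sk (smooth_coord j oD (smooth_derive (ey R) sX))) => p _.
    by rewrite Fij ie F2 mxE.
  by case: i ii n0 n1 n2 {Fij} => -[|[|[|[|?]]]].
apply: (smooth_row oD) => j.
pose M p : 'M[R]_3 := row' i3 (col' j (F p)).
have sM (s : 'S_3) l : smooth D (fun p => M p l (s l) : R).
  have := sF (lift i3 l) (lift j (s l)); rewrite eq_sym neq_lift => /(_ isT).
  by apply: (eq_smooth oD) => p _; rewrite !mxE.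
have sp (s : 'S_3) : smooth D (fun p => (-1) ^+ s * \prod_l M p l (s l) : R).
  apply: (smooth_mul oD); first exact: smooth_cst oD.
  move=> k; exact: (@Ck_prod _ _ _ (index_enum 'I_3) xpredT k _ _ oD (fun l _ => sM s l k)).
have sd := @smooth_sum _ _ _ (index_enum 'S_3) xpredT _ _ oD (fun s _ => sp s).
have sc : smooth D (fun p => cofactor (F p) i3 j : R).
  by apply: (smooth_mul oD) sd; exact: smooth_cst oD.
apply: (eq_smooth oD) sc => p Dp.
have [H detF] := surface_gauss Dp; rewrite -/(F p) mulmx1 in H detF.
have FT : \adj (F p) = (F p)^T.
  have := mul_mx_adj (F p); rewrite detF => A.
  by rewrite -[LHS]mul1mx -(mulmx1C H) -mulmxA A mulmx1.
have := congr1 (fun A : 'M[R]_4 => A j i3) FT.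
rewrite /= [in X in X = _]mxE [in X in _ = X]mxE => ->.
by rewrite -F3 [RHS]mxE.
Qed.

(** [X_z] and [X_zbar] are null with product [E], so the coefficient along one is the product with
    the other divided by [E]. The expansion is the one in the orthonormal frame, with the two unit
    tangents combined. *)
Lemma frame_expand p (w : 'rV[C]_4) : D p ->
  w = dot w (x p) *: x p + (dot w (xb p) / E p) *: xz p + (dot w (xz p) / E p) *: xb p
      + dot w (n p) *: n p.
Proof.
move=> Dp; have [H _] := surface_gauss Dp; rewrite -/(F p) mulmx1 in H.
rewrite [LHS](orthonormal_expand w H).
rewrite !big_ord_recl big_ord0 addr0.
have -> : lift ord0 (lift ord0 (lift ord0 ord0)) = i3 by apply: val_inj.
have -> : lift ord0 (lift ord0 ord0) = i2 :> 'I_4 by apply: val_inj.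
have -> : lift ord0 ord0 = i1 :> 'I_4 by apply: val_inj.
have -> : ord0 = i0 :> 'I_4 by apply: val_inj.
rewrite F0 F1 F2 F3 -/(x p) -/(n p).
rewrite (dzv_cplxE (surface_diff Dp)) (dzbarv_cplxE (surface_diff Dp)).
have kE := kfE Dp; have E0 := sqnorm_neq0 Dp.
move: ('D_(ex R) X p) ('D_(ey R) X p) => a b; rewrite !map_mxZ.
rewrite !(sprodZr, sprodDr, sprodNr).
move: (map_mx rc a) (map_mx rc b) => {}a {}b.
rewrite !scalerA !scalerDr !scalerN !scalerA.
move: (dot w a) (dot w b) => wa wb.
rewrite -!addrA; congr (_ + _); rewrite !addrA; congr (_ + _).
have k2 : rc (kf p) * wa * rc (kf p) = wa * (2 * E p)^-1 by rewrite -kE rmorphXn /=; ring.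
have k2' : rc (kf p) * wb * rc (kf p) = wb * (2 * E p)^-1 by rewrite -kE rmorphXn /=; ring.
rewrite k2 k2'.
rewrite -[RHS]addrA [RHS]addrACA -scaleNr -[X in _ = X + _]scalerDl -[X in _ = _ + X]scalerDl.
have ii1 : 'i * 'i = -1 :> C by rewrite -expr2 sqr_i.
congr (_ *: _ + _ *: _).
  by move: (E p) E0 => e e0; field.
transitivity ((- ('i * 'i)) * wb / (2 * E p)); first by rewrite ii1; ring.
by move: (E p) ('i : C) E0 => e i e0; field.
Qed.
End Surface.

(** A suffix [z] or [b] stands for a derivative in [z] or [zbar], [v] for the conjugate of [u], and
    [G] for [E_{z zbar}]. The hypotheses are the Codazzi equation for [u], its conjugate, the Gauss
    equation and the [z]-derivative of Codazzi. The right side is [2 E (W_z u - W u_z)] with the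
    Willmore operator W expanded. *)
Lemma bryant_dzbar_alg (K : fieldType) (E Ez Eb u v h hz hb hzz hzb hzzb uz ub vz G uzb : K) :
  E != 0 -> ub = hz - Eb / E * u -> vz = hb - Ez / E * v ->
  G = - E ^+ 2 * (1 + h ^+ 2) + Ez * Eb / E + E ^+ 2 * u * v ->
  uzb = hzz - (G / E - Eb * Ez / E ^+ 2) * u - Eb / E * uz ->
  2 * Eb * (u * hzz - hz * uz) + 2 * E * (ub * hzz + u * hzzb - (hzb * uz + hz * uzb))
   + (2 * u * ub * E ^+ 2 * (1 + h ^+ 2) + u ^+ 2 * (2 * E * Eb) * (1 + h ^+ 2) + u ^+ 2 * E ^+ 2 * (2 * h * hb))
  = 2 * E * ((hzzb + (Ez * u * v * h + E * uz * v * h + E * u * vz * h + E * u * v * hz)) * u - (hzb + E * u * v * h) * uz).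
Proof. by move=> E0 -> -> -> ->; field. Qed.

Lemma minkE (K : comNzRingType) m (a b : 'rV[K]_m) (s t : 'rV[K]_1) :
  sprod (minkowski_gram K m) (row_mx a s) (row_mx b t) = sprod 1%:M a b - s 0 0 * t 0 0.
Proof.
rewrite /sprod /minkowski_gram mul_row_block !mulmx0 addr0 add0r tr_row_mx mul_row_col mulmx1.
by rewrite mulmxN mulmx1 mulNmx mxE [X in _ + X]mxE [X in _ - X]mxE big_ord1 [t^T _ _]mxE.
Qed.

Lemma mink_tr (K : comNzRingType) m : (minkowski_gram K m)^T = minkowski_gram K m.
Proof. by rewrite /minkowski_gram tr_block_mx !trmx0 linearN /= !trmx1. Qed.

Lemma normc_sqr (R : realType) (z : R[i]) : `|z| ^+ 2 = z * conjc z.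
Proof.
rewrite -add_Re2_Im2; case: z => a b; apply: complexP => /=; last by ring.
by rewrite !expr2; ring.
Qed.

#[global] Hint Constants Opaque : typeclass_instances.
#[global] Hint Extern 0 (csmooth _ (fun q => sprod _ _ _)) => (apply: csmooth_disk_sprod) : typeclass_instances.
#[global] Hint Extern 0 (csmooth _ (fun _ => ?a)) => (apply: csmooth_disk_cst) : typeclass_instances.
#[global] Hint Extern 0 (vsmooth _ (fun _ => ?a)) => (apply: vsmooth_disk_cst) : typeclass_instances.
#[global] Hint Extern 0 (csmooth _ (fun q => _ * _)) => (apply: csmooth_mul) : typeclass_instances.
#[global] Hint Extern 0 (csmooth _ (fun q => _ + _)) => (apply: csmooth_add) : typeclass_instances.
#[global] Hint Extern 0 (csmooth _ (fun q => - _)) => (apply: csmooth_opp) : typeclass_instances.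
#[global] Hint Extern 0 (csmooth _ (fun q => _ ^+ _)) => (apply: csmooth_exp) : typeclass_instances.
#[global] Hint Extern 0 (vsmooth _ (fun q => _ + _)) => (apply: vsmooth_add) : typeclass_instances.
#[global] Hint Extern 0 (vsmooth _ (fun q => - _)) => (apply: vsmooth_opp) : typeclass_instances.
#[global] Hint Extern 0 (vsmooth _ (fun q => _ *: _)) => (apply: vsmooth_scale) : typeclass_instances.
#[global] Hint Extern 0 (vsmooth _ (fun q => row_mx _ _)) => (apply: vsmooth_row_mx) : typeclass_instances.
#[global] Hint Extern 0 (vsmooth _ (fun q => _ *m _)) => (apply: vsmooth_disk_mulmx) : typeclass_instances.
Section Surface.
Variables (R : realType) (X N : 'rV[R]_2 -> 'rV[R]_4).
Context {sXN : surface X N}.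
Local Notation C := R[i].
Local Notation D := (@unit_disk R).
Local Notation rc := (real_complex R).
Local Notation dot := (sprod (1%:M : 'M[C]_4)).
Local Notation x := (cplx X).
Local Notation n := (cplx N).
Local Notation xz := (dzv (cplx X)).
Local Notation xb := (dzbarv (cplx X)).
Local Notation E := (sqnorm_dz 1%:M X).
Local Notation h := (mean_curvature 1%:M X N).
Local Notation om := (tracefree_curvature X N).
Local Notation oD := (@open_disk R).
Local Notation sX := (@surface_smooth R X N sXN).
Local Notation sN := (@surface_normal_smooth R X N sXN).

Lemma dot_map (u v : 'rV[R]_4) : dot (map_mx rc u) (map_mx rc v) = (sprod 1%:M u v)%:C.
Proof. by rewrite -sprod_map map_mx1. Qed.

Lemma dot_map_eq0 (w a b : 'rV[R]_4) : sprod 1%:M w a = 0 -> sprod 1%:M w b = 0 ->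
  dot (map_mx rc w) (2^-1 *: (map_mx rc a - 'i *: map_mx rc b)) = 0.
Proof.
move=> wa wb; rewrite sprodZr sprodDr sprodNr sprodZr !dot_map wa wb.
by rewrite mulr0 subr0 mulr0.
Qed.

Lemma conj_dot (u v : 'rV[C]_4) : conjc (dot u v) = dot (map_mx conjc u) (map_mx conjc v).
Proof. by rewrite -sprod_map map_mx1. Qed.

Global Instance vsmooth_X : vsmooth D x. Proof. exact: vsmooth_cplx oD sX. Qed.
Global Instance vsmooth_N : vsmooth D n. Proof. exact: vsmooth_cplx oD sN. Qed.

Global Instance csmooth_E : csmooth D E.
Proof.
have s : csmooth D (fun q => dot (xz q) (xb q)) by exact: _.
by apply: eq_csmooth s => q Dq; rewrite -sqnormE.
Qed.

Lemma Einv_smooth : csmooth D (fun q => (E q)^-1).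
Proof. by apply: csmooth_inv => q Dq; exact: sqnorm_neq0. Qed.

Lemma mean_curvatureE q : h q = (E q)^-1 * dot (dzbarv xz q) (n q).
Proof. by rewrite /mean_curvature csprod1E sprodZl. Qed.

Lemma tracefreeE q : om q = 2 * dot (dzv xz q) (n q).
Proof. by rewrite /tracefree_curvature csprod1E. Qed.

Global Instance csmooth_h : csmooth D h.
Proof.
have s0 : csmooth D (fun q => dot (dzbarv xz q) (n q)) by exact: _.
have s := csmooth_mul Einv_smooth s0.
by apply: eq_csmooth s => q Dq; rewrite -mean_curvatureE.
Qed.

Global Instance csmooth_om : csmooth D om.
Proof.
have s : csmooth D (fun q => 2 * dot (dzv xz q) (n q)) by exact: _.
by apply: eq_csmooth s => q Dq; rewrite -tracefreeE.
Qed.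

(** By [nzE], minus the coefficient of [X_zbar] in [N_z]; this normalization of omega absorbs the
    factor [2 E]. *)
Definition ucoef q : C := om q * (2 * E q)^-1.
Local Notation u := ucoef.

Lemma twoE_neq0 q : D q -> 2 * E q != 0.
Proof. by move=> Dq; rewrite mulf_neq0 ?sqnorm_neq0// half_neq0. Qed.

Global Instance csmooth_u : csmooth D u.
Proof.
have s : csmooth D (fun q => (2 * E q)^-1) by apply: csmooth_inv => q Dq; exact: twoE_neq0.
exact: csmooth_mul csmooth_om s.
Qed.

Lemma omE q : D q -> om q = 2 * E q * u q.
Proof. by move=> Dq; rewrite /ucoef mulrC divfK// twoE_neq0. Qed.

Lemma u_neq0 q : D q -> u q != 0.
Proof. 
move=> Dq; apply: mulf_neq0; first exact: (surface_umb (X := X) (N := N) Dq).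
by rewrite invr_eq0; exact: twoE_neq0. Qed.

Lemma vs_xz : vsmooth D xz. Proof. exact: vsmooth_dzv vsmooth_X. Qed.
Lemma vs_xb : vsmooth D xb. Proof. exact: vsmooth_dzbarv vsmooth_X. Qed.
Lemma vs_xzz : vsmooth D (dzv xz). Proof. exact: vsmooth_dzv vs_xz. Qed.

Section Point.
Variable p : 'rV[R]_2.
Hypothesis Dp : D p.

Lemma conj_xz : map_mx conjc (xz p) = xb p. Proof. exact: conj_dzv_cplx oD Dp sX. Qed.
Lemma conj_xb : map_mx conjc (xb p) = xz p. Proof. exact: conj_dzbarv_cplx oD Dp sX. Qed.
Lemma conj_n : map_mx conjc (n p) = n p. Proof. exact: conj_cplx. Qed.
Lemma conj_x : map_mx conjc (x p) = x p. Proof. exact: conj_cplx. Qed.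

Lemma dot_xx : dot (x p) (x p) = 1.
Proof. by rewrite /cplx dot_map; have [[-> _ _ _ _] _] := surface_frame (X := X) Dp. Qed.
Lemma dot_nn : dot (n p) (n p) = 1.
Proof. by rewrite /cplx dot_map; have [[_ -> _ _ _] _] := surface_frame (X := X) Dp. Qed.
Lemma dot_nx : dot (n p) (x p) = 0.
Proof. by rewrite /cplx dot_map; have [[_ _ -> _ _] _] := surface_frame (X := X) Dp. Qed.
Lemma dot_xn : dot (x p) (n p) = 0.
Proof. by rewrite sprod1C dot_nx. Qed.
Lemma dot_nz : dot (n p) (xz p) = 0.
Proof.
rewrite (dzv_cplxE (smooth_differentiable sX Dp)).
by have [[_ _ _ a b] _] := surface_frame (X := X) Dp; exact: dot_map_eq0.
Qed.
Lemma dot_zn : dot (xz p) (n p) = 0.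
Proof. by rewrite sprod1C dot_nz. Qed.
Lemma dot_bn : dot (xb p) (n p) = 0.
Proof. by rewrite -conj_xz -conj_n -conj_dot dot_zn conjc0. Qed.
Lemma dot_nb : dot (n p) (xb p) = 0.
Proof. by rewrite sprod1C dot_bn. Qed.
Lemma dot_xz : dot (x p) (xz p) = 0.
Proof.
rewrite (dzv_cplxE (smooth_differentiable sX Dp)).
by have [_ [a b _]] := surface_frame (X := X) Dp; exact: dot_map_eq0.
Qed.
Lemma dot_zx : dot (xz p) (x p) = 0.
Proof. by rewrite sprod1C dot_xz. Qed.
Lemma dot_bx : dot (xb p) (x p) = 0.
Proof. by rewrite -conj_xz -conj_x -conj_dot dot_zx conjc0. Qed.
Lemma dot_xb : dot (x p) (xb p) = 0.
Proof. by rewrite sprod1C dot_bx. Qed.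
Lemma dot_zz : dot (xz p) (xz p) = 0.
Proof.
have [_ /(_ _ Dp)[_ c o]] := surface_conf (X := X).
by rewrite -csprod1E; exact: (sprod_dz_dz (trmx1 _ _) (smooth_differentiable sX Dp) c o).
Qed.
Lemma dot_bb : dot (xb p) (xb p) = 0.
Proof. by rewrite -conj_xz -conj_dot dot_zz conjc0. Qed.
Lemma dot_zb : dot (xz p) (xb p) = E p.
Proof. by rewrite sqnormE. Qed.
Lemma dot_bz : dot (xb p) (xz p) = E p.
Proof. by rewrite sprod1C dot_zb. Qed.
Definition dots := (dot_xx, dot_nn, dot_nx, dot_xn, dot_nz, dot_zn, dot_bn, dot_nb, dot_xz, dot_zx,
  dot_bx, dot_xb, dot_zz, dot_bb, dot_zb, dot_bz).

Lemma dz_dot (F G : _ -> 'rV[C]_4) (c : _ -> C) (sF : vsmooth D F) (sG : vsmooth D G) :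
  (forall q, D q -> dot (F q) (G q) = c q) ->
  dot (dzv F p) (G p) + dot (F p) (dzv G p) = dz c p.
Proof.
move=> H; rewrite -(eq_dz Dp oD H).
by rewrite (dz_sprod Dp 1%:M oD (sF := sF) (sG := sG)).
Qed.
Lemma dzbar_dot (F G : _ -> 'rV[C]_4) (c : _ -> C) (sF : vsmooth D F) (sG : vsmooth D G) :
  (forall q, D q -> dot (F q) (G q) = c q) ->
  dot (dzbarv F p) (G p) + dot (F p) (dzbarv G p) = dzbar c p.
Proof.
move=> H; rewrite -(eq_dzbar Dp oD H).
by rewrite (dzbar_sprod Dp 1%:M oD (sF := sF) (sG := sG)).
Qed.
End Point.

Lemma xzbC p : D p -> dzv xb p = dzbarv xz p.
Proof. by move=> Dp; rewrite (dzv_dzbarvC Dp). Qed.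

Lemma addr_eq0_half (a : C) : a + a = 0 -> a = 0.
Proof.
have -> : a + a = 2 * a by ring.
by move=> /eqP; rewrite mulf_eq0 (negbTE (half_neq0 R)) => /eqP.
Qed.

Lemma xzzE p : D p -> dzv xz p = (dz E p / E p) *: xz p + (om p / 2) *: n p.
Proof.
move=> Dp; rewrite [LHS](frame_expand _ Dp).
have -> : dot (dzv xz p) (x p) = 0.
  have := dz_dot Dp vs_xz vsmooth_X (fun q => @dot_zx q); rewrite (dz_cst p 0) (dot_zz Dp) addr0; exact.
have -> : dot (dzv xz p) (xz p) = 0.
  have := dz_dot Dp vs_xz vs_xz (fun q => @dot_zz q); rewrite (dz_cst p 0) (sprod1C (xz p) (dzv xz p)).
  exact: addr_eq0_half.
(* Since [X_z] stays null, [<X_z, X_{z zbar}>] drops out of the derivative of [E], which leaves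
   [<X_zz, X_zbar> = E_z]. *)
have b0 : dot (xz p) (dzbarv xz p) = 0.
  have := dzbar_dot Dp vs_xz vs_xz (fun q => @dot_zz q); rewrite (dzbar_cst p 0) (sprod1C (dzbarv xz p) (xz p)).
  exact: addr_eq0_half.
have -> : dot (dzv xz p) (xb p) = dz E p.
  have := dz_dot Dp vs_xz vs_xb (fun q => @dot_zb q); rewrite (xzbC Dp) b0 addr0; exact.
have -> : dot (dzv xz p) (n p) = om p / 2.
  by rewrite tracefreeE mulrC mulKf// half_neq0.
by rewrite scale0r add0r mul0r scale0r addr0.
Qed.

Lemma xzbE p : D p -> dzbarv xz p = (- E p) *: x p + (E p * h p) *: n p.
Proof.
move=> Dp; rewrite [LHS](frame_expand _ Dp).
have -> : dot (dzbarv xz p) (x p) = - E p.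
  have := dzbar_dot Dp vs_xz vsmooth_X (fun q => @dot_zx q); rewrite (dzbar_cst p 0) (dot_zb Dp).
  by move=> /eqP; rewrite addr_eq0 => /eqP.
have -> : dot (dzbarv xz p) (xz p) = 0.
  have := dzbar_dot Dp vs_xz vs_xz (fun q => @dot_zz q); rewrite (dzbar_cst p 0) (sprod1C (xz p) (dzbarv xz p)).
  exact: addr_eq0_half.
have -> : dot (dzbarv xz p) (xb p) = 0.
  have := dz_dot Dp vs_xb vs_xb (fun q => @dot_bb q); rewrite (dz_cst p 0) (sprod1C (xb p) (dzv xb p)) (xzbC Dp).
  exact: addr_eq0_half.
rewrite mean_curvatureE mulVKf ?sqnorm_neq0//.
by rewrite !mul0r !scale0r !addr0.
Qed.

Lemma nzE p : D p -> dzv n p = (- h p) *: xz p - u p *: xb p.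
Proof.
move=> Dp; rewrite [LHS](frame_expand _ Dp).
have E0 : E p != 0 by exact: (sqnorm_neq0 Dp).
have -> : dot (dzv n p) (x p) = 0.
  have := dz_dot Dp vsmooth_N vsmooth_X (fun q => @dot_nx q); rewrite (dz_cst p 0) (dot_nz Dp) addr0; exact.
have -> : dot (dzv n p) (n p) = 0.
  have := dz_dot Dp vsmooth_N vsmooth_N (fun q => @dot_nn q); rewrite (dz_cst p 1) (sprod1C (n p) (dzv n p)).
  exact: addr_eq0_half.
have -> : dot (dzv n p) (xz p) = - (om p / 2).
  have := dz_dot Dp vsmooth_N vs_xz (fun q => @dot_nz q); rewrite (dz_cst p 0) (xzzE Dp) sprodDr !sprodZr (dot_nz Dp) (dot_nn Dp).
  by rewrite mulr0 add0r mulr1 => /eqP; rewrite addr_eq0 => /eqP.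
have -> : dot (dzv n p) (xb p) = - (E p * h p).
  have := dz_dot Dp vsmooth_N vs_xb (fun q => @dot_nb q); rewrite (dz_cst p 0) (xzbC Dp) (xzbE Dp) sprodDr !sprodZr (dot_nx Dp) (dot_nn Dp).
  by rewrite mulr0 add0r mulr1 => /eqP; rewrite addr_eq0 => /eqP.
have e1 : - (E p * h p) / E p = - h p by move: (E p) (h p) E0 => e k e0; field.
have e2 : - (om p / 2) / E p = - u p by rewrite /ucoef; move: (E p) (om p) E0 => e k e0; field.
by rewrite e1 e2 scale0r add0r scale0r addr0 (scaleNr (u p)).
Qed.

(** [X_{z zbar}] is real because the two Wirtinger derivatives commute. *)
Lemma conj_h p : D p -> conjc (h p) = h p.
Proof.
move=> Dp; rewrite mean_curvatureE rmorphM fmorphV /= (conj_sqnorm Dp) conj_dot conj_n.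
by rewrite -(dzv_conj Dp) (eq_dzv Dp oD (fun q => @conj_xz q)) (xzbC Dp).
Qed.

Lemma conj_dz_real f p : csmooth D f -> (forall q, D q -> conjc (f q) = f q) -> D p ->
  conjc (dz f p) = dzbar f p.
Proof. by move=> sf H Dp; rewrite -(dzbar_conj Dp) (eq_dzbar Dp oD H). Qed.
Lemma conj_dzbar_real f p : csmooth D f -> (forall q, D q -> conjc (f q) = f q) -> D p ->
  conjc (dzbar f p) = dz f p.
Proof. by move=> sf H Dp; rewrite -(dz_conj Dp) (eq_dz Dp oD H). Qed.

Lemma conj_dz_h p : D p -> conjc (dz h p) = dzbar h p.
Proof. exact: conj_dz_real conj_h. Qed.
Lemma conj_dzbar_E p : D p -> conjc (dzbar E p) = dz E p.
Proof. by apply: conj_dzbar_real => q; exact: conj_sqnorm. Qed.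
Lemma conj_dz_E p : D p -> conjc (dz E p) = dzbar E p.
Proof. by apply: conj_dz_real => q; exact: conj_sqnorm. Qed.

Lemma conj_scale m (a : C) (v : 'rV[C]_m) : map_mx conjc (a *: v) = conjc a *: map_mx conjc v.
Proof. by rewrite map_mxZ. Qed.

Lemma nbE p : D p -> dzbarv n p = (- h p) *: xb p - conjc (u p) *: xz p.
Proof.
move=> Dp; rewrite -(conj_dzv_cplx oD Dp sN) (nzE Dp).
rewrite map_mxD map_mxN !conj_scale (conj_xz Dp) (conj_xb Dp); congr (_ *: _ - _).
by rewrite rmorphN; congr (- _); exact: conj_h.
Qed.

Lemma conj_om p : D p -> conjc (om p) = 2 * E p * conjc (u p).
Proof.
move=> Dp; rewrite (omE Dp) rmorphM; congr (_ * _).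
by rewrite rmorphM rmorph_nat; congr (_ * _); exact: conj_sqnorm.
Qed.

Lemma xbbE p : D p -> dzbarv xb p = (dzbar E p / E p) *: xb p + (conjc (om p) / 2) *: n p.
Proof.
move=> Dp; rewrite -(eq_dzbarv Dp oD (fun q => @conj_xz q)) (dzbarv_conj Dp) (xzzE Dp).
rewrite map_mxD !conj_scale (conj_xz Dp) conj_n; congr (_ *: _ + _ *: _).
  by rewrite rmorphM fmorphV /= (conj_dz_E Dp) (conj_sqnorm Dp).
by rewrite rmorphM fmorphV rmorph_nat.
Qed.

Lemma xzzbE p : D p -> dzbarv (dzv xz) p =
  (- dz E p) *: x p + (- E p) *: xz p + ((dz E p * h p + E p * dz h p) *: n p + (E p * h p) *: dzv n p).
Proof.
move=> Dp; rewrite (dzv_dzbarvC Dp) (eq_dzv Dp oD xzbE).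
have s1 : csmooth D (fun q => - E q) by exact: _.
have s2 : csmooth D (fun q => E q * h q) by exact: _.
by rewrite (dzvD Dp) !(dzvZ Dp) (dzN Dp) (dzM Dp).
Qed.

(** [X_{zz zbar}] is computed as the [z]-derivative of [X_{z zbar} = - E X + E h N] and paired with
    [N]; adding [<X_zz, N_zbar>] gives half the [zbar]-derivative of omega. *)
Lemma codazzi p : D p -> dzbar om p = 2 * E p * dz h p.
Proof.
move=> Dp; have E0 : E p != 0 by exact: (sqnorm_neq0 Dp).
have H := dzbar_dot Dp vs_xzz vsmooth_N (fun q _ => erefl (dot (dzv xz q) (n q))).
rewrite (eq_dzbar Dp oD (fun q _ => tracefreeE q)) (dzbarM Dp) (dzbar_cst p 2) mul0r add0r -H.
rewrite -mulrA; congr (_ * _).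
rewrite (xzzbE Dp) (nzE Dp) (nbE Dp) (xzzE Dp).
rewrite !(sprodDl, sprodDr, sprodZl, sprodZr, sprodNl, sprodNr) !(dots Dp).
move: (E p) (dz E p) (h p) (dz h p) (u p) (conjc (u p)) (om p) E0 => e ez hh hz uu uc o e0.
by field.
Qed.

(** The same expression of [X_{zz zbar}] is paired with [X_zbar] instead of [N], since
    [E_z = <X_zz, X_zbar>]. *)
Lemma gauss_equation p : D p -> dzbar (dz E) p =
  - E p ^+ 2 * (1 + h p ^+ 2) + dz E p * dzbar E p / E p + E p ^+ 2 * u p * conjc (u p).
Proof.
move=> Dp; have E0 : E p != 0 by exact: (sqnorm_neq0 Dp).
have Ez q : D q -> dot (dzv xz q) (xb q) = dz E q.
  move=> Dq; rewrite (xzzE Dq) sprodDl !sprodZl (dot_zb Dq) (dot_nb Dq) mulr0 addr0.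
  have e0 : E q != 0 by exact: (sqnorm_neq0 Dq).
  by move: (E q) (dz E q) e0 => e d e0; field.
have H := dzbar_dot Dp vs_xzz vs_xb Ez; rewrite -H (xzzbE Dp) (nzE Dp) (xbbE Dp) (xzzE Dp).
rewrite !(sprodDl, sprodDr, sprodZl, sprodZr, sprodNl, sprodNr) !(dots Dp).
rewrite (conj_om Dp) (omE Dp).
move: (E p) (dz E p) (dzbar E p) (h p) (dz h p) (u p) (conjc (u p)) E0 => e ez eb hh hz uu uc e0.
by field.
Qed.

Lemma dzbar_u p : D p -> dzbar u p = dz h p - dzbar E p / E p * u p.
Proof.
move=> Dp; have E0 : E p != 0 by exact: (sqnorm_neq0 Dp).
have s : csmooth D (fun q => 2 * E q) by exact: _.
have := codazzi Dp; rewrite (eq_dzbar Dp oD omE) (dzbarM Dp) (dzbarM Dp) (dzbar_cst p 2).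
move: (E p) (dzbar E p) (dz h p) (u p) (dzbar u p) E0 => e eb hz uu ub e0 H.
have -> : ub = (((0 * e + 2 * eb) * uu + 2 * e * ub) - 2 * eb * uu) / (2 * e) by field.
by rewrite H; field.
Qed.

Lemma dz_conj_u p : D p -> dz (fun q => conjc (u q)) p = dzbar h p - dz E p / E p * conjc (u p).
Proof.
move=> Dp; rewrite (dz_conj Dp) (dzbar_u Dp) rmorphB.
congr (_ - _); first exact: conj_dz_h.
rewrite rmorphM rmorphM fmorphV; congr (_ * _^-1 * _); first exact: conj_dzbar_E.
exact: conj_sqnorm.
Qed.

Lemma willmoreE p : D p -> willmore X N p = dzbar (dz h) p + E p * u p * conjc (u p) * h p.
Proof.
move=> Dp; have E0 : E p != 0 by exact: (sqnorm_neq0 Dp).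
rewrite /willmore normc_sqr (exp_factorE2 Dp); congr (_ + _).
rewrite (conj_om Dp) (omE Dp).
move: (E p) (h p) (u p) (conjc (u p)) E0 => e hh uu uc e0; by field.
Qed.

Local Notation nu q := (row_mx (x q) (1%:M : 'rV[C]_1)).
Local Notation Y := (conformal_gauss_map X N).

(** The [X_z] components cancel, [h X_z] from the first term against [- h X_z] in [N_z]. What
    remains is isotropic: the conformal Gauss map is conformal. *)
Lemma dzvY p : D p -> dzv Y p = dz h p *: nu p - u p *: row_mx (xb p) 0.
Proof.
move=> Dp; have s1 : vsmooth D (fun q => nu q) by exact: _.
have s2 : vsmooth D (fun q => h q *: nu q) by exact: _.
have s3 : vsmooth D (fun q => row_mx (n q) (0 : 'rV[C]_1)) by exact: _.
rewrite /conformal_gauss_map (dzvD Dp) (dzvZ Dp) !(dzv_row_mx p) (dzv_cst p 1%:M) (dzv_cst p 0) (nzE Dp).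
rewrite -addrA; congr (_ + _).
by rewrite !scale_row_mx opp_row_mx add_row_mx !scaler0 oppr0 addr0 scaleNr addrA subrr add0r.
Qed.

Global Instance vsmooth_Y : vsmooth D Y.
Proof. rewrite /conformal_gauss_map; exact: _. Qed.

Lemma dzvvY p : D p -> dzv (dzv Y) p =
  dz (dz h) p *: nu p + dz h p *: row_mx (xz p) 0 - (dz u p *: row_mx (xb p) 0 + u p *: row_mx (dzbarv xz p) 0).
Proof.
move=> Dp; rewrite (eq_dzv Dp oD dzvY).
have s1 : vsmooth D (fun q => nu q) by exact: _.
have s2 : vsmooth D (fun q => dz h q *: nu q) by exact: _.
have s3 : vsmooth D (fun q => row_mx (xb q) (0 : 'rV[C]_1)) by exact: _.
have s4 : vsmooth D (fun q => u q *: row_mx (xb q) (0 : 'rV[C]_1)) by exact: _.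
rewrite (dzvD Dp) (dzvN Dp) !(dzvZ Dp) !(dzv_row_mx p) (dzv_cst p 1%:M) (dzv_cst p 0).
by rewrite (xzbC Dp).
Qed.

Lemma bryantE p : D p -> bryant X N p =
  2 * E p * (u p * dz (dz h) p - dz h p * dz u p) + u p ^+ 2 * E p ^+ 2 * (1 + h p ^+ 2).
Proof.
move=> Dp; rewrite /bryant (dzvvY Dp) (xzbE Dp).
rewrite !(sprodDl, sprodDr, sprodZl, sprodZr, sprodNl, sprodNr) !minkE.
rewrite !(sprodDl, sprodDr, sprodZl, sprodZr, sprodNl, sprodNr) !(dots Dp) !mxE /=.
move: (E p) (u p) (h p) (dz h p) (dz u p) (dz (dz h) p) => *; ring.
Qed.

Lemma bryant_smooth : csmooth D (bryant X N).
Proof. rewrite /bryant; exact: _. Qed.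

Lemma willmore_smooth : csmooth D (willmore X N).
Proof.
have s : csmooth D (fun p => dzbar (dz h) p + E p * u p * conjc (u p) * h p) by exact: _.
by apply: eq_csmooth s => q Dq; rewrite willmoreE.
Qed.

Lemma dzbar_bryant_expr (E0 u0 h0 hz hzz uz : _ -> C) p :
  csmooth D E0 -> csmooth D u0 -> csmooth D h0 -> csmooth D hz -> csmooth D hzz -> csmooth D uz -> D p ->
  dzbar (fun q => 2 * E0 q * (u0 q * hzz q - hz q * uz q) + u0 q ^+ 2 * E0 q ^+ 2 * (1 + h0 q ^+ 2)) p =
  2 * dzbar E0 p * (u0 p * hzz p - hz p * uz p) + 2 * E0 p * (dzbar u0 p * hzz p + u0 p * dzbar hzz p - (dzbar hz p * uz p + hz p * dzbar uz p))
   + (2 * u0 p * dzbar u0 p * E0 p ^+ 2 * (1 + h0 p ^+ 2) + u0 p ^+ 2 * (2 * E0 p * dzbar E0 p) * (1 + h0 p ^+ 2) + u0 p ^+ 2 * E0 p ^+ 2 * (2 * h0 p * dzbar h0 p)).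
Proof.
move=> s1 s2 s3 s4 s5 s6 Dp.
rewrite ?(dzbarD Dp) ?(dzbarM Dp) ?(dzbarX2 Dp) ?(dzbarD Dp) ?(dzbarN Dp) ?(dzbarM Dp) ?(dzbarX2 Dp) ?(dzbar_cst p).
move: (E0 p) (u0 p) (h0 p) (hz p) (hzz p) (uz p) (dzbar _ p) (dzbar _ p) (dzbar _ p) (dzbar _ p) (dzbar _ p) (dzbar _ p) => *; ring.
Qed.

Lemma dz_willmore_expr (E0 u0 v0 h0 w0 : _ -> C) p :
  csmooth D E0 -> csmooth D u0 -> csmooth D v0 -> csmooth D h0 -> csmooth D w0 -> D p ->
  dz (fun q => w0 q + E0 q * u0 q * v0 q * h0 q) p =
  dz w0 p + (dz E0 p * u0 p * v0 p * h0 p + E0 p * dz u0 p * v0 p * h0 p + E0 p * u0 p * dz v0 p * h0 p + E0 p * u0 p * v0 p * dz h0 p).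
Proof.
move=> s1 s2 s3 s4 s5 Dp.
rewrite ?(dzD Dp) ?(dzM Dp).
move: (E0 p) (u0 p) (h0 p) (v0 p) (w0 p) (dz _ p) (dz _ p) (dz _ p) (dz _ p) (dz _ p) => *; ring.
Qed.

(** Holomorphy of Q thus means [W_z u = W u_z]. Both directions of the equivalence rest on this
    identity, through [bryant_holo] and [kappa_z]. *)
Lemma bryant_dzbar p : D p -> dzbar (bryant X N) p =
  2 * E p * (dz (willmore X N) p * u p - willmore X N p * dz u p).
Proof.
move=> Dp; have E0 : E p != 0 by exact: (sqnorm_neq0 Dp).
have s1 : csmooth D (fun q => (E q)^-1) := Einv_smooth.
have uzb : dzbar (dz u) p = dz (dz h) p - (dzbar (dz E) p / E p - dzbar E p * dz E p / E p ^+ 2) * u p - dzbar E p / E p * dz u p.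
  rewrite (dz_dzbarC Dp) (eq_dz Dp oD dzbar_u) (dzD Dp) (dzN Dp) (dzM Dp) (dzM Dp) (dzV Dp); last first.
    by move=> q Dq; exact: sqnorm_neq0.
  rewrite -(dz_dzbarC Dp).
  move: (E p) (dz E p) (dzbar E p) (dzbar (dz E) p) (u p) (dz u p) (dz (dz h) p) E0 => *; by field.
rewrite (eq_dz Dp oD willmoreE) (willmoreE Dp) (eq_dzbar Dp oD bryantE).
have G := gauss_equation Dp; have ub := dzbar_u Dp; have vz := dz_conj_u Dp.
have H := bryant_dzbar_alg (dzbar (dz h) p) (dz (dzbar (dz h)) p) E0 ub vz G uzb.
rewrite (dzbar_bryant_expr csmooth_E csmooth_u csmooth_h (csmooth_dz csmooth_h) (csmooth_dz (csmooth_dz csmooth_h)) (csmooth_dz csmooth_u) Dp).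
rewrite (dz_willmore_expr csmooth_E csmooth_u (csmooth_conj csmooth_u) csmooth_h (csmooth_dzbar (csmooth_dz csmooth_h)) Dp).
rewrite (dz_dzbarC (f := dz h) Dp).
exact: H.
Qed.
End Surface.

(** * Consequences of a constant height of the conformal Gauss map *)

Lemma constY_alg1 (K : fieldType) (E Eb u v h hz hzb t tb ub tbb eta H W : K) :
  ub = hz - Eb / E * u -> tbb = Eb / E * tb + E * v * eta ->
  hzb * t + hz * tb = ub * tb + u * tbb -> h * t + eta = H -> W = hzb + E * u * v * h ->
  W * t = E * u * v * H.
Proof.
move=> -> -> H1 <- ->.
have A : hzb * t = u * E * v * eta by apply: (addIr (hz * tb)); rewrite H1; ring.
by rewrite mulrDl A; ring.
Qed.

(** In these algebraic lemmas [t] is tau, [eta] is [<(N, 0), v>], [s] the last coordinate of [v],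
    [H] the height [<Y, v>] and [vv] is [<v, v>]; suffixes denote derivatives. Here the equation
    [h_z tau = u tau_zbar] and its [z]-derivative eliminate the derivatives of [h] from Q, and the
    formula for [tau_{z zbar}] then brings in [<v, v>]. *)
Lemma constY_alg2 (K : fieldType) (E u uz h hz hzz t tz tb tbz eta s H vv Q : K) : E != 0 ->
  hz * t = u * tb -> hzz * t + hz * tz = uz * tb + u * tbz ->
  tbz = E * (- (t + s) + h * eta) -> h * t + eta = H ->
  vv = (t + s) ^+ 2 + 2 * tz * tb / E + eta ^+ 2 - s ^+ 2 ->
  Q = 2 * E * (u * hzz - hz * uz) + u ^+ 2 * E ^+ 2 * (1 + h ^+ 2) ->
  t ^+ 2 * Q = u ^+ 2 * E ^+ 2 * (H ^+ 2 - vv).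
Proof.
move=> E0 H1 H2 H3 <- -> ->.
have A : t ^+ 2 * (u * hzz - hz * uz) = u ^+ 2 * (t * tbz - tb * tz).
  have -> : t ^+ 2 * (u * hzz - hz * uz) = t * u * (hzz * t + hz * tz) - u * tz * (hz * t) - uz * t * (hz * t) by ring.
  by rewrite H2 H1; ring.
have -> : t ^+ 2 * (2 * E * (u * hzz - hz * uz) + u ^+ 2 * E ^+ 2 * (1 + h ^+ 2)) =
  2 * E * (t ^+ 2 * (u * hzz - hz * uz)) + t ^+ 2 * u ^+ 2 * E ^+ 2 * (1 + h ^+ 2) by ring.
by rewrite A H3; field.
Qed.

Lemma constY_alg3 (K : fieldType) (E Ez u uz v vz hb t tz W Wz H : K) : E != 0 ->
  vz = hb - Ez / E * v -> hb * t = v * tz -> W * t = E * u * v * H ->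
  Wz * t + W * tz = (Ez * u * v + E * uz * v + E * u * vz) * H ->
  t ^+ 2 * (Wz * u - W * uz) = 0.
Proof.
move=> E0 -> H1 H2 H3.
have -> : t ^+ 2 * (Wz * u - W * uz) = t * u * (Wz * t + W * tz) - u * tz * (W * t) - t * uz * (W * t) by ring.
rewrite H3 H2.
have -> : (Ez * u * v + E * uz * v + E * u * (hb - Ez / E * v)) * H = (E * uz * v + E * u * hb) * H by field.
have -> : t * u * ((E * uz * v + E * u * hb) * H) = u * E * H * (uz * v * t + u * (hb * t)) by ring.
by rewrite H1; ring.
Qed.

Lemma constY_alg4 (K : fieldType) (E u v H vv t Q W : K) : 
  t ^+ 2 * Q = u ^+ 2 * E ^+ 2 * (H ^+ 2 - vv) -> W * t = E * u * v * H ->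
  t ^+ 2 * (W ^+ 2 - v ^+ 2 * Q) = (E * u * v) ^+ 2 * vv.
Proof.
move=> H1 H2.
have -> : t ^+ 2 * (W ^+ 2 - v ^+ 2 * Q) = (W * t) ^+ 2 - v ^+ 2 * (t ^+ 2 * Q) by ring.
by rewrite H1 H2; ring.
Qed.

Lemma conjcM (R : realType) (a b : R[i]) : conjc (a * b) = conjc a * conjc b.
Proof. exact: rmorphM. Qed.
Lemma conjcD (R : realType) (a b : R[i]) : conjc (a + b) = conjc a + conjc b.
Proof. exact: rmorphD. Qed.
Lemma conjcN (R : realType) (a : R[i]) : conjc (- a) = - conjc a.
Proof. exact: rmorphN. Qed.
Lemma conjcV (R : realType) (a : R[i]) : conjc a^-1 = (conjc a)^-1.
Proof. exact: fmorphV. Qed.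

Section ConstVector.
Variables (R : realType) (X N : 'rV[R]_2 -> 'rV[R]_4).
Context {sXN : surface X N}.
Local Notation C := R[i].
Local Notation D := (@unit_disk R).
Local Notation dot := (sprod (1%:M : 'M[C]_4)).
Local Notation x := (cplx X).
Local Notation n := (cplx N).
Local Notation xz := (dzv (cplx X)).
Local Notation xb := (dzbarv (cplx X)).
Local Notation E := (sqnorm_dz 1%:M X).
Local Notation h := (mean_curvature 1%:M X N).
Local Notation om := (tracefree_curvature X N).
Local Notation u := (ucoef X N).
Local Notation W := (willmore X N).
Local Notation Q := (bryant X N).
Local Notation oD := (@open_disk R).

Lemma bryant_discriminantE p : D p -> bryant_discriminant X N p = W p ^+ 2 - conjc (u p) ^+ 2 * Q p.
Proof.
move=> Dp; rewrite /bryant_discriminant (exp_factorE4 Dp) (conj_om Dp).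
have E0 : 2 * E p != 0 by exact: twoE_neq0 Dp.
move: (W p) (Q p) (conjc (u p)) (2 * E p) E0 => w q c e e0.
by congr (_ - _ * _); rewrite exprMn mulrAC divff ?mul1r// expf_neq0.
Qed.

Variables (w : 'rV[C]_4) (s H : C).
Hypotheses (wr : map_mx conjc w = w).

(** The constant vector is [(w, s)]; the minus sign is that of the Lorentzian form in the product
    with [(X, 1)]. *)
Definition tauv q : C := dot (x q) w - s.
Definition etav q : C := dot (n q) w.
Local Notation tau := tauv.
Local Notation eta := etav.

Global Instance csmooth_tau : csmooth D tau.
Proof.
have s1 : csmooth D (fun q => dot (x q) w - s) by exact: _.
exact: s1.
Qed.
Global Instance csmooth_eta : csmooth D eta.
Proof.
have s1 : csmooth D (fun q => dot (n q) w) by exact: _.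
exact: s1.
Qed.

Lemma dz_dotw (F : _ -> 'rV[C]_4) p : vsmooth D F -> D p -> dz (fun q => dot (F q) w) p = dot (dzv F p) w.
Proof.
move=> sF Dp; rewrite (dz_sprod Dp 1%:M oD (sF := sF) (sG := vsmooth_disk_cst w)).
by rewrite (dzv_cst p w) sprod0r addr0.
Qed.
Lemma dzbar_dotw (F : _ -> 'rV[C]_4) p : vsmooth D F -> D p -> dzbar (fun q => dot (F q) w) p = dot (dzbarv F p) w.
Proof.
move=> sF Dp; rewrite (dzbar_sprod Dp 1%:M oD (sF := sF) (sG := vsmooth_disk_cst w)).
by rewrite (dzbarv_cst p w) sprod0r addr0.
Qed.

Lemma dz_tau p : D p -> dz tau p = dot (xz p) w.
Proof.
move=> Dp; have s1 : csmooth D (fun q => dot (x q) w) by exact: _.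
have -> : dz tau p = dz (fun q => dot (x q) w + - s) p by [].
by rewrite (dzD Dp) (dz_cst p) addr0 (dz_dotw _ Dp).
Qed.
Lemma dzbar_tau p : D p -> dzbar tau p = dot (xb p) w.
Proof.
move=> Dp; have s1 : csmooth D (fun q => dot (x q) w) by exact: _.
have -> : dzbar tau p = dzbar (fun q => dot (x q) w + - s) p by [].
by rewrite (dzbarD Dp) (dzbar_cst p) addr0 (dzbar_dotw _ Dp).
Qed.
Lemma dzzbar_tau p : D p -> dz (dzbar tau) p = E p * (- (tau p + s) + h p * eta p).
Proof.
move=> Dp; rewrite (eq_dz Dp oD dzbar_tau) (dz_dotw (@vs_xb R X N sXN) Dp) (xzbC Dp) (xzbE Dp).
rewrite sprodDl !sprodZl /tauv /etav.
by move: (E p) (h p) (dot _ _) (dot _ _) => *; ring.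
Qed.
Lemma dzbarbar_tau p : D p -> dzbar (dzbar tau) p = dzbar E p / E p * dzbar tau p + E p * conjc (u p) * eta p.
Proof.
move=> Dp; rewrite (eq_dzbar Dp oD dzbar_tau) (dzbar_dotw (@vs_xb R X N sXN) Dp) (xbbE Dp) (dzbar_tau Dp).
rewrite sprodDl !sprodZl (conj_om Dp) -/(etav p).
by congr (_ + _ * _); move: (E p) (conjc (u p)) => *; field.
Qed.

Lemma dotww p : D p -> dot w w = dot (x p) w ^+ 2 + 2 * dz tau p * dzbar tau p / E p + eta p ^+ 2.
Proof.
move=> Dp; rewrite (dz_tau Dp) (dzbar_tau Dp) {1}[w](frame_expand w Dp).
rewrite !sprodDl !sprodZl (sprod1C w (x p)) (sprod1C w (xz p)) (sprod1C w (xb p)) (sprod1C w (n p)).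
have E0 : E p != 0 by exact: (sqnorm_neq0 Dp).
rewrite -/(etav p); move: (E p) (dot (x p) w) (dot (xz p) w) (dot (xb p) w) (eta p) E0 => e a b c d e0.
by field.
Qed.

Hypothesis HY : forall q, D q -> h q * tau q + eta q = H.

(** The [z]-derivative of [h tau + eta = H], where [h tau_z] cancels against
    [eta_z = - h tau_z - u tau_zbar]. The relations for W and Q come from differentiating this
    one. *)
Lemma dz_h_tau p : D p -> dz h p * tau p = u p * dzbar tau p.
Proof.
move=> Dp; have := eq_dz Dp oD HY.
rewrite (dzD Dp) (dzM Dp) (dz_cst p) (dz_tau Dp) (dzbar_tau Dp).
rewrite /etav (dz_dotw _ Dp) (nzE Dp) sprodDl sprodNl !sprodZl.
move: (u p) (h p) (dz h p) (dot (xz p) w) (dot (xb p) w) (tau p) => a b c d e f.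
move=> K; have -> : c * f = (c * f + b * d + (- b * d - a * e)) + a * e by ring.
by rewrite K; ring.
Qed.

(** The [zbar]-derivative of [dz_h_tau]. Once Codazzi replaces [u_zbar] and [dzbarbar_tau] replaces
    the second derivative of tau, the terms in [h_z tau_zbar] and in [E_zbar] cancel. *)
Lemma willmore_tau p : D p -> W p * tau p = E p * u p * conjc (u p) * H.
Proof.
move=> Dp; have := eq_dzbar Dp oD dz_h_tau.
rewrite (dzbarM Dp (f := dz h) (g := tau)) (dzbarM Dp (f := u) (g := dzbar tau)) => K.
exact: (constY_alg1 (dzbar_u Dp) (dzbarbar_tau Dp) K (HY Dp) (willmoreE Dp)).
Qed.

Lemma bryant_tau p : D p -> tau p ^+ 2 * Q p = u p ^+ 2 * E p ^+ 2 * (H ^+ 2 - (dot w w - s ^+ 2)).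
Proof.
move=> Dp; have E0 : E p != 0 by exact: (sqnorm_neq0 Dp).
have := eq_dz Dp oD dz_h_tau.
rewrite (dzM Dp (f := dz h) (g := tau)) (dzM Dp (f := u) (g := dzbar tau)) => K.
have vv : dot w w - s ^+ 2 = (tau p + s) ^+ 2 + 2 * dz tau p * dzbar tau p / E p + eta p ^+ 2 - s ^+ 2.
  by rewrite (dotww Dp) /tauv subrK.
exact: (constY_alg2 E0 (dz_h_tau Dp) K (dzzbar_tau Dp) (HY Dp) vv (bryantE Dp)).
Qed.

(** In the difference of the square of [willmore_tau] and of [bryant_tau] multiplied by the square
    of [conj u], the terms in [H ^ 2] cancel and [<v, v>] is left. *)
Lemma discriminant_tau p : D p ->
  tau p ^+ 2 * bryant_discriminant X N p = (E p * u p * conjc (u p)) ^+ 2 * (dot w w - s ^+ 2).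
Proof.
move=> Dp; rewrite (bryant_discriminantE Dp).
exact: constY_alg4 (bryant_tau Dp) (willmore_tau Dp).
Qed.

(** Where tau vanishes, [h_z tau = u tau_zbar] and [u != 0] give [tau_zbar = 0]. The
    [zbar]-derivative of the same equation then gives [eta = 0] and its [z]-derivative gives
    [s = 0], so [w] has no component left in the frame. *)
Lemma tau_eq0 p : D p -> tau p = 0 -> w = 0 /\ s = 0.
Proof.
move=> Dp t0; have E0 : E p != 0 by exact: (sqnorm_neq0 Dp).
have u0 : u p != 0 by exact: (u_neq0 Dp).
have tb : dzbar tau p = 0.
  by have /eqP := dz_h_tau Dp; rewrite t0 mulr0 eq_sym mulf_eq0 (negbTE u0) => /eqP.
have tz : dz tau p = 0.
  have := tb; rewrite (dzbar_tau Dp) (dz_tau Dp) -(conj_xb Dp) -[in X in _ -> X]wr -conj_dot => ->.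
  exact: conjc0.
have K1 := eq_dzbar Dp oD dz_h_tau.
rewrite (dzbarM Dp (f := dz h) (g := tau)) (dzbarM Dp (f := u) (g := dzbar tau)) t0 tb !mulr0 !add0r in K1.
have cu0 : conjc (u p) != 0 by rewrite conjc_eq0.
have e0 : eta p = 0.
  apply: (mulfI (mulf_neq0 u0 (mulf_neq0 E0 cu0))).
  by rewrite mulr0 K1 (dzbarbar_tau Dp) tb mulr0 add0r !mulrA.
have K2 := eq_dz Dp oD dz_h_tau.
rewrite (dzM Dp (f := dz h) (g := tau)) (dzM Dp (f := u) (g := dzbar tau)) t0 tb tz !mulr0 !add0r in K2.
have s0 : s = 0.
  apply: oppr_inj; apply: (mulfI (mulf_neq0 u0 E0)).
  by rewrite oppr0 mulr0 K2 (dzzbar_tau Dp) e0 t0 mulr0 addr0 add0r mulrA.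
split=> //; rewrite (frame_expand w Dp).
rewrite (sprod1C w (x p)) (sprod1C w (xz p)) (sprod1C w (xb p)) (sprod1C w (n p)).
rewrite -(dz_tau Dp) -(dzbar_tau Dp) -/(etav p) tz tb e0.
have -> : dot (x p) w = 0 by move: t0; rewrite /tauv s0 subr0.
by rewrite mul0r !scale0r !addr0.
Qed.

Hypothesis ws : w != 0 \/ s != 0.

Lemma tau_neq0 p : D p -> tau p != 0.
Proof.
by move=> Dp; apply/eqP => /(tau_eq0 Dp)[w0 s0]; case: ws; rewrite ?w0 ?s0 eqxx.
Qed.

Hypothesis Hr : conjc H = H.
Hypothesis sr : conjc s = s.

Lemma conj_tau p : D p -> conjc (tau p) = tau p.
Proof.
move=> Dp; rewrite /tauv rmorphB; congr (_ - _); last exact: sr.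
by etransitivity; [exact: conj_dot|rewrite wr (conj_x X p)].
Qed.

Lemma dzbar_h_tau p : D p -> dzbar h p * tau p = conjc (u p) * dz tau p.
Proof.
move=> Dp; have := congr1 conjc (dz_h_tau Dp).
rewrite (conjcM (dz h p)) (conjcM (u p)).
have -> : conjc (tau p) = tau p by exact: conj_tau.
have -> : conjc (dz h p) = dzbar h p by exact: conj_dz_h.
have -> // : conjc (dzbar tau p) = dz tau p.
by apply: conj_dzbar_real => // q; exact: conj_tau.
Qed.

Lemma dz_prod3 (E0 u0 v0 : _ -> C) c p : csmooth D E0 -> csmooth D u0 -> csmooth D v0 -> D p ->
  dz (fun q => E0 q * u0 q * v0 q * c) p = (dz E0 p * u0 p * v0 p + E0 p * dz u0 p * v0 p + E0 p * u0 p * dz v0 p) * c.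
Proof.
move=> s1 s2 s3 Dp; rewrite ?(dzM Dp) (dz_cst p).
by move: (E0 p) (u0 p) (v0 p) (dz E0 p) (dz u0 p) (dz v0 p) => *; ring.
Qed.

Lemma bryant_holo p : D p -> dzbar Q p = 0.
Proof.
move=> Dp; have E0 : E p != 0 by exact: (sqnorm_neq0 Dp).
rewrite (bryant_dzbar Dp).
have sW : csmooth D W by exact: willmore_smooth.
have sE : csmooth D E by exact: _.
have su : csmooth D u by exact: _.
have K := eq_dz Dp oD willmore_tau.
rewrite (dzM Dp (f := W) (g := tau)) in K.
rewrite (dz_prod3 H sE su (csmooth_conj su) Dp) in K.
have A := (@constY_alg3 _ (E p) (dz E p) (u p) (dz u p) (conjc (u p)) (dz (fun q => conjc (u q)) p)
    (dzbar h p) (tau p) (dz tau p) (W p) (dz W p) H E0 (dz_conj_u Dp) (dzbar_h_tau Dp) (willmore_tau Dp) K).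
have t20 : tau p ^+ 2 != 0 by rewrite expf_neq0// tau_neq0.
have -> : dz W p * u p - W p * dz u p = 0 by apply: (mulfI t20); rewrite mulr0; exact: A.
by rewrite mulr0.
Qed.

(** By Codazzi the numerator of the derivative of the quotient is [2 E (u tau_zbar - h_z tau)]. *)
Lemma tau_om_holo p : D p -> dzbar (fun q => tau q * (om q)^-1) p = 0.
Proof.
move=> Dp; have E0 : E p != 0 by exact: (sqnorm_neq0 Dp).
have o0 q : D q -> om q != 0 by exact: (surface_umb (X := X) (N := N)).
have sV : csmooth D (fun q => (om q)^-1) by exact: csmooth_inv.
rewrite (dzbarM Dp) (dzbarV Dp o0) (codazzi Dp).
have u0 : u p != 0 by exact: (u_neq0 Dp).
have := dz_h_tau Dp; rewrite (omE Dp).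
move: (E p) (u p) (tau p) (dzbar tau p) (dz h p) E0 u0 => e uu t tb hz e0 u0 K.
have -> : tb / (2 * e * uu) + t * (- (2 * e * hz) / (2 * e * uu) ^+ 2) =
   2 * e * (uu * tb - hz * t) / (2 * e * uu) ^+ 2 by field; rewrite e0 u0.
by rewrite K subrr mulr0 mul0r.
Qed.
End ConstVector.

Section RayArguments.
Variable R : realType.
Local Notation C := R[i].
Local Notation D := (@unit_disk R).
Local Notation oD := (@open_disk R).

#[local] Transparent cdiff dz dzbar.
Lemma cdiff_exE (f : _ -> C) p : cdiff (ex R) f p = dz f p + dzbar f p.
Proof. by rewrite /dz /dzbar; move: (cdiff _ f p) (cdiff _ f p) ('i : C) => a b i; field. Qed.

Lemma cdiff_eyE (f : _ -> C) p : cdiff (ey R) f p = 'i * (dz f p - dzbar f p).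
Proof.
rewrite /dz /dzbar; move: (cdiff (ex R) f p) (cdiff (ey R) f p) => a b.
transitivity (- ('i * 'i) * b); first by rewrite i2 opprK mul1r.
by move: ('i : C) => i; field.
Qed.
Lemma derive_plane (f : 'rV[R]_2 -> R) p v : differentiable f p ->
  'D_v f p = v 0 0 * 'D_(ex R) f p + v 0 1 * 'D_(ey R) f p.
Proof.
move=> df; rewrite (derive_row _ df) !big_ord_recl big_ord0 addr0.
have -> : lift ord0 ord0 = 1 :> 'I_2 by apply: val_inj.
by [].
Qed.

Lemma Re_dz0_const (f : _ -> C) : csmooth D f ->
  (forall q, D q -> cdiff (ex R) f q = 0) -> (forall q, D q -> cdiff (ey R) f q = 0) ->
  forall p, D p -> f p = f 0.
Proof.
move=> [_ sr si] fx fy p Dp.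
have dr q : D q -> differentiable (fun q => complex.Re (f q)) q by exact: smooth_differentiable sr.
have di q : D q -> differentiable (fun q => complex.Im (f q)) q by exact: smooth_differentiable si.
apply: complexP.
  apply: (derive0_ray (f := fun q => complex.Re (f q))) => t t01; have Dt := disk_ray Dp t01; first exact: dr.
  have := congr1 (@complex.Re R) (fx _ Dt); have := congr1 (@complex.Re R) (fy _ Dt).
  by rewrite (derive_plane _ (dr _ Dt)) /cdiff /= => -> ->; rewrite !mulr0 addr0.
apply: (derive0_ray (f := fun q => complex.Im (f q))) => t t01; have Dt := disk_ray Dp t01; first exact: di.
have := congr1 (@complex.Im R) (fx _ Dt); have := congr1 (@complex.Im R) (fy _ Dt).
by rewrite (derive_plane _ (di _ Dt)) /cdiff /= => -> ->; rewrite !mulr0 addr0.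
Qed.

Lemma dz0_const (f : _ -> C) : csmooth D f ->
  (forall q, D q -> dz f q = 0) -> (forall q, D q -> dzbar f q = 0) ->
  forall p, D p -> f p = f 0.
Proof.
move=> sf f1 f2; apply: Re_dz0_const => // q Dq.
  by rewrite cdiff_exE f1// f2// addr0.
by rewrite cdiff_eyE f1// f2// subr0 mulr0.
Qed.

(* along the ray to p, both functions solve y' = a y with a = - 2 p_0 Re th + 2 p_1 Im th *)
Lemma dz_parallel (f g th : _ -> C) : csmooth D f -> csmooth D g -> csmooth D th ->
  (forall q, D q -> conjc (f q) = f q) -> (forall q, D q -> conjc (g q) = g q) ->
  (forall q, D q -> dz f q = - th q * f q) -> (forall q, D q -> dz g q = - th q * g q) ->
  forall p, D p -> f p * g 0 = g p * f 0.
Proof.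
move=> sf sg sth fr gr df dg p Dp.
have real0 (z : C) : conjc z = z -> complex.Im z = 0.
  case: z => a b [] /eqP; rewrite eq_sym -addr_eq0 -mulr2n mulrn_eq0 /= => /eqP; exact.
pose F q := f q * g 0 - g q * f 0.
have D0 := @disk0 R.
have sF : csmooth D F by have s : csmooth D (fun q => f q * g 0 - g q * f 0) by exact: _.
have Fr q : D q -> conjc (F q) = F q.
  by move=> Dq; rewrite /F conjcD conjcN !conjcM !fr ?gr// .
have dF q : D q -> dz F q = - th q * F q.
  move=> Dq; rewrite (_ : F = fun q => f q * g 0 + - (g q * f 0))//.
  rewrite (dzD Dq) (dzN Dq) !(dzM Dq) !(dz_cst q) (df _ Dq) (dg _ Dq) /F.
  by move: (f q) (g q) (f 0) (g 0) (th q) => *; ring.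
have dF' q : D q -> dzbar F q = - conjc (th q) * F q.
  by move=> Dq; rewrite -(conj_dz_real sF Fr Dq) (dF _ Dq) conjcM conjcN Fr.
have [_ sr _] := sF; have [_ tr ti] := sth.
suff F0 : F p = 0 by apply/eqP; rewrite -subr_eq0 -/(F p) F0.
have diffF q : D q -> differentiable (fun q => complex.Re (F q)) q by exact: smooth_differentiable sr.
apply: complexP; last by rewrite (real0 _ (Fr _ Dp)).
apply: (@linear_ode_ray _ _ (fun q => complex.Re (F q))
   (fun q => - (2 * p 0 0) * complex.Re (th q) + (2 * p 0 1) * complex.Im (th q))).
- by move=> t t01; apply: diffF; exact: disk_ray.
- move=> t t01; have Dt := disk_ray Dp t01.
  have s : smooth D (fun q => - (2 * p 0 0) * complex.Re (th q) + (2 * p 0 1) * complex.Im (th q) : R).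
    by apply: (smooth_add oD); apply: (smooth_mul oD) => //; exact: smooth_cst oD.
  exact: smooth_continuous s Dt.
- move=> t t01; have Dt := disk_ray Dp t01.
  rewrite (derive_plane _ (diffF _ Dt)).
  have Ex : 'D_(ex R) (fun q => complex.Re (F q)) (t *: p) = complex.Re (cdiff (ex R) F (t *: p)) by [].
  have Ey : 'D_(ey R) (fun q => complex.Re (F q)) (t *: p) = complex.Re (cdiff (ey R) F (t *: p)) by [].
  rewrite Ex Ey cdiff_exE cdiff_eyE (dF _ Dt) (dF' _ Dt).
  have := real0 _ (Fr _ Dt).
  case: (F (t *: p)) (th (t *: p)) => [a b] [c d] /= ->; ring.
- by rewrite /F mulrC subrr.
Qed.
End RayArguments.
#[local] Opaque cdiff dz dzbar.

(** * Reconstruction of the constant vector *)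

Lemma kap_alg (K : fieldType) (E Ez u uz v hb th W Wz k kz vz : K) : E != 0 -> u != 0 -> v != 0 ->
  vz = hb - Ez / E * v -> th * v = hb -> k * (E * u * v) = W -> Wz * u = W * uz ->
  kz * (E * u * v) + k * (Ez * u * v + E * uz * v + E * u * vz) = Wz -> kz = - th * k.
Proof.
move=> E0 u0 v0 -> <- <- H1 H2.
have n0 : E * u * v * u != 0 by rewrite !mulf_neq0.
apply: (mulIf n0).
have -> : kz * (E * u * v * u) = (kz * (E * u * v)) * u by ring.
have -> : kz * (E * u * v) = Wz - k * (Ez * u * v + E * uz * v + E * u * (th * v - Ez / E * v)) by rewrite -H2; ring.
by rewrite mulrBl H1; field.
Qed.

Lemma thz_alg (K : fieldType) (E Ez u v h hb hzb th thz vz k W eta : K) : E != 0 -> v != 0 -> 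
  vz = hb - Ez / E * v -> th * v = hb -> thz * v + th * vz = hzb -> k * (E * u * v) = W ->
  W = hzb + E * u * v * h -> eta = k - h ->
  thz = Ez / E * th + E * u * eta - th ^+ 2.
Proof.
move=> E0 v0 -> <- H1 H2 H3 ->; apply: (mulIf v0).
have -> : thz * v = hzb - th * (th * v - Ez / E * v) by rewrite -H1; ring.
have -> : hzb = k * (E * u * v) - E * u * v * h by rewrite H2 H3; ring.
by ring.
Qed.

Section Converse.
Variables (R : realType) (X N : 'rV[R]_2 -> 'rV[R]_4).
Context {sXN : surface X N}.
Local Notation C := R[i].
Local Notation D := (@unit_disk R).
Local Notation dot := (sprod (1%:M : 'M[C]_4)).
Local Notation x := (cplx X).
Local Notation n := (cplx N).
Local Notation xz := (dzv (cplx X)).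
Local Notation xb := (dzbarv (cplx X)).
Local Notation E := (sqnorm_dz 1%:M X).
Local Notation h := (mean_curvature 1%:M X N).
Local Notation u := (ucoef X N).
Local Notation W := (willmore X N).
Local Notation Q := (bryant X N).
Local Notation oD := (@open_disk R).

(** If the vector exists, [dzbar_h_tau] reads [theta = tau_z / tau] and [willmore_tau] reads
    [kappa = H / tau]. Both quotients are thereby expressed by the surface alone. *)
Definition theta q : C := dzbar h q * (conjc (u q))^-1.
Definition kappa q : C := W q * (E q * u q * conjc (u q))^-1.
Local Notation th := theta.
Local Notation kap := kappa.

Lemma cu_neq0 q : D q -> conjc (u q) != 0.
Proof. by move=> Dq; rewrite conjc_eq0; exact: u_neq0. Qed.

Global Instance csmooth_theta : csmooth D th.
Proof.
have s0 : csmooth D (fun q => conjc (u q)) by exact: _.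
have s1 : csmooth D (fun q => (conjc (u q))^-1) by apply: csmooth_inv s0; exact: cu_neq0.
have s2 : csmooth D (dzbar h) by exact: _.
exact: csmooth_mul s2 s1.
Qed.

Lemma Euv_neq0 q : D q -> E q * u q * conjc (u q) != 0.
Proof.
move=> Dq; apply: mulf_neq0; last exact: cu_neq0.
by apply: mulf_neq0; [exact: sqnorm_neq0|exact: u_neq0].
Qed.

Global Instance csmooth_kappa : csmooth D kap.
Proof.
have s0 : csmooth D (fun q => E q * u q * conjc (u q)) by exact: _.
have s1 : csmooth D (fun q => (E q * u q * conjc (u q))^-1) by apply: csmooth_inv s0; exact: Euv_neq0.
have s2 : csmooth D W by exact: willmore_smooth.
exact: csmooth_mul s2 s1.
Qed.

Lemma theta_u q : D q -> th q * conjc (u q) = dzbar h q.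
Proof. by move=> Dq; rewrite /theta divfK// cu_neq0. Qed.

Lemma kappaE q : D q -> kap q * (E q * u q * conjc (u q)) = W q.
Proof. by move=> Dq; rewrite /kappa divfK// Euv_neq0. Qed.

Lemma conj_theta_u q : D q -> conjc (th q) * u q = dz h q.
Proof.
move=> Dq; have := congr1 conjc (theta_u Dq); rewrite (conjcM (th q)) conjcK => ->.
by apply: conj_dzbar_real Dq => // p; exact: conj_h.
Qed.

Lemma conj_willmore q : D q -> conjc (W q) = W q.
Proof.
move=> Dq; rewrite (willmoreE Dq) (conjcD (dzbar (dz h) q)) (conjcM (_ * _ * _)) (conjcM (_ * _)) (conjcM (E q)).
rewrite (conj_h Dq) (conj_sqnorm Dq) conjcK -(dz_conj Dq (f := dz h)) (eq_dz Dq oD (fun p => @conj_dz_h _ _ _ _ p)).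
rewrite -(dz_dzbarC Dq (f := h)); congr (_ + _ * _).
by move: (E q) (u q) (conjc (u q)) => *; ring.
Qed.

Lemma conj_kappa q : D q -> conjc (kap q) = kap q.
Proof.
move=> Dq; rewrite /kappa (conjcM (W q)) conjcV !(conjcM _ (conjc (u q))) (conjcM (E q) (u q)) conjcK.
by rewrite (conj_willmore Dq) (conj_sqnorm Dq) mulrAC.
Qed.

(** The components of [v / tau]. From [h tau + eta = H] comes [eta0]. From [dzzbar_tau], where
    [tau_{z zbar} = (theta_zbar + theta conj theta) tau], comes [s0]. Finally [w0] is the expansion
    of [frame_expand] with the products [1 + s0], [theta], [conj theta] and [eta0]. *)
Definition eta0 q : C := kap q - h q.
Definition s0 q : C := h q * eta0 q - 1 - (dzbar th q + th q * conjc (th q)) * (E q)^-1.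
Definition w0 q : 'rV[C]_4 := (1 + s0 q) *: x q + (conjc (th q) * (E q)^-1) *: xz q
  + (th q * (E q)^-1) *: xb q + eta0 q *: n q.

Global Instance csmooth_eta0 : csmooth D eta0.
Proof. by have s : csmooth D (fun q => kap q - h q) by exact: _. Qed.
Global Instance csmooth_s0 : csmooth D s0.
Proof.
have s1 : csmooth D (fun q => (E q)^-1) by exact: Einv_smooth.
by have s : csmooth D (fun q => h q * eta0 q - 1 - (dzbar th q + th q * conjc (th q)) * (E q)^-1) by exact: _.
Qed.
Global Instance vsmooth_w0 : vsmooth D w0.
Proof.
have s1 : csmooth D (fun q => (E q)^-1) by exact: Einv_smooth.
by have s : vsmooth D (fun q => (1 + s0 q) *: x q + (conjc (th q) * (E q)^-1) *: xz q
  + (th q * (E q)^-1) *: xb q + eta0 q *: n q) by exact: _.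
Qed.

Section Dots.
Variable q : 'rV[R]_2.
Hypothesis Dq : D q.
Lemma dot_w0x : dot (w0 q) (x q) = 1 + s0 q.
Proof. by rewrite /w0 !sprodDl !sprodZl !(dots Dq) !mulr0 mulr1 !addr0. Qed.
Lemma dot_w0z : dot (w0 q) (xz q) = th q.
Proof. by rewrite /w0 !sprodDl !sprodZl !(dots Dq) !mulr0 add0r add0r addr0 divfK//; exact: sqnorm_neq0. Qed.
Lemma dot_w0b : dot (w0 q) (xb q) = conjc (th q).
Proof. by rewrite /w0 !sprodDl !sprodZl !(dots Dq) !mulr0 add0r !addr0 divfK//; exact: sqnorm_neq0. Qed.
Lemma dot_w0n : dot (w0 q) (n q) = eta0 q.
Proof. by rewrite /w0 !sprodDl !sprodZl !(dots Dq) !mulr0 !add0r mulr1. Qed.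
End Dots.

Hypothesis Qh : forall q, D q -> dzbar Q q = 0.
Hypothesis thr : forall q, D q -> conjc (dzbar th q) = dzbar th q.

Lemma conj_eta0 q : D q -> conjc (eta0 q) = eta0 q.
Proof. by move=> Dq; rewrite /eta0 (conjcD (kap q)) conjcN (conj_kappa Dq) (conj_h Dq). Qed.

Lemma conj_s0 q : D q -> conjc (s0 q) = s0 q.
Proof.
move=> Dq; rewrite /s0 !conjcD !conjcN (conjcM (h q)) (conj_h Dq) (conj_eta0 Dq) conjc1.
rewrite (conjcM _ (E q)^-1) conjcV (conj_sqnorm Dq) (conjcD (dzbar th q)) (thr Dq) (conjcM (th q)) conjcK.
by rewrite (mulrC (th q)).
Qed.

Lemma conj_w0 q : D q -> map_mx conjc (w0 q) = w0 q.
Proof.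
move=> Dq; rewrite /w0 !map_mxD !conj_scale (conj_x X q) (conj_n N q) (conj_xz Dq) (conj_xb Dq).
rewrite (conj_eta0 Dq) (conjcD 1) conjc1 (conj_s0 Dq) (conjcM (conjc _)) (conjcM (th q)) conjcK conjcV (conj_sqnorm Dq).
by rewrite -!addrA; congr (_ + _); rewrite addrCA.
Qed.

(** Holomorphy of Q enters here, as [W_z u = W u_z]; the result is what [kappa = H / tau] and
    [theta = tau_z / tau] require. *)
Lemma kappa_z q : D q -> dz kap q = - th q * kap q.
Proof.
move=> Dq.
have sE : csmooth D E by exact: _.
have su : csmooth D u by exact: _.
have sEuv : csmooth D (fun p => E p * u p * conjc (u p)) by exact: _.
have K := eq_dz Dq oD kappaE.
rewrite (dzM Dq (f := kap) (g := fun p => E p * u p * conjc (u p))) in K.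
have := @dz_prod3 R E u (fun p => conjc (u p)) 1 q sE su (csmooth_conj su) Dq.
rewrite mulr1 (eq_dz Dq oD (g := fun p => E p * u p * conjc (u p))); last by move=> p _; rewrite mulr1.
move=> P; rewrite P in K.
have B : dz W q * u q = W q * dz u q.
  have HB := etrans (esym (Qh Dq)) (bryant_dzbar Dq).
  have t0 : 2 * E q != 0 by exact: twoE_neq0 Dq.
  by apply/eqP; rewrite -subr_eq0; apply/eqP; apply: (mulfI t0); rewrite mulr0 -HB.
exact: (@kap_alg _ (E q) (dz E q) (u q) (dz u q) (conjc (u q)) (dzbar h q) (th q) (W q) (dz W q) (kap q) (dz kap q)
  (dz (fun p => conjc (u p)) q) (sqnorm_neq0 Dq) (u_neq0 Dq) (cu_neq0 Dq) (dz_conj_u Dq) (theta_u Dq) (kappaE Dq) B K).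
Qed.

(** The [z]-derivative of [theta conj u = h_zbar], with [h_{z zbar}] expressed by W and hence by
    [kappa]. *)
Lemma theta_z q : D q -> dz th q = dz E q / E q * th q + E q * u q * eta0 q - th q ^+ 2.
Proof.
move=> Dq.
have scu : csmooth D (fun p => conjc (u p)) by exact: _.
have K := eq_dz Dq oD theta_u.
rewrite (dzM Dq (f := th) (g := fun p => conjc (u p))) -(dz_dzbarC (f := h) Dq) in K.
exact: (@thz_alg _ (E q) (dz E q) (u q) (conjc (u q)) (h q) (dzbar h q) (dzbar (dz h) q) (th q) (dz th q)
  (dz (fun p => conjc (u p)) q) (kap q) (W q) (eta0 q) (sqnorm_neq0 Dq) (cu_neq0 Dq) (dz_conj_u Dq) (theta_u Dq) K
  (kappaE Dq) (willmoreE Dq) erefl).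
Qed.

(** The defect of [V0 = (w0, s0)]: one has [V0_z + theta V0 = bb (X, 1)], by [dzw0] for the first
    four coordinates and by construction for the last. *)
Definition bb q : C := dz s0 q + th q * s0 q.
Global Instance csmooth_bb : csmooth D bb.
Proof. by have s : csmooth D (fun q => dz s0 q + th q * s0 q) by exact: _. Qed.

(** The products of [w0] with the frame are known, so their [z]-derivatives and the structure
    equations determine the products of the derivative of [w0]. All of them fit except the one with
    [X], which contains the derivative of [s0]. *)
Lemma dzw0 q : D q -> dzv w0 q = bb q *: x q - th q *: w0 q.
Proof.
move=> Dq; have E0 : E q != 0 by exact: (sqnorm_neq0 Dq).
suff A : dzv w0 q + th q *: w0 q = bb q *: x q by rewrite -A addrK.
rewrite [LHS](frame_expand _ Dq) !sprodDl !sprodZl.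
rewrite (dot_w0x Dq) (dot_w0z Dq) (dot_w0b Dq) (dot_w0n Dq).
have a1 : dot (dzv w0 q) (x q) + th q * (1 + s0 q) = bb q.
  have s1 : csmooth D (fun q => 1 + s0 q) by exact: _.
  have := dz_dot Dq vsmooth_w0 (@vsmooth_X R X N sXN) (fun p => @dot_w0x p).
  rewrite (dzD Dq) (dz_cst q 1) add0r (dot_w0z Dq) /bb => <-.
  by move: (dot _ _) (th q) (s0 q) => *; ring.
have a2 : dot (dzv w0 q) (xz q) + th q * th q = 0.
  have := dz_dot Dq vsmooth_w0 (@vs_xz R X N sXN) (fun p => @dot_w0z p).
  rewrite (xzzE Dq) sprodDr !sprodZr (dot_w0z Dq) (dot_w0n Dq) (theta_z Dq) (omE Dq).
  move: (dot _ _) (E q) (dz E q) (th q) (u q) (eta0 q) E0 => d e ez t uu et e0 K.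
  have -> : d = (d + (ez / e * t + 2 * e * uu / 2 * et)) - (ez / e * t + 2 * e * uu / 2 * et) by ring.
  by rewrite K; field.
have a3 : dot (dzv w0 q) (xb q) + th q * conjc (th q) = 0.
  have := dz_dot Dq vsmooth_w0 (@vs_xb R X N sXN) (fun p => @dot_w0b p).
  rewrite (dz_conj Dq) (thr Dq) (xzbC Dq) (xzbE Dq) sprodDr !sprodZr (dot_w0x Dq) (dot_w0n Dq) /s0.
  move: (dot _ _) (E q) (th q) (h q) (eta0 q) (conjc (th q)) (dzbar th q) E0 => d e t hh et tc tb e0 K.
  have -> : d = (d + (- e * (1 + (hh * et - 1 - (tb + t * tc) / e)) + e * hh * et)) - (- e * (1 + (hh * et - 1 - (tb + t * tc) / e)) + e * hh * et) by ring.
  by rewrite K; field.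
have a4 : dot (dzv w0 q) (n q) + th q * eta0 q = 0.
  have := dz_dot Dq vsmooth_w0 (@vsmooth_N R X N sXN) (fun p => @dot_w0n p).
  rewrite (nzE Dq) sprodDr sprodNr !sprodZr (dot_w0z Dq) (dot_w0b Dq) => K.
  have : dz eta0 q = dz kap q - dz h q by rewrite (_ : eta0 = fun p => kap p - h p)// (dzD Dq) (dzN Dq).
  rewrite (kappa_z Dq) -(conj_theta_u Dq) -K /eta0.
  move: (dot _ _) (th q) (u q) (h q) (kap q) (conjc (th q)) => d t uu hh k tc L.
  have -> : d = (d + (- hh * t - uu * tc)) - (- hh * t - uu * tc) by ring.
  by rewrite L; ring.
by rewrite a1 a2 a3 a4 !mul0r !scale0r !addr0.
Qed.

Lemma dzbarw0 q : D q -> dzbarv w0 q = conjc (bb q) *: x q - conjc (th q) *: w0 q.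
Proof.
move=> Dq; rewrite -(eq_dzbarv Dq oD conj_w0) (dzbarv_conj Dq) (dzw0 Dq).
by rewrite map_mxD map_mxN !conj_scale (conj_x X q) (conj_w0 Dq).
Qed.

Lemma dzs0 q : D q -> dz s0 q = bb q - th q * s0 q.
Proof. by move=> Dq; rewrite /bb addrK. Qed.
Lemma dzbars0 q : D q -> dzbar s0 q = conjc (bb q) - conjc (th q) * s0 q.
Proof.
move=> Dq; rewrite -(conj_dz_real csmooth_s0 conj_s0 Dq) (dzs0 Dq).
by rewrite (conjcD (bb q)) conjcN (conjcM (th q)) (conj_s0 Dq).
Qed.

(** The mixed derivatives of [w0] agree. As theta_zbar is real, the terms in theta_zbar cancel, and
    the product with [X_z] keeps only [bb <X_zbar, X_z> = bb E]. *)
Lemma bb0 q : D q -> bb q = 0.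
Proof.
move=> Dq; have E0 : E q != 0 by exact: (sqnorm_neq0 Dq).
have scb : csmooth D (fun p => conjc (bb p)) by exact: _.
have sct : csmooth D (fun p => conjc (th p)) by exact: _.
have st : csmooth D (fun p => th p * s0 p) by exact: _.
have sct' : csmooth D (fun p => conjc (th p) * s0 p) by exact: _.
have A : dzbar (dz s0) q = dz (dzbar s0) q by exact: dz_dzbarC.
rewrite (eq_dzbar Dq oD dzs0) (eq_dz Dq oD dzbars0) in A.
rewrite (dzbarD Dq (f := bb)) (dzbarN Dq) (dzbarM Dq (f := th)) (dzbars0 Dq) in A.
rewrite (dzD Dq (f := fun p => conjc (bb p))) (dzN Dq) (dzM Dq (f := fun p => conjc (th p))) (dz_conj Dq (f := th)) (thr Dq) (dzs0 Dq) in A.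
have vx : vsmooth D (fun p => bb p *: x p) by exact: _.
have vx' : vsmooth D (fun p => conjc (bb p) *: x p) by exact: _.
have vt : vsmooth D (fun p => th p *: w0 p) by exact: _.
have vt' : vsmooth D (fun p => conjc (th p) *: w0 p) by exact: _.
have B : dzbarv (dzv w0) q = dzv (dzbarv w0) q by exact: dzv_dzbarvC.
rewrite (eq_dzbarv Dq oD dzw0) (eq_dzv Dq oD dzbarw0) in B.
rewrite (dzbarvD Dq (F := fun p => bb p *: x p)) (dzbarvN Dq) (dzbarvZ Dq (a := bb)) (dzbarvZ Dq (a := th)) (dzbarw0 Dq) in B.
rewrite (dzvD Dq (F := fun p => conjc (bb p) *: x p)) (dzvN Dq) (dzvZ Dq (a := fun p => conjc (bb p))) (dzvZ Dq (a := fun p => conjc (th p))) (dz_conj Dq (f := th)) (thr Dq) (dzw0 Dq) in B.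
have := congr1 (fun v => dot v (xz q)) B.
have h1 : dot (x q) (xz q) = 0 by exact: dot_xz.
have h2 : dot (xb q) (xz q) = E q by exact: dot_bz.
have h3 : dot (xz q) (xz q) = 0 by exact: dot_zz.
move: h1 h2 h3 (dot_w0z Dq).
move: (x q) (xz q) (xb q) (w0 q) (bb q) (conjc (bb q)) (th q) (conjc (th q)) (dzbar bb q) (dz _ q) (dzbar th q) (E q) E0.
move=> a1 a2 a3 a4 b bc t tc bz bcz tb e e0 h1 h2 h3 h4.
rewrite !(sprodDl, sprodNl, sprodZl) h1 h2 h3 h4 => K.
apply: (mulIf e0); rewrite mul0r.
have -> : b * e = (bz * 0 + b * e - (tb * t + t * (bc * 0 - tc * t))) - (- (tb * t + t * (bc * 0 - tc * t))) by ring.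
by rewrite K; ring.
Qed.

Lemma exists_const_vector : exists (w : 'rV[C]_4) (s H : C),
  [/\ map_mx conjc w = w, conjc s = s, conjc H = H, w != 0 \/ s != 0 &
   forall q, D q -> h q * tauv X w s q + etav N w q = H].
Proof.
have D0 := @disk0 R.
have dw q j : D q -> dz (fun p => w0 p 0 j) q = - th q * w0 q 0 j.
  move=> Dq; have := congr1 (fun v : 'rV[C]_4 => v 0 j) (dzw0 Dq).
  by rewrite (bb0 Dq) scale0r add0r !mxE mulNr.
have ds q : D q -> dz s0 q = - th q * s0 q.
  by move=> Dq; rewrite (dzs0 Dq) (bb0 Dq) add0r mulNr.
have rw j q : D q -> conjc (w0 q 0 j) = w0 q 0 j.
  by move=> Dq; have := congr1 (fun v : 'rV[C]_4 => v 0 j) (conj_w0 Dq); rewrite mxE.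
have sw j : csmooth D (fun p => w0 p 0 j) by exact: vsmooth_w0.
have nz q : D q -> dot (w0 q) (x q) - s0 q = 1 by move=> Dq; rewrite (dot_w0x Dq) addrK.
have key q : D q -> exists2 c, c != 0 & w0 q = c *: w0 0 /\ s0 q = c * s0 0.
  move=> Dq.
  have par (f g : _ -> C) : csmooth D f -> csmooth D g -> (forall q, D q -> conjc (f q) = f q) -> (forall q, D q -> conjc (g q) = g q) ->
   (forall q, D q -> dz f q = - th q * f q) -> (forall q, D q -> dz g q = - th q * g q) -> f q * g 0 = g q * f 0.
    by move=> *; exact: (dz_parallel (th := th)).
  (* As [<(X, 1), V0> = 1], some coordinate of [V0] is nonzero at the origin; divided by its value
     there, it is the factor of proportionality between [V0 q] and [V0 0]. *)
  have [g [g0 gw gs]] : exists g : 'rV[R]_2 -> C, [/\ g 0 != 0, forall j, w0 q 0 j * g 0 = g q * w0 0 0 j & s0 q * g 0 = g q * s0 0].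
    have [s00|s00] := eqVneq (s0 0) 0.
      have [w00|] := eqVneq (w0 0) 0.
        by have := nz _ D0; rewrite w00 s00 sprod0l subr0 => /eqP; rewrite eq_sym oner_eq0.
      move=> /rV0Pn[k wk]; exists (fun p => w0 p 0 k); split => // [j|].
        exact: (par (fun p => w0 p 0 j) (fun p => w0 p 0 k) _ _ (rw j) (rw k) (dw^~ j) (dw^~ k)).
      exact: (par s0 (fun p => w0 p 0 k) _ _ conj_s0 (rw k) ds (dw^~ k)).
    exists s0; split => // j.
    exact: (par (fun p => w0 p 0 j) s0 _ _ (rw j) conj_s0 (dw^~ j) ds).
  have Ew : w0 q = (g q / g 0) *: w0 0.
    by apply/rowP => j; rewrite [RHS]mxE; apply: (mulIf g0); rewrite gw [RHS]mulrAC divfK.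
  have Es : s0 q = g q / g 0 * s0 0 by apply: (mulIf g0); rewrite gs [RHS]mulrAC divfK.
  exists (g q / g 0) => //; apply: contraTneq (oner_neq0 C) => c0.
  by rewrite -(nz _ Dq) Ew Es c0 scale0r mul0r sprod0l subr0 eqxx.
pose w := w0 0; pose s := s0 0.
have ct q c : D q -> w0 q = c *: w -> s0 q = c * s -> c * tauv X w s q = 1.
  by move=> Dq Ew Es; rewrite -(nz _ Dq) Ew Es /tauv sprodZl (sprod1C (x q)) mulrBr.
pose G q := h q * tauv X w s q + etav N w q.
(* For the constant vector [V0 0] one has [tau = 1 / c], so the height is [kappa tau]; it is
   constant since [kappa_z = - theta kappa] and [tau_z = theta tau]. *)
have GE q : D q -> G q = kap q * tauv X w s q.
  move=> Dq; have [c c0 [Ew Es]] := key _ Dq; have ce := ct _ _ Dq Ew Es.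
  have := dot_w0n Dq; rewrite Ew sprodZl (sprod1C w) -/(etav N w q) /eta0 => e1.
  apply: (mulfI c0); rewrite /G mulrDr e1.
  have -> : c * (kap q * tauv X w s q) = kap q * (c * tauv X w s q) by ring.
  have -> : c * (h q * tauv X w s q) = h q * (c * tauv X w s q) by ring.
  by rewrite ce; ring.
have sG : csmooth D G by have : csmooth D (fun q => h q * tauv X w s q + etav N w q) by exact: _.
have rw0 : map_mx conjc w = w by exact: conj_w0.
have rs0 : conjc s = s by exact: conj_s0.
have rG q : D q -> conjc (G q) = G q.
  move=> Dq; rewrite (GE _ Dq) (conjcM (kap q)) (conj_kappa Dq).
  by congr (_ * _); exact: (conj_tau X rw0 rs0 Dq).
have dG q : D q -> dz G q = 0.
  move=> Dq; rewrite (eq_dz Dq oD GE) (dzM Dq (f := kap)) (kappa_z Dq) (dz_tau _ _ Dq).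
  have [c c0 [Ew Es]] := key _ Dq; have ce := ct _ _ Dq Ew Es.
  have := dot_w0z Dq; rewrite Ew sprodZl (sprod1C w) => e1.
  have -> : dot (xz q) w = th q * tauv X w s q.
    by apply: (mulfI c0); rewrite e1 mulrCA ce mulr1.
  by move: (kap q) (th q) (tauv X w s q) => *; ring.
have dG' q : D q -> dzbar G q = 0.
  by move=> Dq; rewrite -(conj_dz_real sG rG Dq) (dG _ Dq) conjc0.
exists w, s, (G 0); split; [exact: rw0|exact: rs0| | |].
- exact: rG.
- have := nz _ D0; case: (eqVneq w 0) => [w00|]; last by left.
  move=> K; right; apply: contraTneq (oner_neq0 C) => s00.
  by rewrite -K -/w -/s w00 s00 sprod0l subr0 eqxx.
- by move=> q Dq; exact: (dz0_const sG dG dG').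
Qed.
End Converse.

Section RealLeibniz.
Variables (R : realType) (V : normedModType R).

Lemma derive_sprod n (J : 'M[R]_n) (A B : V -> 'rV[R]_n) p v : differentiable A p -> differentiable B p ->
  'D_v (fun y => sprod J (A y) (B y)) p = sprod J ('D_v A p) (B p) + sprod J (A p) ('D_v B p).
Proof.
move=> dA dB.
have dAi i : differentiable (fun y => A y 0 i) p by exact: differentiable_coord_comp.
have dBi i : differentiable (fun y => B y 0 i) p by exact: differentiable_coord_comp.
pose g i j (y : V) : R := A y 0 i * J i j * B y 0 j.
have dg i j : differentiable (g i j) p.
  apply: (@differentiableM _ _ (fun y => A y 0 i * J i j) (fun y => B y 0 j)) => //.
  apply: (@differentiableM _ _ (fun y => A y 0 i) (fun=> J i j)) => //; exact: differentiable_cst.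
have -> : (fun y => sprod J (A y) (B y)) = \sum_i \sum_j g i j.
  apply/funext => y; rewrite sprodE fct_sumE; apply: eq_bigr => i _.
  by rewrite fct_sumE.
rewrite derive_sum; last first.
  by move=> i; apply: derivable_sum => j; exact: diff_derivable (dg i j).
rewrite !sprodE -big_split; apply: eq_bigr => i _ /=.
rewrite derive_sum; last by move=> j; exact: diff_derivable (dg i j).
rewrite -big_split; apply: eq_bigr => j _ /=.
rewrite /g (@deriveM _ _ (fun y => A y 0 i * J i j) (fun y => B y 0 j)); first last.
- exact: diff_derivable (dBi j).
- apply: diff_derivable.
  apply: (@differentiableM _ _ (fun y => A y 0 i) (fun=> J i j)) => //; exact: differentiable_cst.
rewrite (@deriveM _ _ (fun y => A y 0 i) (fun=> J i j)); first last.
- exact: derivable_cst.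
- exact: diff_derivable (dAi i).
rewrite derive_cst scaler0 add0r (derive_coord _ _ dA) (derive_coord _ _ dB).
move: ('D_v A p 0 i) ('D_v B p 0 j) (A p 0 i) (B p 0 j) (J i j) => *.
by rewrite /GRing.scale /=; ring.
Qed.

Lemma derive_symv n U (A : V -> 'rV[R]_n) p u v : open U -> U p -> smooth U A ->
  'D_u ('D_v A) p = 'D_v ('D_u A) p.
Proof.
move=> oU Up sA.
have dA q : U q -> differentiable A q by exact: smooth_differentiable.
have d1 w : differentiable ('D_w A) p by exact: smooth_differentiable (smooth_derive w sA) Up.
apply/rowP => j.
have E w q : U q -> 'D_w A q 0 j = 'D_w (fun y => A y 0 j) q.
  by move=> Uq; exact: esym (derive_coord w j (dA q Uq)).
apply: etrans (esym (derive_coord u j (d1 v))) _.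
apply: etrans (eq_derive_open u oU Up (E v)) _.
apply: etrans (derive_sym u v oU Up (smooth_coord j oU sA 2)) _.
apply: etrans (esym (eq_derive_open v oU Up (E u))) _.
exact: (derive_coord v j (d1 u)).
Qed.
End RealLeibniz.

(** * Liouville's theorem in the light cone *)

Section MinkowskiFrame.
Variable R : realType.
Local Notation J := (minkowski_gram R 4).
Local Notation mk := (sprod J).

Lemma mink_sq : J *m J = 1%:M.
Proof.
by rewrite /minkowski_gram mulmx_block !mulmx0 !mul0mx !addr0 add0r mulmx1 mulNmx mulmxN mulmx1 opprK -scalar_mx_block.
Qed.

Lemma mkC u v : mk u v = mk v u.
Proof. by apply: sprodC; exact: mink_tr. Qed.

(** The Gram matrix of the five vectors is nondegenerate: pairing a linear relation with [f]
    isolates the coefficient of [g], pairing with [f1], [f2], [f3] then isolates their own, and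
    pairing with [g] that of [f]. *)
Lemma cone_frame (f f1 f2 f3 g w : 'rV[R]_5) :
  mk f f = 0 -> mk f f1 = 0 -> mk f f2 = 0 -> mk f f3 = 0 -> mk f g = -1 ->
  mk f1 f1 = 1 -> mk f2 f2 = 1 -> mk f3 f3 = 1 -> mk f1 f2 = 0 -> mk f1 f3 = 0 -> mk f2 f3 = 0 ->
  mk f1 g = 0 -> mk f2 g = 0 -> mk f3 g = 0 ->
  mk f w = 0 -> mk f1 w = 0 -> mk f2 w = 0 -> mk f3 w = 0 -> mk g w = 0 -> w = 0.
Proof.
move=> ff f01 f02 f03 fg f11 f22 f33 f12 f13 f23 g1 g2 g3 w0 w1 w2 w3 w4.
pose B : 'M[R]_5 := \matrix_(i < 5) nth 0 [:: f; f1; f2; f3; g] i.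
pose o (k : nat) (H : (k < 5)%N) : 'I_5 := Ordinal H.
have Bu : B \in unitmx.
  rewrite -row_free_unit; apply/inj_row_free => r.
  rewrite mulmx_sum_row !big_ord_recl big_ord0 addr0 !rowK /= => rB.
  have P v : r 0 ord0 * mk f v + (r 0 (lift ord0 ord0) * mk f1 v + (r 0 (lift ord0 (lift ord0 ord0)) * mk f2 v
    + (r 0 (lift ord0 (lift ord0 (lift ord0 ord0))) * mk f3 v + r 0 (lift ord0 (lift ord0 (lift ord0 (lift ord0 ord0)))) * mk g v))) = 0.
    by rewrite -!sprodZl -!sprodDl rB sprod0l.
  have := P f; rewrite ff (mkC f1) f01 (mkC f2) f02 (mkC f3) f03 (mkC g) fg !mulr0 !add0r mulrN1 => /eqP; rewrite oppr_eq0 => /eqP r4.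
  have := P f1; rewrite r4 mul0r f01 f11 (mkC f2) f12 (mkC f3) f13 !mulr0 !addr0 add0r mulr1 => r1.
  have := P f2; rewrite r4 mul0r f02 f22 f12 (mkC f3) f23 !mulr0 !addr0 !add0r mulr1 => r2.
  have := P f3; rewrite r4 mul0r f03 f33 f13 f23 !mulr0 !addr0 !add0r mulr1 => r3.
  have := P g; rewrite r4 r1 r2 r3 !mul0r fg !addr0 mulrN1 => /eqP; rewrite oppr_eq0 => /eqP r0.
  apply/rowP => i; rewrite mxE.
  by case: i => -[|[|[|[|[|//]]]]] Hi; [rewrite -[RHS]r0|rewrite -[RHS]r1|rewrite -[RHS]r2|rewrite -[RHS]r3|rewrite -[RHS]r4]; congr (r 0 _); apply: val_inj.
have BJw : B *m (J *m w^T) = 0.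
  apply/colP => i; rewrite mulmxA.
  have -> : (B *m J *m w^T) i 0 = mk (row i B) w.
    by rewrite /sprod -row_mul -row_mul [RHS]mxE.
  rewrite rowK [RHS]mxE.
  have K k : (k < 5)%N -> mk (nth 0 [:: f; f1; f2; f3; g] k) w = 0.
    by case: k => [|[|[|[|[|k]]]]].
  exact: (K i (ltn_ord i)).
have := congr1 (mulmx (invmx B)) BJw; rewrite mulmx0 mulmxA mulVmx// mul1mx => /(congr1 (mulmx J)).
rewrite mulmx0 mulmxA mink_sq mul1mx => /(congr1 trmx).
by rewrite trmxK trmx0.
Qed.
End MinkowskiFrame.

Section FlatConeJet.
Variables (R : realType) (f : 'rV[R]_5) (f1 : 'I_3 -> 'rV[R]_5) (f2 : 'I_3 -> 'I_3 -> 'rV[R]_5).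
Local Notation J := (minkowski_gram R 4).
Local Notation mk := (sprod J).
Hypothesis ff : mk f f = 0.
Hypothesis ff1 : forall i, mk f (f1 i) = 0.
Hypothesis fifj : forall i j, mk (f1 i) (f1 j) = (i == j)%:R.
Hypothesis ff2 : forall i j, mk f (f2 i j) = - (i == j)%:R.
Hypothesis f1f2 : forall i j k, mk (f1 k) (f2 i j) = 0.
Hypothesis f2C : forall i j, f2 i j = f2 j i.
Hypothesis gaussE : forall i j k l, mk (f2 i j) (f2 k l) = mk (f2 k j) (f2 i l).

(** [f], [f1] and [f2] are the value and the first and second derivatives, at a point, of an
    isometric map of flat space into the cone. Since [<f, f2 k k> = -1], the vector [f2 k k]
    completes [f] and [f1] to a frame, in which [w] only has a component along [f]. *)
Lemma jet_frame (k : 'I_3) w : mk f w = 0 -> (forall l, mk (f1 l) w = 0) ->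
  w = - mk (f2 k k) w *: f.
Proof.
move=> w0 wl; apply/eqP; rewrite -subr_eq0; apply/eqP.
have Fij a b : a != b -> mk (f1 a) (f1 b) = 0 by move=> ab; rewrite fifj (negbTE ab).
have Fii a : mk (f1 a) (f1 a) = 1 by rewrite fifj eqxx.
have fk : mk f (f2 k k) = -1 by rewrite ff2 eqxx.
apply: (cone_frame ff (ff1 0) (ff1 1) (ff1 2%:R) fk (Fii 0) (Fii 1) (Fii 2%:R) (Fij 0 1 isT) (Fij 0 2%:R isT)
  (Fij 1 2%:R isT) (f1f2 k k 0) (f1f2 k k 1) (f1f2 k k 2%:R)).
- by rewrite sprodDr sprodNr sprodZr w0 ff mulr0 subr0.
- by rewrite sprodDr sprodNr sprodZr wl (mkC (f1 0)) ff1 mulr0 subr0.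
- by rewrite sprodDr sprodNr sprodZr wl (mkC (f1 1)) ff1 mulr0 subr0.
- by rewrite sprodDr sprodNr sprodZr wl (mkC (f1 _)) ff1 mulr0 subr0.
- by rewrite sprodDr sprodNr sprodZr (mkC _ f) ff2 eqxx mulNr mulrN mulr1 opprK subrr.
Qed.

Lemma third (i j : 'I_3) : exists k, (k != i) && (k != j).
Proof.
by case: i => -[|[|[|//]]] ?; case: j => -[|[|[|//]]] ?; (try by exists 0); (try by exists 1); by exists 2%:R.
Qed.

(** The off-diagonal second derivatives are multiples of [f]. With [k] the third index, the factor
    of [f2 i j] is [- <f2 k k, f2 i j>], which the Gauss equation turns into a product of two
    off-diagonal terms, that is, of two multiples of the null vector [f]. *)
Lemma jet_off i j : i != j -> f2 i j = 0.
Proof.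
move=> ij; have [k /andP[ki kj]] := third i j.
have par a b (c : 'I_3) : a != b -> exists d, f2 a b = d *: f.
  move=> ab; exists (- mk (f2 c c) (f2 a b)); apply: jet_frame => [|l]; last exact: f1f2.
  by rewrite ff2 (negbTE ab) oppr0.
rewrite (jet_frame k _ (f1f2 i j)); last by rewrite ff2 (negbTE ij) oppr0.
have [a E1] := par k i k ki; have [b E2] := par k j k kj.
by rewrite (gaussE k k i j) (f2C i k) E1 E2 sprodZl sprodZr ff !mulr0 oppr0 scale0r.
Qed.

(** The Gauss equation makes distinct diagonal terms orthogonal. The difference is therefore
    orthogonal to [f], to [f1] and to [f2 k k] for the third index [k]. *)
Lemma jet_diag i j : f2 i i = f2 j j.
Proof.
have [->//|ij] := eqVneq i j.
have [k /andP[ki kj]] := third i j.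
have orth a b : a != b -> mk (f2 a a) (f2 b b) = 0.
  by move=> ab; rewrite gaussE jet_off ?sprod0l// eq_sym.
apply/eqP; rewrite -subr_eq0; apply/eqP.
rewrite (@jet_frame k (f2 i i - f2 j j)).
- by rewrite sprodDr sprodNr !orth// subr0 oppr0 scale0r.
- by rewrite sprodDr sprodNr !ff2 !eqxx subrr.
- by move=> l; rewrite sprodDr sprodNr !f1f2 subrr.
Qed.

End FlatConeJet.

Section LiouvilleCone.
Variables (R : realType) (F : 'rV[R]_3 -> 'rV[R]_5).
Local Notation J := (minkowski_gram R 4).
Local Notation mk := (sprod J).
Local Notation e := (fun i : 'I_3 => delta_mx 0 i : 'rV[R]_3).
Local Notation oT := (@openT 'rV[R]_3).
Hypothesis sF : smooth setT F.
Hypothesis FF : forall y, mk (F y) (F y) = 0.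
Hypothesis FiFj : forall y i j, mk ('D_(e i) F y) ('D_(e j) F y) = (i == j)%:R.

Let F1 i := 'D_(e i) F.
Let F2 i j := 'D_(e i) (F1 j).
Let F3 i j k := 'D_(e i) (F2 j k).
Let s1 i : smooth setT (F1 i). Proof. exact: smooth_derive. Qed.
Let s2 i j : smooth setT (F2 i j). Proof. exact: smooth_derive. Qed.
Let dF y : differentiable F y. Proof. exact: smooth_differentiable sF _. Qed.
Let d1 i y : differentiable (F1 i) y. Proof. exact: smooth_differentiable (s1 i) _. Qed.
Let d2 i j y : differentiable (F2 i j) y. Proof. exact: smooth_differentiable (s2 i j) _. Qed.
Let F2C i j y : F2 i j y = F2 j i y.
Proof. exact: (derive_symv _ _ oT (I : setT y) sF). Qed.
Let F3C i j k y : F3 i j k y = F3 j i k y.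
Proof. exact: (derive_symv _ _ oT (I : setT y) (s1 k)). Qed.

Let leib (A B : 'rV[R]_3 -> 'rV[R]_5) (c : R) v y : differentiable A y -> differentiable B y ->
  (forall z, mk (A z) (B z) = c) -> mk ('D_v A y) (B y) + mk (A y) ('D_v B y) = 0.
Proof.
move=> dA dB H; rewrite -derive_sprod//.
have -> : (fun y => mk (A y) (B y)) = cst c by apply/funext.
by rewrite derive_cst.
Qed.

Let half0 (a : R) : a + a = 0 -> a = 0.
Proof. by rewrite -mulr2n => /eqP; rewrite mulrn_eq0 => /eqP. Qed.

Let opp_of_add (a b : R) : a + b = 0 -> a = - b.
Proof. by move=> /eqP; rewrite addr_eq0 => /eqP. Qed.

Let FF1 i y : mk (F y) (F1 i y) = 0.
Proof. by apply: half0; have := leib (e i) (dF y) (dF y) FF; rewrite (mkC ('D_(e i) F y)). Qed.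

Let FF2 i j y : mk (F y) (F2 i j y) = - (i == j)%:R.
Proof.
have := leib (e i) (dF y) (d1 j y) (FF1 j).
by rewrite FiFj addrC => /eqP; rewrite addr_eq0 => /eqP.
Qed.

Let F1F2 i j k y : mk (F1 k y) (F2 i j y) = 0.
Proof.
have A a b c : mk (F1 c y) (F2 a b y) = - mk (F1 b y) (F2 a c y).
  have L : mk (F2 a b y) (F1 c y) + mk (F1 b y) (F2 a c y) = 0 by exact: (leib (e a) (d1 b y) (d1 c y) (fun z => FiFj z b c)).
  exact: etrans (mkC _ _) (opp_of_add L).
(* As for the Christoffel symbols of a constant metric: an array symmetric in its first two indices
   and antisymmetric in its last two vanishes. *)
have alg (T : 'I_3 -> 'I_3 -> 'I_3 -> R) : (forall a b c, T a b c = - T a c b) ->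
    (forall a b c, T a b c = T b a c) -> forall i j k, T i j k = 0.
  move=> A1 S i' j' k'; apply: half0.
  by rewrite {1}(A1 i' j' k') (S i' k' j') (A1 k' i' j') opprK (S k' j' i') (A1 j' k' i') (S j' i' k') addNr.
by apply: (alg (fun a b c => mk (F1 c y) (F2 a b y)) A) => a b c; rewrite F2C.
Qed.

(** Differentiating [F1F2] expresses a product of second derivatives by a product with a third
    derivative, and third derivatives commute. *)
Let gauss i j k l y : mk (F2 i j y) (F2 k l y) = mk (F2 k j y) (F2 i l y).
Proof.
have A a b c d : mk (F2 b c y) (F2 a d y) = - mk (F1 d y) (F3 a b c y).
  have L : mk (F2 a d y) (F2 b c y) + mk (F1 d y) (F3 a b c y) = 0 by exact: (leib (e a) (d1 d y) (d2 b c y) (F1F2 b c d)).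
  exact: etrans (mkC _ _) (opp_of_add L).
exact: etrans (A k i j l) (etrans (congr1 (fun t => - mk (F1 l y) t) (F3C k i j y)) (esym (A i k j l))).
Qed.

Let F2off i j y : i != j -> F2 i j y = 0.
Proof.
exact: (@jet_off R (F y) (F1^~ y) (fun i j => F2 i j y) (FF y) (FF1^~ y) (FiFj y) (fun i j => FF2 i j y)
  (fun i j k => F1F2 i j k y) (fun i j => F2C i j y) (fun i j k l => gauss i j k l y) i j).
Qed.

Let F2diag i j y : F2 i i y = F2 j j y.
Proof.
exact: (@jet_diag R (F y) (F1^~ y) (fun i j => F2 i j y) (FF y) (FF1^~ y) (FiFj y) (fun i j => FF2 i j y)
  (fun i j k => F1F2 i j k y) (fun i j => F2C i j y) (fun i j k l => gauss i j k l y) i j).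
Qed.

Let const_of (G : 'rV[R]_3 -> 'rV[R]_5) : smooth setT G -> (forall y i, 'D_(e i) G y = 0) -> forall y, G y = G 0.
Proof.
move=> sG DG y; apply/rowP => j.
have dG z : differentiable G z by exact: smooth_differentiable sG _.
apply: (derive0_ray (f := fun z => G z 0 j)) => t _.
  exact: differentiable_coord_comp.
rewrite derive_coord// derive_row// summxE big1// => i _.
by rewrite DG scaler0 mxE.
Qed.

Let Cc y := F2 0 0 y.
(** For [k] different from [i], the [i]-derivative of [F_kk] is the [k]-derivative of [F_ik = 0].
    All [F_kk] being equal, such a [k] is available for each [i]. *)
Let CcE y : Cc y = Cc 0.
Proof.
apply: (const_of (s2 0 0)) => {}y i.
have [k /andP[ki _]] := third i i.
have E1 : Cc = F2 k k by apply/funext => z; exact: F2diag.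
have ik : i != k by rewrite eq_sym.
have E2 : F2 i k = cst 0 by apply/funext => z; exact: F2off.
apply: etrans (congr1 (fun G => 'D_(e i) G y) E1) _.
apply: etrans (F3C i k k y) _.
apply: etrans (congr1 (fun G => 'D_(e k) G y) E2) _.
exact: derive_cst.
Qed.

Let derive_coordinate (v y : 'rV[R]_3) i : 'D_v (fun z : 'rV[R]_3 => z 0 i) y = v 0 i.
Proof.
have di : differentiable (id : 'rV[R]_3 -> 'rV[R]_3) y by case: (@is_diff_id _ _ y).
have e1 : 'D_v (id : 'rV[R]_3 -> 'rV[R]_3) y = v by exact: derive_id.
exact: etrans (derive_coord v i di) (congr1 (fun w : 'rV[R]_3 => w 0 i) e1).
Qed.

Let scoord i : smooth setT (fun z : 'rV[R]_3 => z 0 i : R).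
Proof.
move=> k; case: k => [|k]; first by move=> p _; exact: coord_continuous.
split=> [p _|v]; first exact: differentiable_coord.
have E p : setT p -> cst (v 0 i) p = 'D_v (fun z : 'rV[R]_3 => z 0 i) p.
  by move=> _; exact: esym (derive_coordinate v p i).
exact: (eq_smooth oT E (@smooth_cst _ _ _ _ (v 0 i) oT) k).
Qed.

Let F1E j y : F1 j y = F1 j 0 + y 0 j *: Cc 0.
Proof.
pose G y := F1 j y - y 0 j *: Cc 0.
have sG : smooth setT G.
  apply: (smooth_row oT) => c.
  apply: (eq_smooth oT (f := fun z => F1 j z 0 c - z 0 j * Cc 0 0 c)); first by move=> z _; rewrite !mxE.
  apply: (smooth_add oT); first exact: smooth_coord oT (s1 j).
  by apply: (smooth_opp oT); apply: (smooth_mul oT) => //; exact: smooth_cst oT.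
have : G y = G 0.
  apply: const_of => // z i; apply/rowP => c; rewrite -derive_coord; last exact: smooth_differentiable sG _.
  have -> : (fun q => G q 0 c) = (fun q => F1 j q 0 c - q 0 j * Cc 0 0 c) by apply/funext => q; rewrite !mxE.
  rewrite (@deriveB _ _ _ (fun q => F1 j q 0 c) (fun q => q 0 j * Cc 0 0 c)); first last.
  - by apply: (@derivableM _ _ (fun q : 'rV[R]_3 => q 0 j) (fun=> Cc 0 0 c)); [apply: diff_derivable; exact: differentiable_coord|exact: derivable_cst].
  - by apply: diff_derivable; exact: differentiable_coord_comp.
  rewrite (@deriveM _ _ (fun q : 'rV[R]_3 => q 0 j) (fun=> Cc 0 0 c)); first last.
  - exact: derivable_cst.
  - by apply: diff_derivable; exact: differentiable_coord.
  rewrite derive_cst scaler0 add0r derive_coordinate derive_coord// !mxE /=.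
  rewrite -/(F2 i j z); have [->|ij] := eqVneq i j.
    by rewrite (F2diag j 0 z) -/(Cc z) CcE /GRing.scale /= mulr1 subrr.
  have e0 : F2 i j z = 0 by apply: F2off; first [exact: ij|rewrite eq_sym; exact: ij].
  by rewrite e0 mxE /GRing.scale /= mulr0 subr0.
rewrite /G mxE scale0r subr0 => <-; by rewrite subrK.
Qed.

Let FE y : F y = F 0 + \sum_i y 0 i *: F1 i 0 + ((\sum_i y 0 i ^+ 2) / 2) *: Cc 0.
Proof.
pose Pl c (y : 'rV[R]_3) : R := \sum_i y 0 i * F1 i 0 0 c + ((\sum_i y 0 i * y 0 i) / 2) * Cc 0 0 c.
pose Pc c i (y : 'rV[R]_3) : R := y 0 i * F1 i 0 0 c + y 0 i * (y 0 i * (Cc 0 0 c / 2)).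
have PE c z : Pl c z = (\sum_i Pc c i) z.
  rewrite fct_sumE /Pl /Pc big_split /= -mulrA mulr_suml; congr (_ + _).
  by apply: eq_bigr => i _; rewrite -mulrA; congr (_ * (_ * _)); rewrite mulrC.
have dc (i : 'I_3) z v : is_derive z v (fun q : 'rV[R]_3 => q 0 i : R) (v 0 i).
  by split; [apply: diff_derivable; exact: differentiable_coord|exact: derive_coordinate].
have dPc c i z v : is_derive z v (Pc c i) (v 0 i * (F1 i 0 0 c + z 0 i * Cc 0 0 c)).
  have H1 := is_deriveM (dc i z v) (is_derive_cst (F1 i 0 0 c) z v).
  have H2 := is_deriveM (dc i z v) (is_deriveM (dc i z v) (is_derive_cst (Cc 0 0 c / 2) z v)).
  apply: (is_derive_eq (is_deriveD H1 H2)).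
  rewrite /GRing.scale /= /cst /=.
  change (((fun q : 'rV[R]_3 => q 0 i) * (fun=> Cc 0 0 c / 2)) z) with (z 0 i * (Cc 0 0 c / 2)).
  by move: (z 0 i) (v 0 i) (F1 i 0 0 c) (Cc 0 0 c) => *; field.
pose G (z : 'rV[R]_3) : 'rV[R]_5 := \row_c (F z 0 c - Pl c z).
have dG z c v : is_derive z v (fun q => F q 0 c - Pl c q) ('D_v F z 0 c - \sum_i (v 0 i * (F1 i 0 0 c + z 0 i * Cc 0 0 c))).
  apply: is_deriveB.
    by split; [apply: diff_derivable; exact: differentiable_coord_comp|rewrite derive_coord].
  have -> : Pl c = \sum_i Pc c i by apply/funext => q; exact: PE.
  exact: is_derive_sum.
apply/rowP => c; have : F y 0 c - Pl c y = F 0 0 c - Pl c 0.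
  have dP z : differentiable (fun q => F q 0 c - Pl c q) z.
    apply: (@differentiableB _ _ _ (fun q => F q 0 c) (Pl c)); first exact: differentiable_coord_comp.
    have -> : Pl c = \sum_i Pc c i by apply/funext => q; exact: PE.
    apply: differentiable_sum => i.
    have dci : differentiable (fun q : 'rV[R]_3 => q 0 i : R) z by exact: differentiable_coord.
    apply: (@differentiableD _ _ _ (fun q : 'rV[R]_3 => q 0 i * F1 i 0 0 c) (fun q : 'rV[R]_3 => q 0 i * (q 0 i * (Cc 0 0 c / 2)))).
      by apply: (@differentiableM _ _ (fun q : 'rV[R]_3 => q 0 i) (fun=> F1 i 0 0 c)) => //; exact: differentiable_cst.
    apply: (@differentiableM _ _ (fun q : 'rV[R]_3 => q 0 i) (fun q : 'rV[R]_3 => q 0 i * (Cc 0 0 c / 2))) => //.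
    by apply: (@differentiableM _ _ (fun q : 'rV[R]_3 => q 0 i) (fun=> Cc 0 0 c / 2)) => //; exact: differentiable_cst.
  apply: (derive0_ray (f := fun q => F q 0 c - Pl c q)) => t _ //.
  rewrite (@derive_val _ _ _ _ _ _ _ (dG (t *: y) c y)) derive_row// summxE.
  apply/eqP; rewrite subr_eq0; apply/eqP; apply: eq_bigr => i _.
  by rewrite mxE -/(F1 i (t *: y)) F1E !mxE.
have -> : Pl c 0 = 0.
  by rewrite /Pl !big1 ?mul0r ?addr0// => i _; rewrite mxE mul0r.
rewrite subr0 => FP.
have E2 : \sum_i y 0 i ^+ 2 = \sum_i y 0 i * y 0 i by apply: eq_bigr => i _; rewrite expr2.
have E3 : (\sum_i y 0 i *: F1 i 0) 0 c = \sum_i y 0 i * F1 i 0 0 c by rewrite summxE; apply: eq_bigr => i _; rewrite mxE.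
have coordE (a b d : 'rV[R]_5) k : (a + b + k *: d) 0 c = a 0 c + b 0 c + k * d 0 c by rewrite !mxE.
apply: etrans (esym (coordE _ _ _ _)); rewrite E2 E3 -addrA -[RHS]/(F 0 0 c + Pl c y) -FP.
by rewrite subrK.
Qed.

(* An isometric lift of R^3 to the light cone, projecting to the stereographic image of y. *)
Definition cone_lift (y : 'rV[R]_3) : 'rV[R]_(4 + 1) :=
  row_mx (row_mx y (((sprod 1%:M y y - 1) / 2)%:M : 'rV[R]_1) : 'rV[R]_(3 + 1))
    (((sprod 1%:M y y + 1) / 2)%:M : 'rV[R]_1).

(** By [FE], [F] is the polynomial [A + sum y_i B_i + |y|^2 C / 2]. Matching it with [cone_lift]
    sends the last two coordinate vectors to [C / 2 - A] and [C / 2 + A], and the products of [A],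
    [B_i] and [C] found above are those that make the matrix Lorentzian. *)
Lemma liouville_cone : exists M : 'M[R]_(4 + 1),
  M *m J *m M^T = J /\ forall y, F y = cone_lift y *m M.
Proof.
pose A := F 0; pose B i := F1 i 0; pose C := Cc 0.
have CC : mk C C = 0.
  by rewrite {1}/C /Cc (F2diag 0 1 0) gauss F2off// sprod0l.
have AA : mk A A = 0 by exact: FF.
have AB i : mk A (B i) = 0 by exact: FF1.
have AC : mk A C = -1 by rewrite /C /Cc FF2 eqxx.
have BC i : mk (B i) C = 0 by exact: F1F2.
have BB i j : mk (B i) (B j) = (i == j)%:R by exact: FiFj.
pose P4 := 2^-1 *: C - A; pose P5 := 2^-1 *: C + A.
pose M3 : 'M[R]_(3, 4 + 1) := \matrix_(i < 3) B i.
pose M : 'M[R]_(4 + 1) := col_mx (col_mx M3 P4 : 'M[R]_(3 + 1, 4 + 1)) P5.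
exists M; split; last first.
  move=> y; rewrite FE /cone_lift /M mul_row_col (@mul_row_col _ 1 3 1 (4 + 1)) !mul_scalar_mx /P4 /P5.
  have -> : y *m M3 = \sum_i y 0 i *: F1 i 0 by rewrite mulmx_sum_row; apply: eq_bigr => i _; rewrite rowK.
  rewrite -/A -/C.
  have -> : sprod 1%:M y y = \sum_i y 0 i ^+ 2 by rewrite sprod1E; apply: eq_bigr => i _; rewrite expr2.
  have alg (A' S' C' : 'rV[R]_(4 + 1)) (s : R) :
      A' + S' + (s / 2) *: C' = S' + ((s - 1) / 2) *: (2^-1 *: C' - A') + ((s + 1) / 2) *: (2^-1 *: C' + A').
    by apply/rowP => j; rewrite !mxE; field.
  exact: alg.
have mkM (m n : nat) (K : 'M[R]_(m, 4 + 1)) (L : 'M[R]_(n, 4 + 1)) : K *m J *m L^T = \matrix_(i, j) mk (row i K) (row j L).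
  apply/matrixP => i j; rewrite [RHS]mxE /sprod -row_mul mxE [RHS]mxE.
  by apply: eq_bigr => k _; rewrite ![in RHS]mxE [in LHS]mxE [_^T k j]mxE.
have E44 : mk P4 P4 = 1.
  by rewrite /P4 !(sprodDl, sprodDr, sprodNl, sprodNr, sprodZl, sprodZr) CC AA (mkC C) AC; field.
have E55 : mk P5 P5 = -1.
  by rewrite /P5 !(sprodDl, sprodDr, sprodZl, sprodZr) CC AA (mkC C) AC; field.
have E45 : mk P4 P5 = 0.
  by rewrite /P4 /P5 !(sprodDl, sprodDr, sprodNl, sprodNr, sprodZl, sprodZr) CC AA (mkC C) AC; field.
have EB4 i : mk (B i) P4 = 0.
  by rewrite /P4 sprodDr sprodNr sprodZr BC (mkC (B i)) AB mulr0 subr0.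
have EB5 i : mk (B i) P5 = 0.
  by rewrite /P5 sprodDr sprodZr BC (mkC (B i)) AB mulr0 addr0.
have row1 (v : 'rV[R]_(4 + 1)) i : row i v = v by apply/rowP => j; rewrite mxE (ord1 i).
have gram (m n : nat) (K : 'M[R]_(m, 4 + 1)) (L : 'M[R]_(n, 4 + 1)) :
    col_mx K L *m J *m (col_mx K L)^T
    = block_mx (K *m J *m K^T) (K *m J *m L^T) (L *m J *m K^T) (L *m J *m L^T).
  by rewrite tr_col_mx mul_col_mx mul_col_row.
have G34 : M3 *m J *m P4^T = 0 by rewrite mkM; apply/matrixP => i j; rewrite mxE rowK row1 EB4 mxE.
have G43 : P4 *m J *m M3^T = 0 by rewrite mkM; apply/matrixP => i j; rewrite mxE rowK row1 mkC EB4 mxE.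
have G35 : M3 *m J *m P5^T = 0 by rewrite mkM; apply/matrixP => i j; rewrite mxE rowK row1 EB5 mxE.
have G53 : P5 *m J *m M3^T = 0 by rewrite mkM; apply/matrixP => i j; rewrite mxE rowK row1 mkC EB5 mxE.
have G33 : M3 *m J *m M3^T = 1%:M by rewrite mkM; apply/matrixP => i j; rewrite mxE !rowK BB mxE.
have G44 : P4 *m J *m P4^T = 1%:M by rewrite mkM; apply/matrixP => i j; rewrite mxE !row1 E44 mxE (ord1 i) (ord1 j).
have G45 : P4 *m J *m P5^T = 0 by rewrite mkM; apply/matrixP => i j; rewrite mxE !row1 E45 mxE.
have G54 : P5 *m J *m P4^T = 0 by rewrite mkM; apply/matrixP => i j; rewrite mxE !row1 mkC E45 mxE.
have G55 : P5 *m J *m P5^T = - 1%:M by rewrite mkM; apply/matrixP => i j; rewrite mxE !row1 E55 !mxE (ord1 i) (ord1 j).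
pose M4 : 'M[R]_(3 + 1, 4 + 1) := col_mx M3 P4.
have H1 : M4 *m J *m M4^T = 1%:M by rewrite /M4 gram G33 G34 G43 G44 -scalar_mx_block.
have H2 : M4 *m J *m P5^T = 0 by rewrite /M4 !mul_col_mx G35 G45 col_mx0.
have H3 : P5 *m J *m M4^T = 0 by rewrite /M4 tr_col_mx mul_mx_row G53 G54 row_mx0.
by rewrite /M -/M4 (@gram 4 1 M4 P5) H1 H2 H3 G55.
Qed.
End LiouvilleCone.

Section RowRules.
Variables (R : realType) (V : normedModType R).

Lemma derive_scale n (k : V -> R) (F : V -> 'rV[R]_n) p v : differentiable k p -> differentiable F p ->
  'D_v (fun q => k q *: F q) p = 'D_v k p *: F p + k p *: 'D_v F p.
Proof.
move=> dk dF; have dFj j : differentiable (fun q => F q 0 j) p by exact: differentiable_coord_comp.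
have E j : (fun q => (k q *: F q) 0 j) = (fun q => k q * F q 0 j) by apply/funext => q; rewrite mxE.
have dkF : differentiable (fun q => k q *: F q) p.
  by apply: differentiable_row => j; rewrite E; exact: differentiableM.
apply/rowP => j; apply: etrans (esym (derive_coord v j dkF)) _.
apply: etrans (congr1 (fun g => 'D_v g p) (E j)) _.
apply: etrans (@deriveM _ _ k (fun q => F q 0 j) p v (diff_derivable dk) (diff_derivable (dFj j))) _.
rewrite (derive_coord v j dF).
have coordE (a b : R) (A B : 'rV[R]_n) : (a *: A + b *: B) 0 j = a * A 0 j + b * B 0 j by rewrite !mxE.
apply: etrans (esym (coordE _ _ _ _)).
by rewrite addrC /GRing.scale /= [X in X + _]mulrC.
Qed.

Lemma derive_row_mx m n (F : V -> 'rV[R]_m) (G : V -> 'rV[R]_n) p v : differentiable F p -> differentiable G p ->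
  'D_v (fun q => row_mx (F q) (G q)) p = row_mx ('D_v F p) ('D_v G p).
Proof.
move=> dF dG.
have El j : (fun q => row_mx (F q) (G q) 0 (lshift n j)) = (fun q => F q 0 j).
  by apply/funext => q; rewrite row_mxEl.
have Er j : (fun q => row_mx (F q) (G q) 0 (rshift m j)) = (fun q => G q 0 j).
  by apply/funext => q; rewrite row_mxEr.
have d : differentiable (fun q => row_mx (F q) (G q)) p.
  apply: differentiable_row => j; case: (split_ordP j) => k ->.
    by rewrite El; exact: differentiable_coord_comp.
  by rewrite Er; exact: differentiable_coord_comp.
apply/rowP => j; apply: etrans (esym (derive_coord v j d)) _; case: (split_ordP j) => k ->.
  apply: etrans (congr1 (fun g => 'D_v g p) (El k)) _.
  by apply: etrans (derive_coord v k dF) _; rewrite row_mxEl.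
apply: etrans (congr1 (fun g => 'D_v g p) (Er k)) _.
by apply: etrans (derive_coord v k dG) _; rewrite row_mxEr.
Qed.

Lemma derive_mulmx m n (F : V -> 'rV[R]_m) (M : 'M[R]_(m, n)) p v : differentiable F p ->
  'D_v (fun q => F q *m M) p = 'D_v F p *m M.
Proof.
move=> dF; have dFj j : differentiable (fun q => F q 0 j) p by exact: differentiable_coord_comp.
have E j : (fun q => (F q *m M) 0 j) = \sum_k (fun q => F q 0 k * M k j).
  by apply/funext => q; rewrite fct_sumE mxE.
have dt j k : is_derive p v (fun q => F q 0 k * M k j) ('D_v F p 0 k * M k j).
  split.
    by apply: derivableM; [exact: diff_derivable (dFj k)|exact: derivable_cst].
  apply: etrans (@deriveM _ _ (fun q => F q 0 k) (fun=> M k j) p v (diff_derivable (dFj k)) (derivable_cst _ _ _)) _.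
  by rewrite derive_cst scaler0 add0r (derive_coord v k dF) /GRing.scale /= mulrC.
have d : differentiable (fun q => F q *m M) p.
  apply: differentiable_row => j; rewrite E; apply: differentiable_sum => k.
  by apply: differentiableM; [exact: dFj|exact: differentiable_cst].
apply/rowP => j; apply: etrans (esym (derive_coord v j d)) _.
apply: etrans (congr1 (fun g => 'D_v g p) (E j)) _.
by rewrite (@derive_val _ _ _ _ _ _ _ (is_derive_sum (dt j))) mxE.
Qed.

Variable U : set V.
Hypothesis oU : open U.

Lemma derive_eq_cst (f : V -> R) c p v : U p -> (forall q, U q -> f q = c) -> 'D_v f p = 0.
Proof.
move=> Up fc; have E := @eq_derive_open R V R f (fun=> c) U p v oU Up fc.
by rewrite E; exact: derive_cst.
Qed.

Lemma smooth_scale n (k : V -> R) (F : V -> 'rV[R]_n) : smooth U k -> smooth U F -> smooth U (fun q => k q *: F q).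
Proof.
move=> sk sF; apply: smooth_row => // j.
apply: (eq_smooth oU) (smooth_mul oU sk (smooth_coord j oU sF)) => q _; by rewrite mxE.
Qed.

Lemma smooth_addv n (F G : V -> 'rV[R]_n) : smooth U F -> smooth U G -> smooth U (fun q => F q + G q).
Proof.
move=> sF sG; apply: smooth_row => // j.
apply: (eq_smooth oU) (smooth_add oU (smooth_coord j oU sF) (smooth_coord j oU sG)) => q _; by rewrite mxE.
Qed.

Lemma smooth_row_mx m n (F : V -> 'rV[R]_m) (G : V -> 'rV[R]_n) : smooth U F -> smooth U G ->
  smooth U (fun q => row_mx (F q) (G q)).
Proof.
move=> sF sG; apply: smooth_row => // j; case: (split_ordP j) => k ->.
  by apply: (eq_smooth oU) (smooth_coord k oU sF) => q _; rewrite row_mxEl.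
by apply: (eq_smooth oU) (smooth_coord k oU sG) => q _; rewrite row_mxEr.
Qed.

Lemma smooth_mulmx m n (F : V -> 'rV[R]_m) (M : 'M[R]_(m, n)) : smooth U F -> smooth U (fun q => F q *m M).
Proof.
move=> sF; apply: smooth_row => // j.
apply: (eq_smooth oU (f := fun q => \sum_k F q 0 k * M k j)); first by move=> q _; rewrite mxE.
apply: smooth_sum => // k _; apply: smooth_mul => //; first exact: smooth_coord oU sF.
exact: smooth_cst oU.
Qed.

Lemma smooth_lsubmx m n (F : V -> 'rV[R]_(m + n)) : smooth U F -> smooth U (fun q => lsubmx (F q)).
Proof.
move=> sF; apply: smooth_row => // j.
by apply: (eq_smooth oU) (smooth_coord (lshift n j) oU sF) => q _; rewrite mxE.
Qed.

Lemma smooth_sprod n (J : 'M[R]_n) (F G : V -> 'rV[R]_n) : smooth U F -> smooth U G ->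
  smooth U (fun q => sprod J (F q) (G q)).
Proof.
move=> sF sG.
apply: (eq_smooth oU (f := fun q => \sum_i \sum_j F q 0 i * J i j * G q 0 j)).
  by move=> q _; rewrite sprodE.
apply: smooth_sum => // i _; apply: smooth_sum => // j _.
apply: smooth_mul => //; last exact: smooth_coord oU sG.
by apply: smooth_mul => //; [exact: smooth_coord oU sF|exact: smooth_cst oU].
Qed.

Lemma smooth_scalar (k : V -> R) : smooth U k -> smooth U (fun q => (k q)%:M : 'rV[R]_1).
Proof.
move=> sk; apply: smooth_row => // j.
by apply: (eq_smooth oU) sk => q _; rewrite mxE (ord1 j).
Qed.

Lemma smooth_compv m n (W : set 'rV[R]_m) (f : V -> 'rV[R]_m) (g : 'rV[R]_m -> 'rV[R]_n) :
  open W -> (forall p, U p -> W (f p)) -> smooth U f -> smooth W g -> smooth U (g \o f).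
Proof.
move=> oW UW sf sg; apply: smooth_row => // j.
exact: (smooth_comp oU oW UW sf (smooth_coord j oW sg)).
Qed.

Lemma smooth_id : smooth U (fun q : V => q).
Proof.
case=> [|k] /=; first by move=> p _; exact: cvg_id.
split=> [p _|v]; first by case: (@is_diff_id _ _ p).
apply: (eq_Ck oU) (@Ck_cst _ _ _ k U v oU) => p _; exact: esym (derive_id _ _).
Qed.
End RowRules.

(** * Null lifts and Moebius transformations of the sphere *)

Section Cone.
Variables (R : realType) (V : normedModType R).
Local Notation J := (minkowski_gram R 4).
Local Notation mk := (sprod J).
Local Notation dot := (sprod (1%:M : 'M[R]_4)).

Definition null_lift (x : 'rV[R]_4) : 'rV[R]_(4 + 1) := row_mx x 1%:M.

Lemma sprod1_row_mx m n (a c : 'rV[R]_m) (b d : 'rV[R]_n) :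
  sprod 1%:M (row_mx a b) (row_mx c d) = sprod 1%:M a c + sprod 1%:M b d.
Proof. by rewrite /sprod !mulmx1 tr_row_mx mul_row_col mxE. Qed.

Lemma sprod1_rV1 (a b : 'rV[R]_1) : sprod 1%:M a b = a 0 0 * b 0 0.
Proof. by rewrite sprod1E big_ord1. Qed.

Lemma sprod1_sqr_gt0 n (x : 'rV[R]_n) : x != 0 -> 0 < sprod 1%:M x x.
Proof.
move=> /rV0Pn[j xj]; rewrite sprod1E (bigD1 j)//= ltr_pwDl//.
  by rewrite -expr2 lt_def sqrf_eq0 xj sqr_ge0.
by apply: sumr_ge0 => i _; rewrite -expr2 sqr_ge0.
Qed.

Lemma mk_lift x y : mk (null_lift x) (null_lift y) = dot x y - 1.
Proof. by rewrite minkE !mxE mulr1. Qed.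

Lemma mk_last (v w : 'rV[R]_(4 + 1)) : mk v w = dot (lsubmx v) (lsubmx w) - v 0 (rshift 4 0) * w 0 (rshift 4 0).
Proof. by rewrite -{1}(hsubmxK v) -{1}(hsubmxK w) minkE !mxE. Qed.

Lemma null_last_neq0 (v : 'rV[R]_(4 + 1)) : mk v v = 0 -> v != 0 -> v 0 (rshift 4 0) != 0.
Proof.
move=> vv; apply: contraNneq => v5; move: vv; rewrite mk_last v5 mul0r subr0 => d0.
have l0 : lsubmx v = 0.
  by apply/eqP; apply: contraTT isT => /sprod1_sqr_gt0; rewrite d0 ltxx.
rewrite -(hsubmxK v) l0; apply/eqP/rowP => j; case: (split_ordP j) => k ->; rewrite ?row_mxEl ?row_mxEr !mxE//.
by rewrite (ord1 k) v5.
Qed.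

Lemma lift_neq0 x : null_lift x != 0.
Proof.
apply/eqP => /(congr1 (fun v : 'rV[R]_(4 + 1) => v 0 (rshift 4 0))).
by rewrite row_mxEr !mxE => /eqP; rewrite oner_eq0.
Qed.

(** The derivative of the factor [k] only contributes along the null vector [null_lift (m p)], which
    is orthogonal to itself and, because [m] stays on the sphere, to the lifted derivatives of
    [m]. *)
Lemma cone_metric U (m : V -> 'rV[R]_4) (k : V -> R) p u v : open U -> U p -> smooth U m -> smooth U k ->
  (forall q, U q -> dot (m q) (m q) = 1) ->
  mk ('D_u (fun q => k q *: null_lift (m q)) p) ('D_v (fun q => k q *: null_lift (m q)) p)
  = k p ^+ 2 * dot ('D_u m p) ('D_v m p).
Proof.
move=> oU Up sm sk m1.
have dm : differentiable m p by exact: smooth_differentiable sm Up.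
have dk : differentiable k p by exact: smooth_differentiable sk Up.
have s1 : smooth U (fun=> 1%:M : 'rV[R]_1) by exact: smooth_cst oU.
have dl : differentiable (fun q => null_lift (m q)) p by exact: smooth_differentiable (smooth_row_mx oU sm s1) Up.
have Dl w : 'D_w (fun q => null_lift (m q)) p = row_mx ('D_w m p) 0.
  apply: etrans (derive_row_mx w dm (smooth_differentiable s1 Up)) _.
  by congr (row_mx _ _); exact: derive_cst.
have mw w : dot ('D_w m p) (m p) = 0.
  have H : dot ('D_w m p) (m p) + dot (m p) ('D_w m p) = 0.
    apply: etrans (esym (derive_sprod 1%:M w dm dm)) _.
    exact: (derive_eq_cst oU w Up m1).
  by move: H; rewrite (sprod1C (m p)) -mulr2n => /eqP; rewrite mulrn_eq0 => /eqP.
rewrite (derive_scale u dk dl) (derive_scale v dk dl) (Dl u) (Dl v).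
move: ('D_u k p) ('D_v k p) ('D_u m p) ('D_v m p) (mw u) (mw v) => ku kv mu mv hu hv.
rewrite !(sprodDl, sprodDr) !(sprodZl, sprodZr) mk_lift (m1 _ Up) !minkE hu (sprod1C (m p)) hv !mxE; ring.
Qed.
End Cone.

Section Moebius.
Variable R : realType.
Local Notation J := (minkowski_gram R 4).
Local Notation mk := (sprod J).
Local Notation dot := (sprod (1%:M : 'M[R]_4)).
Local Notation S3 := (@S3 R).
Implicit Types (M : 'M[R]_(4 + 1)) (x y : 'rV[R]_4).

Definition lorentz M := M *m J *m M^T = J.

Lemma lorentz_sprod M u v : lorentz M -> mk (u *m M) (v *m M) = mk u v.
Proof. by move=> LM; rewrite /sprod trmx_mul !mulmxA -(mulmxA u M) -(mulmxA u) LM. Qed.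

Lemma lorentz_ext M : (forall u v, mk (u *m M) (v *m M) = mk u v) -> lorentz M.
Proof.
move=> H; apply/matrixP => i j; have := H (delta_mx 0 i) (delta_mx 0 j).
rewrite /sprod trmx_mul !mulmxA -(mulmxA (delta_mx 0 i) M) -(mulmxA (delta_mx 0 i)).
by rewrite trmx_delta -!rowE -!colE !mxE.
Qed.

Definition lorentz_inv M : 'M[R]_(4 + 1) := J *m M^T *m J.

Lemma lorentz_mulV M : lorentz M -> M *m lorentz_inv M = 1%:M.
Proof. by move=> LM; rewrite /lorentz_inv !mulmxA LM mink_sq. Qed.

Lemma lorentz_mulVl M : lorentz M -> lorentz_inv M *m M = 1%:M.
Proof. by move=> LM; apply: mulmx1C; exact: lorentz_mulV. Qed.

Lemma lorentz_invP M : lorentz M -> lorentz (lorentz_inv M).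
Proof.
move=> LM; apply: lorentz_ext => u v.
by rewrite -(lorentz_sprod _ _ LM) -(mulmxA u) -(mulmxA v) lorentz_mulVl// !mulmx1.
Qed.

Lemma lorentz_adjoint M u v : lorentz M -> mk (u *m M) v = mk u (v *m lorentz_inv M).
Proof.
by move=> LM; rewrite -[in RHS](lorentz_sprod _ _ LM) -(mulmxA v) lorentz_mulVl// mulmx1.
Qed.

(** The action of a Lorentz matrix on the projectivized cone. Division by the last coordinate, of
    either sign, also covers matrices that exchange the two halves of the cone. *)
Definition mob M x : 'rV[R]_4 := ((null_lift x *m M) 0 (rshift 4 0))^-1 *: lsubmx (null_lift x *m M).

Lemma lift_unit M x : lorentz M -> S3 x -> (null_lift x *m M) 0 (rshift 4 0) != 0.
Proof.
move=> LM x1; apply: null_last_neq0; first by rewrite lorentz_sprod// mk_lift x1 subrr.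
apply: contraNneq (lift_neq0 x) => H.
by rewrite -(mulmx1 (null_lift x)) -(lorentz_mulV LM) mulmxA H mul0mx.
Qed.

Lemma lift_mob M x : lorentz M -> S3 x -> null_lift x *m M = (null_lift x *m M) 0 (rshift 4 0) *: null_lift (mob M x).
Proof.
move=> LM x1; have := lift_unit LM x1; rewrite /mob; move: (null_lift x *m M) => v v5.
apply/rowP => j; rewrite mxE; case: (split_ordP j) => k ->.
  by rewrite row_mxEl !mxE mulrA divff// mul1r.
by rewrite row_mxEr !mxE (ord1 k) mulr1.
Qed.

Lemma mob_eq M x y c : c != 0 -> null_lift x *m M = c *: null_lift y -> mob M x = y.
Proof.
move=> c0 E; rewrite /mob E mxE row_mxEr !mxE mulr1.
by rewrite linearZ /= row_mxKl scalerA mulVf// scale1r.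
Qed.

Lemma mob_S3 M x : lorentz M -> S3 x -> S3 (mob M x).
Proof.
move=> LM x1; have c0 := lift_unit LM x1.
have := lorentz_sprod (null_lift x) (null_lift x) LM; rewrite mk_lift x1 subrr (lift_mob LM x1) sprodZl sprodZr mk_lift.
by move=> /eqP; rewrite !mulf_eq0 (negbTE c0)/= subr_eq0 => /eqP.
Qed.

Lemma mobK M x : lorentz M -> S3 x -> mob (lorentz_inv M) (mob M x) = x.
Proof.
move=> LM x1; have c0 := lift_unit LM x1.
apply: (mob_eq (c := ((null_lift x *m M) 0 (rshift 4 0))^-1)); first by rewrite invr_eq0.
apply: (scalerI c0); rewrite scalemxAl -(lift_mob LM x1) -(mulmxA (null_lift x)) lorentz_mulV// mulmx1.
by rewrite scalerA divff// scale1r.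
Qed.

Local Notation U0 := (~` [set (0 : 'rV[R]_4)]).
Local Notation nrm := (fun q : 'rV[R]_4 => Num.sqrt (dot q q)).

Lemma open_U0 : open U0.
Proof. by apply: closed_openC; apply: accessible_closed_set1; apply: hausdorff_accessible; exact: norm_hausdorff. Qed.

Lemma nrm_gt0 q : U0 q -> 0 < nrm q.
Proof. by move=> /eqP q0; rewrite sqrtr_gt0; exact: sprod1_sqr_gt0. Qed.

Lemma smooth_nrm : smooth U0 nrm.
Proof.
apply: smooth_sqrt; first exact: open_U0.
  by move=> q /eqP q0; exact: sprod1_sqr_gt0.
by apply: smooth_sprod; [exact: open_U0|exact: smooth_id open_U0|exact: smooth_id open_U0].
Qed.

Lemma radial_S3 q : U0 q -> S3 ((nrm q)^-1 *: q).
Proof.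
move=> q0; have r0 := nrm_gt0 q0; rewrite /S3 /= sprodZl sprodZr.
have E : dot q q = nrm q * nrm q by rewrite -expr2 sqr_sqrtr// ltW// -sqrtr_gt0.
move: (nrm q) r0 E => r r0 ->.
by rewrite mulKf ?mulVf// gt_eqF.
Qed.

Lemma S3_U0 x : S3 x -> U0 x.
Proof. by move=> + x0; rewrite /S3 /= x0 sprod0l => /eqP; rewrite eq_sym oner_eq0. Qed.

Lemma nrm_S3 x : S3 x -> nrm x = 1.
Proof. by move=> /= ->; rewrite sqrtr1. Qed.

Lemma radialE (f : 'rV[R]_4 -> 'rV[R]_4) x : S3 x -> radial f x = f x.
Proof. by move=> x1; rewrite /radial (nrm_S3 x1) invr1 scale1r. Qed.

(** The homogeneous extension of the null lift. It makes [radial (mob M)] a quotient of coordinates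
    of [cone q *m M], see [radial_mobE], hence smooth off the origin. *)
Definition cone q : 'rV[R]_(4 + 1) := row_mx q (nrm q)%:M.

Lemma smooth_cone : smooth U0 cone.
Proof.
apply: smooth_row_mx; [exact: open_U0|exact: smooth_id open_U0|].
by apply: smooth_scalar; [exact: open_U0|exact: smooth_nrm].
Qed.

Lemma cone_lift_nrm q : U0 q -> cone q = nrm q *: null_lift ((nrm q)^-1 *: q).
Proof.
move=> q0; rewrite /null_lift scale_row_mx scalerA divff ?gt_eqF ?nrm_gt0// scale1r.
by congr (row_mx _ _); rewrite scale_scalar_mx mulr1.
Qed.

(** Differentiating [<cone, cone> = 0] shows that the last coordinate of [cone], the norm, is
    stationary in tangent directions. *)
Lemma mk_Dcone x u v : S3 x -> dot u x = 0 -> dot v x = 0 -> mk ('D_u cone x) ('D_v cone x) = dot u v.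
Proof.
move=> x1 ux vx; have x0 := S3_U0 x1; have oU := open_U0.
have dn : differentiable nrm x by exact: smooth_differentiable smooth_nrm x0.
have di : differentiable (fun q : 'rV[R]_4 => q) x by exact: smooth_differentiable (smooth_id oU) x0.
have dc : differentiable cone x by exact: smooth_differentiable smooth_cone x0.
have ds : differentiable (fun q => (nrm q)%:M : 'rV[R]_1) x.
  exact: smooth_differentiable (smooth_scalar oU smooth_nrm) x0.
have D w : 'D_w cone x = row_mx w ('D_w (fun q => (nrm q)%:M : 'rV[R]_1) x).
  by apply: etrans (derive_row_mx w di ds) _; congr (row_mx _ _); exact: derive_id.
have key w : dot w x = 0 -> ('D_w (fun q => (nrm q)%:M : 'rV[R]_1) x) 0 0 = 0.
  move=> wx.
  have H : mk ('D_w cone x) (cone x) + mk (cone x) ('D_w cone x) = 0.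
    apply: etrans (esym (derive_sprod J w dc dc)) _.
    apply: (derive_eq_cst oU (c := 0) w x0) => q q0; rewrite cone_lift_nrm// sprodZl sprodZr mk_lift.
    by have /= -> := radial_S3 q0; rewrite subrr !mulr0.
  move: H; rewrite (mkC (cone x)) -mulr2n D /cone minkE (nrm_S3 x1) wx !mxE mulr1 sub0r.
  by move=> /eqP; rewrite mulrn_eq0 /= oppr_eq0 => /eqP.
rewrite (D u) (D v); move: ('D_u _ x) ('D_v _ x) (key u ux) => a b a0.
by rewrite minkE a0 mul0r subr0.
Qed.

Lemma radial_mobE M q : lorentz M -> U0 q -> radial (mob M) q = ((cone q *m M) 0 (rshift 4 0))^-1 *: lsubmx (cone q *m M).
Proof.
move=> LM q0; have r0 : nrm q != 0 by rewrite gt_eqF// nrm_gt0.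
rewrite cone_lift_nrm// -scalemxAl /radial /mob.
move: (nrm q) (null_lift _ *m M) r0 => r v r0.
have -> : (r *: v) 0 (rshift 4 0) = r * v 0 (rshift 4 0) by rewrite mxE.
by rewrite linearZ /= scalerA invfM mulrAC mulVf// mul1r.
Qed.

Lemma cone_unit M q : lorentz M -> U0 q -> (cone q *m M) 0 (rshift 4 0) != 0.
Proof.
move=> LM q0; rewrite cone_lift_nrm// -scalemxAl [X in X != 0]mxE mulf_neq0//; first by rewrite gt_eqF// nrm_gt0.
by apply: lift_unit => //; exact: radial_S3.
Qed.

Lemma smooth_S3_mob M : lorentz M -> smooth_S3 (mob M).
Proof.
move=> LM; have oU := open_U0; have sc := smooth_mulmx oU M smooth_cone.
apply: (eq_smooth oU) (smooth_scale oU (smooth_inv oU _ (smooth_coord (rshift 4 0) oU sc)) (smooth_lsubmx oU sc)).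
  by move=> q q0; rewrite radial_mobE.
by move=> q q0; exact: cone_unit.
Qed.

Lemma conformal_diffeo_mob M : lorentz M -> conformal_diffeo_S3 (mob M).
Proof.
move=> LM; have LV := lorentz_invP LM; split.
  exists (mob (lorentz_inv M)); split; [exact: smooth_S3_mob|exact: smooth_S3_mob| |] => x x1.
    by split; [exact: mob_S3|exact: mobK].
  split; first exact: mob_S3.
  have MK : lorentz_inv (lorentz_inv M) = M.
    by rewrite /lorentz_inv !trmx_mul trmxK mink_tr !mulmxA mink_sq mul1mx -mulmxA mink_sq mulmx1.
  by rewrite -{1}MK; exact: mobK.
move=> x x1; have x0 := S3_U0 x1; have oU := open_U0.
pose k q := (cone q *m M) 0 (rshift 4 0).
have k0 : k x != 0 by exact: cone_unit.
(* The factor comes from [cone_metric]: [cone q *m M] is [k q] times the null lift of the image, and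
   [M] preserves the form. *)
exists ((k x) ^- 2); first by rewrite invr_gt0 lt_def sqrf_eq0 k0 sqr_ge0.
move=> u v ux vx.
have sc := smooth_mulmx oU M smooth_cone.
have sk : smooth U0 k by exact: smooth_coord oU sc.
have m1 q : U0 q -> dot (radial (mob M) q) (radial (mob M) q) = 1.
  by move=> q0; exact: (mob_S3 LM (radial_S3 q0)).
have E q : U0 q -> cone q *m M = k q *: null_lift (radial (mob M) q).
  move=> q0; have e1 : cone q *m M = nrm q *: (null_lift ((nrm q)^-1 *: q) *m M).
    by rewrite {1}(cone_lift_nrm q0) -scalemxAl.
  have e2 := lift_mob LM (radial_S3 q0).
  rewrite /k e1 [in LHS]e2 scalerA; congr (_ *: _).
  by rewrite [RHS]mxE.
have := cone_metric u v oU x0 (smooth_S3_mob LM) sk m1.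
rewrite -(eq_derive_open u oU x0 E) -(eq_derive_open v oU x0 E).
have dc : differentiable cone x by exact: smooth_differentiable smooth_cone x0.
rewrite (derive_mulmx M u dc) (derive_mulmx M v dc) lorentz_sprod// mk_Dcone// => ->.
by rewrite mulKf// sqrf_eq0.
Qed.

Lemma eq_conformal_diffeo f g : (forall x, S3 x -> f x = g x) -> conformal_diffeo_S3 f -> conformal_diffeo_S3 g.
Proof.
move=> fg; have E q : U0 q -> radial f q = radial g q by move=> q0; exact: fg (radial_S3 q0).
have oU := open_U0.
move=> [[k [sf sk fk kf]] conf]; split.
  exists k; split => //.
  - exact: eq_smooth oU E sf.
  - by move=> x x1; rewrite -fg//; exact: fk.
  - by move=> x x1; have [k1 fk1] := kf x x1; split => //; rewrite -(fg _ k1).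
move=> x x1; have [l l0 H] := conf x x1; exists l => // u v ux vx.
rewrite -(eq_derive_open u oU (S3_U0 x1) E) -(eq_derive_open v oU (S3_U0 x1) E); exact: H.
Qed.

Lemma stereo_invK x : S3 x -> stereo_inv (stereo x) = x.
Proof.
rewrite /S3 /= => x1; have Emax : (ord_max : 'I_4) = rshift 3 (0 : 'I_1) by apply: val_inj.
have xE : x = row_mx (lsubmx (x : 'rV[R]_(3 + 1))) (x 0 ord_max)%:M.
  apply: etrans (esym (@hsubmxK _ 1 3 1 x)) _.
  suff -> : rsubmx (x : 'rV[R]_(3 + 1)) = (x 0 ord_max)%:M by [].
  by apply/rowP => j; rewrite !mxE (ord1 j) Emax.
rewrite /stereo; move: (lsubmx _) (x 0 ord_max) xE => w t xE.
move: x1; rewrite xE (@sprod1_row_mx R 3 1) sprod1_rV1 !mxE eqxx !mulr1n => wt.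
case: (eqVneq t 1) => [t1|t1] /=.
  have w0 : w = 0.
    have w00 : sprod 1%:M w w = 0 by move: wt; rewrite t1 mulr1 => /(canRL (addrK _)); rewrite subrr.
    by apply/eqP; apply: contraTT isT => /sprod1_sqr_gt0; rewrite w00 ltxx.
  by rewrite w0 t1.
rewrite sprodZl sprodZr.
have t1' : 1 - t != 0 by rewrite subr_eq0 eq_sym.
have -> : sprod 1%:M w w = 1 - t * t by exact: (canRL (addrK _) wt).
have -> : (1 - t)^-1 * ((1 - t)^-1 * (1 - t * t)) = (1 + t) / (1 - t) by field.
have -> : 1 + (1 + t) / (1 - t) = 2 / (1 - t) by field.
have -> : (1 + t) / (1 - t) - 1 = 2 * t / (1 - t) by field.
rewrite (@scale_row_mx _ 1 3 1) !scalerA; apply: (congr2 (fun a b => @row_mx _ 1 3 1 a b)).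
  by rewrite -[RHS]scale1r; congr (_ *: _); field.
by rewrite scale_scalar_mx; congr (_%:M); field.
Qed.
End Moebius.

(** * Conformal diffeomorphisms of the sphere are Moebius transformations *)

Section LiouvilleSphere.
Variables (R : realType) (phi : 'rV[R]_4 -> 'rV[R]_4).
Local Notation J := (minkowski_gram R 4).
Local Notation mk := (sprod J).
Local Notation dot := (sprod (1%:M : 'M[R]_4)).
Local Notation S3 := (@S3 R).
Local Notation e := (fun i : 'I_3 => delta_mx 0 i : 'rV[R]_3).
Local Notation oT := (@openT 'rV[R]_3).
Local Notation U0 := (~` [set (0 : 'rV[R]_4)]).
Hypothesis conf : conformal_diffeo_S3 phi.

Let k (y : 'rV[R]_3) : R := (1 + sprod 1%:M y y) / 2.
Let s (y : 'rV[R]_3) := stereo_inv (Some y).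

Let sq_ge0 (y : 'rV[R]_3) : 0 <= sprod 1%:M y y.
Proof. by rewrite sprod1E; apply: sumr_ge0 => i _; rewrite -expr2 sqr_ge0. Qed.

Let k_gt0 y : 0 < k y.
Proof. by rewrite divr_gt0// ltr_pwDl. Qed.

Let cone_liftE y : cone_lift y = k y *: null_lift (s y).
Proof.
have k0 : 1 + sprod 1%:M y y != 0 by rewrite gt_eqF// ltr_pwDl.
rewrite /cone_lift /null_lift /s /stereo_inv !scale_row_mx (@scale_row_mx _ 1 3 1) /k.
apply: (congr2 (fun a b => @row_mx _ 1 4 1 a b)).
  apply: (congr2 (fun a b => @row_mx _ 1 3 1 a b)).
    by rewrite !scalerA -[LHS]scale1r; congr (_ *: _); field.
  by rewrite !scale_scalar_mx; congr (_%:M); field.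
by rewrite !scale_scalar_mx; congr (_%:M); field.
Qed.

Let s_S3 y : S3 (s y).
Proof.
have k0 : 1 + sprod 1%:M y y != 0 by rewrite gt_eqF// ltr_pwDl.
rewrite /S3 /= /s /stereo_inv sprodZl sprodZr (@sprod1_row_mx R 3 1) sprodZl sprodZr.
rewrite sprod1_rV1 !mxE eqxx !mulr1n.
by move: (sprod _ y y) k0 => a a0; field.
Qed.

Let smooth_sq : smooth setT (fun y : 'rV[R]_3 => sprod 1%:M y y).
Proof. by apply: smooth_sprod; [exact: oT|exact: smooth_id oT|exact: smooth_id oT]. Qed.

Let smooth_k : smooth setT k.
Proof.
apply: (smooth_mul oT); last exact: smooth_cst oT.
by apply: (smooth_add oT) smooth_sq; exact: smooth_cst oT.
Qed.

Let smooth_s : smooth setT s.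
Proof.
rewrite /s /stereo_inv; apply: (smooth_scale oT).
  apply: (smooth_inv oT) => [y _|]; first by rewrite gt_eqF// ltr_pwDl.
  by apply: (smooth_add oT) smooth_sq; exact: smooth_cst oT.
apply: (smooth_row_mx oT).
  by apply: (smooth_scale oT); [exact: smooth_cst oT|exact: smooth_id oT].
apply: (smooth_scalar oT); apply: (smooth_add oT) smooth_sq _; exact: smooth_cst oT.
Qed.

Let f y := radial phi (s y).
Let fE y : f y = phi (s y). Proof. exact: radialE (s_S3 y). Qed.

Let srad : smooth U0 (radial phi).
Proof. by case: conf => [[g []]]. Qed.

Let phi_S3 x : S3 x -> S3 (phi x).
Proof. by case: conf => [[g [_ _ H _]]] _ /H[]. Qed.

Let smooth_f : smooth setT f.
Proof. by apply: (smooth_compv oT (@open_U0 R)) smooth_s srad => y _; exact: S3_U0 (s_S3 y). Qed.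

Let f_S3 y : dot (f y) (f y) = 1.
Proof. rewrite fE; exact: (phi_S3 (s_S3 y)). Qed.

Let ds y : differentiable s y. Proof. exact: smooth_differentiable smooth_s _. Qed.

(** The last two coordinates of [cone_lift] differ by a constant, so their derivatives are equal and
    cancel in the Lorentzian form. *)
Let mk_cone_lift i j y : mk ('D_(e i) (@cone_lift R) y) ('D_(e j) (@cone_lift R) y) = (i == j)%:R.
Proof.
pose B (y : 'rV[R]_3) : 'rV[R]_1 := ((sprod 1%:M y y - 1) / 2)%:M.
have E : @cone_lift R = fun y => row_mx (row_mx y (B y)) (B y + 1%:M).
  apply/funext => z; rewrite /cone_lift; congr (row_mx _ _).
  by apply/rowP => l; rewrite !mxE (ord1 l) eqxx !mulr1n; field.
have sB : smooth setT B.
  apply: (smooth_scalar oT); apply: (smooth_mul oT); last exact: smooth_cst oT.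
  by apply: (smooth_add oT) smooth_sq _; exact: smooth_cst oT.
have s1 : smooth setT (fun _ : 'rV[R]_3 => 1%:M : 'rV[R]_1) by exact: smooth_cst oT.
have sid : smooth setT (fun y : 'rV[R]_3 => y) by exact: smooth_id oT.
have sB1 := smooth_addv oT sB s1.
have srB := smooth_row_mx oT sid sB.
have D l : 'D_(e l) (@cone_lift R) y = row_mx (row_mx (e l) ('D_(e l) B y)) ('D_(e l) B y).
  apply: etrans (congr1 (fun g => 'D_(e l) g y) E) _.
  apply: etrans (derive_row_mx (e l) (smooth_differentiable srB (I : setT y)) (smooth_differentiable sB1 (I : setT y))) _.
  congr (row_mx _ _).
    apply: etrans (derive_row_mx (e l) (smooth_differentiable sid (I : setT y)) (smooth_differentiable sB (I : setT y))) _.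
    by congr (row_mx _ _); exact: derive_id.
  have H := @deriveD _ _ _ B (fun=> 1%:M) y (e l) (diff_derivable (smooth_differentiable sB (I : setT y))) (diff_derivable (smooth_differentiable s1 (I : setT y))).
  by apply: etrans H _; rewrite derive_cst addr0.
rewrite (D i) (D j); move: ('D_(e i) B y) ('D_(e j) B y) => a b.
rewrite minkE (@sprod1_row_mx R 3 1) sprod1_rV1 addrK sprod1E (bigD1 i)//= big1 ?addr0.
  by rewrite !mxE !eqxx mul1r.
by move=> l li; rewrite mxE (negbTE li) mul0r.
Qed.

Let ds_dot i j y : dot ('D_(e i) s y) ('D_(e j) s y) = (k y) ^- 2 * (i == j)%:R.
Proof.
have s1 q : setT q -> dot (s q) (s q) = 1 by move=> _; exact: s_S3.
have := cone_metric (e i) (e j) oT (I : setT y) smooth_s smooth_k s1.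
have -> : (fun q => k q *: null_lift (s q)) = @cone_lift R by apply/funext => z; rewrite cone_liftE.
rewrite mk_cone_lift => ->; rewrite mulKf// sqrf_eq0 gt_eqF//.
Qed.

Let ds_tangent i y : dot ('D_(e i) s y) (s y) = 0.
Proof.
have H : dot ('D_(e i) s y) (s y) + dot (s y) ('D_(e i) s y) = 0.
  apply: etrans (esym (derive_sprod 1%:M (e i) (ds y) (ds y))) _.
  by apply: (derive_eq_cst oT (c := 1) (e i) (I : setT y)) => q _; exact: s_S3.
by move: H; rewrite (sprod1C (s y)) -mulr2n => /eqP; rewrite mulrn_eq0 => /eqP.
Qed.

Let df_dot y : exists2 l, 0 < l & forall i j, dot ('D_(e i) f y) ('D_(e j) f y) = l * (i == j)%:R.
Proof.
have [l l0 H] := conf.2 (s y) (s_S3 y).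
exists (l * (k y) ^- 2); first by rewrite mulr_gt0// invr_gt0 exprn_gt0.
move=> i j.
have drad : differentiable (radial phi) (s y) by exact: smooth_differentiable srad (S3_U0 (s_S3 y)).
have D a : 'D_(e a) f y = 'D_('D_(e a) s y) (radial phi) (s y) by exact: (derive_comp (e a) (ds y) drad).
by rewrite (D i) (D j) H ?ds_tangent// ds_dot mulrA.
Qed.

Let mu y := dot ('D_(e 0) f y) ('D_(e 0) f y).

Let mu_gt0 y : 0 < mu y.
Proof. by rewrite /mu; have [l l0 ->] := df_dot y; rewrite eqxx mulr1. Qed.

Let smooth_mu : smooth setT mu.
Proof. by apply: (smooth_sprod oT); exact: smooth_derive. Qed.

Let a y := (Num.sqrt (mu y))^-1.

Let smooth_a : smooth setT a.
Proof.
apply: (smooth_inv oT) => [y _|]; first by rewrite gt_eqF// sqrtr_gt0.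
by apply: (smooth_sqrt oT).
Qed.

(** In the stereographic chart, the null lift of [phi] is divided by the square root of the
    conformal factor [mu]. It becomes an isometric map of flat space into the cone, and
    [liouville_cone] compares it with [cone_lift], the same lift for the identity. *)
Lemma liouville_chart : exists2 M, lorentz M & forall y, phi (s y) = mob M (s y).
Proof.
pose F y := a y *: null_lift (f y).
have sF : smooth setT F.
  apply: (smooth_scale oT) => //; apply: (smooth_row_mx oT) => //; exact: smooth_cst oT.
have [] := @liouville_cone R F sF.
- by move=> y; rewrite /F sprodZl sprodZr mk_lift f_S3 subrr !mulr0.
- move=> y i j.
  have f1 q : setT q -> dot (f q) (f q) = 1 by move=> _; exact: f_S3.
  apply: etrans (cone_metric (e i) (e j) oT (I : setT y) smooth_f smooth_a f1) _.
  have m0 := mu_gt0 y; have [l l0 H] := df_dot y.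
  rewrite H /a exprVn sqr_sqrtr ?ltW// /mu H eqxx mulr1 mulKf// gt_eqF//.
move=> M [LM FM]; exists M => // y; apply/esym.
have a0 : a y != 0 by rewrite invr_eq0 gt_eqF// sqrtr_gt0.
have k0 : k y != 0 by rewrite gt_eqF.
apply: (@mob_eq _ _ _ _ ((k y)^-1 * a y)); first by rewrite mulf_neq0// invr_eq0.
rewrite -scalerA -fE -/(F y) FM cone_liftE -scalemxAl scalerA mulVf// scale1r.
by [].
Qed.

(** The chart omits the north pole. By continuity of the radial extensions, a disagreement there
    would persist nearby, at points that project away from the pole, where the two maps agree. *)
Lemma liouville : exists2 M, lorentz M & forall x, S3 x -> phi x = mob M x.
Proof.
have [M LM H] := liouville_chart; exists M => // x x1.
have Hn q : S3 q -> q 0 ord_max != 1 -> phi q = mob M q.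
  move=> q1 qn; rewrite -(stereo_invK q1) /stereo (negbTE qn); exact: H.
have [xn|] := eqVneq (x 0 ord_max) 1; last exact: Hn.
rewrite -(radialE phi x1) -(radialE (mob M) x1); apply/rowP => j.
apply/eqP; rewrite -subr_eq0; apply: contraT => d0.
have oU := @open_U0 R; have x0 := S3_U0 x1.
pose d (q : 'rV[R]_4) : R := radial phi q 0 j - radial (mob M) q 0 j.
have sd : smooth U0 d.
  apply: (smooth_add oU); first exact: smooth_coord oU srad.
  by apply: (smooth_opp oU); exact: smooth_coord oU (smooth_S3_mob LM).
have nd : \forall q \near x, d q != 0.
  exact: (@cvgr_neq0 _ _ _ _ _ d (d x) (smooth_continuous sd x0) d0).
have nd2 : \forall q \near x, d q != 0 /\ U0 q by exact: filterI nd (open_near oU x0).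
have [r r0 P] := near_line2 (delta_mx 0 0) (0 : 'rV[R]_4) nd2.
have [dr ur] : d (x + r *: delta_mx 0 0) != 0 /\ U0 (x + r *: delta_mx 0 0).
  by have := P r 0; rewrite scaler0 addr0; apply; rewrite ?lexx ?(ltW r0).
have q1 := radial_S3 ur.
move: dr; rewrite /d /radial Hn ?subrr ?eqxx//.
(* The point [q] is displaced from the pole along a tangent direction, so its norm [n] exceeds 1 and
   its projection has last coordinate [1 / n], different from 1. The lines below refute [n = 1]. *)
pose q := x + r *: (delta_mx 0 0 : 'rV[R]_4).
rewrite -/q; set n := Num.sqrt _; apply/eqP => qn.
have n0 : 0 < n by exact: nrm_gt0.
have qmax : q 0 ord_max = 1 by rewrite /q !mxE xn /= mulr0 addr0.
have n1 : n = 1.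
  move: qn; rewrite mxE qmax mulr1 => n1.
  by rewrite -[n]invrK n1 invr1.
have : dot q q = 1 by rewrite -(sqr_sqrtr (ltW _ : 0 <= dot q q)) -/n ?n1 ?expr1n//; rewrite -sqrtr_gt0.
have add1 (c : R) : 1 + c = 1 -> c = 0 by move=> /(canRL (addKr 1)) ->; rewrite addNr.
rewrite sprod1E (bigD1 ord_max)//= qmax mulr1 (bigD1 0)//= => /add1 H1.
have x00 : x 0 0 = 0.
  move: x1; rewrite /S3 /= sprod1E (bigD1 ord_max)//= xn mulr1 (bigD1 0)//= => /add1 /eqP.
  rewrite addr_eq0 => /eqP E.
  have : x 0 0 * x 0 0 <= 0 by rewrite E oppr_le0; apply: sumr_ge0 => i _; rewrite -expr2 sqr_ge0.
  by rewrite -expr2 real_exprn_even_le0 ?num_real// => /eqP.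
have : q 0 0 = r by rewrite /q !mxE x00 eqxx mulr1 add0r.
move=> q0; move: H1; rewrite q0 => H1.
have : 0 < r * r + \sum_(i < 4 | (i != ord_max) && (i != 0)) q 0 i * q 0 i.
  by rewrite ltr_pwDl ?mulr_gt0//; apply: sumr_ge0 => i _; rewrite -expr2 sqr_ge0.
by rewrite H1 ltxx.
Qed.
End LiouvilleSphere.

Section ComplexLorentz.
Variable R : realType.
Local Notation rc := (real_complex R).

Lemma map_mink m : map_mx rc (minkowski_gram R m) = minkowski_gram R[i] m.
Proof. by rewrite /minkowski_gram map_block_mx map_mxN !map_mx1 !map_mx0. Qed.

Lemma half_complex_neq0 (a : R) : 0 < a -> (a / 2)%:C != 0 :> R[i].
Proof. by move=> a0; rewrite fmorph_eq0 mulf_neq0 ?invr_eq0 ?pnatr_eq0// gt_eqF. Qed.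

Lemma sprod_lorentzC (M : 'M[R]_(4 + 1)) u v : lorentz M ->
  sprod (minkowski_gram R[i] 4) (u *m map_mx rc M) (v *m map_mx rc M) = sprod (minkowski_gram R[i] 4) u v.
Proof.
move=> LM; rewrite /sprod trmx_mul !mulmxA -(mulmxA u (map_mx rc M)) -(mulmxA u).
by rewrite -map_mink map_trmx -!map_mxM LM.
Qed.
End ComplexLorentz.

(** * Space forms as sections of the light cone *)

(* The conformal immersions of the disk into a space form are written in the light cone: mu is a lift
   normalized by [<mu, e> = -1], and P an isometry from the orthogonal of e to the ambient space. *)
Section SpaceForm.
Variables (R : realType) (X N : 'rV[R]_2 -> 'rV[R]_4).
Context {sXN : surface X N}.
Local Notation C := R[i].
Local Notation D := (@unit_disk R).
Local Notation rc := (real_complex R).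
Local Notation x := (cplx X).
Local Notation h := (mean_curvature 1%:M X N).
Local Notation Y := (conformal_gauss_map X N).
Local Notation oD := (@open_disk R).
Local Notation sX := (@surface_smooth R X N sXN).
Local Notation sN := (@surface_normal_smooth R X N sXN).
Local Notation J := (minkowski_gram R 4).
Local Notation JC := (minkowski_gram C 4).
Local Notation mk := (sprod J).
Local Notation mkc := (sprod JC).
Variables (n : nat) (Jn : 'M[R]_n) (e : 'rV[R]_(4 + 1)) (P : 'M[R]_(4 + 1, n)).
Variables (M : 'M[R]_(4 + 1)) (sigma : 'rV[R]_2 -> R) (f : 'rV[R]_2 -> 'rV[R]_n).
Hypothesis JnT : Jn^T = Jn.
Hypothesis isoC : forall u v : 'rV[C]_(4 + 1), mkc u (map_mx rc e) = 0 -> mkc v (map_mx rc e) = 0 ->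
  csprod Jn (u *m map_mx rc P) (v *m map_mx rc P) = mkc u v.
Hypothesis LM : lorentz M.
Hypothesis ss : smooth D sigma.
Hypothesis s0 : forall p, D p -> sigma p != 0.

Definition real_gauss (p : 'rV[R]_2) : 'rV[R]_(4 + 1) :=
  complex.Re (h p) *: null_lift (X p) + row_mx (N p) (0 : 'rV[R]_1).
Local Notation YR := real_gauss.
Definition cone_surface p : 'rV[R]_(4 + 1) := sigma p *: (null_lift (X p) *m M).
Local Notation mu := cone_surface.
Hypothesis mue : forall p, D p -> mk (mu p) e = -1.
Hypothesis fE : forall p, D p -> f p = mu p *m P.
(** The product [<Y, v>] for the preimage [v] of [e] under [M], equivalently [<Y M, e>]. *)
Definition curvature_height p : R := mk (YR p) (e *m lorentz_inv M).
Local Notation kap := curvature_height.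
(** The multiple of [mu] makes the vector orthogonal to [e], thanks to [<mu, e> = -1]. As [mu] is
    null and orthogonal to [Y M] and to its own derivatives, the norm and the orthogonality to the
    surface are unaffected. *)
Definition cone_normal p : 'rV[R]_(4 + 1) := YR p *m M + kap p *: mu p.
Local Notation nt := cone_normal.
Definition space_normal p : 'rV[R]_n := nt p *m P.

Lemma mk_map u v : mkc (map_mx rc u) (map_mx rc v) = (mk u v)%:C.
Proof. by rewrite -sprod_map map_mink. Qed.

Lemma space_iso u v : mk u e = 0 -> mk v e = 0 -> sprod Jn (u *m P) (v *m P) = mk u v.
Proof.
move=> ue ve; apply: (fmorph_inj rc); rewrite -[LHS]sprod_map !map_mxM.
have := @isoC (map_mx rc u) (map_mx rc v); rewrite !mk_map ue ve => H.
exact: H erefl erefl.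
Qed.

Lemma cplx_real_gauss p : D p -> map_mx rc (YR p) = Y p.
Proof.
move=> Dp; rewrite /real_gauss map_mxD map_mxZ /null_lift !map_row_mx map_mx1 map_mx0.
have hE : (complex.Re (h p))%:C = h p.
  have ImC (z : C) : complex.Im (conjc z) = - complex.Im z by case: z.
  have h1 : - complex.Im (h p) = complex.Im (h p) by rewrite -ImC (conj_h (X := X) (N := N) Dp).
  have h0 : complex.Im (h p) = 0 by move: h1; move: (complex.Im _) => c hc; lra.
  by apply: complexP; [|exact: esym h0].
rewrite /conformal_gauss_map; congr (_ *: _ + _); exact: hE.
Qed.

Let frame p (Dp : D p) := @surface_frame R X N sXN p Dp.

Lemma mk_YR p : D p -> [/\ mk (YR p) (YR p) = 1, mk (YR p) (null_lift (X p)) = 0,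
  mk (null_lift (X p)) (null_lift (X p)) = 0 & forall v, v = ex R \/ v = ey R -> mk (YR p) (row_mx ('D_v X p) 0) = 0].
Proof.
move=> Dp; have [[xx nn nx n1 n2] [x1 x2 _]] := frame Dp.
rewrite /real_gauss; split.
- rewrite !(sprodDl, sprodDr, sprodZl, sprodZr) mk_lift /null_lift !minkE xx nn nx (sprod1C (X p)) nx !mxE.
  by rewrite subrr !(mulr0, mul0r, oppr0, addr0, add0r).
- by rewrite sprodDl sprodZl mk_lift /null_lift minkE xx nx !mxE subrr mulr0 mul0r subrr addr0.
- by rewrite mk_lift xx subrr.
- move=> v [->|->]; rewrite sprodDl sprodZl /null_lift !minkE ?x1 ?x2 ?n1 ?n2 !mxE;
  by rewrite !(mulr0, mul0r, oppr0, addr0).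
Qed.

Lemma smooth_null_lift : smooth D (fun p => null_lift (X p)).
Proof. by apply: (smooth_row_mx oD) => //; [exact: sX|exact: smooth_cst oD]. Qed.

Lemma smooth_cone_surface : smooth D mu.
Proof. by apply: (smooth_scale oD) => //; apply: (smooth_mulmx oD); exact: smooth_null_lift. Qed.

Lemma smooth_space : smooth D f.
Proof.
by apply: (eq_smooth oD) (smooth_mulmx oD P smooth_cone_surface) => p Dp; rewrite fE.
Qed.

Lemma smooth_real_gauss : smooth D YR.
Proof.
apply: (smooth_addv oD); last first.
  by apply: (smooth_row_mx oD); [exact: sN|exact: smooth_cst oD].
by apply: (smooth_scale oD) smooth_null_lift; exact: (csmooth_re (csmooth := csmooth_h (X := X) (N := N))).
Qed.

Lemma smooth_space_normal : smooth D space_normal.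
Proof.
apply: (smooth_mulmx oD); apply: (smooth_addv oD).
  by apply: (smooth_mulmx oD); exact: smooth_real_gauss.
apply: (smooth_scale oD) smooth_cone_surface.
apply: (smooth_sprod oD); [exact: smooth_real_gauss|exact: smooth_cst oD].
Qed.

Lemma derive_null_lift v p : D p -> 'D_v (fun p => null_lift (X p)) p = row_mx ('D_v X p) 0.
Proof.
move=> Dp; have s1 : smooth D (fun _ : 'rV[R]_2 => 1%:M : 'rV[R]_1) by exact: smooth_cst oD.
apply: etrans (derive_row_mx v (smooth_differentiable sX Dp) (smooth_differentiable s1 Dp)) _.
by congr (row_mx _ _); exact: derive_cst.
Qed.

Lemma derive_cone_surface v p : D p ->
  'D_v mu p = ('D_v sigma p *: null_lift (X p) + sigma p *: row_mx ('D_v X p) 0) *m M.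
Proof.
move=> Dp; have sl := smooth_null_lift; have dl := smooth_differentiable sl Dp.
have slM := smooth_differentiable (smooth_mulmx oD M sl) Dp.
apply: etrans (derive_scale v (smooth_differentiable ss Dp) slM) _.
have -> : 'D_v (fun q => null_lift (X q) *m M) p = row_mx ('D_v X p) 0 *m M.
  by apply: etrans (derive_mulmx M v dl) _; rewrite derive_null_lift.
by rewrite mulmxDl !scalemxAl.
Qed.

Lemma mk_mu p : D p -> mk (mu p) (mu p) = 0.
Proof.
move=> Dp; have [_ _ H _] := mk_YR Dp.
by rewrite /cone_surface sprodZl sprodZr lorentz_sprod// H !mulr0.
Qed.

Lemma mk_YR_mu p : D p -> mk (YR p *m M) (mu p) = 0.
Proof.
move=> Dp; have [_ H _ _] := mk_YR Dp.
by rewrite /cone_surface sprodZr lorentz_sprod// H mulr0.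
Qed.

Lemma derive_mu_e v p : D p -> mk ('D_v mu p) e = 0.
Proof.
move=> Dp; have sm := smooth_cone_surface; have se : smooth D (fun _ : 'rV[R]_2 => e) by exact: smooth_cst oD.
have H : mk ('D_v mu p) e + mk (mu p) ('D_v (fun _ : 'rV[R]_2 => e) p) = 0.
  apply: etrans (esym (derive_sprod J v (smooth_differentiable sm Dp) (smooth_differentiable se Dp))) _.
  by apply: (derive_eq_cst oD (c := -1) v Dp) => q Dq; exact: mue.
by move: H; rewrite derive_cst sprod0r addr0.
Qed.

Lemma derive_space v p : D p -> 'D_v f p = 'D_v mu p *m P.
Proof.
move=> Dp; apply: etrans (eq_derive_open v oD Dp fE) _.
exact: derive_mulmx (smooth_differentiable smooth_cone_surface Dp).
Qed.

Lemma cone_surface_metric u v p : D p -> mk ('D_u mu p) ('D_v mu p) = sigma p ^+ 2 * sprod 1%:M ('D_u X p) ('D_v X p).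
Proof.
move=> Dp; have X1 q : D q -> sprod 1%:M (X q) (X q) = 1 by move=> /frame[[]].
rewrite -(cone_metric u v oD Dp sX ss X1).
have sl := smooth_scale oD ss smooth_null_lift; have dl := smooth_differentiable sl Dp.
have E w : 'D_w mu p = 'D_w (fun q => sigma q *: null_lift (X q)) p *m M.
  apply: etrans (eq_derive_open w oD Dp (g := fun q => (sigma q *: null_lift (X q)) *m M) _) _.
    by move=> q _; rewrite /cone_surface scalemxAl.
  exact: derive_mulmx dl.
by rewrite (E u) (E v) lorentz_sprod.
Qed.

Lemma space_metric u v p : D p -> sprod Jn ('D_u f p) ('D_v f p) = sigma p ^+ 2 * sprod 1%:M ('D_u X p) ('D_v X p).
Proof.
move=> Dp; rewrite (derive_space u Dp) (derive_space v Dp).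
by rewrite space_iso ?derive_mu_e// cone_surface_metric.
Qed.

Lemma space_conformal p : D p -> [/\ 0 < sprod Jn ('D_(ex R) f p) ('D_(ex R) f p),
  sprod Jn ('D_(ex R) f p) ('D_(ex R) f p) = sprod Jn ('D_(ey R) f p) ('D_(ey R) f p) &
  sprod Jn ('D_(ex R) f p) ('D_(ey R) f p) = 0].
Proof.
move=> Dp; have [_ H] := @surface_conf R X N sXN.
have alg (s a b c : R) : s != 0 -> [/\ 0 < a, a = b & c = 0] -> [/\ 0 < s ^+ 2 * a, s ^+ 2 * a = s ^+ 2 * b & s ^+ 2 * c = 0].
  by move=> s1 [a0 <- ->]; rewrite mulr0 mulr_gt0// lt_def sqrf_eq0 s1 sqr_ge0.
have [h1 h2 h3] := alg _ _ _ _ (s0 Dp) (H p Dp).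
split; first by rewrite (space_metric (ex R) (ex R) Dp); exact: h1.
  exact: etrans (space_metric _ _ Dp) (etrans h2 (esym (space_metric _ _ Dp))).
exact: etrans (space_metric _ _ Dp) h3.
Qed.

Lemma mk_YR_Dmu v p : D p -> v = ex R \/ v = ey R -> mk (YR p *m M) ('D_v mu p) = 0.
Proof.
move=> Dp Hv; have [_ H1 _ H2] := mk_YR Dp.
rewrite (derive_cone_surface v Dp) lorentz_sprod//; move: (H2 v Hv) => {}H2.
by rewrite sprodDr !sprodZr H1 H2 !mulr0 addr0.
Qed.

Lemma mk_mu_Dmu v p : D p -> mk (mu p) ('D_v mu p) = 0.
Proof.
move=> Dp; have dm := smooth_differentiable smooth_cone_surface Dp.
have H : mk ('D_v mu p) (mu p) + mk (mu p) ('D_v mu p) = 0.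
  apply: etrans (esym (derive_sprod J v dm dm)) _.
  by apply: (derive_eq_cst oD (c := 0) v Dp) => q Dq; exact: mk_mu.
move: H; rewrite (mkC ('D_v mu p)) -mulr2n => /eqP; rewrite mulrn_eq0 => /eqP //.
Qed.

Lemma mk_nt_e p : D p -> mk (nt p) e = 0.
Proof.
move=> Dp; rewrite /cone_normal sprodDl sprodZl mue// lorentz_adjoint//.
by rewrite -/(kap p) mulrN1 subrr.
Qed.

Lemma mk_nt_mu p : D p -> mk (nt p) (mu p) = 0.
Proof. by move=> Dp; rewrite /cone_normal sprodDl sprodZl mk_mu// mk_YR_mu// mulr0 addr0. Qed.

Lemma space_normal_unit p : D p -> sprod Jn (space_normal p) (space_normal p) = 1.
Proof.
move=> Dp; rewrite /space_normal space_iso ?mk_nt_e//.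
have := mk_nt_mu Dp; rewrite {2}/cone_normal => H.
rewrite sprodDr sprodZr H mulr0 addr0 /cone_normal sprodDl sprodZl (mkC (mu p)) mk_YR_mu// mulr0 addr0.
by rewrite lorentz_sprod//; have [] := mk_YR Dp.
Qed.

Lemma space_normal_tangent v p : D p -> v = ex R \/ v = ey R -> sprod Jn (space_normal p) ('D_v f p) = 0.
Proof.
move=> Dp Hv; rewrite (derive_space v Dp) space_iso ?mk_nt_e ?derive_mu_e//.
by rewrite /cone_normal sprodDl sprodZl mk_YR_Dmu// mk_mu_Dmu// mulr0 addr0.
Qed.

Lemma space_position a p : D p -> mk e (mu p + a *: e) = 0 -> e *m P = 0 ->
  sprod Jn (f p) (f p) = - a /\ sprod Jn (space_normal p) (f p) = 0 /\
  forall v, sprod Jn (f p) ('D_v f p) = 0.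
Proof.
move=> Dp Ha eP; have Hf : f p = (mu p + a *: e) *m P by rewrite mulmxDl -scalemxAl eP scaler0 addr0 fE.
have Ha' : mk (mu p + a *: e) e = 0 by rewrite mkC.
have H : forall w, mk w e = 0 -> mk (mu p + a *: e) w = mk (mu p) w.
  by move=> w we; rewrite sprodDl [mk (a *: e) w]sprodZl (mkC e) we mulr0 addr0.
split; first by rewrite Hf space_iso// H// sprodDr mk_mu// [mk (mu p) (a *: e)]sprodZr mue// add0r mulrN1.
split.
  by rewrite Hf /space_normal space_iso ?mk_nt_e// mkC H ?mk_nt_e// mkC mk_nt_mu.
move=> v; rewrite Hf (derive_space v Dp) space_iso ?derive_mu_e//.
by rewrite H ?derive_mu_e// mk_mu_Dmu.
Qed.

Local Notation m := (cplx mu).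
Local Notation Mc := (map_mx rc M).
Local Notation ec := (map_mx rc e).
Local Notation Pc := (map_mx rc P).
Local Notation yM := (fun q => Y q *m Mc).
Let smc : vsmooth D m. Proof. exact: vsmooth_cplx oD smooth_cone_surface. Qed.
Let syM : vsmooth D yM. Proof. by apply: vsmooth_disk_mulmx; exact: (vsmooth_Y (X := X) (N := N)). Qed.

Let dm p (Dp : D p) := smooth_differentiable smooth_cone_surface Dp.

Let mz_dot (w : 'rV[R]_(4 + 1)) p : D p -> mk ('D_(ex R) mu p) w = 0 -> mk ('D_(ey R) mu p) w = 0 ->
  mkc (dzv m p) (map_mx rc w) = 0 /\ mkc (dzbarv m p) (map_mx rc w) = 0.
Proof.
move=> Dp h1 h2; rewrite (dzv_cplxE (dm Dp)) (dzbarv_cplxE (dm Dp)).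
move: ('D_(ex R) mu p) ('D_(ey R) mu p) h1 h2 => a b h1 h2.
by rewrite !(sprodDl, sprodZl, sprodNl) !mk_map h1 h2 !(mulr0, oppr0, addr0).
Qed.

Let mz_e p : D p -> mkc (dzv m p) ec = 0 /\ mkc (dzbarv m p) ec = 0.
Proof. by move=> Dp; apply: mz_dot => //; exact: derive_mu_e. Qed.

Let mz_y p : D p -> mkc (dzv m p) (yM p) = 0.
Proof.
move=> Dp; have E : Y p *m Mc = map_mx rc (YR p *m M) by rewrite map_mxM (cplx_real_gauss Dp).
have [H _] : mkc (dzv m p) (map_mx rc (YR p *m M)) = 0 /\ mkc (dzbarv m p) (map_mx rc (YR p *m M)) = 0.
  by apply: mz_dot => //; rewrite mkC; apply: mk_YR_Dmu => //; [left|right].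
exact: etrans (congr1 (mkc (dzv m p)) E) H.
Qed.

Let mz_m p : D p -> mkc (dzv m p) (m p) = 0.
Proof.
move=> Dp; by have [] : mkc (dzv m p) (map_mx rc (mu p)) = 0 /\ mkc (dzbarv m p) (map_mx rc (mu p)) = 0 by
  apply: mz_dot => //; rewrite mkC; apply: mk_mu_Dmu.
Qed.

Let mzb_dot (F : _ -> 'rV[C]_(4 + 1)) p : vsmooth D F -> D p -> (forall q, D q -> mkc (dzv m q) (F q) = 0) ->
  mkc (dzbarv (dzv m) p) (F p) + mkc (dzv m p) (dzbarv F p) = 0.
Proof.
move=> sF Dp H; have sz : vsmooth D (dzv m) by exact: vsmooth_dzv smc.
have E0 : dzbar (fun q => mkc (dzv m q) (F q)) p = mkc (dzbarv (dzv m) p) (F p) + mkc (dzv m p) (dzbarv F p).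
  exact: (dzbar_sprod Dp JC (F := dzv m) (G := F) (sF := sz) (sG := sF) oD).
by rewrite -E0 (eq_dzbar Dp oD (g := fun=> 0) H) dzbar_cst.
Qed.

Let dzbarv_Y p : D p -> dzbarv Y p = dzbar h p *: row_mx (x p) 1%:M - conjc (ucoef X N p) *: row_mx (dzv x p) 0.
Proof.
move=> Dp; have sY : vsmooth D Y by exact: vsmooth_Y.
have -> : dzbarv Y p = map_mx conjc (dzv Y p).
  rewrite -(dzbarv_conj Dp (F := Y)); apply: (eq_dzbarv Dp oD) => q Dq.
  by rewrite -(cplx_real_gauss Dq); exact: esym (conj_cplx YR q).
rewrite (dzvY Dp) map_mxD map_mxN !conj_scale !map_row_mx map_mx1 map_mx0.
by rewrite (conj_dz_h Dp) (conj_xb Dp) conj_x.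
Qed.

(** Up to [M], both vectors are combinations of [(X, 1)] and [(X_z, 0)], which span an isotropic
    plane. *)
Let mz_yb p : D p -> mkc (dzv m p) (dzbarv yM p) = 0.
Proof.
move=> Dp; have sY : vsmooth D Y by exact: vsmooth_Y.
have -> : dzbarv yM p = dzbarv Y p *m Mc by exact: (dzbarv_mulmx Dp (F := Y) Mc (sF := sY) oD).
pose sc := (fun q => (sigma q)%:C).
have sS : csmooth D sc by exact: csmooth_real oD ss.
pose nu q := row_mx (x q) (1%:M : 'rV[C]_1).
have sx : vsmooth D x by exact: (vsmooth_X (X := X) (N := N)).
have s1 : vsmooth D (fun _ => 1%:M : 'rV[C]_1) by exact: vsmooth_disk_cst.
have snu : vsmooth D nu by exact: (vsmooth_row_mx sx s1).
have sG : vsmooth D (fun q => sc q *: nu q) by exact: (vsmooth_scale sS snu).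
have E q : D q -> m q = (sc q *: nu q) *m Mc.
  by move=> Dq; rewrite /cplx /cone_surface map_mxZ map_mxM /null_lift map_row_mx map_mx1 scalemxAl.
have -> : dzv m p = dzv (fun q => (sc q *: nu q) *m Mc) p by exact: (eq_dzv Dp oD E).
have -> : dzv (fun q => (sc q *: nu q) *m Mc) p = dzv (fun q => sc q *: nu q) p *m Mc.
  exact: (dzv_mulmx Dp (F := fun q => sc q *: nu q) Mc (sF := sG) oD).
rewrite sprod_lorentzC// (dzvZ Dp (a := sc) (F := nu)) (dzbarv_Y Dp).
have -> : dzv nu p = row_mx (dzv x p) 0.
  by rewrite /nu (dzv_row_mx p x (fun=> 1%:M)); congr (row_mx _ _); exact: dzv_cst.
rewrite /nu !(sprodDl, sprodDr, sprodNr, sprodZl, sprodZr) !minkE.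
by rewrite (dot_xx (X := X) Dp) (dot_xz (X := X) Dp) (dot_zx (X := X) Dp) (dot_zz (X := X) Dp) !mxE !(mulr1, mulr0, mul0r, subrr, subr0, oppr0, addr0).
Qed.

(** By [mz_y] and [mz_yb], [mu_{z zbar}] is orthogonal to [Y M]. In its product with the normal only
    the correction along [mu] counts: [kap <mu_{z zbar}, mu> = - kap <mu_z, mu_zbar>]. *)
Lemma space_mean_curvature p : D p -> mean_curvature Jn f space_normal p = (- kap p)%:C.
Proof.
move=> Dp; have sf := vsmooth_cplx oD smooth_space.
have smc' : vsmooth D m by exact: smc.
have smP : vsmooth D (fun q => m q *m Pc) by exact: vsmooth_disk_mulmx.
have Ef q : D q -> cplx f q = m q *m Pc by move=> Dq; rewrite /cplx fE// map_mxM.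
have fz q : D q -> dzv (cplx f) q = dzv m q *m Pc.
  by move=> Dq; rewrite (eq_dzv Dq oD Ef); exact: (dzv_mulmx Dq (F := m) Pc (sF := smc') oD).
have fb q : D q -> dzbarv (cplx f) q = dzbarv m q *m Pc.
  by move=> Dq; rewrite (eq_dzbarv Dq oD Ef); exact: (dzbarv_mulmx Dq (F := m) Pc (sF := smc') oD).
have szm : vsmooth D (dzv m) by exact: vsmooth_dzv.
have fzb : dzbarv (dzv (cplx f)) p = dzbarv (dzv m) p *m Pc.
  by rewrite (eq_dzbarv Dp oD fz); exact: (dzbarv_mulmx Dp (F := dzv m) Pc (sF := szm) oD).
have [e1 e2] := mz_e Dp.
have S : sqnorm_dz Jn f p = mkc (dzv m p) (dzbarv m p) by rewrite /sqnorm_dz (fz _ Dp) (fb _ Dp) isoC.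
have S0 : sqnorm_dz Jn f p != 0.
  have [a0 a1 _] := space_conformal Dp.
  rewrite (sqnorm_dzE JnT (smooth_differentiable smooth_space Dp) a1).
  exact: half_complex_neq0 a0.
have e3 : mkc (dzbarv (dzv m) p) ec = 0.
  have se : vsmooth D (fun _ : 'rV[R]_2 => ec) by exact: vsmooth_disk_cst.
  have := @mzb_dot (fun=> ec) p se Dp (fun q Dq => (mz_e Dq).1).
  by rewrite dzbarv_cst sprod0r addr0.
have e4 : mkc (dzbarv (dzv m) p) (yM p) = 0.
  by have := mzb_dot syM Dp mz_y; rewrite (mz_yb Dp) addr0.
have e5 : mkc (dzbarv (dzv m) p) (m p) = - sqnorm_dz Jn f p.
  by have := mzb_dot smc Dp mz_m; rewrite -S => /eqP; rewrite addr_eq0 => /eqP.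
have En : cplx (nt) p = yM p + (kap p)%:C *: m p.
  by rewrite /cplx /cone_normal map_mxD map_mxZ map_mxM (cplx_real_gauss Dp).
rewrite /mean_curvature csprodE sprodZl fzb.
have -> : cplx space_normal p = cplx nt p *m Pc by rewrite /cplx /space_normal map_mxM.
have -> : sprod (map_mx rc Jn) (dzbarv (dzv m) p *m Pc) (cplx nt p *m Pc) = mkc (dzbarv (dzv m) p) (cplx nt p).
  by apply: isoC => //; rewrite /cplx mk_map mk_nt_e.
rewrite En sprodDr e4 sprodZr e5 add0r !mulrN mulrCA mulVf// mulr1.
by rewrite rmorphN.
Qed.
End SpaceForm.

Transparent cdiff.
(** * Isothermic charts *)

Section ChainRule.
Variable R : realType.
Local Notation C := R[i].
Local Notation plane := 'rV[R]_2.
Implicit Types (U W : set plane) (psi : plane -> plane) (f : plane -> C).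

(** A directional derivative read as a complex number; for [v = ex] and holomorphic [psi] it is the
    complex derivative of [psi]. *)
Definition speed psi (v q : plane) : C := of_plane ('D_v psi q).

Lemma csmooth_comp U W psi f : open U -> csmooth W f -> smooth U psi -> (forall q, U q -> W (psi q)) ->
  csmooth U (f \o psi).
Proof.
move=> oU sf sp UW; have oW := csmooth_open (csmooth := sf); split => //.
  exact: (smooth_comp oU oW UW sp (csmooth_re (csmooth := sf))).
exact: (smooth_comp oU oW UW sp (csmooth_im (csmooth := sf))).
Qed.

Lemma csmooth_speed U psi v : open U -> smooth U psi -> csmooth U (speed psi v).
Proof.
by move=> oU sp; split => //; apply: smooth_coord => //; exact: smooth_derive.
Qed.

Lemma cdiff_lin U f p (a : plane) : csmooth U f -> U p ->
  cdiff a f p = dz f p * of_plane a + dzbar f p * conjc (of_plane a).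
Proof.
move=> sf Up.
have dr := smooth_differentiable (csmooth_re (csmooth := sf)) Up.
have di := smooth_differentiable (csmooth_im (csmooth := sf)) Up.
have -> : cdiff a f p = (a 0 0)%:C * cdiff (ex R) f p + (a 0 1)%:C * cdiff (ey R) f p.
  rewrite /cdiff (derive_plane a dr) (derive_plane a di).
  move: ('D_(ex R) _ p) ('D_(ey R) _ p) ('D_(ex R) _ p) ('D_(ey R) _ p) => a1 a2 a3 a4.
  by apply: complexP => /=; ring.
rewrite cdiff_exE cdiff_eyE /of_plane.
move: (dz f p) (dzbar f p) (a 0 0) (a 0 1) => b c s t.
have -> : s +i* t = s%:C + 'i * t%:C by apply: complexP => /=; ring.
have -> : conjc (s%:C + 'i * t%:C) = s%:C - 'i * t%:C by apply: complexP => /=; ring.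
by ring.
Qed.

Lemma cdiff_comp U W psi f q v : open U -> csmooth W f -> smooth U psi -> (forall q, U q -> W (psi q)) -> U q ->
  cdiff v (f \o psi) q = dz f (psi q) * speed psi v q + dzbar f (psi q) * conjc (speed psi v q).
Proof.
move=> oU sf sp UW Uq.
have dp := smooth_differentiable sp Uq.
have dr := smooth_differentiable (csmooth_re (csmooth := sf)) (UW _ Uq).
have di := smooth_differentiable (csmooth_im (csmooth := sf)) (UW _ Uq).
rewrite -(cdiff_lin _ sf (UW _ Uq)) /cdiff; congr (_ +i* _).
  exact: (derive_comp v dp dr).
exact: (derive_comp v dp di).
Qed.

(* [e = 1] for an orientation preserving psi and [e = -1] for a reversing one *)
Section OneSheet.
Variables (U W : set plane) (psi : plane -> plane) (e : C).
Hypothesis oU : open U.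
Hypothesis sp : smooth U psi.
Hypothesis UW : forall q, U q -> W (psi q).
Local Notation ze := (speed psi (ex R)).
Hypothesis psiy : forall q, U q -> speed psi (ey R) q = e * ('i * ze q).

Lemma wirt_hol f q : e = 1 -> csmooth W f -> U q ->
  dz (f \o psi) q = dz f (psi q) * ze q /\ dzbar (f \o psi) q = dzbar f (psi q) * conjc (ze q).
Proof.
move=> e1 sf Uq; rewrite (dzE (f \o psi)) (dzbarE (f \o psi)) /wirt !(cdiff_comp _ oU sf sp UW Uq) (psiy Uq) e1 mul1r.
have -> : conjc ('i * ze q) = - 'i * conjc (ze q) by rewrite conjcM; congr (_ * _); apply: complexP => /=; ring.
move: (dz f _) (dzbar f _) (ze q) (conjc _) (@i2 R) => a b z zc ii.
have ii' : ('i : C) * ('i * z) = - z by rewrite mulrA ii mulN1r.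
have ii2 : ('i : C) * ('i * zc) = - zc by rewrite mulrA ii mulN1r.
split.
  have -> : a * z + b * zc + - 'i * (a * ('i * z) + b * (- 'i * zc)) = a * z - a * ('i * ('i * z)) + (b * zc + b * ('i * ('i * zc))) by ring.
  by rewrite ii' ii2; field.
have -> : a * z + b * zc + 'i * (a * ('i * z) + b * (- 'i * zc)) = a * z + a * ('i * ('i * z)) + (b * zc - b * ('i * ('i * zc))) by ring.
by rewrite ii' ii2; field.
Qed.

Lemma wirt_antihol f q : e = -1 -> csmooth W f -> U q ->
  dzbar (f \o psi) q = dz f (psi q) * ze q /\ dz (f \o psi) q = dzbar f (psi q) * conjc (ze q).
Proof.
move=> e1 sf Uq; rewrite (dzE (f \o psi)) (dzbarE (f \o psi)) /wirt !(cdiff_comp _ oU sf sp UW Uq) (psiy Uq) e1 mulN1r.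
have -> : conjc (- ('i * ze q)) = 'i * conjc (ze q).
  by rewrite conjcN conjcM -mulNr; congr (_ * _); apply: complexP => /=; ring.
move: (dz f _) (dzbar f _) (ze q) (conjc _) (@i2 R) => a b z zc ii.
have ii' : ('i : C) * ('i * z) = - z by rewrite mulrA ii mulN1r.
have ii2 : ('i : C) * ('i * zc) = - zc by rewrite mulrA ii mulN1r.
split.
  have -> : a * z + b * zc + 'i * (a * - ('i * z) + b * ('i * zc)) = a * z - a * ('i * ('i * z)) + (b * zc + b * ('i * ('i * zc))) by ring.
  by rewrite ii' ii2; field.
have -> : a * z + b * zc + - 'i * (a * - ('i * z) + b * ('i * zc)) = a * z + a * ('i * ('i * z)) + (b * zc - b * ('i * ('i * zc))) by ring.
by rewrite ii' ii2; field.
Qed.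

Let dp q (Uq : U q) := smooth_differentiable sp Uq.
Let sz : csmooth U ze. Proof. exact: csmooth_speed. Qed.

Let dD v q : U q -> differentiable ('D_v psi) q.
Proof. by move=> Uq; exact: smooth_differentiable (smooth_derive v sp) Uq. Qed.

Lemma speed_cr q : U q -> cdiff (ey R) ze q = e * ('i * cdiff (ex R) ze q).
Proof.
move=> Uq.
have C j : 'D_(ey R) (fun q => 'D_(ex R) psi q 0 j) q = 'D_(ex R) (fun q => 'D_(ey R) psi q 0 j) q.
  apply: etrans (derive_coord (ey R) j (dD (ex R) Uq)) _.
  apply: etrans (congr1 (fun w : 'rV[R]_2 => w 0 j) (derive_symv (ey R) (ex R) oU Uq sp)) _.
  exact: esym (derive_coord (ex R) j (dD (ey R) Uq)).
have -> : cdiff (ey R) ze q = cdiff (ex R) (speed psi (ey R)) q by exact: (congr2 (fun a b => a +i* b) (C 0) (C 1)).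
have H0 := eq_cdiff Uq (ex R) oU psiy.
have sc (a : R[i]) : csmooth U (fun=> a) by exact: csmooth_cst.
have s1 : csmooth U (fun q => 'i * ze q) by exact: csmooth_mul.
rewrite H0 (cdiffM Uq (ex R) (sc e) s1) (cdiff_cst q (ex R) e) mul0r add0r; congr (_ * _).
by rewrite (cdiffM Uq (ex R) (sc 'i) sz) (cdiff_cst q (ex R) 'i) mul0r add0r.
Qed.

Lemma speed_hol q : e = 1 -> U q -> dzbar ze q = 0.
Proof.
by move=> e1 Uq; rewrite dzbarE /wirt (speed_cr Uq) e1 mul1r mulrA i2 mulN1r subrr mul0r.
Qed.

Lemma speed_antihol q : e = -1 -> U q -> dz ze q = 0.
Proof.
by move=> e1 Uq; rewrite dzE /wirt (speed_cr Uq) e1 mulN1r mulrNN mulrA i2 mulN1r subrr mul0r.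
Qed.

Lemma dzv_hol n (F : plane -> 'rV[C]_n) q : e = 1 -> vsmooth W F -> U q ->
  dzv (F \o psi) q = ze q *: dzv F (psi q).
Proof.
move=> e1 sF Uq; apply/rowP => j; rewrite !mxE mulrC.
exact: (wirt_hol e1 (sF j) Uq).1.
Qed.

Lemma dzv_antihol n (F : plane -> 'rV[C]_n) q : e = -1 -> vsmooth W F -> U q ->
  dzv (F \o psi) q = conjc (ze q) *: dzbarv F (psi q).
Proof.
move=> e1 sF Uq; apply/rowP => j; rewrite !mxE mulrC.
exact: (wirt_antihol e1 (sF j) Uq).2.
Qed.

Lemma vsmooth_comp n (F : plane -> 'rV[C]_n) : vsmooth W F -> vsmooth U (F \o psi).
Proof. by move=> sF j; exact: (csmooth_comp oU (sF j) sp UW). Qed.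
End OneSheet.
End ChainRule.
Opaque cdiff.

Section Reparametrization.
Variables (R : realType) (X N : 'rV[R]_2 -> 'rV[R]_4).
Context {sXN : surface X N}.
Local Notation C := R[i].
Local Notation plane := 'rV[R]_2.
Local Notation D := (@unit_disk R).
Local Notation dot := (sprod (1%:M : 'M[C]_4)).
Local Notation x := (cplx X).
Local Notation n := (cplx N).
Local Notation h := (mean_curvature 1%:M X N).
Local Notation om := (tracefree_curvature X N).
Local Notation th := (theta X N).
Local Notation oD := (@open_disk R).
Variables (U : set plane) (psi : plane -> plane) (e : C).
Hypothesis oU : open U.
Hypothesis sp : smooth U psi.
Hypothesis UD : forall q, U q -> D (psi q).
Local Notation ze := (speed psi (ex R)).
Hypothesis psiy : forall q, U q -> speed psi (ey R) q = e * ('i * ze q).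

Let vx : vsmooth D x. Proof. exact: vsmooth_X. Qed.
Let vn : vsmooth D n. Proof. exact: vsmooth_N. Qed.
Let sz : csmooth U ze. Proof. exact: csmooth_speed. Qed.

(** omega is a quadratic differential: the second derivative of [psi] multiplies [X_z], which is
    orthogonal to [N]. *)
Lemma tracefree_hol q : e = 1 -> U q ->
  tracefree_curvature (X \o psi) (N \o psi) q = om (psi q) * ze q ^+ 2.
Proof.
move=> e1 Uq; have Dq := UD Uq; have sz' : csmooth U ze by exact: sz.
rewrite (tracefreeE X N (psi q)) /tracefree_curvature csprod1E.
have vz : vsmooth D (dzv x) by exact: _.
have sc : vsmooth U (dzv x \o psi) by exact: (vsmooth_comp oU sp UD).
have E1 q' : U q' -> dzv (cplx (X \o psi)) q' = ze q' *: (dzv x \o psi) q'.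
  by move=> Uq'; exact: (dzv_hol oU sp UD psiy e1 vx Uq').
rewrite (eq_dzv Uq oU E1) (dzvZ Uq (a := ze) (F := dzv x \o psi)) (dzv_hol oU sp UD psiy e1 vz Uq).
rewrite !(sprodDl, sprodZl) -[cplx (N \o psi) q]/(n (psi q)) -[(dzv x \o psi) q]/(dzv x (psi q)).
rewrite (dot_zn (X := X) (N := N) Dq) mulr0 add0r.
by move: (dot _ _) (ze q) => a b; ring.
Qed.

(** For a reversing [psi], [z]-derivatives of the composition are [zbar]-derivatives of [X], and
    [<X_{zbar zbar}, N>] is half the conjugate of omega. *)
Lemma tracefree_antihol q : e = -1 -> U q ->
  tracefree_curvature (X \o psi) (N \o psi) q = conjc (om (psi q) * ze q ^+ 2).
Proof.
move=> e1 Uq; have Dq := UD Uq; have sz' : csmooth U ze by exact: sz.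
have -> : conjc (om (psi q) * ze q ^+ 2) = conjc (om (psi q)) * (conjc (ze q) * conjc (ze q)).
  by rewrite expr2 !conjcM.
rewrite /(tracefree_curvature (X \o psi)) csprod1E.
have vb : vsmooth D (dzbarv x) by exact: _.
have scz : csmooth U (fun q => conjc (ze q)) by exact: csmooth_conj.
have sc : vsmooth U (dzbarv x \o psi) by exact: (vsmooth_comp oU sp UD).
have vbz : dzv (dzbarv x \o psi) q = conjc (ze q) *: dzbarv (dzbarv x) (psi q) by exact: (dzv_antihol oU sp UD psiy e1 vb Uq).
have E1 q' : U q' -> dzv (cplx (X \o psi)) q' = conjc (ze q') *: (dzbarv x \o psi) q'.
  by move=> Uq'; exact: (dzv_antihol oU sp UD psiy e1 vx Uq').
rewrite (eq_dzv Uq oU E1) (dzvZ Uq (a := fun q => conjc (ze q)) (F := dzbarv x \o psi)) vbz.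
rewrite !(sprodDl, sprodZl) -[cplx (N \o psi) q]/(n (psi q)) -[(dzbarv x \o psi) q]/(dzbarv x (psi q)).
rewrite (dot_bn (X := X) (N := N) Dq) mulr0 add0r (xbbE (X := X) (N := N) Dq).
rewrite sprodDl !sprodZl (dot_bn (X := X) (N := N) Dq) (dot_nn (X := X) (N := N) Dq) mulr0 add0r mulr1.
by move: (conjc (om _)) (conjc (ze q)) => a b; field.
Qed.

Hypothesis iso : forall q, U q -> tracefree_curvature (X \o psi) (N \o psi) q \is Num.real.

Let co q := conjc (om q).
Let sco : csmooth D co. Proof. exact: csmooth_conj. Qed.

Lemma dz_conj_om p : D p -> dz co p = th p * co p.
Proof.
move=> Dp; rewrite (dz_conj Dp (f := om)) (codazzi Dp) /co (conj_om Dp).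
have -> : th p * (2 * sqnorm_dz 1%:M X p * conjc (ucoef X N p)) = 2 * sqnorm_dz 1%:M X p * (th p * conjc (ucoef X N p)).
  by move: (th p) (conjc _) (sqnorm_dz _ _ _) => *; ring.
have cM3 (a b c : C) : conjc (a * b * c) = conjc a * conjc b * conjc c by rewrite !conjcM.
rewrite (theta_u Dp) cM3 (conj_sqnorm Dp); congr (_ * _ * _); first by rewrite rmorph_nat.
exact: conj_dz_h.
Qed.

(** The tracefree curvature of the reparametrized surface when [psi] reverses the orientation, its
    conjugate otherwise; real in both cases by [iso]. *)
Let rho q := co (psi q) * (conjc (ze q) * conjc (ze q)).
Let srho : csmooth U rho.
Proof.
have s1 : csmooth U (co \o psi) by exact: (csmooth_comp oU sco sp UD).
have s2 : csmooth U (fun q => conjc (ze q)) by exact: csmooth_conj.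
exact: csmooth_mul s1 (csmooth_mul s2 s2).
Qed.

(** In the application [r] is [rho], [K] is [rho_{z zbar}] and [T] is theta_zbar. As [r] is real,
    the last summand is the real number [|t z|^2 r], so [K] real leaves [T] real. *)
Lemma theta_alg (T t z r K : C) : conjc K = K -> conjc r = r -> r != 0 -> z != 0 ->
  K = T * conjc z * z * r + t * z * conjc (t * z * r) -> conjc T = T.
Proof.
move=> Kr rr r0 z0 E.
have zz0 : conjc z * z * r != 0 by rewrite !mulf_neq0// conjc_eq0.
apply: (mulIf zz0).
have -> : T * (conjc z * z * r) = K - t * z * conjc (t * z * r) by rewrite E; ring.
have -> : conjc T * (conjc z * z * r) = conjc (T * (conjc z * z * r)) by rewrite !conjcM conjcK rr; ring.
have -> : T * (conjc z * z * r) = K - t * z * conjc (t * z * r) by rewrite E; ring.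
by rewrite conjcD conjcN Kr !conjcM !conjcK rr; ring.
Qed.

(** For a holomorphic [psi], [rho_z = theta psi' rho], and a second differentiation expresses
    [rho_{z zbar}] by theta_zbar because [psi'] is holomorphic. For a reversing [psi] the roles of
    [z] and [zbar] are exchanged. *)
Lemma theta_real q : e = 1 \/ e = -1 -> U q -> ze q != 0 -> conjc (dzbar th (psi q)) = dzbar th (psi q).
Proof.
move=> e1 Uq z0; have Dq := UD Uq.
have real_conj (c : C) : c \is Num.real -> conjc c = c by move=> /complex_realP[a ->]; rewrite conjc_real.
have rr q' : U q' -> conjc (rho q') = rho q'.
  move=> Uq'; have := iso Uq'; rewrite /rho /co.
  case: e1 => e1; [rewrite (tracefree_hol e1 Uq')|rewrite (tracefree_antihol e1 Uq')] => /real_conj.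
    by rewrite expr2 !conjcM !conjcK => ->.
  by rewrite expr2 !conjcM !conjcK => <-.
have r0 : rho q != 0.
  by rewrite !mulf_neq0 ?conjc_eq0//; exact: (surface_umb Dq).
have sth : csmooth D th by exact: _.
have s1 : csmooth U (co \o psi) by exact: (csmooth_comp oU sco sp UD).
have s2 : csmooth U (fun q => conjc (ze q)) by exact: csmooth_conj.
have s22 := csmooth_mul s2 s2.
have s3 : csmooth U (th \o psi) by exact: (csmooth_comp oU sth sp UD).
have sz' : csmooth U ze by exact: sz.
have sr' : csmooth U rho by exact: srho.
have s4 : csmooth U (fun q => (th \o psi) q * ze q) by exact: csmooth_mul.
have sdz : csmooth U (dz rho) by exact: (csmooth_dz sr').
have sdb : csmooth U (dzbar rho) by exact: (csmooth_dzbar sr').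
have cdz q' : U q' -> conjc (dz rho q') = dzbar rho q'.
  by move=> Uq'; rewrite -(dzbar_conj Uq' (f := rho)); apply: (eq_dzbar Uq' oU) => p Up; exact: rr.
have cdb q' : U q' -> conjc (dzbar rho q') = dz rho q' by move=> Uq'; rewrite -cdz// conjcK.
have CK : conjc (dzbar (dz rho) q) = dzbar (dz rho) q.
  rewrite -(dz_conj Uq (f := dz rho)) (eq_dz Uq oU cdz) [RHS](dz_dzbarC (f := rho) Uq) //.
have final (dA dr dT dZ : C) : dA = dT * ze q + th (psi q) * dZ -> dT = dzbar th (psi q) * conjc (ze q) -> dZ = 0 ->
    dr = conjc (th (psi q) * ze q * rho q) -> dA * rho q + th (psi q) * ze q * dr
    = dzbar th (psi q) * conjc (ze q) * ze q * rho q + th (psi q) * ze q * conjc (th (psi q) * ze q * rho q).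
  by move=> -> -> -> ->; rewrite mulr0 addr0.
case: e1 => e1.
  have Dr q' : U q' -> dz rho q' = (th \o psi) q' * ze q' * rho q'.
    move=> Uq'; rewrite /rho (dzM Uq' (f := co \o psi) (g := fun q => conjc (ze q) * conjc (ze q))).
    rewrite (dzM Uq' (f := fun q => conjc (ze q)) (g := fun q => conjc (ze q))) (dz_conj Uq' (f := ze)).
    rewrite (speed_hol oU sp psiy e1 Uq') conjc0 mul0r mulr0 addr0 mulr0 addr0.
    rewrite (wirt_hol oU sp UD psiy e1 sco Uq').1 (dz_conj_om (UD Uq')).
    rewrite -[(th \o psi) q']/(th (psi q')).
  by move: (th (psi q')) (co (psi q')) (ze q') (conjc (ze q')) => *; ring.
  apply: (theta_alg (t := th (psi q)) CK (rr _ Uq) r0 z0).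
  have W1 := (wirt_hol oU sp UD psiy e1 sth Uq).2.
  have W2 : dzbar ze q = 0 by exact: (speed_hol oU sp psiy e1 Uq).
  have R1 : dzbar rho q = conjc (th (psi q) * ze q * rho q) := etrans (esym (cdz q Uq)) (congr1 conjc (Dr q Uq)).
  have E1 := eq_dzbar Uq oU Dr.
  have E2 := dzbarM Uq (f := fun q => (th \o psi) q * ze q) (g := rho) (sf := s4) (sg := sr').
  have E3 := dzbarM Uq (f := th \o psi) (g := ze) (sf := s3) (sg := sz').
  exact: etrans E1 (etrans E2 (final _ _ _ _ E3 W1 W2 R1)).
have Dr q' : U q' -> dzbar rho q' = (th \o psi) q' * ze q' * rho q'.
  move=> Uq'; rewrite /rho (dzbarM Uq' (f := co \o psi) (g := fun q => conjc (ze q) * conjc (ze q))).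
  rewrite (dzbarM Uq' (f := fun q => conjc (ze q)) (g := fun q => conjc (ze q))) (dzbar_conj Uq' (f := ze)).
  rewrite (speed_antihol oU sp psiy e1 Uq') conjc0 mul0r mulr0 addr0 mulr0 addr0.
  rewrite (wirt_antihol oU sp UD psiy e1 sco Uq').1 (dz_conj_om (UD Uq')).
  rewrite -[(th \o psi) q']/(th (psi q')).
  by move: (th (psi q')) (co (psi q')) (ze q') (conjc (ze q')) => *; ring.
apply: (theta_alg (t := th (psi q)) CK (rr _ Uq) r0 z0).
have W1 := (wirt_antihol oU sp UD psiy e1 sth Uq).2.
have W2 : dz ze q = 0 by exact: (speed_antihol oU sp psiy e1 Uq).
have R1 : dz rho q = conjc (th (psi q) * ze q * rho q) := etrans (esym (cdb q Uq)) (congr1 conjc (Dr q Uq)).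
have E1 := eq_dz Uq oU Dr.
have E2 := dzM Uq (f := fun q => (th \o psi) q * ze q) (g := rho) (sf := s4) (sg := sr').
have E3 := dzM Uq (f := th \o psi) (g := ze) (sf := s3) (sg := sz').
exact: etrans (dz_dzbarC (f := rho) (sf := sr') Uq) (etrans E1 (etrans E2 (final _ _ _ _ E3 W1 W2 R1))).
Qed.
End Reparametrization.

Section IsothermicTheta.
Variables (R : realType) (X N : 'rV[R]_2 -> 'rV[R]_4).
Context {sXN : surface X N}.
Local Notation D := (@unit_disk R).

Lemma orthogonal_frame_alg (K : fieldType) (a0 a1 b0 b1 : K) : a0 * a0 + a1 * a1 != 0 ->
  a0 * a0 + a1 * a1 = b0 * b0 + b1 * b1 -> a0 * b0 + a1 * b1 = 0 ->
  let s := (a0 * b1 - a1 * b0) / (a0 * a0 + a1 * a1) in [/\ b0 = - (s * a1), b1 = s * a0 & s ^+ 2 = 1].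
Proof.
move=> n0 nn ab s.
have E0 : b0 = - (s * a1).
  apply: (mulIf n0); rewrite /s mulNr mulrAC divfK//.
  have -> : b0 * (a0 * a0 + a1 * a1) = a0 * (a0 * b0 + a1 * b1) - (a0 * b1 - a1 * b0) * a1 by ring.
  by rewrite ab; ring.
have E1 : b1 = s * a0.
  apply: (mulIf n0); rewrite /s mulrAC divfK//.
  have -> : b1 * (a0 * a0 + a1 * a1) = a1 * (a0 * b0 + a1 * b1) + (a0 * b1 - a1 * b0) * a0 by ring.
  by rewrite ab; ring.
split => //; apply: (mulIf n0); rewrite mul1r [RHS]nn {1 2}E0 {1 2}E1; ring.
Qed.

Lemma conformal_plane_alg (u v : 'rV[R]_2) : 0 < sprod 1%:M u u -> sprod 1%:M u u = sprod 1%:M v v -> sprod 1%:M u v = 0 ->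
  let s := (u 0 0 * v 0 1 - u 0 1 * v 0 0) / (u 0 0 * u 0 0 + u 0 1 * u 0 1) in
  [/\ v 0 0 = - (s * u 0 1), v 0 1 = s * u 0 0 & s ^+ 2 = 1] /\ 0 < u 0 0 * u 0 0 + u 0 1 * u 0 1.
Proof.
have dot2 (a b : 'rV[R]_2) : sprod 1%:M a b = a 0 0 * b 0 0 + a 0 1 * b 0 1.
  by rewrite sprod1E !big_ord_recl big_ord0 addr0; congr (_ + a 0 _ * b 0 _); apply: val_inj.
rewrite !dot2 => a0 aa ab s; split => //; apply: orthogonal_frame_alg => //; by rewrite gt_eqF.
Qed.

(** The orientation of the chart is the function [s], the Jacobian divided by [|psi_x|^2]. It is
    smooth with [s ^ 2 = 1], hence constant near [q0], where one of the two cases of [theta_real]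
    applies. *)
Lemma isothermic_theta : isothermic X N -> forall p, D p -> conjc (dzbar (theta X N) p) = dzbar (theta X N) p.
Proof.
move=> iso p Dp; have [U [psi [oU [sp cp] _ [UD [q0 Uq0 pE]] rU]]] := iso p Dp.
pose a q j := 'D_(ex R) psi q 0 j; pose b q j := 'D_(ey R) psi q 0 j.
pose s q := (a q 0 * b q 1 - a q 1 * b q 0) / (a q 0 * a q 0 + a q 1 * a q 1).
have key q : U q -> [/\ b q 0 = - (s q * a q 1), b q 1 = s q * a q 0 & s q ^+ 2 = 1] /\ 0 < a q 0 * a q 0 + a q 1 * a q 1.
  by move=> Uq; have [h1 h2 h3] := cp q Uq; exact: (conformal_plane_alg h1 h2 h3).
have sa j : smooth U (fun q => a q j) by apply: smooth_coord => //; exact: smooth_derive.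
have sb j : smooth U (fun q => b q j) by apply: smooth_coord => //; exact: smooth_derive.
have ss : smooth U s.
  apply: (smooth_mul oU).
    apply: (smooth_add oU); first exact: smooth_mul oU (sa 0) (sb 1).
    by apply: (smooth_opp oU); exact: smooth_mul oU (sa 1) (sb 0).
  apply: (smooth_inv oU); first by move=> q Uq; rewrite gt_eqF//; have [] := key q Uq.
  by apply: (smooth_add oU); [exact: smooth_mul oU (sa 0) (sa 0)|exact: smooth_mul oU (sa 1) (sa 1)].
have s1 q : U q -> s q = 1 \/ s q = -1.
  by move=> Uq; have [[_ _ /eqP]] := key q Uq; rewrite sqrf_eq1 => /orP[]/eqP ->; [left|right].
have s00 : s q0 != 0 by case: (s1 _ Uq0) => ->; rewrite ?oppr_eq0 oner_eq0.
have near1 : \forall q \near q0, s q = s q0 /\ U q.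
  have n1 : \forall q \near q0, s q * s q0 > 0.
    have sc : {for q0, continuous (fun q => s q * s q0)}.
      exact: smooth_continuous (smooth_mul oU ss (smooth_cst (s q0) oU)) Uq0.
    apply: (cvgr_gt (s q0 * s q0)) sc _ _; by rewrite -expr2 lt_def sqrf_eq0 s00 sqr_ge0.
  apply: filterS2 n1 (open_near oU Uq0) => q sq Uq; split; last exact: Uq.
  move: sq; case: (s1 _ Uq) => ->; case: (s1 _ Uq0) => -> //; by rewrite ?mul1r ?mulr1 oppr_gt0 ltr10.
have nb : nbhs q0 [set q | s q = s q0 /\ U q] by exact: near1.
move: nb; rewrite nbhsE => -[B [oB Bq0] HB].
have BU : B `<=` U by move=> q /HB[].
have spB : smooth B psi by exact: smoothW BU sp.
rewrite -pE; apply: (@theta_real R X N sXN B psi (s q0)%:C oB spB _ _ _ q0).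
- by move=> q Bq; apply: UD; exists q => //; exact: BU.
- move=> q Bq; have [sq Uq] := HB _ Bq; have [[b0 b1 _] _] := key q Uq.
  rewrite /speed /of_plane -/(b q 0) -/(b q 1) b0 b1 sq.
  by apply: complexP => /=; rewrite -/(a q 0) -/(a q 1); ring.
- by move=> q Bq; exact: rU (BU _ Bq).
- by case: (s1 _ Uq0) => ->; [left|right]; rewrite ?rmorphN rmorph1.
- exact: Bq0.
- have [_ a0] := key _ Uq0; apply/eqP => z0; move: a0.
  have a00 : a q0 0 = 0 by have := congr1 (@complex.Re R) z0.
  have a01 : a q0 1 = 0 by have := congr1 (@complex.Im R) z0.
  by rewrite a00 a01 mul0r addr0 ltxx.
Qed.
End IsothermicTheta.

(** * Primitives of closed forms and local inverses *)

Section DifferentiabilityCriterion.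
Variables (R : realType) (V : normedModType R).

Lemma differentiable_flat (g : V -> R) x :
  (forall e, 0 < e -> \forall k \near (0 : V), `|g (k + x) - g x| <= e * `|k|) ->
  differentiable g x /\ forall v, 'D_v g x = 0.
Proof.
move=> H; pose d : {linear V -> R} := 'd (cst (0 : R)) x.
have d0 : d = (fun=> 0) :> (V -> R) by rewrite /d diff_cst.
have dc : continuous d by rewrite d0; exact: cst_continuous.
have eqo : g \o shift x = cst (g x) + d +o_ (0 : V) id.
  apply/eqaddoP => e e0; apply: filterS (H e e0) => k Hk.
  have -> : (g \o shift x - (cst (g x) + d)) k = g (k + x) - g x.
    by rewrite -[LHS]/(g (k + x) - (g x + d k)) d0 addr0.
  exact: Hk.
have dE := diff_unique dc eqo.
have dg : differentiable g x by apply/diff_locallyP; rewrite dE.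
by split => // v; rewrite deriveE// dE d0.
Qed.

Lemma differentiable_approx (f l : V -> R) x : differentiable l x ->
  (forall e, 0 < e -> \forall k \near (0 : V), `|f (k + x) - f x - (l (k + x) - l x)| <= e * `|k|) ->
  differentiable f x /\ forall v, 'D_v f x = 'D_v l x.
Proof.
move=> dl H.
have [|dg Dg] := @differentiable_flat (fun y => f y - l y) x.
  move=> e e0; apply: filterS (H e e0) => k.
  have -> // : f (k + x) - l (k + x) - (f x - l x) = f (k + x) - f x - (l (k + x) - l x).
  by move: (f _) (l _) (f x) (l x) => *; ring.
have E : f = (fun y => (f y - l y) + l y) by apply/funext => y; rewrite subrK.
have df : differentiable f x by rewrite E; exact: (@differentiableD _ _ _ (fun y => f y - l y) l).
split => // v; rewrite E.
apply: etrans (@deriveD _ _ _ (fun y => f y - l y) l x v (diff_derivable dg) (diff_derivable dl)) _.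
by rewrite Dg add0r.
Qed.
End DifferentiabilityCriterion.

Section Primitive1.
Variable R : realType.
Implicit Types (f F : R -> R) (c r x y : R).

(** The oriented integral from [c] to [x], on either side of [c], as a difference of two integrals
    from the left end [c - r]. *)
Definition prim f c r x : R :=
  (\int[@lebesgue_measure R]_(t in `[(c - r), x]) f t) - (\int[@lebesgue_measure R]_(t in `[(c - r), c]) f t).

Lemma prim_center f c r : prim f c r c = 0.
Proof. exact: subrr. Qed.

Lemma is_derive_prim f c r x : (forall z, `|z - c| <= r -> {for z, continuous f}) -> `|x - c| < r ->
  is_derive x 1 (prim f c r) (f x).
Proof.
move=> cf; rewrite ltr_norml => /andP[x1 x2].
have a1 : c - r < x by lra.
have a2 : x < c + r by lra.
have cW : {within `[(c - r), (c + r)], continuous f}.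
  apply: continuous_in_subspaceT => z; rewrite inE /= in_itv /= => /andP[z1 z2].
  by apply: cf; rewrite ler_norml; apply/andP; split; lra.
have fi : (@lebesgue_measure R).-integrable `[(c - r), (c + r)] (EFin \o f).
  by apply: continuous_compact_integrable => //; exact: segment_compact.
have cx : {for x, continuous f} by apply: cf; rewrite ler_norml; apply/andP; split; lra.
have [dF F'] := continuous_FTC1_closed a2 fi a1 cx.
pose F1 (x : R) : R := \int[@lebesgue_measure R]_(t in `[(c - r), x]) f t.
have dF1 : derivable F1 x 1 by exact: dF.
have F1' : 'D_1 F1 x = f x by rewrite -derive1E; exact: F'.
have E : prim f c r = F1 - cst (F1 c) by apply/funext.
rewrite E; have dc := derivable_cst (F1 c) x 1.
split; first exact: (@derivableB _ _ _ F1 (cst (F1 c)) x 1 dF1 dc).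
apply: etrans (@deriveB _ _ _ F1 (cst (F1 c)) x 1 dF1 dc) _.
by rewrite derive_cst subr0.
Qed.

(** No order between [x] and [y] is assumed; the intermediate point is no farther from [x] than [y]
    is. *)
Lemma mvt1 f F c r x y : (forall z, `|z - c| < r -> is_derive z 1 F (f z)) -> `|x - c| < r -> `|y - c| < r ->
  exists2 z, `|z - c| < r /\ `|z - x| <= `|y - x| & F y - F x = (y - x) * f z.
Proof.
move=> dF xr yr.
have H u v : `|u - c| < r -> `|v - c| < r -> u <= v -> exists2 z, u <= z <= v & F v - F u = (v - u) * f z.
  move=> ur vr uv.
  have zr z : u <= z <= v -> `|z - c| < r.
    move: ur vr; rewrite !ltr_norml => /andP[u1 u2] /andP[v1 v2] /andP[z1 z2].
    by apply/andP; split; lra.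
  have [||z] := @MVT_segment R F f u v uv.
  - by move=> z; rewrite in_itv /= => /andP[z1 z2]; apply/dF/zr; rewrite !ltW.
  - apply: derivable_within_continuous => z; rewrite in_itv /= => zuv.
    by have [] := dF z (zr z zuv).
  - by rewrite in_itv /= => zuv ->; exists z => //; rewrite mulrC.
have [xy|yx] := leP x y.
  have [z /andP[z1 z2] E] := H x y xr yr xy; exists z => //; split.
    by move: xr yr; rewrite !ltr_norml => /andP[? ?] /andP[? ?]; apply/andP; split; lra.
  by rewrite !ger0_norm ?subr_ge0// lerB.
have [z /andP[z1 z2] E] := H y x yr xr (ltW yx); exists z.
  split; first by move: xr yr; rewrite !ltr_norml => /andP[? ?] /andP[? ?]; apply/andP; split; lra.
  by rewrite !ler0_norm ?subr_le0 ?(ltW yx)// !opprB lerB.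
by rewrite -opprB E; ring.
Qed.
End Primitive1.

Section Primitive2.
Variable R : realType.
Local Notation plane := 'rV[R]_2.
Variables (U : set plane) (a b : plane -> R) (p : plane).
Hypothesis oU : open U.
Hypothesis Up : U p.
Hypothesis sa : smooth U a.
Hypothesis sb : smooth U b.
Hypothesis closed_form : forall q, U q -> 'D_(ey R) a q = 'D_(ex R) b q.

Definition pt (s t : R) : plane := s *: ex R + t *: ey R.

Lemma pt0 s t : pt s t 0 0 = s.
Proof. by rewrite /pt /ex /ey !mxE /= mulr1 mulr0 addr0. Qed.
Lemma pt1 s t : pt s t 0 1 = t.
Proof. by rewrite /pt /ex /ey !mxE /= mulr1 mulr0 add0r. Qed.

Lemma ptE (q : plane) : q = pt (q 0 0) (q 0 1).
Proof.
apply/rowP => j; case: j => -[|[|//]] Hj.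
  rewrite (_ : Ordinal Hj = 0); last exact: val_inj.
  by rewrite pt0.
rewrite (_ : Ordinal Hj = 1); last exact: val_inj.
by rewrite pt1.
Qed.

Lemma coordB (v w : plane) j : (v - w) 0 j = v 0 j - w 0 j.
Proof. by rewrite !mxE. Qed.

Lemma coord_le (v : plane) j : `|v 0 j| <= `|v|.
Proof.
rewrite [leRHS]/Num.Def.normr/= mx_normrE.
exact: (le_bigmax _ (fun i : 'I_1 * 'I_2 => `|v i.1 i.2|) (0, j)).
Qed.

Lemma plane_norm_lt (v : plane) e : `|v 0 0| < e -> `|v 0 1| < e -> `|v| < e.
Proof.
move=> v0 v1; rewrite [ltLHS]/Num.Def.normr/= mx_normrE; apply/bigmax_ltP; split.
  exact: le_lt_trans v0.
move=> [i j] _ /=; rewrite (ord1 i); case: j => -[|[|//]] Hj.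
  by rewrite (_ : Ordinal Hj = 0)//; exact: val_inj.
by rewrite (_ : Ordinal Hj = 1)//; exact: val_inj.
Qed.

Lemma linear_form_diff (c d : R) (q : plane) : differentiable (fun y : plane => c * y 0 0 + d * y 0 1) q /\
  forall v, 'D_v (fun y : plane => c * y 0 0 + d * y 0 1) q = c * v 0 0 + d * v 0 1.
Proof.
have cst_mul (g : R) j : differentiable (fun y : plane => g * y 0 j) q.
  by apply: (@differentiableM _ _ (fun=> g) (fun y : plane => y 0 j)); [exact: differentiable_cst|exact: differentiable_coord].
split=> [|v]; first exact: (@differentiableD _ _ _ (fun y : plane => c * y 0 0) (fun y : plane => d * y 0 1)).
have E0 (g : R) j : 'D_v (fun y : plane => g * y 0 j) q = g * v 0 j.
  have di : differentiable (fun y : plane => y) q by case: (@is_diff_id _ _ q).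
  have e1 : 'D_v (id : plane -> plane) q = v by exact: derive_id.
  have e2 := etrans (derive_coord v j di) (congr1 (fun w : plane => w 0 j) e1).
  apply: etrans (@deriveM _ _ (fun=> g) (fun y : plane => y 0 j) q v (derivable_cst _ _ _) (diff_derivable (differentiable_coord _ _ _))) _.
  by rewrite e2 derive_cst scaler0 addr0.
apply: etrans (@deriveD _ _ _ (fun y : plane => c * y 0 0) (fun y : plane => d * y 0 1) q v (diff_derivable (cst_mul _ _)) (diff_derivable (cst_mul _ _))) _.
by rewrite !E0.
Qed.

Lemma is_derive_t (f : plane -> R) s t : differentiable f (pt s t) ->
  is_derive t 1 (fun t => f (pt s t)) ('D_(ey R) f (pt s t)).
Proof. exact: is_derive_line. Qed.

Lemma is_derive_s (f : plane -> R) s t : differentiable f (pt s t) ->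
  is_derive s 1 (fun s => f (pt s t)) ('D_(ex R) f (pt s t)).
Proof.
rewrite /pt addrC => df.
have -> : (fun s => f (s *: ex R + t *: ey R)) = (fun s => f (t *: ey R + s *: ex R)) by apply/funext => z; rewrite addrC.
exact: is_derive_line.
Qed.

Lemma is_derive1_continuous (f : R -> R) (x d : R) : is_derive x 1 f d -> {for x, continuous f}.
Proof. by move=> [df _]; apply: differentiable_continuous; apply/derivable1_diffP. Qed.

(** [W] integrates [b] vertically on the line through [p], then [a] horizontally. Differentiation
    under the integral sign is avoided: the increment of [W] is estimated directly by the mean value
    theorem in each variable. *)
Lemma closed_form_primitive : exists r W, [/\ 0 < r, ball p r `<=` U &
  forall q, ball p r q -> differentiable W q /\ forall v, 'D_v W q = a q * v 0 0 + b q * v 0 1].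
Proof.
have sDa : smooth U ('D_(ey R) a) by exact: smooth_derive.
have sDDa : smooth U ('D_(ey R) ('D_(ey R) a)) by exact: smooth_derive.
pose DDa := 'D_(ey R) ('D_(ey R) a).
have da q : U q -> differentiable a q by move=> Uq; exact: smooth_differentiable sa Uq.
have db q : U q -> differentiable b q by move=> Uq; exact: smooth_differentiable sb Uq.
have dDa q : U q -> differentiable ('D_(ey R) a) q by move=> Uq; exact: smooth_differentiable sDa Uq.
(* A bound of the second vertical derivative of [a] near [p]; it will hold on the closed square of
   half-side [r = r0 / 2]. *)
pose C := `|DDa p| + 1.
have C0 : 0 <= C by rewrite addr_ge0.
have nC : \forall q \near p, `|DDa q| < C.
  have c1 : {for p, continuous DDa} by exact: smooth_continuous sDDa Up.
  move/cvgrPdist_lt : c1 => /(_ 1 ltr01); apply: filterS => q Hq.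
  have -> : DDa q = DDa p - (DDa p - DDa q) by rewrite opprB addrC subrK.
  by apply: le_lt_trans (ler_normB _ _) _; rewrite ltrD2l.
have /nbhs_ballP[r0 /= r00 Hr0] : nbhs p [set q | U q /\ `|DDa q| < C] by exact: filterI (open_near oU Up) nC.
pose r := r0 / 2; have rp : 0 < r by rewrite divr_gt0.
have rr0 : r < r0 by rewrite /r; lra.
have inU s t : `|s - p 0 0| <= r -> `|t - p 0 1| <= r -> U (pt s t) /\ `|DDa (pt s t)| < C.
  move=> hs ht; apply: Hr0; rewrite -ball_normE /= -normrN opprB; apply: plane_norm_lt.
    by rewrite coordB pt0; exact: le_lt_trans hs rr0.
  by rewrite coordB pt1; exact: le_lt_trans ht rr0.
pose p0 := p 0 0; pose p1 := p 0 1.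
have pr0 : `|p0 - p0| <= r by rewrite subrr normr0 ltW.
pose al s t := prim (fun s => a (pt s t)) p0 r s.
pose be t := prim (fun t => b (pt p0 t)) p1 r t.
have dal s t : `|s - p0| < r -> `|t - p1| < r -> is_derive s 1 (al^~ t) (a (pt s t)).
  move=> hs ht; apply: is_derive_prim hs => z hz.
  by apply: is_derive1_continuous (is_derive_s (da _ _)); have [] := inU z t hz (ltW ht).
have dbe t : `|t - p1| < r -> is_derive t 1 be (b (pt p0 t)).
  move=> ht; apply: is_derive_prim ht => z hz.
  by apply: is_derive1_continuous (is_derive_t (db _ _)); have [] := inU p0 z pr0 hz.
pose W (q : plane) := al (q 0 0) (q 0 1) + be (q 0 1).
exists r, W; split => // [q|q Hq].
  by move=> Bq; have [] // := Hr0 q _; apply: le_ball Bq; exact: ltW.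
have [hs ht] : `|q 0 0 - p0| < r /\ `|q 0 1 - p1| < r.
  move: Hq; rewrite -ball_normE /= -normrN opprB => Hq.
  by split; apply: le_lt_trans Hq; [have := coord_le (q - p) 0|have := coord_le (q - p) 1]; rewrite !mxE.
pose s := q 0 0; pose t := q 0 1.
have Uq : U q by rewrite (ptE q); have [] := inU s t (ltW hs) (ltW ht).
pose l (y : plane) := a q * y 0 0 + b q * y 0 1.
have [dl Dl] := linear_form_diff (a q) (b q) q.
have [|dW DW] := @differentiable_approx R plane W l q dl; last by split => // v; rewrite DW; exact: Dl.
move=> e e0; have e3 : 0 < e / 3 by rewrite divr_gt0.
have /nbhs_ballP[d1 /= d10 H1] : \forall y \near q, `|a q - a y| < e / 3.
  have ca : {for q, continuous a} by exact: smooth_continuous sa Uq.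
  by move/cvgrPdist_lt : ca; apply.
have cb : {for t, continuous (fun t => b (pt p0 t))}.
  by apply: is_derive1_continuous (is_derive_t (db _ _)); have [] := inU p0 t pr0 (ltW ht).
have /nbhs_ballP[d2 /= d20 H2] : \forall y \near t, `|b (pt p0 t) - b (pt p0 y)| < e / 3.
  by move/cvgrPdist_lt : cb; apply.
pose d3 := e / 3 / (r * C + 1).
have rC : 0 < r * C + 1 by rewrite ltr_wpDl// mulr_ge0// ltW.
have d30 : 0 < d3 by rewrite divr_gt0.
pose d4 := r - `|s - p0|; have d40 : 0 < d4 by rewrite subr_gt0.
pose d5 := r - `|t - p1|; have d50 : 0 < d5 by rewrite subr_gt0.
apply/nbhs_ballP; exists (Num.min d1 (Num.min d2 (Num.min d3 (Num.min d4 d5)))) => /=.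
  by rewrite !lt_min d10 d20 d30 d40 d50.
move=> k; rewrite -ball_normE /= sub0r normrN !lt_min => /and5P[k1 k2 k3 k4 k5].
pose x0 := k 0 0; pose x1 := k 0 1.
have kx0 : `|x0| <= `|k| by exact: coord_le.
have kx1 : `|x1| <= `|k| by exact: coord_le.
pose s' := x0 + s; pose t' := x1 + t.
have hs' : `|s' - p0| < r.
  rewrite /s' -addrA; apply: le_lt_trans (ler_normD _ _) _.
  by rewrite -ltrBrDr; exact: le_lt_trans kx0 k4.
have ht' : `|t' - p1| < r.
  rewrite /t' -addrA; apply: le_lt_trans (ler_normD _ _) _.
  by rewrite -ltrBrDr; exact: le_lt_trans kx1 k5.
(* The increment splits into a horizontal move at the new height, the effect of the change of height
   on the horizontal integral, and a vertical move on the line through [p]. Each part is allowed a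
   third of the error. *)
have WE : W (k + q) - W q - (l (k + q) - l q) =
   (al s' t' - al s t' - x0 * a q) + (al s t' - al s t - x1 * (b q - b (pt p0 t))) + (be t' - be t - x1 * b (pt p0 t)).
  rewrite /W /l !mxE -/x0 -/x1 -/s -/t /s' /t'.
  by move: (al (x0 + s) (x1 + t)) (al s (x1 + t)) (al s t) (be (x1 + t)) (be t) (a q) (b q) (b (pt p0 t)) => *; ring.
have T1 : `|al s' t' - al s t' - x0 * a q| <= e / 3 * `|x0|.
  have [xi [xi1 xi2] ->] := mvt1 (fun z hz => dal z t' hz ht') hs hs'.
  have -> : s' - s = x0 by rewrite /s' addrK.
  rewrite -mulrBr normrM mulrC ler_wpM2r// distrC ltW//; apply: H1.
  rewrite -ball_normE /= -normrN opprB; apply: plane_norm_lt.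
    rewrite coordB pt0 -/s; apply: le_lt_trans xi2 _.
    by rewrite /s' addrK; exact: le_lt_trans kx0 k1.
  by rewrite coordB pt1 -/t /t' addrK; exact: le_lt_trans kx1 k1.
have T3 : `|be t' - be t - x1 * b (pt p0 t)| <= e / 3 * `|x1|.
  have [xi [xi1 xi2] ->] := mvt1 dbe ht ht'.
  have -> : t' - t = x1 by rewrite /t' addrK.
  rewrite -mulrBr normrM mulrC ler_wpM2r// distrC ltW//; apply: H2.
  rewrite -ball_normE /= distrC; apply: le_lt_trans xi2 _.
  by rewrite /t' addrK; exact: le_lt_trans kx1 k2.
have T2 : `|al s t' - al s t - x1 * (b q - b (pt p0 t))| <= e / 3 * `|x1|.
  (* [V] vanishes at [p0]. By closedness its derivative is [x1 (y1 - t) a_yy] at an intermediate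
     point, which is of second order in [k]. *)
  pose V z := al z t' - al z t - x1 * (b (pt z t) - b (pt p0 t)).
  have dV z : `|z - p0| < r -> is_derive z 1 V (a (pt z t') - a (pt z t) - x1 * 'D_(ex R) b (pt z t)).
    move=> hz; have [Uz _] := inU z t (ltW hz) (ltW ht).
    have i1 := is_deriveB (dal z t' hz ht') (dal z t hz ht).
    have i2 := is_deriveB (is_derive_s (db _ Uz)) (is_derive_cst (b (pt p0 t)) z 1).
    apply: is_derive_eq (is_deriveB i1 (is_deriveZ x1 i2)) _.
    by rewrite subr0.
  have hp0 : `|p0 - p0| < r by rewrite subrr normr0.
  have [z [hz _] Vz] := mvt1 dV hp0 hs.
  have V0 : V p0 = 0 by rewrite /V /al !prim_center !subrr mulr0 subrr.
  have -> : al s t' - al s t - x1 * (b q - b (pt p0 t)) = (s - p0) * (a (pt z t') - a (pt z t) - x1 * 'D_(ex R) b (pt z t)).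
    by rewrite -Vz V0 subr0 /V -ptE.
  have inz y : `|y - p1| < r -> U (pt z y) by move=> hy; have [] := inU z y (ltW hz) (ltW hy).
  have [y1 [hy1 hy1'] ->] := mvt1 (fun y hy => is_derive_t (da _ (inz y hy))) ht ht'.
  have [y2 [hy2 _] E2] := mvt1 (fun y hy => is_derive_t (dDa _ (inz y hy))) ht hy1.
  have -> : t' - t = x1 by rewrite /t' addrK.
  rewrite -(closed_form (inz t ht)) -mulrBr E2 !normrM.
  have D2 : `|DDa (pt z y2)| <= C by have [_ /ltW] := inU z y2 (ltW hz) (ltW hy2).
  have y1k : `|y1 - t| <= `|k| by apply: le_trans hy1' _; rewrite /t' addrK.
  have -> : e / 3 * `|x1| = `|x1| * (e / 3) by rewrite mulrC.
  rewrite mulrCA ler_wpM2l//.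
  apply: (@le_trans _ _ (r * (`|k| * C))).
    by apply: ler_pM; [exact: normr_ge0|apply: mulr_ge0; exact: normr_ge0|exact: ltW|apply: ler_pM; [exact: normr_ge0|exact: normr_ge0|exact: y1k|exact: D2]].
  apply: (@le_trans _ _ (d3 * (r * C + 1))); last by rewrite /d3 divfK// gt_eqF.
  rewrite mulrCA; apply: ler_pM; [exact: normr_ge0|by apply: mulr_ge0 => //; exact: ltW|exact: ltW k3|by rewrite lerDl].
rewrite WE; apply: le_trans (ler_normD _ _) _; apply: le_trans (lerD (ler_normD _ _) (lexx _)) _.
apply: le_trans (lerD (lerD T1 T2) T3) _.
have e3' := ltW e3.
have -> : e * `|k| = e / 3 * `|k| + e / 3 * `|k| + e / 3 * `|k| by move: (`|k|) => z; field.
by apply: lerD; [apply: lerD|]; rewrite ler_wpM2l.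
Qed.
End Primitive2.

Lemma continuous_norm_shift (R : realType) (n : nat) (p x : 'rV[R]_n) : {for x, continuous (fun x : 'rV[R]_n => `|x - p|)}.
Proof.
have H : {for x, continuous (fun x : 'rV[R]_n => x - p)}.
  by apply: (@continuousB _ _ _ (fun x : 'rV[R]_n => x) (fun=> p)); [exact: cvg_id|exact: cst_continuous].
exact: (@continuous_comp _ _ _ (fun x : 'rV[R]_n => x - p) (fun y => `|y|) x H (@norm_continuous _ _ _)).
Qed.

Lemma near_gt (R : realType) (V : normedModType R) (f : V -> R) p c : {for p, continuous f} -> c < f p -> \forall q \near p, c < f q.
Proof. by move=> cf cp; move/cvgr_gt : cf => /(_ _ cp). Qed.

Section LocalInverse.
Variable R : realType.
Local Notation plane := 'rV[R]_2.
Variables (B : set plane) (k1 k2 W1 W2 : plane -> R) (p : plane) (r : R).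
Hypothesis r0 : 0 < r.
Hypothesis BE : B = ball p r.
Hypothesis sk1 : smooth B k1.
Hypothesis sk2 : smooth B k2.
Hypothesis dW1 : forall q, B q -> differentiable W1 q /\ forall v, 'D_v W1 q = k1 q * v 0 0 + - k2 q * v 0 1.
Hypothesis dW2 : forall q, B q -> differentiable W2 q /\ forall v, 'D_v W2 q = k2 q * v 0 0 + k1 q * v 0 1.
Let c2 := k1 p ^+ 2 + k2 p ^+ 2.
Hypothesis c20 : 0 < c2.
Hypothesis kp : forall q, B q -> c2 / 2 <= k1 q * k1 p + k2 q * k2 p.

Let nrm2 (v : plane) : R := v 0 0 ^+ 2 + v 0 1 ^+ 2.
Let w q : plane := pt (W1 q) (W2 q).

Let oB : open B. Proof. by rewrite BE; exact: ball_open. Qed.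
Let Bp : B p. Proof. by rewrite BE; exact: ballxx. Qed.
Let BP q : B q <-> `|q - p| < r.
Proof. by rewrite BE -ball_normE /= -normrN opprB. Qed.

Let r2r : r / 2 < r. Proof. by rewrite ltr_pdivrMr// ltr_pMr// ltr1n. Qed.

Let nrm2_ge0 v : 0 <= nrm2 v. Proof. by rewrite addr_ge0 ?sqr_ge0. Qed.

Let sqr_norm_le (v : plane) j : `|v 0 j| ^+ 2 <= nrm2 v.
Proof.
rewrite real_normK ?num_real// /nrm2; case: j => -[|[|//]] Hj.
  by rewrite (_ : Ordinal Hj = 0) ?lerDl ?sqr_ge0//; exact: val_inj.
by rewrite (_ : Ordinal Hj = 1) ?lerDr ?sqr_ge0//; exact: val_inj.
Qed.

Let nrm2_le (v : plane) : nrm2 v <= 2 * `|v| ^+ 2.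
Proof.
have H j : v 0 j ^+ 2 <= `|v| ^+ 2.
  by rewrite -(real_normK (num_real (v 0 j))) ler_sqr ?nnegrE// coord_le.
by have := H 0; have := H 1; rewrite /nrm2 => ? ?; lra.
Qed.

Let le_nrm2 (v : plane) : `|v| ^+ 2 <= nrm2 v.
Proof.
rewrite leNgt; apply/negP => H.
have v0 : 0 < `|v|.
  by rewrite lt_def normr_ge0 andbT; apply: contraTneq H => ->; rewrite expr0n /= -leNgt.
have Hj j : `|v 0 j| < `|v|.
  by rewrite -(@ltr_pXn2r _ 2) ?nnegrE//; exact: le_lt_trans (sqr_norm_le v j) H.
by have := plane_norm_lt (Hj 0) (Hj 1); rewrite ltxx.
Qed.

Let conv x y t : B x -> B y -> 0 <= t <= 1 -> B (y + t *: (x - y)).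
Proof.
move=> /BP Bx /BP By /andP[t0 t1]; apply/BP.
have -> : y + t *: (x - y) - p = (1 - t) *: (y - p) + t *: (x - p) by apply/rowP => j; rewrite !mxE; ring.
apply: le_lt_trans (ler_normD _ _) _; rewrite !normrZ (ger0_norm t0) (@ger0_norm _ (1 - t)) ?subr_ge0//.
have [->|tn0] := eqVneq t 0; first by rewrite subr0 mul1r mul0r addr0.
have tp : 0 < t by rewrite lt_def tn0.
have H1 : (1 - t) * `|y - p| <= (1 - t) * r by rewrite ler_wpM2l ?subr_ge0// ltW.
have H2 : t * `|x - p| < t * r by rewrite ltr_pM2l.
have -> : r = (1 - t) * r + t * r by ring.
exact: ler_ltD.
Qed.

(** If [(D1, D2)] has product at least [c n / 2] with a vector of square norm [c n], then the
    Cauchy-Schwarz inequality bounds its square norm below by [c n / 4]. *)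
Let cs (a0 a1 d0 d1 c n D1 D2 : R) : c = a0 ^+ 2 + a1 ^+ 2 -> 0 < c -> n = d0 ^+ 2 + d1 ^+ 2 ->
  c / 2 * n <= D1 * (a0 * d0 - a1 * d1) + D2 * (a1 * d0 + a0 * d1) -> c / 4 * n <= D1 ^+ 2 + D2 ^+ 2.
Proof.
move=> cE c0 nE H; have n0 : 0 <= n by rewrite nE addr_ge0 ?sqr_ge0.
have [->|nn] := eqVneq n 0; first by rewrite mulr0 addr_ge0 ?sqr_ge0.
have np : 0 < n by rewrite lt_def nn.
have A0 : 0 <= c / 2 * n by rewrite !mulr_ge0// ltW.
have S1 : (c / 2 * n) ^+ 2 <= (D1 * (a0 * d0 - a1 * d1) + D2 * (a1 * d0 + a0 * d1)) ^+ 2.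
  by rewrite ler_sqr ?nnegrE//; exact: le_trans A0 H.
have S2 : (D1 * (a0 * d0 - a1 * d1) + D2 * (a1 * d0 + a0 * d1)) ^+ 2 <= (D1 ^+ 2 + D2 ^+ 2) * (c * n).
  have -> : (D1 ^+ 2 + D2 ^+ 2) * (c * n) = (D1 * (a0 * d0 - a1 * d1) + D2 * (a1 * d0 + a0 * d1)) ^+ 2
     + (D1 * (a1 * d0 + a0 * d1) - D2 * (a0 * d0 - a1 * d1)) ^+ 2 by rewrite cE nE; ring.
  by rewrite lerDl sqr_ge0.
have S3 := le_trans S1 S2.
rewrite -(ler_pM2r (mulr_gt0 c0 np)); apply: le_trans _ S3.
by rewrite le_eqVlt; apply/orP; left; apply/eqP; field.
Qed.

(** The derivative of [w] is multiplication by the complex number [k = k1 + i k2]. The mean value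
    theorem is applied to the scalar product of [w] with [k(p) (x - y)]; by [kp] the factor [k]
    turns little on the ball, so this product grows enough for [cs]. *)
Let expand x y : B x -> B y -> c2 / 4 * nrm2 (x - y) <= nrm2 (w x - w y).
Proof.
move=> Bx By; pose d := x - y.
pose e1 := k1 p * d 0 0 - k2 p * d 0 1; pose e2 := k2 p * d 0 0 + k1 p * d 0 1.
pose G q := W1 q * e1 + W2 q * e2.
have dG q : B q -> differentiable G q /\ 'D_d G q = (k1 q * k1 p + k2 q * k2 p) * nrm2 d.
  move=> Bq; have [dq1 D1] := dW1 Bq; have [dq2 D2] := dW2 Bq.
  have m1 : differentiable (fun q => W1 q * e1) q by apply: differentiableM => //; exact: differentiable_cst.
  have m2 : differentiable (fun q => W2 q * e2) q by apply: differentiableM => //; exact: differentiable_cst.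
  split; first exact: (@differentiableD _ _ _ (fun q => W1 q * e1) (fun q => W2 q * e2)).
  have M (f : plane -> R) c : differentiable f q -> 'D_d (fun q => f q * c) q = 'D_d f q * c.
    move=> df; apply: etrans (@deriveM _ _ f (fun=> c) q d (diff_derivable df) (derivable_cst _ _ _)) _.
    by rewrite derive_cst scaler0 add0r /GRing.scale /= mulrC.
  apply: etrans (@deriveD _ _ _ (fun q => W1 q * e1) (fun q => W2 q * e2) q d (diff_derivable m1) (diff_derivable m2)) _.
  rewrite (M W1 e1 dq1) (M W2 e2 dq2) D1 D2 /e1 /e2 /nrm2; move: (d 0 0) (d 0 1) (k1 q) (k2 q) (k1 p) (k2 p) => *; ring.
have [|s /andP[s0 s1] E] := @MVT_line R plane G y d 1 ltr01.
  by move=> t t01; have [] := dG _ (conv Bx By t01).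
move: E; rewrite scale1r mul1r [y + d]addrC subrK => E.
have Bs : B (y + s *: d) by apply: conv => //; rewrite !ltW.
have [_ Ds] := dG _ Bs; rewrite Ds in E.
have wE : (w x - w y) 0 0 = W1 x - W1 y /\ (w x - w y) 0 1 = W2 x - W2 y.
  by split; rewrite coordB /w ?pt0 ?pt1.
have [w0 w1] := wE; rewrite {2}/nrm2 w0 w1.
apply: (@cs (k1 p) (k2 p) (d 0 0) (d 0 1) c2 (nrm2 d)) => //.
have -> : (W1 x - W1 y) * (k1 p * d 0 0 - k2 p * d 0 1) + (W2 x - W2 y) * (k2 p * d 0 0 + k1 p * d 0 1) = G x - G y.
  by rewrite /G -/e1 -/e2; ring.
by rewrite E ler_wpM2r//; exact: kp.
Qed.

Let cW1 q : B q -> {for q, continuous W1}. Proof. by move=> Bq; apply: differentiable_continuous; have [] := dW1 Bq. Qed.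
Let cW2 q : B q -> {for q, continuous W2}. Proof. by move=> Bq; apply: differentiable_continuous; have [] := dW2 Bq. Qed.

(** Chosen for [surj]: a minimum outside the open half ball would give [c2 / 4 * (r / 2) ^ 2 <= 4 *
    nrm2 (z - w p)], against [nrm2 (z - w p) < rho]. *)
Let rho := c2 / 16 * (r / 2) ^+ 2.

Let target := [set z : plane | nrm2 (z - w p) < rho].

Let rho0 : 0 < rho.
Proof. by rewrite mulr_gt0 ?exprn_gt0 ?divr_gt0. Qed.

(** The distance from [w x] to [z] is minimized over the closed ball of radius [r / 2]. By the
    choice of [rho] the minimum is interior, hence critical, and the invertible derivative of [w]
    forces the distance to be 0. *)
Let surj z : target z -> exists2 x, B x & w x = z.
Proof.
move=> Tz; pose K := [set x : plane | `|x - p| <= r / 2].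
have KB x : K x -> B x by move=> Kx; apply/BP; exact: le_lt_trans Kx r2r.
have K0 : K p by rewrite /K /= subrr normr0 divr_ge0// ltW.
have Kc : compact K.
  apply: bounded_closed_compact.
    exists (`|p| + r); split; first exact: num_real.
    move=> M HM x Kx; apply: ltW; apply: le_lt_trans HM.
    rewrite -[x](subrK p); apply: le_trans (ler_normD _ _) _; rewrite addrC lerD2l; exact: le_trans Kx (ltW r2r).
  have -> : K = (fun x => `|x - p|) @^-1` [set y | y <= r / 2] by [].
  apply: preimage_closed (@closed_le R (r / 2)) => x _.
  exact: continuous_norm_shift.
pose f x := (W1 x - z 0 0) * (W1 x - z 0 0) + (W2 x - z 0 1) * (W2 x - z 0 1).
have fE x : f x = nrm2 (w x - z) by rewrite /nrm2 !coordB /w pt0 pt1 /f -!expr2.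
have df x : B x -> differentiable f x /\ forall v, 'D_v f x = 2 * (W1 x - z 0 0) * 'D_v W1 x + 2 * (W2 x - z 0 1) * 'D_v W2 x.
  move=> Bx; have [d1 _] := dW1 Bx; have [d2 _] := dW2 Bx.
  have S (g : plane -> R) c : differentiable g x -> differentiable (fun x => (g x - c) * (g x - c)) x /\
     forall v, 'D_v (fun x => (g x - c) * (g x - c)) x = 2 * (g x - c) * 'D_v g x.
    move=> dg; have dgc : differentiable (fun x => g x - c) x.
      by apply: (@differentiableB _ _ _ g (fun=> c)) => //; exact: differentiable_cst.
    split=> [|v]; first exact: differentiableM.
    apply: etrans (@deriveM _ _ (fun x => g x - c) (fun x => g x - c) x v (diff_derivable dgc) (diff_derivable dgc)) _.
    have -> : 'D_v (fun x => g x - c) x = 'D_v g x.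
      apply: etrans (@deriveB _ _ _ g (fun=> c) x v (diff_derivable dg) (derivable_cst _ _ _)) _.
      by rewrite derive_cst subr0.
    by rewrite /GRing.scale /=; move: ('D_v g x) (g x) => *; ring.
  have [f1 D1] := S W1 (z 0 0) d1; have [f2 D2] := S W2 (z 0 1) d2; split=> [|v].
    exact: (@differentiableD _ _ _ (fun x => (W1 x - z 0 0) * (W1 x - z 0 0)) (fun x => (W2 x - z 0 1) * (W2 x - z 0 1))).
  apply: etrans (@deriveD _ _ _ (fun x => (W1 x - z 0 0) * (W1 x - z 0 0)) (fun x => (W2 x - z 0 1) * (W2 x - z 0 1)) x v (diff_derivable f1) (diff_derivable f2)) _.
  by rewrite D1 D2.
have cf : {within K, continuous f}.
  apply: continuous_in_subspaceT => x; rewrite inE => /KB Bx.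
  by apply: differentiable_continuous; have [] := df x Bx.
have [c /set_mem Kc' cmin] := EVT_min_rV (ex_intro _ p K0) Kc cf.
have Bc := KB _ Kc'.
have ci : `|c - p| < r / 2.
  rewrite ltNge; apply/negP => H.
  have fp : f c <= f p by apply: cmin; rewrite inE.
  have h1 := expand Bc Bp.
  have h2 : (r / 2) ^+ 2 <= nrm2 (c - p).
    by apply: le_trans (le_nrm2 _); rewrite ler_sqr ?nnegrE ?divr_ge0// ltW.
  have h3 : nrm2 (w c - w p) <= 2 * nrm2 (w c - z) + 2 * nrm2 (z - w p).
    rewrite /nrm2 !coordB; move: (w c 0 0) (w c 0 1) (z 0 0) (z 0 1) (w p 0 0) (w p 0 1) => a b d e g h.
    have -> : 2 * ((a - d) ^+ 2 + (b - e) ^+ 2) + 2 * ((d - g) ^+ 2 + (e - h) ^+ 2)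
      = ((a - g) ^+ 2 + (b - h) ^+ 2) + ((a - d - (d - g)) ^+ 2 + (b - e - (e - h)) ^+ 2) by ring.
    by rewrite lerDl addr_ge0 ?sqr_ge0.
  have h4 : nrm2 (w p - z) = nrm2 (z - w p) by rewrite /nrm2 !coordB; ring.
  move: fp; rewrite !fE h4 => fp.
  have h5 : c2 / 4 * (r / 2) ^+ 2 <= 4 * nrm2 (z - w p).
    apply: le_trans (le_trans (ler_wpM2l _ h2) h1) _; first by rewrite divr_ge0// ltW.
    by apply: le_trans h3 _; lra.
  move: Tz; rewrite /target /= /rho => Tz; move: h5 Tz; move: (nrm2 _) ((r / 2) ^+ 2 ) => A D.
  have -> : c2 / 16 * D = c2 / 4 * D / 4 by field.
  by move: (c2 / 4 * D) => E; lra.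
have Dc v : 'D_v f c = 0.
  have nK : \forall x \near c, K x.
    have co := @continuous_norm_shift R 2 p c.
    move/cvgr_lt : co => /(_ _ ci); apply: filterS => x; exact: ltW.
  have [s s0 Hs] := near_line2 v (- v) nK.
  have inK t : `|t| <= s -> K (c + t *: v).
    rewrite ler_norml => /andP[t1 t2]; have [t0|t0] := leP 0 t.
      by have := Hs t 0; rewrite scale0r addr0; apply; rewrite ?lexx ?t0 ?t2 ?(ltW s0).
    have := Hs 0 (- t); rewrite scale0r addr0 scalerN scaleNr opprK; apply; first by rewrite lexx ltW.
    by apply/andP; split; lra.
  have dl (t : R) : `|t| <= s -> is_derive t (1 : R) (fun t => f (c + t *: v)) ('D_v f (c + t *: v)).
    by move=> /inK /KB Bt; apply: is_derive_line; have [] := df _ Bt.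
  have Hm : is_derive (0 : R) 1 (fun t => f (c + t *: v)) 0.
    apply: (@derive1_at_min R _ (- s) s) => [| | |t].
    - by lra.
    - move=> t; rewrite in_itv /= => /andP[? ?].
      by have [] := dl t _; rewrite // ler_norml; apply/andP; split; lra.
    - by rewrite in_itv /=; apply/andP; split; lra.
    - rewrite in_itv /= => /andP[? ?]; rewrite scale0r addr0; apply: cmin; rewrite inE; apply: inK.
      by rewrite ler_norml; apply/andP; split; lra.
  have H0 : is_derive (0 : R) 1 (fun t => f (c + t *: v)) ('D_v f (c + 0 *: v)) by apply: dl; rewrite normr0 ltW.
  have e1 := @derive_val _ _ _ _ _ _ _ Hm; have e2 := @derive_val _ _ _ _ _ _ _ H0.
  by rewrite e1 scale0r addr0 in e2.
exists c => //.
have [_ Df] := df c Bc; have [_ D1] := dW1 Bc; have [_ D2] := dW2 Bc.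
have E1 := Dc (pt 1 0); have E2 := Dc (pt 0 1); rewrite Df D1 D2 pt0 pt1 in E1; rewrite Df D1 D2 pt0 pt1 in E2.
have kc : 0 < k1 c ^+ 2 + k2 c ^+ 2.
  have := kp Bc; have [k0|k0] := eqVneq (k1 c ^+ 2 + k2 c ^+ 2) 0; last by rewrite lt_def k0 addr_ge0 ?sqr_ge0.
  move: k0 => /eqP; rewrite paddr_eq0 ?sqr_ge0// !sqrf_eq0 => /andP[/eqP -> /eqP ->].
  by rewrite !mul0r addr0 => H; exfalso; move: H; rewrite leNgt divr_gt0.
rewrite [RHS]ptE /w; move: E1 E2 kc; move: (W1 c) (W2 c) (k1 c) (k2 c) (z 0 0) (z 0 1) => a b k l s t E1 E2 kc.
have n0 : k ^+ 2 + l ^+ 2 != 0 by rewrite gt_eqF.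
have A : a - s = 0.
  apply: (mulIf n0); rewrite mul0r.
  have -> : (a - s) * (k ^+ 2 + l ^+ 2) = ((2 * (a - s) * (k * 1 + - l * 0) + 2 * (b - t) * (l * 1 + k * 0)) * k
     - (2 * (a - s) * (k * 0 + - l * 1) + 2 * (b - t) * (l * 0 + k * 1)) * l) / 2 by field.
  by rewrite E1 E2 !mul0r subrr mul0r.
have A' : b - t = 0.
  apply: (mulIf n0); rewrite mul0r.
  have -> : (b - t) * (k ^+ 2 + l ^+ 2) = ((2 * (a - s) * (k * 1 + - l * 0) + 2 * (b - t) * (l * 1 + k * 0)) * l
     + (2 * (a - s) * (k * 0 + - l * 1) + 2 * (b - t) * (l * 0 + k * 1)) * k) / 2 by field.
  by rewrite E1 E2 !mul0r addr0 mul0r.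
by congr (pt _ _); apply/eqP; rewrite -subr_eq0 ?A ?A'.
Qed.

Let psi z : plane := xget p [set x | B x /\ w x = z].

Let psiP z : target z -> B (psi z) /\ w (psi z) = z.
Proof. by move=> /surj[x Bx wx]; rewrite /psi; case: xgetP => [y _ //|/(_ x)]; case. Qed.

Let open_target : open target.
Proof.
have -> : target = (fun z => nrm2 (z - w p)) @^-1` [set y | y < rho] by [].
apply: open_comp (@open_lt R rho) => z _.
have H j : {for z, continuous (fun z : plane => (z - w p) 0 j)}.
  have -> : (fun z : plane => (z - w p) 0 j) = (fun z => z 0 j - w p 0 j) by apply/funext => y; rewrite coordB.
  by apply: (@continuousB _ _ _ (fun z : plane => z 0 j) (fun=> w p 0 j)); [exact: coord_continuous|exact: cst_continuous].
apply: (@continuousD _ _ _ (fun z : plane => (z - w p) 0 0 ^+ 2) (fun z : plane => (z - w p) 0 1 ^+ 2)).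
  exact: (@continuousM _ _ (fun z : plane => (z - w p) 0 0) (fun z : plane => (z - w p) 0 0) _ (H 0) (H 0)).
exact: (@continuousM _ _ (fun z : plane => (z - w p) 0 1) (fun z : plane => (z - w p) 0 1) _ (H 1) (H 1)).
Qed.

Let kn q : B q -> 0 < k1 q ^+ 2 + k2 q ^+ 2.
Proof.
move=> Bq; have := kp Bq; have [k0|k0] := eqVneq (k1 q ^+ 2 + k2 q ^+ 2) 0; last by rewrite lt_def k0 addr_ge0 ?sqr_ge0.
move: k0 => /eqP; rewrite paddr_eq0 ?sqr_ge0// !sqrf_eq0 => /andP[/eqP -> /eqP ->].
by rewrite !mul0r addr0 => H; exfalso; move: H; rewrite leNgt divr_gt0.
Qed.

Let n2 q := k1 q ^+ 2 + k2 q ^+ 2.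

Let psi_lip z z' : target z -> target z' -> `|psi z - psi z'| ^+ 2 <= 8 / c2 * `|z - z'| ^+ 2.
Proof.
move=> Tz Tz'; have [B1 E1] := psiP Tz; have [B2 E2] := psiP Tz'.
have := expand B1 B2; rewrite E1 E2 => H.
have := le_nrm2 (psi z - psi z'); have := nrm2_le (z - z') => h1 h2.
apply: le_trans h2 _; rewrite -(ler_pM2l (_ : 0 < c2 / 4)) ?divr_gt0//.
apply: le_trans H (le_trans h1 _); rewrite le_eqVlt; apply/orP; left; apply/eqP.
by move: (`|z - z'|) => y; field; rewrite gt_eqF.
Qed.

(** [c0] and [c1] form a row of the inverse derivative of [w]. The first-order errors of [W1] and
    [W2] are small against the increment of [psi], which [psi_lip] bounds by the increment of
    [z]. *)
Let psi_diff (z : plane) (c0 c1 : R) j : target z ->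
  (forall x0 x1 : R, (if j == 0 :> 'I_2 then x0 else x1) = c0 * (k1 (psi z) * x0 + - k2 (psi z) * x1) + c1 * (k2 (psi z) * x0 + k1 (psi z) * x1)) ->
  differentiable (fun z => psi z 0 j) z /\ forall v, 'D_v (fun z => psi z 0 j) z = c0 * v 0 0 + c1 * v 0 1.
Proof.
move=> Tz alg0; have [dl Dl] := linear_form_diff c0 c1 z.
have alg (x0 x1 h0 h1 e : R) : 0 <= e -> `|h0 - (k1 (psi z) * x0 + - k2 (psi z) * x1)| <= e ->
    `|h1 - (k2 (psi z) * x0 + k1 (psi z) * x1)| <= e ->
    `|(if j == 0 then x0 else x1) - (c0 * h0 + c1 * h1)| <= (`|c0| + `|c1|) * e.
  move=> e0 H0 H1; rewrite alg0.
  move: H0 H1; move: (k1 (psi z) * x0 + - k2 (psi z) * x1) (k2 (psi z) * x0 + k1 (psi z) * x1) => A0 A1 H0 H1.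
  have -> : c0 * A0 + c1 * A1 - (c0 * h0 + c1 * h1) = - (c0 * (h0 - A0) + c1 * (h1 - A1)) by ring.
  rewrite normrN mulrDl; apply: le_trans (ler_normD _ _) _; rewrite !normrM.
  by apply: lerD; apply: ler_wpM2l.
have [Bx Ex] := psiP Tz; set x := psi z in Bx Ex alg *.
have [d1 D1] := dW1 Bx; have [d2 D2] := dW2 Bx.
have [|dp Dp] := @differentiable_approx R plane (fun z => psi z 0 j) (fun y => c0 * y 0 0 + c1 * y 0 1) z dl; last first.
  by split => // v; rewrite Dp; exact: Dl.
move=> e e0.
(* [L] is the Lipschitz constant of [psi] and [m] dominates [|c0| + |c1|]; [e'] is such that
   [m e' L = e]. *)
pose L := Num.sqrt (8 / c2); have L0 : 0 < L by rewrite sqrtr_gt0 divr_gt0.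
pose m := `|c0| + `|c1| + 1; have m0 : 0 < m by rewrite ltr_wpDl// addr_ge0.
pose e' := e / (m * L); have e'0 : 0 < e' by rewrite divr_gt0// mulr_gt0.
have /nbhs_ballP[r1 /= r10 H1] := diff_approx d1 e'0.
have /nbhs_ballP[r2 /= r20 H2] := diff_approx d2 e'0.
have nT : \forall k \near (0 : plane), target (k + z).
  have cs' : {for 0, continuous (fun k : plane => k + z)} by apply: (@continuousD _ _ _ (fun k : plane => k) (fun=> z)); [exact: cvg_id|exact: cst_continuous].
  have T0 : nbhs (0 + z) target by rewrite add0r; exact: (open_near open_target Tz).
  exact: cs' T0.
have nr : \forall k \near (0 : plane), L * `|k| < Num.min r1 r2.
  apply/nbhs_ballP; exists (Num.min r1 r2 / L) => /=; first by rewrite divr_gt0// lt_min r10.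
  by move=> k; rewrite -ball_normE /= sub0r normrN ltr_pdivlMr// mulrC.
apply: filterS2 nT nr => k Tk kr.
have [Bk Ek] := psiP Tk; set x' := psi (k + z) in Bk Ek *.
pose d := x' - x.
have dle : `|d| <= L * `|k|.
  have HL := psi_lip Tk Tz; rewrite addrK in HL.
  have LE : (L * `|k|) ^+ 2 = 8 / c2 * `|k| ^+ 2 by rewrite exprMn sqr_sqrtr// divr_ge0// ltW.
  have Lk : 0 <= L * `|k| by rewrite mulr_ge0// ltW.
  by rewrite -LE ler_sqr ?nnegrE// in HL.
have dr : `|d| < Num.min r1 r2 by exact: le_lt_trans dle kr.
move: dr; rewrite lt_min => /andP[dr1 dr2].
have h1 := H1 d; rewrite -ball_normE /= sub0r normrN in h1; have {}h1 := h1 dr1.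
have h2 := H2 d; rewrite -ball_normE /= sub0r normrN in h2; have {}h2 := h2 dr2.
rewrite D1 /d subrK in h1; rewrite D2 /d subrK in h2.
have k0E : W1 x' - W1 x = k 0 0.
  have := congr1 (fun v : plane => v 0 0) Ek; have := congr1 (fun v : plane => v 0 0) Ex.
  by rewrite /w !pt0 !mxE => -> ->; rewrite addrK.
have k1E : W2 x' - W2 x = k 0 1.
  have := congr1 (fun v : plane => v 0 1) Ek; have := congr1 (fun v : plane => v 0 1) Ex.
  by rewrite /w !pt1 !mxE => -> ->; rewrite addrK.
rewrite k0E in h1; rewrite k1E in h2.
have ed : 0 <= e' * `|d| by rewrite mulr_ge0// ltW.
have := alg _ _ _ _ _ ed h1 h2 => A.
have -> : x' 0 j - x 0 j - (c0 * (k + z) 0 0 + c1 * (k + z) 0 1 - (c0 * z 0 0 + c1 * z 0 1))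
   = (if j == 0 then d 0 0 else d 0 1) - (c0 * k 0 0 + c1 * k 0 1).
  have -> : (if j == 0 then d 0 0 else d 0 1) = x' 0 j - x 0 j.
    rewrite -coordB -/d; case: j {alg alg0 A} => -[|[|//]] Hj /=; congr (d 0 _); exact: val_inj.
  by rewrite [(k + z) 0 0]mxE [(k + z) 0 1]mxE; ring.
apply: le_trans A _; apply: (@le_trans _ _ (m * (e' * (L * `|k|)))).
  by apply: ler_pM; rewrite ?addr_ge0// ?lerDl// ler_wpM2l// ltW.
rewrite /e' le_eqVlt; apply/orP; left; apply/eqP; field; by rewrite !gt_eqF.
Qed.
(** [cf0 j] and [cf1 j] are the entries of row [j] of the inverse of the matrix of multiplication by
    [k1 + i k2]. *)
Let cf0 (j : 'I_2) q : R := if j == 0 then k1 q * (n2 q)^-1 else - k2 q * (n2 q)^-1.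
Let cf1 (j : 'I_2) q : R := if j == 0 then k2 q * (n2 q)^-1 else k1 q * (n2 q)^-1.

Let psi_der j z : target z -> differentiable (fun z => psi z 0 j) z /\
  forall v, 'D_v (fun z => psi z 0 j) z = cf0 j (psi z) * v 0 0 + cf1 j (psi z) * v 0 1.
Proof.
move=> Tz; apply: psi_diff => // x0 x1.
have [Bx _] := psiP Tz; have := kn Bx; rewrite /cf0 /cf1 /n2.
move: (k1 _) (k2 _) => a b ab0; have ab : a ^+ 2 + b ^+ 2 != 0 by rewrite gt_eqF.
by case: (j == 0); field.
Qed.

Let smooth_n2 : smooth B (fun q => (n2 q)^-1).
Proof.
apply: (smooth_inv oB) => [q Bq|]; first by rewrite gt_eqF// kn.
apply: (eq_smooth oB (f := fun q => k1 q * k1 q + k2 q * k2 q)); first by move=> q _; rewrite /n2 !expr2.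
by apply: (smooth_add oB); apply: (smooth_mul oB).
Qed.

Let smooth_cf (v : plane) (j : 'I_2) : smooth B (fun q => cf0 j q * v 0 0 + cf1 j q * v 0 1 : R).
Proof.
have s0 : smooth B (cf0 j).
  by rewrite /cf0; case: (j == 0); apply: (smooth_mul oB) => //; exact: smooth_opp.
have s1 : smooth B (cf1 j) by rewrite /cf1; case: (j == 0); apply: (smooth_mul oB).
apply: (smooth_add oB); [apply: (smooth_mul oB) s0 _|apply: (smooth_mul oB) s1 _]; exact: smooth_cst oB.
Qed.

(** The derivatives of [psi] are smooth functions of [psi] itself, so order [n] for [psi] gives
    order [n] for its derivatives. *)
Let psi_Ck n : forall j, Ck n target (fun z => psi z 0 j : R).
Proof.
elim: n => [|n IH] j /=.
  by move=> z Tz; apply: differentiable_continuous; have [] := psi_der j Tz.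
split=> [z Tz|v]; first by have [] := psi_der j Tz.
have sP : Ck n target psi by apply: Ck_row.
have sC := Ck_comp open_target oB (fun z Tz => (psiP Tz).1) sP (smooth_cf v j n).
apply: (eq_Ck open_target) sC => z Tz /=.
by have [_ ->] := psi_der j Tz.
Qed.

Lemma local_inverse : exists U (psi : plane -> plane), [/\ open U, smooth U psi, {in U &, injective psi},
  (forall z, U z -> B (psi z)) /\ (psi @` U) p &
  forall z, U z -> 'D_(ex R) psi z = pt (k1 (psi z) / (k1 (psi z) ^+ 2 + k2 (psi z) ^+ 2)) (- k2 (psi z) / (k1 (psi z) ^+ 2 + k2 (psi z) ^+ 2)) /\
    'D_(ey R) psi z = pt (k2 (psi z) / (k1 (psi z) ^+ 2 + k2 (psi z) ^+ 2)) (k1 (psi z) / (k1 (psi z) ^+ 2 + k2 (psi z) ^+ 2))].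
Proof.
have sP : smooth target psi by move=> n; apply: Ck_row => // j; exact: psi_Ck.
have inj : {in target &, injective psi}.
  move=> z z'; rewrite !inE => /psiP[_ E1] /psiP[_ E2] E.
  by rewrite -E1 -E2 E.
have Tp : target (w p) by rewrite /target /nrm2 /= subrr !mxE expr0n addr0.
exists target, psi; split => //.
- split; first by move=> z /psiP[].
  exists (w p) => //; have [B1 E1] := psiP Tp.
  have := expand B1 Bp; rewrite E1 subrr /nrm2 ![(0 : plane) _ _]mxE expr0n addr0 => H.
  have N0 : (psi (w p) - p) 0 0 ^+ 2 + (psi (w p) - p) 0 1 ^+ 2 = 0.
    apply/eqP; rewrite eq_le addr_ge0 ?sqr_ge0// andbT.
    by move: H; rewrite pmulr_rle0// divr_gt0.
  move: N0 => /eqP; rewrite paddr_eq0 ?sqr_ge0// !sqrf_eq0 !coordB !subr_eq0 => /andP[/eqP e0 /eqP e1].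
  by apply: etrans (ptE _) _; rewrite e0 e1; exact: esym (ptE p).
- move=> z Tz; have dz := smooth_differentiable sP Tz.
  have E v : 'D_v psi z = pt (cf0 0 (psi z) * v 0 0 + cf1 0 (psi z) * v 0 1) (cf0 1 (psi z) * v 0 0 + cf1 1 (psi z) * v 0 1).
    rewrite [LHS]ptE -(derive_coord v 0 dz) -(derive_coord v 1 dz).
    by have [_ ->] := psi_der 0 Tz; have [_ ->] := psi_der 1 Tz.
  have x0 : (ex R) 0 0 = 1 /\ (ex R) 0 1 = 0 by rewrite /ex !mxE.
  have y0 : (ey R) 0 0 = 0 /\ (ey R) 0 1 = 1 by rewrite /ey !mxE.
  rewrite !E x0.1 x0.2 y0.1 y0.2 /cf0 /cf1 /n2 /= !mulr0 !mulr1 !addr0 !add0r.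
  by split.
Qed.
End LocalInverse.

Transparent cdiff.

(** * Holomorphic square roots and charts *)

Section HolomorphicChart.
Variable R : realType.
Local Notation C := R[i].
Local Notation plane := 'rV[R]_2.
Local Notation D := (@unit_disk R).

Lemma cauchy_riemann (U : set plane) (k : plane -> C) q : csmooth U k -> U q -> dzbar k q = 0 ->
  'D_(ey R) (fun q => complex.Re (k q)) q = - 'D_(ex R) (fun q => complex.Im (k q)) q /\
  'D_(ey R) (fun q => complex.Im (k q)) q = 'D_(ex R) (fun q => complex.Re (k q)) q.
Proof.
move=> sk Uq k0; have E : cdiff (ey R) k q = 'i * cdiff (ex R) k q by rewrite cdiff_eyE cdiff_exE k0 subr0 addr0.
have E1 := congr1 (@complex.Re R) E; have E2 := congr1 (@complex.Im R) E.
rewrite ReM /cdiff /= in E1; rewrite ImM /cdiff /= in E2.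
move: E1 E2; move: ('D_(ey R) _ q) ('D_(ey R) _ q) ('D_(ex R) _ q) ('D_(ex R) _ q) => a b c d E1 E2.
by split; [rewrite E1|rewrite E2]; ring.
Qed.

(** The principal root [(|G| + Re G + i Im G) / sqrt (2 (|G| + Re G))]; the sign condition at [p]
    keeps [|G| + Re G] positive nearby. Holomorphy follows by differentiating the equation
    [s ^ 2 = G]. *)
Lemma holomorphic_sqrt (U : set plane) (G : plane -> C) p : open U -> csmooth U G -> U p ->
  (forall q, U q -> dzbar G q = 0) -> G p != 0 -> 0 <= complex.Re (G p) ->
  exists U' s, [/\ open U', U' p, U' `<=` U, csmooth U' s & forall q, U' q -> [/\ s q ^+ 2 = G q, s q != 0 & dzbar s q = 0]].
Proof.
move=> oU sG Up hG G0 Gp.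
pose Rr q := complex.Re (G q); pose Ii q := complex.Im (G q).
have sR : smooth U Rr by exact: (csmooth_re (csmooth := sG)).
have sI : smooth U Ii by exact: (csmooth_im (csmooth := sG)).
pose nn q := Rr q * Rr q + Ii q * Ii q.
have snn : smooth U nn by apply: (smooth_add oU); apply: (smooth_mul oU).
have nnp : 0 < nn p by rewrite /nn -!expr2; exact: sumsq_gt0.
have near_nn : \forall q \near p, 0 < nn q.
  exact: near_gt (smooth_continuous snn Up) nnp.
have [U1 [oU1 U1p] HU1] : exists2 B, open_nbhs p B & B `<=` [set q | U q /\ 0 < nn q].
  have : nbhs p [set q | U q /\ 0 < nn q] by exact: filterI (open_near oU Up) near_nn.
  by rewrite nbhsE => -[B oB HB]; exists B.
have U1U : U1 `<=` U by move=> q /HU1[].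
have sR1 := smoothW U1U sR; have sI1 := smoothW U1U sI; have snn1 := smoothW U1U snn.
pose a q := Num.sqrt (nn q) + Rr q.
have sa : smooth U1 a by apply: (smooth_add oU1) sR1; apply: (smooth_sqrt oU1) snn1 => q /HU1[].
have ap : 0 < a p by rewrite ltr_pwDl// sqrtr_gt0.
have near_a : \forall q \near p, 0 < a q.
  exact: near_gt (smooth_continuous sa U1p) ap.
have [U2 [oU2 U2p] HU2] : exists2 B, open_nbhs p B & B `<=` [set q | U1 q /\ 0 < a q].
  have : nbhs p [set q | U1 q /\ 0 < a q] by exact: filterI (open_near oU1 U1p) near_a.
  by rewrite nbhsE => -[B oB HB]; exists B.
have U21 : U2 `<=` U1 by move=> q /HU2[].
have sa2 := smoothW U21 sa; have sI2 := smoothW U21 sI1.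
pose t q := (Num.sqrt (2 * a q))^-1.
have a2 q : U2 q -> 0 < 2 * a q by move=> /HU2[_ a0]; rewrite mulr_gt0.
have st : smooth U2 t.
  apply: (smooth_inv oU2) => [q Uq|]; first by rewrite gt_eqF// sqrtr_gt0 a2.
  by apply: (smooth_sqrt oU2 a2); apply: (smooth_mul oU2) sa2; exact: smooth_cst oU2.
pose s q : C := (a q * t q) +i* (Ii q * t q).
have ss : csmooth U2 s by split => //; apply: (smooth_mul oU2).
have s2 q : U2 q -> s q * s q = G q.
  move=> Uq; have [U1q a0] := HU2 _ Uq; have [_ n0] := HU1 _ U1q.
  have tt : t q * t q = (2 * a q)^-1 by rewrite /t -invfM -expr2 sqr_sqrtr// ltW// a2.
  have aR : a q * a q = nn q + 2 * (a q - Rr q) * Rr q + Rr q * Rr q.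
    rewrite /a addrK; have E : Num.sqrt (nn q) * Num.sqrt (nn q) = nn q by rewrite -expr2 sqr_sqrtr// ltW.
    by move: (Num.sqrt (nn q)) E => S E; rewrite -E; ring.
  apply: complexP; rewrite ?ReM ?ImM /=.
    have -> : a q * t q * (a q * t q) - Ii q * t q * (Ii q * t q) = (a q * a q - Ii q * Ii q) * (t q * t q) by ring.
    rewrite tt aR /nn -/(Rr q); move: (a q) (Rr q) (Ii q) a0 => A B E A0; field; by rewrite gt_eqF.
  have -> : a q * t q * (Ii q * t q) + Ii q * t q * (a q * t q) = 2 * a q * Ii q * (t q * t q) by ring.
  rewrite tt -/(Ii q); move: (a q) (Ii q) a0 => A E A0; field; by rewrite gt_eqF.
have Gn q : U2 q -> G q != 0.
  move=> Uq; have [U1q _] := HU2 _ Uq; have [_ n0] := HU1 _ U1q.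
  by apply: contraTneq n0 => g0; rewrite /nn /Rr /Ii g0 /= !mul0r addr0 ltxx.
have sn q : U2 q -> s q != 0.
  by move=> Uq; apply: contraTneq (Gn _ Uq) => s0; rewrite -(s2 _ Uq) s0 mul0r eqxx.
exists U2, s; split => //; first exact: subset_trans U21 U1U.
move=> q Uq; split; [by rewrite expr2 s2|exact: sn|].
have E : dzbar (fun q => s q * s q) q = dzbar s q * s q + s q * dzbar s q by exact: (dzbarM Uq (sf := ss) (sg := ss)).
have H := eq_dzbar Uq oU2 s2; rewrite (hG _ (U1U _ (U21 _ Uq))) E in H.
apply: (mulfI (sn _ Uq)); rewrite mulr0; apply: (mulfI (@half_neq0 R)); rewrite mulr0 -[RHS]H.
by move: (s q) (dzbar s q) => *; ring.
Qed.

(** [psi] is the inverse of a primitive of [1 / s] with [s ^ 2 = c g], so its complex derivative is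
    [s \o psi]. *)
Lemma holomorphic_chart (g : plane -> C) p : csmooth D g -> (forall q, D q -> dzbar g q = 0) ->
  (forall q, D q -> g q != 0) -> D p ->
  exists U psi (c : R), [/\ open U, smooth U psi, {in U &, injective psi}, (forall z, U z -> D (psi z)) /\ (psi @` U) p &
   forall z, U z -> [/\ speed psi (ey R) z = 'i * speed psi (ex R) z, speed psi (ex R) z != 0 & speed psi (ex R) z ^+ 2 = c%:C * g (psi z)]].
Proof.
move=> sg hg g0 Dp; have oD := @open_disk R.
(* The sign of the real factor is free; it is chosen to meet the condition of [holomorphic_sqrt] at
   [p]. *)
have [c [c1 cp]] : exists c : R, c != 0 /\ 0 <= complex.Re (c%:C * g p).
  have [h|h] := leP 0 (complex.Re (g p)).
    by exists 1; split; [exact: oner_neq0|rewrite mul1r].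
  exists (-1); split; first by rewrite oppr_eq0 oner_neq0.
  by rewrite ReM /= mul0r subr0 mulN1r oppr_ge0 ltW.
pose G q := c%:C * g q.
have sc : csmooth D (fun=> c%:C) by exact: csmooth_disk_cst.
have sG : csmooth D G by exact: csmooth_mul.
have hG q : D q -> dzbar G q = 0.
  move=> Dq; have E : dzbar G q = dzbar (fun=> c%:C) q * g q + c%:C * dzbar g q by exact: (dzbarM Dq (sf := sc) (sg := sg)).
  by rewrite E dzbar_cst (hg _ Dq) mul0r mulr0 addr0.
have G0 : G p != 0 by rewrite mulf_neq0// ?g0// fmorph_eq0.
have [U [s [oU Up UD ss Hs]]] := holomorphic_sqrt oD sG Dp hG G0 cp.
pose k q := (s q)^-1.
have sn q : U q -> s q != 0 by move=> /Hs[].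
have sk : csmooth U k by exact: csmooth_inv.
have hk q : U q -> dzbar k q = 0.
  move=> Uq; have E : dzbar k q = - dzbar s q / s q ^+ 2 by exact: (dzbarV Uq (sf := ss) sn).
  by have [_ _ ds] := Hs _ Uq; rewrite E ds oppr0 mul0r.
pose k1 q := complex.Re (k q); pose k2 q := complex.Im (k q).
have sk1 : smooth U k1 by exact: (csmooth_re (csmooth := sk)).
have sk2 : smooth U k2 by exact: (csmooth_im (csmooth := sk)).
have snk2 : smooth U (fun q => - k2 q) by exact: smooth_opp.
have CR q : U q -> 'D_(ey R) k1 q = - 'D_(ex R) k2 q /\ 'D_(ey R) k2 q = 'D_(ex R) k1 q.
  by move=> Uq; exact: cauchy_riemann sk Uq (hk _ Uq).
(* [W1] and [W2] are the real and imaginary parts of a primitive of [k]; the two forms are closed by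
   the Cauchy-Riemann equations. *)
have [r1 [W1 [r10 B1 H1]]] := closed_form_primitive oU Up sk1 snk2 (fun q Uq => etrans (CR q Uq).1
  (esym (@deriveN _ _ _ k2 q (ex R) (diff_derivable (smooth_differentiable sk2 Uq))))).
have [r2 [W2 [r20 B2 H2]]] := closed_form_primitive oU Up sk2 sk1 (fun q Uq => (CR q Uq).2).
pose c2 := k1 p ^+ 2 + k2 p ^+ 2.
have c20 : 0 < c2 by apply: sumsq_gt0; rewrite invr_eq0 sn.
pose m q := k1 q * k1 p + k2 q * k2 p.
have sm : smooth U m by apply: (smooth_add oU); apply: (smooth_mul oU) => //; exact: smooth_cst oU.
have nm : \forall q \near p, c2 / 2 < m q.
  apply: near_gt (smooth_continuous sm Up) _.
  by rewrite /m -!expr2 -/c2; lra.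
have /nbhs_ballP[r3 /= r30 H3] := nm.
pose r := Num.min r1 (Num.min r2 r3).
have r0 : 0 < r by rewrite !lt_min r10 r20 r30.
have Br1 : ball p r `<=` ball p r1 by apply: le_ball; rewrite ge_min lexx.
have Br2 : ball p r `<=` ball p r2 by apply: le_ball; rewrite !ge_min lexx orbT.
have Br3 : ball p r `<=` ball p r3 by apply: le_ball; rewrite !ge_min lexx !orbT.
have BU : ball p r `<=` U by exact: subset_trans Br1 B1.
have [V [psi [oV sV iV [VB Vp] HV]]] := @local_inverse R (ball p r) k1 k2 W1 W2 p r r0 erefl (smoothW BU sk1) (smoothW BU sk2)
  (fun q Bq => H1 q (Br1 _ Bq)) (fun q Bq => H2 q (Br2 _ Bq)) c20 (fun q Bq => ltW (H3 q (Br3 _ Bq))).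
exists V, psi, c; split => //; first by split => // z Vz; exact: UD (BU _ (VB _ Vz)).
move=> z Vz; have Uz := BU _ (VB _ Vz); have [Ex Ey] := HV z Vz; have [s2 s0 _] := Hs _ Uz.
have kz : k (psi z) != 0 by rewrite invr_eq0.
have sE : speed psi (ex R) z = s (psi z).
  have E : s (psi z) = (k (psi z))^-1 by rewrite /k invrK.
  by rewrite /speed Ex /of_plane pt0 pt1 E /k1 /k2; case: (k (psi z)) => a b; rewrite /= mulNr.
split; [|by rewrite sE|by rewrite sE s2].
rewrite /speed Ex Ey /of_plane !pt0 !pt1.
by apply: complexP => /=; ring.
Qed.
End HolomorphicChart.
Opaque cdiff.

(** * Lorentz transitivity, direct frames and models of the space forms *)

Section Transitivity.
Variable R : realType.
Local Notation J := (minkowski_gram R 4).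
Local Notation mk := (sprod J).
Implicit Types u v a : 'rV[R]_(4 + 1).

Definition reflection a : 'M[R]_(4 + 1) := 1%:M - (2 / mk a a) *: (J *m a^T *m a).

Lemma reflectionE a u : u *m reflection a = u - (2 / mk a a * mk u a) *: a.
Proof.
rewrite /reflection mulmxBr mulmx1 -scalemxAr !mulmxA; congr (_ - _).
by rewrite -scalerA; congr (_ *: _); rewrite [u *m J *m a^T]mx11_scalar mul_scalar_mx.
Qed.

Lemma lorentz_reflection a : mk a a != 0 -> lorentz (reflection a).
Proof.
move=> a0; apply: lorentz_ext => u v; rewrite !reflectionE.
rewrite !(sprodDl, sprodDr, sprodNl, sprodNr, sprodZl, sprodZr) (mkC a v).
by move: (mk u v) (mk u a) (mk v a) (mk a a) a0 => *; field.
Qed.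

Lemma lorentz_opp (M : 'M[R]_(4 + 1)) : lorentz M -> lorentz (- M).
Proof. by move=> LM; rewrite /lorentz linearN /= !mulNmx mulmxN opprK. Qed.

(** The reflection in [u - v] maps [u] to [v] unless [u - v] is null. In that case [u + v] is not
    null, by the parallelogram identity, and minus the reflection in [u + v] does it. *)
Lemma lorentz_transitive u v : mk u u = mk v v -> mk v v != 0 -> exists2 M, lorentz M & u *m M = v.
Proof.
move=> uv v0.
have [d0|d0] := eqVneq (mk (u - v) (u - v)) 0; last first.
  exists (reflection (u - v)); first exact: lorentz_reflection.
  rewrite reflectionE.
  have E : mk (u - v) (u - v) = 2 * mk u (u - v).
    by rewrite !(sprodDl, sprodDr, sprodNl, sprodNr) (mkC v u) uv; ring.
  have -> : 2 / mk (u - v) (u - v) * mk u (u - v) = 1.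
    by move: d0; rewrite E => d0; field; move: d0; rewrite mulf_eq0 negb_or => /andP[].
  by rewrite scale1r opprB addrC subrK.
have s0 : mk (u + v) (u + v) = 4 * mk v v.
  have : mk (u + v) (u + v) + mk (u - v) (u - v) = 4 * mk v v.
    by rewrite !(sprodDl, sprodDr, sprodNl, sprodNr) uv; ring.
  by rewrite d0 addr0.
have s1 : mk (u + v) (u + v) != 0 by rewrite s0 mulf_neq0// pnatr_eq0.
exists (- reflection (u + v)); first exact/lorentz_opp/lorentz_reflection.
rewrite mulmxN reflectionE.
have E : mk (u + v) (u + v) = 2 * mk u (u + v).
  by rewrite !(sprodDl, sprodDr) (mkC v u) uv; ring.
have -> : 2 / mk (u + v) (u + v) * mk u (u + v) = 1.
  by move: s1; rewrite E => s1; field; move: s1; rewrite mulf_eq0 negb_or => /andP[].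
by rewrite scale1r opprB [u + v]addrC addrK.
Qed.
End Transitivity.

Section FrameLemmas.
Variable R : realType.

Lemma gram_row n (J F : 'M[R]_n) j k : (F *m J *m F^T) j k = sprod J (row j F) (row k F).
Proof.
rewrite /sprod -row_mul [LHS]mxE [RHS]mxE.
by apply: eq_bigr => l _; rewrite [in RHS]mxE; congr (_ * _); rewrite !mxE.
Qed.

Lemma frame_normal n (J F : 'M[R]_n) i w : J *m J = 1%:M -> F *m J *m F^T = J ->
  (forall j, j != i -> sprod J (row j F) w = 0) -> sprod J w w = sprod J (row i F) (row i F) -> J i i = 1 ->
  (forall j, j != i -> J j i = 0) ->
  exists2 c : R, c ^+ 2 = 1 & row i F = c *: w.
Proof.
move=> JJ FJF tw ww Jii Joff.
have rowsJ j k : sprod J (row j F) (row k F) = J j k.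
  by rewrite -[in RHS]FJF gram_row.
pose c := sprod J (row i F) w.
have inv : (J *m F^T *m J) *m F = 1%:M.
  by apply: mulmx1C; rewrite !mulmxA FJF.
have z0 (z : 'rV[R]_n) : (forall j, sprod J (row j F) z = 0) -> z = 0.
  move=> zF; have E : F *m J *m z^T = 0.
    by apply/matrixP => j k; rewrite (ord1 k) [RHS]mxE -(zF j) /sprod -!row_mul [RHS]mxE.
  have : J *m z^T = 0 by rewrite -[J]mul1mx -inv -!mulmxA [F *m _]mulmxA E !mulmx0.
  by move=> /(congr1 (mulmx J)); rewrite mulmxA JJ mul1mx mulmx0 => /(congr1 trmx); rewrite trmxK trmx0.
have wE : w = c *: row i F.
  apply/eqP; rewrite -subr_eq0; apply/eqP/z0 => j; rewrite sprodDr sprodNr sprodZr rowsJ.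
  have [->|ji] := eqVneq j i; first by rewrite Jii mulr1 subrr.
  by rewrite tw// Joff// mulr0 subrr.
have c1 : c ^+ 2 = 1.
  by move: ww; rewrite [in LHS]wE sprodZl sprodZr rowsJ Jii mulr1 -expr2.
by exists c => //; rewrite wE scalerA -expr2 c1 scale1r.
Qed.

Lemma det_scale_row n (F : 'M[R]_n) (i : 'I_n) (e : R) :
  \det (\matrix_(j < n) (if j == i then e *: row j F else row j F)) = e * \det F.
Proof.
rewrite (@determinant_multilinear _ _ _ F F i e 0) ?mul0r ?addr0//.
- by apply/rowP => k; rewrite !mxE eqxx !mxE mul0r addr0.
- by apply/matrixP => j k; rewrite !mxE eq_sym (negbTE (neq_lift _ _)) mxE.
- by apply/matrixP => j k; rewrite !mxE eq_sym (negbTE (neq_lift _ _)) mxE.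
Qed.

Lemma smooth_det (V : normedModType R) (U : set V) n (F : V -> 'M[R]_n) : open U ->
  (forall i j, smooth U (fun q => F q i j)) -> smooth U (fun q => \det (F q)).
Proof.
move=> oU sF; rewrite /determinant; apply: smooth_sum => // s _.
apply: smooth_mul => //; first exact: smooth_cst oU.
by move=> k; apply: Ck_prod => // i _; exact: sF.
Qed.

Lemma smooth_sqr1_const (d : 'rV[R]_2 -> R) : smooth (@unit_disk R) d ->
  (forall q, unit_disk q -> d q ^+ 2 = 1) -> forall q, unit_disk q -> d q = d 0.
Proof.
move=> sd d1 q Dq; have oD := @open_disk R.
apply: (derive0_ray (f := d)) => t t01.
  exact: smooth_differentiable sd (disk_ray Dq t01).
have Dt := disk_ray Dq t01; have dd := smooth_differentiable sd Dt.
have H : 'D_q (fun y => d y * d y) (t *: q) = 0.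
  by apply: (derive_eq_cst oD (c := 1) q Dt) => y Dy; rewrite -expr2; exact: d1.
move: H; rewrite (@deriveM _ _ d d (t *: q) q (diff_derivable dd) (diff_derivable dd)).
rewrite /GRing.scale /= -mulr2n => /eqP; rewrite mulrn_eq0 /= mulf_eq0 => /orP[/eqP d0|/eqP //].
by move: (d1 _ Dt); rewrite d0 expr0n /= => /eqP; rewrite eq_sym oner_eq0.
Qed.

(** The quotient of [d] by its absolute value is smooth with square 1. *)
Lemma smooth_sign_const (d : 'rV[R]_2 -> R) : smooth (@unit_disk R) d ->
  (forall q, unit_disk q -> d q != 0) -> forall q, unit_disk q -> (0 < d q) = (0 < d 0).
Proof.
move=> sd d0 q Dq; have oD := @open_disk R.
pose s q := d q * (Num.sqrt (d q * d q))^-1.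
have dd0 p : unit_disk p -> 0 < d p * d p by move=> Dp; rewrite -expr2 lt_def sqrf_eq0 d0// sqr_ge0.
have ss : smooth (@unit_disk R) s.
  apply: (smooth_mul oD) => //; apply: (smooth_inv oD) => [p Dp|]; first by rewrite gt_eqF// sqrtr_gt0 dd0.
  by apply: (smooth_sqrt oD dd0); exact: smooth_mul.
have s1 p : unit_disk p -> s p ^+ 2 = 1.
  by move=> Dp; rewrite /s exprMn exprVn sqr_sqrtr ?(ltW (dd0 _ Dp))// expr2 divff// gt_eqF ?dd0.
have sE p : unit_disk p -> (0 < s p) = (0 < d p).
  by move=> Dp; rewrite /s pmulr_lgt0// invr_gt0 sqrtr_gt0 dd0.
by rewrite -sE// (smooth_sqr1_const ss s1 Dq) sE//; exact: disk0.
Qed.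

Lemma expR_half_ln (a : R) : 0 < a -> expR (- (ln (2 * (a / 2)) / 2)) = (Num.sqrt a)^-1.
Proof.
move=> a0; have -> : 2 * (a / 2) = a by field.
rewrite expRN; congr (_^-1); apply/eqP; rewrite -(@eqrXn2 _ 2) ?expR_ge0 ?sqrtr_ge0//.
rewrite sqr_sqrtr ?ltW// -expRM_natl -mulr_natl.
by rewrite (_ : _ * _ = ln a) ?lnK//; field.
Qed.

Lemma unit_tangentE n (J : 'M[R]_n) (f : 'rV[R]_2 -> 'rV[R]_n) v p : J^T = J -> differentiable f p ->
  0 < sprod J ('D_(ex R) f p) ('D_(ex R) f p) ->
  sprod J ('D_(ex R) f p) ('D_(ex R) f p) = sprod J ('D_(ey R) f p) ('D_(ey R) f p) ->
  unit_tangent J f v p = (Num.sqrt (sprod J ('D_(ex R) f p) ('D_(ex R) f p)))^-1 *: 'D_v f p.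
Proof.
move=> JT df a0 aa; rewrite /unit_tangent /conformal_factor (sqnorm_dzE JT df aa); congr (_ *: _).
exact: expR_half_ln.
Qed.
End FrameLemmas.

Section DirectFrames.
Variables (R : realType) (n : nat) (Jn : 'M[R]_n).
Local Notation D := (@unit_disk R).
Hypothesis JJ : Jn *m Jn = 1%:M.

Lemma frame_det F : F *m Jn *m F^T = Jn -> \det F ^+ 2 = 1.
Proof.
move=> /(congr1 determinant); rewrite !det_mulmx det_tr.
have J0 : \det Jn != 0.
  by apply/eqP => J0; have := congr1 determinant JJ; rewrite det_mulmx J0 mul0r det1 => /eqP; rewrite eq_sym oner_eq0.
rewrite mulrAC -expr2 => H; apply: (mulIf J0); by rewrite mul1r.
Qed.

(** The determinant of a frame with Gram matrix [Jn] is 1 or -1 and constant on the disk;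
    multiplying row [i0] by it makes the frame direct. This sign is the reason why heights and
    curvatures are compared by their squares. *)
Lemma direct_frame_sign (r : 'I_n -> 'rV[R]_2 -> 'rV[R]_n) (i0 : 'I_n) :
  (forall i, smooth D (r i)) -> (forall p i j, D p -> sprod Jn (r i p) (r j p) = Jn i j) ->
  (forall j, j != i0 -> Jn i0 j = 0 /\ Jn j i0 = 0) ->
  exists2 e : R, e ^+ 2 = 1 & forall p, D p ->
    direct_frame Jn (\matrix_(i < n) (if i == i0 then e *: r i p else r i p)).
Proof.
move=> sr gr Joff; pose F p : 'M[R]_n := \matrix_(i < n) r i p.
have FJ p : D p -> F p *m Jn *m (F p)^T = Jn.
  by move=> Dp; apply/matrixP => i j; rewrite gram_row !rowK gr.
have sd : smooth D (fun p => \det (F p)).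
  apply: smooth_det; first exact: open_disk.
  move=> i j; apply: (eq_smooth (@open_disk R)) (smooth_coord j (@open_disk R) (sr i)) => p _.
  by rewrite mxE.
have d1 p : D p -> \det (F p) ^+ 2 = 1 by move=> Dp; exact: frame_det (FJ _ Dp).
have dc := smooth_sqr1_const sd d1.
exists (\det (F 0)) => [|p Dp]; first exact: d1 _ (@disk0 R).
split.
  apply/matrixP => i j; rewrite gram_row !rowK.
  have e2 : \det (F 0) * \det (F 0) = 1 by rewrite -expr2 d1//; exact: disk0.
  case: (eqVneq i i0) => [->|ii]; case: (eqVneq j i0) => [->|jj].
  - by rewrite sprodZl sprodZr gr// mulrA e2 mul1r.
  - by rewrite sprodZl gr// (Joff j jj).1 mulr0.
  - by rewrite sprodZr gr// (Joff i ii).2 mulr0.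
  - by rewrite gr.
have -> : \matrix_(i < n) (if i == i0 then \det (F 0) *: r i p else r i p)
   = \matrix_(j < n) (if j == i0 then \det (F 0) *: row j (F p) else row j (F p)).
  by apply/row_matrixP => i; rewrite !rowK.
by rewrite det_scale_row (dc _ Dp) -expr2 d1//; exact: disk0.
Qed.
End DirectFrames.

Lemma sprod1_row_mx_gen (K : comNzRingType) m n (a c : 'rV[K]_m) (b d : 'rV[K]_n) :
  sprod 1%:M (row_mx a b) (row_mx c d) = sprod 1%:M a c + sprod 1%:M b d.
Proof. by rewrite /sprod !mulmx1 tr_row_mx mul_row_col mxE. Qed.

Section Models.
Variable K : comNzRingType.
Local Notation mk := (sprod (minkowski_gram K 4)).

Definition vec5 (w : 'rV[K]_3) (a b : 'rV[K]_1) : 'rV[K]_(4 + 1) := row_mx (row_mx w a : 'rV[K]_(3 + 1)) b.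

Lemma vec5P u : exists w a b, u = vec5 w a b.
Proof.
exists (lsubmx (lsubmx u : 'rV[K]_(3 + 1))), (rsubmx (lsubmx u : 'rV[K]_(3 + 1))), (rsubmx u).
apply: etrans (esym (hsubmxK u)) _; rewrite /vec5.
exact: (congr1 (fun a => row_mx a (rsubmx u)) (esym (@hsubmxK _ 1 3 1 (lsubmx u)))).
Qed.

Lemma mk_vec5 w a b w' a' b' : mk (vec5 w a b) (vec5 w' a' b') = sprod 1%:M w w' + a 0 0 * a' 0 0 - b 0 0 * b' 0 0.
Proof.
rewrite /vec5 minkE; congr (_ - _); rewrite /sprod !mulmx1 (@tr_row_mx _ 1 3 1) (@mul_row_col _ 1 3 1) mxE; congr (_ + _).
by rewrite mxE big_ord1 mxE.
Qed.

(** The sections [<., e> = -1] of the cone: last coordinate 1 for [eS], fourth coordinate -1 for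
    [eH], last minus fourth equal to 1 for [eR]. Dropping the fixed coordinate, or the last two for
    [eR], gives S^3, the two sheets of the hyperboloid and R^3; these are the maps [PS], [PH] and
    [PR]. *)
Definition eS : 'rV[K]_(4 + 1) := vec5 0 0 1%:M.
Definition eH : 'rV[K]_(4 + 1) := vec5 0 1%:M 0.
Definition eR : 'rV[K]_(4 + 1) := vec5 0 1%:M 1%:M.
Definition PS : 'M[K]_(4 + 1, 4) := col_mx 1%:M 0.
Definition PH : 'M[K]_(4 + 1, 4) :=
  col_mx (col_mx (row_mx 1%:M 0 : 'M[K]_(3, 3 + 1)) 0 : 'M[K]_(3 + 1, 3 + 1)) (row_mx 0 1%:M : 'M[K]_(1, 3 + 1)).
Definition PR : 'M[K]_(4 + 1, 3) := col_mx (col_mx 1%:M 0 : 'M[K]_(3 + 1, 3)) 0.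

Lemma mul_PS w a b : vec5 w a b *m PS = row_mx w a.
Proof. by rewrite /vec5 /PS mul_row_col mulmx1 mulmx0 addr0. Qed.

Lemma mul_PR w a b : vec5 w a b *m PR = w.
Proof. by rewrite /vec5 /PR mul_row_col (@mul_row_col _ 1 3 1) mulmx1 !mulmx0 !addr0. Qed.

Lemma mul_PH w a b : vec5 w a b *m PH = row_mx w b.
Proof.
rewrite /vec5 /PH mul_row_col (@mul_row_col _ 1 3 1) mulmx0 addr0 (@mul_mx_row _ 1 3 3 1) (@mul_mx_row _ 1 1 3 1) !mulmx1 !mulmx0.
by rewrite (@add_row_mx _ 1 3 1) addr0 add0r.
Qed.

Lemma mk_eS w a b : mk (vec5 w a b) eS = - b 0 0.
Proof. by rewrite mk_vec5 sprod0r !mxE eqxx mulr1n mulr0 mulr1 !add0r. Qed.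

Lemma mk_eH w a b : mk (vec5 w a b) eH = a 0 0.
Proof. by rewrite mk_vec5 sprod0r !mxE eqxx mulr1n mulr0 mulr1 add0r subr0. Qed.

Lemma mk_eR w a b : mk (vec5 w a b) eR = a 0 0 - b 0 0.
Proof. by rewrite mk_vec5 sprod0r !mxE eqxx mulr1n !mulr1 add0r. Qed.

Lemma isoS u v : mk u eS = 0 -> mk v eS = 0 -> sprod 1%:M (u *m PS) (v *m PS) = mk u v.
Proof.
have [w [a [b ->]]] := vec5P u; have [w' [a' [b' ->]]] := vec5P v.
rewrite !mul_PS !mk_eS mk_vec5 => /eqP; rewrite oppr_eq0 => /eqP -> _; rewrite mul0r subr0.
by rewrite (@sprod1_row_mx_gen _ 3 1); congr (_ + _); rewrite sprod1E big_ord1.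
Qed.

(** Orthogonality to the null vector [eR] makes the last two coordinates equal, so their
    contributions to the form cancel. *)
Lemma isoR u v : mk u eR = 0 -> mk v eR = 0 -> sprod 1%:M (u *m PR) (v *m PR) = mk u v.
Proof.
have [w [a [b ->]]] := vec5P u; have [w' [a' [b' ->]]] := vec5P v.
rewrite !mul_PR !mk_eR mk_vec5 => /eqP; rewrite subr_eq0 => /eqP -> /eqP; rewrite subr_eq0 => /eqP ->.
by rewrite addrK.
Qed.

Lemma isoH u v : mk u eH = 0 -> mk v eH = 0 -> sprod (minkowski_gram K 3) (u *m PH) (v *m PH) = mk u v.
Proof.
have [w [a [b ->]]] := vec5P u; have [w' [a' [b' ->]]] := vec5P v.
rewrite !mul_PH !mk_eH mk_vec5 minkE => -> _; by rewrite mul0r addr0.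
Qed.
End Models.

Section ModelMaps.
Variable R : realType.
Local Notation rc := (real_complex R).

Lemma map_vec5 w a b : map_mx rc (vec5 w a b) = vec5 (map_mx rc w) (map_mx rc a) (map_mx rc b).
Proof. by rewrite /vec5 map_row_mx (@map_row_mx _ _ rc 1 3 1). Qed.

Lemma map_eS : map_mx rc (eS R) = eS R[i].
Proof. by rewrite /eS map_vec5 !map_mx0 map_mx1. Qed.
Lemma map_eH : map_mx rc (eH R) = eH R[i].
Proof. by rewrite /eH map_vec5 !map_mx0 map_mx1. Qed.
Lemma map_eR : map_mx rc (eR R) = eR R[i].
Proof. by rewrite /eR map_vec5 !map_mx0 !map_mx1. Qed.
Lemma map_PS : map_mx rc (PS R) = PS R[i].
Proof. by rewrite /PS !map_col_mx !map_mx0 map_mx1. Qed.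
Lemma map_PR : map_mx rc (PR R) = PR R[i].
Proof. by rewrite /PR map_col_mx (@map_col_mx _ _ rc 3 1 3) !map_mx0 map_mx1. Qed.
Lemma map_PH : map_mx rc (PH R) = PH R[i].
Proof. by rewrite /PH map_col_mx (@map_col_mx _ _ rc 3 1 4) (@map_row_mx _ _ rc 3 3 1) (@map_row_mx _ _ rc 1 3 1) !map_mx0 !map_mx1. Qed.

Lemma isoSC (u v : 'rV[R[i]]_(4 + 1)) : sprod (minkowski_gram R[i] 4) u (map_mx rc (eS R)) = 0 ->
  sprod (minkowski_gram R[i] 4) v (map_mx rc (eS R)) = 0 ->
  csprod 1%:M (u *m map_mx rc (PS R)) (v *m map_mx rc (PS R)) = sprod (minkowski_gram R[i] 4) u v.
Proof. by rewrite map_eS map_PS /csprod map_mx1; exact: isoS. Qed.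
Lemma isoRC (u v : 'rV[R[i]]_(4 + 1)) : sprod (minkowski_gram R[i] 4) u (map_mx rc (eR R)) = 0 ->
  sprod (minkowski_gram R[i] 4) v (map_mx rc (eR R)) = 0 ->
  csprod 1%:M (u *m map_mx rc (PR R)) (v *m map_mx rc (PR R)) = sprod (minkowski_gram R[i] 4) u v.
Proof. by rewrite map_eR map_PR /csprod map_mx1; exact: isoR. Qed.
Lemma isoHC (u v : 'rV[R[i]]_(4 + 1)) : sprod (minkowski_gram R[i] 4) u (map_mx rc (eH R)) = 0 ->
  sprod (minkowski_gram R[i] 4) v (map_mx rc (eH R)) = 0 ->
  csprod (minkowski_gram R 3) (u *m map_mx rc (PH R)) (v *m map_mx rc (PH R)) = sprod (minkowski_gram R[i] 4) u v.
Proof. by rewrite map_eH map_PH /csprod map_mink; exact: isoH. Qed.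
End ModelMaps.

(** * Constant mean curvature and constant vectors *)

Section GramMatrices.
Variable K : comNzRingType.

Lemma mink_entry m (i j : 'I_(m + 1)) :
  minkowski_gram K m i j = if i == j then (if (i < m)%N then 1 else -1) else 0.
Proof.
rewrite /minkowski_gram; case: (split_ordP i) => i' ->; case: (split_ordP j) => j' ->.
- by rewrite block_mxEul mxE eq_lshift; case: (i' == j').
- by rewrite block_mxEur mxE eq_lrshift.
- by rewrite block_mxEdl mxE eq_rlshift.
- by rewrite block_mxEdr !mxE eq_rshift; case: (i' == j'); rewrite ?oppr0.
Qed.

Lemma gram4 n (J : 'M[K]_n) (a b c d : 'rV[K]_n) (A B C D : K) : J^T = J ->
  [/\ sprod J a a = A, sprod J b b = B, sprod J c c = C & sprod J d d = D] ->
  [/\ sprod J a b = 0, sprod J a c = 0 & sprod J a d = 0] ->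
  [/\ sprod J b c = 0, sprod J b d = 0 & sprod J c d = 0] ->
  forall i j : 'I_4, sprod J (nth 0 [:: a; b; c; d] i) (nth 0 [:: a; b; c; d] j)
    = if i == j then nth 0 [:: A; B; C; D] i else 0.
Proof.
move=> JT [aa bb cc dd] [ab ac ad] [bc bd cd].
by move=> [[|[|[|[|i]]]] //= Hi] [[|[|[|[|j]]]] //= Hj]; rewrite // sprodC.
Qed.

Lemma gram3 n (J : 'M[K]_n) (a b c : 'rV[K]_n) (A B C : K) : J^T = J ->
  [/\ sprod J a a = A, sprod J b b = B & sprod J c c = C] ->
  [/\ sprod J a b = 0, sprod J a c = 0 & sprod J b c = 0] ->
  forall i j : 'I_3, sprod J (nth 0 [:: a; b; c] i) (nth 0 [:: a; b; c] j)
    = if i == j then nth 0 [:: A; B; C] i else 0.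
Proof.
move=> JT [aa bb cc] [ab ac bc].
by move=> [[|[|[|i]]] //= Hi] [[|[|[|j]]] //= Hj]; rewrite // sprodC.
Qed.
End GramMatrices.

Lemma mink_sqr (R : realType) m : minkowski_gram R m *m minkowski_gram R m = 1%:M.
Proof.
rewrite /minkowski_gram mulmx_block !mulmx0 !mul0mx !addr0 !add0r mulmx1 mulmxN mulmx1 opprK.
by rewrite [RHS]scalar_mx_block.
Qed.

Lemma mean_curvature_scale (R : realType) n (J : 'M[R]_n) (f N0 N1 : 'rV[R]_2 -> 'rV[R]_n) (c : R) p :
  N1 p = c *: N0 p -> mean_curvature J f N1 p = c%:C * mean_curvature J f N0 p.
Proof.
rewrite /mean_curvature /cplx => ->; rewrite map_mxZ /csprod sprodZr; exact: erefl.
Qed.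

Section Model.
Variables (R : realType) (X N : 'rV[R]_2 -> 'rV[R]_4).
Context {sXN : surface X N}.
Local Notation C := R[i].
Local Notation D := (@unit_disk R).
Local Notation rc := (real_complex R).
Local Notation oD := (@open_disk R).
Local Notation mk := (sprod (minkowski_gram R 4)).
Local Notation mkc := (sprod (minkowski_gram C 4)).
Variables (n : nat) (Jn : 'M[R]_n) (e : 'rV[R]_(4 + 1)) (P : 'M[R]_(4 + 1, n)).
Variables (M : 'M[R]_(4 + 1)) (f : 'rV[R]_2 -> 'rV[R]_n).
Hypothesis JnT : Jn^T = Jn.
Hypothesis JJ : Jn *m Jn = 1%:M.
Hypothesis isoC : forall u v : 'rV[C]_(4 + 1), mkc u (map_mx rc e) = 0 -> mkc v (map_mx rc e) = 0 ->
  csprod Jn (u *m map_mx rc P) (v *m map_mx rc P) = mkc u v.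
Hypothesis LM : lorentz M.
Hypothesis ht0 : forall p, D p -> mk (null_lift (X p) *m M) e != 0.

(** The factor that brings [(X, 1) M] into the section [<., e> = -1]. *)
Definition model_scale p : R := - (mk (null_lift (X p) *m M) e)^-1.
Definition model_cone p := cone_surface X M model_scale p.
Hypothesis fE : forall p, D p -> f p = model_cone p *m P.

Lemma smooth_model_scale : smooth D model_scale.
Proof.
have sh : smooth D (fun p => mk (null_lift (X p) *m M) e).
  apply: (smooth_sprod oD); last exact: smooth_cst oD.
  by apply: (smooth_mulmx oD); exact: smooth_null_lift.
have si := smooth_inv oD ht0 sh; exact: smooth_opp oD si.
Qed.

Lemma model_scale_neq0 p : D p -> model_scale p != 0.
Proof. by move=> Dp; rewrite oppr_eq0 invr_eq0 ht0. Qed.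

Lemma model_cone_height p : D p -> mk (model_cone p) e = -1.
Proof. by move=> Dp; rewrite sprodZl mulNr mulVf// ht0. Qed.

Local Notation nf := (space_normal X N e P M model_scale).
Local Notation kap := (curvature_height X N e M).
Local Notation sc := smooth_model_scale.
Local Notation s0 := model_scale_neq0.
Local Notation me := model_cone_height.

Definition model_tangent (v p : 'rV[R]_2) : 'rV[R]_n :=
  (Num.sqrt (sprod Jn ('D_(ex R) f p) ('D_(ex R) f p)))^-1 *: 'D_v f p.

Let sf : smooth D f. Proof. exact: smooth_space sc fE. Qed.
Let conf p (Dp : D p) := space_conformal isoC LM sc s0 me fE Dp.

Lemma model_unit_tangent v p : D p -> unit_tangent Jn f v p = model_tangent v p.
Proof.
move=> Dp; have [a0 aa _] := conf Dp.
exact: unit_tangentE JnT (smooth_differentiable sf Dp) a0 aa.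
Qed.

Lemma smooth_model_tangent v : smooth D (model_tangent v).
Proof.
have sd w : smooth D ('D_w f) by exact: smooth_derive.
apply: (smooth_scale oD) (sd v); apply: (smooth_inv oD); first by move=> p /conf[a0 _ _]; rewrite gt_eqF// sqrtr_gt0.
by apply: (smooth_sqrt oD); [move=> p /conf[]|exact: (smooth_sprod oD)].
Qed.

Lemma model_tangent_gram p : D p -> [/\ sprod Jn (model_tangent (ex R) p) (model_tangent (ex R) p) = 1,
  sprod Jn (model_tangent (ey R) p) (model_tangent (ey R) p) = 1 &
  sprod Jn (model_tangent (ex R) p) (model_tangent (ey R) p) = 0].
Proof.
have Z (c : R) u w : sprod Jn (c *: u) (c *: w) = c * (c * sprod Jn u w) by rewrite sprodZl sprodZr.
move=> Dp; have [] := conf Dp; rewrite /model_tangent.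
move: ('D_(ex R) f p) ('D_(ey R) f p) => u w; rewrite !Z.
move: (sprod Jn _ _) (sprod Jn _ _) (sprod Jn _ _) => c b a a0 <- ->.
rewrite !mulr0; suff H : (Num.sqrt a)^-1 * ((Num.sqrt a)^-1 * a) = 1 by split.
have r0 : Num.sqrt a != 0 by rewrite gt_eqF// sqrtr_gt0.
have E : a = Num.sqrt a * Num.sqrt a by rewrite -expr2 sqr_sqrtr// ltW.
by rewrite [X in _ * (_ * X)]E mulKf// mulVf.
Qed.

Lemma model_normal_gram p : D p -> [/\ sprod Jn (nf p) (nf p) = 1,
  sprod Jn (model_tangent (ex R) p) (nf p) = 0 & sprod Jn (model_tangent (ey R) p) (nf p) = 0].
Proof.
move=> Dp; have H v (Hv : v = ex R \/ v = ey R) : sprod Jn (nf p) ('D_v f p) = 0.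
  exact: (space_normal_tangent isoC LM sc me fE Dp Hv).
have H1 := H _ (or_introl erefl); have H2 := H _ (or_intror erefl).
split; first exact: (space_normal_unit isoC LM me Dp).
  by rewrite /model_tangent sprodZl (sprodC _ _ JnT); move: H1; move: (sprod Jn _ _) => a ->; rewrite mulr0.
by rewrite /model_tangent sprodZl (sprodC _ _ JnT); move: H2; move: (sprod Jn _ _) => a ->; rewrite mulr0.
Qed.

Lemma model_position_gram a p : D p -> a * mk e e = 1 -> e *m P = 0 -> [/\ sprod Jn (f p) (f p) = - a,
  sprod Jn (f p) (nf p) = 0, sprod Jn (f p) (model_tangent (ex R) p) = 0 & sprod Jn (f p) (model_tangent (ey R) p) = 0].
Proof.
move=> Dp ae eP; have H : mk e (model_cone p + a *: e) = 0.
  by rewrite sprodDr sprodZr ae mkC me// addNr.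
have [H1 [H2 H3]] := space_position isoC LM sc me fE Dp H eP.
split => //; first by rewrite (sprodC _ _ JnT).
  by rewrite /model_tangent sprodZr; move: (H3 (ex R)); move: (sprod Jn _ _) => b ->; rewrite mulr0.
by rewrite /model_tangent sprodZr; move: (H3 (ey R)); move: (sprod Jn _ _) => b ->; rewrite mulr0.
Qed.

Lemma model_mean_curvature p : D p -> mean_curvature Jn f nf p = (- kap p)%:C.
Proof. by move=> Dp; exact: (space_mean_curvature JnT isoC LM sc s0 me fE Dp). Qed.

(** By [frame_normal] the given Gauss map is [nf] up to sign, and the sign disappears in the
    square. *)
Lemma model_height_cmc (F : 'M[R]_n) (Nf : 'rV[R]_2 -> 'rV[R]_n) (i : 'I_n) c p : D p -> F *m Jn *m F^T = Jn ->
  row i F = Nf p -> Jn i i = 1 -> (forall j, j != i -> Jn j i = 0) ->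
  (forall j, j != i -> sprod Jn (row j F) (nf p) = 0) ->
  mean_curvature Jn f Nf p = c%:C -> kap p ^+ 2 = c ^+ 2.
Proof.
move=> Dp FJ FN Jii Ji perp; have [n1 _ _] := model_normal_gram Dp.
have nn : sprod Jn (nf p) (nf p) = sprod Jn (row i F) (row i F) by rewrite n1 -gram_row FJ Jii.
have [k k1 Nk] := frame_normal JJ FJ perp nn Jii Ji.
rewrite (mean_curvature_scale Jn f (N0 := nf) (c := k)); last by rewrite -FN.
rewrite model_mean_curvature// -rmorphM => /complexI <-.
by rewrite exprMn k1 mul1r sqrrN.
Qed.
End Model.

Section ModelS3.
Variables (R : realType) (X N : 'rV[R]_2 -> 'rV[R]_4).
Context {sXN : surface X N}.
Local Notation D := (@unit_disk R).
Local Notation oD := (@open_disk R).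
Local Notation mk := (sprod (minkowski_gram R 4)).
Local Notation Jn := (1%:M : 'M[R]_4).
Local Notation e := (eS R).
Local Notation P := (PS R).
Variables (M : 'M[R]_(4 + 1)) (f : 'rV[R]_2 -> 'rV[R]_4).
Hypothesis LM : lorentz M.
Hypothesis ht : forall p, D p -> mk (null_lift (X p) *m M) e != 0.
Hypothesis fE : forall p, D p -> f p = model_cone X e M p *m P.
Local Notation nf := (space_normal X N e P M (model_scale X e M)).
Local Notation kap := (curvature_height X N e M).
Local Notation T := (model_tangent Jn f).
Let i0 : 'I_4 := Ordinal (isT : 3 < 4)%N.
Let JT : Jn^T = Jn. Proof. exact: trmx1. Qed.
Let JJ : Jn *m Jn = 1%:M. Proof. exact: mulmx1. Qed.
Let eP : e *m P = 0. Proof. by rewrite mul_PS row_mx0. Qed.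
Let ae : (-1) * mk e e = 1. Proof. by rewrite mk_eS !mxE eqxx mulr1n mulrNN mulr1. Qed.

Lemma cmc_S3_height c : cmc_S3 f c -> forall p, D p -> kap p ^+ 2 = c ^+ 2.
Proof.
move=> [Nf gf hf] p Dp; have [FJ _] := gf p Dp.
have [_ n1 n2] := model_normal_gram JT (@isoSC R) LM ht fE Dp.
apply: (model_height_cmc (i := i0) JT JJ (@isoSC R) LM ht fE Dp FJ _ _ _ _ (hf p Dp)).
- by rewrite rowK.
- by rewrite mxE eqxx.
- by move=> j ji; rewrite mxE (negbTE ji).
- case=> -[|[|[|[|//]]]] Hj jn; rewrite rowK /=.
  + have [_ H _ _] := model_position_gram JT (@isoSC R) LM ht fE Dp ae eP; exact: H.
  + rewrite (model_unit_tangent JT (@isoSC R) LM ht fE _ Dp); exact: n1.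
  + rewrite (model_unit_tangent JT (@isoSC R) LM ht fE _ Dp); exact: n2.
  + by case/eqP: jn; exact: val_inj.
Qed.

Lemma height_cmc_S3 H : (forall p, D p -> kap p = H) -> exists2 c : R, c ^+ 2 = H ^+ 2 & cmc_S3 f c.
Proof.
move=> hH; pose r (i : 'I_4) (p : 'rV[R]_2) := nth 0 [:: f p; T (ex R) p; T (ey R) p; nf p] i.
have sr i : smooth D (r i).
  case: i => -[|[|[|[|//]]]] Hi.
  - exact: smooth_space (smooth_model_scale ht) fE.
  - exact: smooth_model_tangent (@isoSC R) LM ht fE _.
  - exact: smooth_model_tangent (@isoSC R) LM ht fE _.
  - exact: smooth_space_normal (smooth_model_scale ht).
have gr p i j : D p -> sprod Jn (r i p) (r j p) = Jn i j.
  move=> Dp; have [n0 n1 n2] := model_normal_gram JT (@isoSC R) LM ht fE Dp.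
  have [t1 t2 t3] := model_tangent_gram (@isoSC R) LM ht fE Dp.
  have [q0 qn q1 q2] := model_position_gram JT (@isoSC R) LM ht fE Dp ae eP.
  apply: etrans (gram4 JT (And4 q0 t1 t2 n0) (And3 q1 q2 qn) (And3 t3 n1 n2) i j) _.
  rewrite mxE; case: (i == j) => //; by case: i => -[|[|[|[|//]]]] Hi; rewrite /= ?opprK.
have Joff j : j != i0 -> Jn i0 j = 0 /\ Jn j i0 = 0.
  move=> ji; have ij : (i0 == j) = false by rewrite eq_sym (negbTE ji).
  by split; rewrite mxE ?ij ?(negbTE ji).
have [s s1 df] := direct_frame_sign JJ sr gr Joff.
(* [s] is the sign that makes the frame direct; the minus comes from [model_mean_curvature]. *)
exists (- (s * H)); first by rewrite sqrrN exprMn s1 mul1r.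
exists (fun p => s *: nf p) => p Dp.
  suff -> : (\matrix_(i < 4) nth 0 [:: f p; unit_tangent Jn f (ex R) p; unit_tangent Jn f (ey R) p; s *: nf p] i) =
     \matrix_(i < 4) (if i == i0 then s *: r i p else r i p) by exact: df.
  apply/row_matrixP => i; rewrite !rowK; case: i => -[|[|[|[|//]]]] Hi.
  - exact: erefl.
  - exact: (model_unit_tangent JT (@isoSC R) LM ht fE _ Dp).
  - exact: (model_unit_tangent JT (@isoSC R) LM ht fE _ Dp).
  - exact: erefl.
rewrite (mean_curvature_scale (R := R) Jn f (N0 := nf) (c := s)); last exact: erefl.
rewrite (model_mean_curvature JT (@isoSC R) LM ht fE Dp) hH//.
by rewrite -rmorphM mulrN.
Qed.
End ModelS3.

Section ModelR3.
Variables (R : realType) (X N : 'rV[R]_2 -> 'rV[R]_4).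
Context {sXN : surface X N}.
Local Notation D := (@unit_disk R).
Local Notation oD := (@open_disk R).
Local Notation mk := (sprod (minkowski_gram R 4)).
Local Notation Jn := (1%:M : 'M[R]_3).
Local Notation e := (eR R).
Local Notation P := (PR R).
Variables (M : 'M[R]_(4 + 1)) (f : 'rV[R]_2 -> 'rV[R]_3).
Hypothesis LM : lorentz M.
Hypothesis ht : forall p, D p -> mk (null_lift (X p) *m M) e != 0.
Hypothesis fE : forall p, D p -> f p = model_cone X e M p *m P.
Local Notation nf := (space_normal X N e P M (model_scale X e M)).
Local Notation kap := (curvature_height X N e M).
Local Notation T := (model_tangent Jn f).
Let i0 : 'I_3 := Ordinal (isT : 2 < 3)%N.
Let JT : Jn^T = Jn. Proof. exact: trmx1. Qed.
Let JJ : Jn *m Jn = 1%:M. Proof. exact: mulmx1. Qed.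

Lemma cmc_R3_height c : cmc_R3 f c -> forall p, D p -> kap p ^+ 2 = c ^+ 2.
Proof.
move=> [Nf gf hf] p Dp; have [FJ _] := gf p Dp.
have [_ n1 n2] := model_normal_gram JT (@isoRC R) LM ht fE Dp.
apply: (model_height_cmc (i := i0) JT JJ (@isoRC R) LM ht fE Dp FJ _ _ _ _ (hf p Dp)).
- by rewrite rowK.
- by rewrite mxE eqxx.
- by move=> j ji; rewrite mxE (negbTE ji).
- case=> -[|[|[|//]]] Hj jn; rewrite rowK /=.
  + rewrite (model_unit_tangent JT (@isoRC R) LM ht fE _ Dp); exact: n1.
  + rewrite (model_unit_tangent JT (@isoRC R) LM ht fE _ Dp); exact: n2.
  + by case/eqP: jn; exact: val_inj.
Qed.

Lemma height_cmc_R3 H : (forall p, D p -> kap p = H) -> exists2 c : R, c ^+ 2 = H ^+ 2 & cmc_R3 f c.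
Proof.
move=> hH; pose r (i : 'I_3) (p : 'rV[R]_2) := nth 0 [:: T (ex R) p; T (ey R) p; nf p] i.
have sr i : smooth D (r i).
  case: i => -[|[|[|//]]] Hi.
  - exact: smooth_model_tangent (@isoRC R) LM ht fE _.
  - exact: smooth_model_tangent (@isoRC R) LM ht fE _.
  - exact: smooth_space_normal (smooth_model_scale ht).
have gr p i j : D p -> sprod Jn (r i p) (r j p) = Jn i j.
  move=> Dp; have [n0 n1 n2] := model_normal_gram JT (@isoRC R) LM ht fE Dp.
  have [t1 t2 t3] := model_tangent_gram (@isoRC R) LM ht fE Dp.
  apply: etrans (gram3 JT (And3 t1 t2 n0) (And3 t3 n1 n2) i j) _.
  rewrite mxE; case: (i == j) => //; by case: i => -[|[|[|//]]] Hi.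
have Joff j : j != i0 -> Jn i0 j = 0 /\ Jn j i0 = 0.
  move=> ji; have ij : (i0 == j) = false by rewrite eq_sym (negbTE ji).
  by split; rewrite mxE ?ij ?(negbTE ji).
have [s s1 df] := direct_frame_sign JJ sr gr Joff.
exists (- (s * H)); first by rewrite sqrrN exprMn s1 mul1r.
exists (fun p => s *: nf p) => p Dp.
  suff -> : (\matrix_(i < 3) nth 0 [:: unit_tangent Jn f (ex R) p; unit_tangent Jn f (ey R) p; s *: nf p] i) =
     \matrix_(i < 3) (if i == i0 then s *: r i p else r i p) by exact: df.
  apply/row_matrixP => i; rewrite !rowK; case: i => -[|[|[|//]]] Hi.
  - exact: (model_unit_tangent JT (@isoRC R) LM ht fE _ Dp).
  - exact: (model_unit_tangent JT (@isoRC R) LM ht fE _ Dp).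
  - exact: erefl.
rewrite (mean_curvature_scale (R := R) Jn f (N0 := nf) (c := s)); last exact: erefl.
rewrite (model_mean_curvature JT (@isoRC R) LM ht fE Dp) hH//.
by rewrite -rmorphM mulrN.
Qed.
End ModelR3.

Section ModelH3.
Variables (R : realType) (X N : 'rV[R]_2 -> 'rV[R]_4).
Context {sXN : surface X N}.
Local Notation D := (@unit_disk R).
Local Notation oD := (@open_disk R).
Local Notation mk := (sprod (minkowski_gram R 4)).
Local Notation Jn := (minkowski_gram R 3).
Local Notation e := (eH R).
Local Notation P := (PH R).
Variables (M : 'M[R]_(4 + 1)) (f : 'rV[R]_2 -> 'rV[R]_4).
Hypothesis LM : lorentz M.
Hypothesis ht : forall p, D p -> mk (null_lift (X p) *m M) e != 0.
Hypothesis fE : forall p, D p -> f p = model_cone X e M p *m P.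
Local Notation nf := (space_normal X N e P M (model_scale X e M)).
Local Notation kap := (curvature_height X N e M).
Local Notation T := (model_tangent Jn f).
Let i0 : 'I_4 := Ordinal (isT : 2 < 4)%N.
Let JT : Jn^T = Jn. Proof. exact: mink_tr. Qed.
Let JJ : Jn *m Jn = 1%:M. Proof. exact: mink_sqr. Qed.
Let eP : e *m P = 0. Proof. by rewrite mul_PH row_mx0. Qed.
Let ae : 1 * mk e e = 1. Proof. by rewrite mk_eH !mxE eqxx mulr1n mulr1. Qed.

Lemma cmc_H3_height c : cmc_H3 f c -> forall p, D p -> kap p ^+ 2 = c ^+ 2.
Proof.
move=> [Nf gf hf] p Dp; have [FJ _] := gf p Dp.
have [_ n1 n2] := model_normal_gram JT (@isoHC R) LM ht fE Dp.
apply: (model_height_cmc (i := i0) JT JJ (@isoHC R) LM ht fE Dp FJ _ _ _ _ (hf p Dp)).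
- by rewrite rowK.
- by rewrite (mink_entry R (m := 3)).
- by move=> j ji; rewrite (mink_entry R (m := 3)) (negbTE ji).
- case=> -[|[|[|[|//]]]] Hj jn; rewrite rowK /=.
  + rewrite (model_unit_tangent JT (@isoHC R) LM ht fE _ Dp); exact: n1.
  + rewrite (model_unit_tangent JT (@isoHC R) LM ht fE _ Dp); exact: n2.
  + by case/eqP: jn; exact: val_inj.
  + have [_ H _ _] := model_position_gram JT (@isoHC R) LM ht fE Dp ae eP; exact: H.
Qed.

Lemma height_cmc_H3 H : (forall p, D p -> kap p = H) -> exists2 c : R, c ^+ 2 = H ^+ 2 & cmc_H3 f c.
Proof.
move=> hH; pose r (i : 'I_4) (p : 'rV[R]_2) := nth 0 [:: T (ex R) p; T (ey R) p; nf p; f p] i.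
have sr i : smooth D (r i).
  case: i => -[|[|[|[|//]]]] Hi.
  - exact: smooth_model_tangent (@isoHC R) LM ht fE _.
  - exact: smooth_model_tangent (@isoHC R) LM ht fE _.
  - exact: smooth_space_normal (smooth_model_scale ht).
  - exact: smooth_space (smooth_model_scale ht) fE.
have gr p i j : D p -> sprod Jn (r i p) (r j p) = Jn i j.
  move=> Dp; have [n0 n1 n2] := model_normal_gram JT (@isoHC R) LM ht fE Dp.
  have [t1 t2 t3] := model_tangent_gram (@isoHC R) LM ht fE Dp.
  have [q0 qn q1 q2] := model_position_gram JT (@isoHC R) LM ht fE Dp ae eP.
  have q1' := etrans (sprodC _ _ JT) q1; have q2' := etrans (sprodC _ _ JT) q2; have qn' := etrans (sprodC _ _ JT) qn.
  apply: etrans (gram4 JT (And4 t1 t2 n0 q0) (And3 t3 n1 q1') (And3 n2 q2' qn') i j) _.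
  rewrite (mink_entry R (m := 3)); case: (i == j) => //; by case: i => -[|[|[|[|//]]]] Hi.
have Joff j : j != i0 -> Jn i0 j = 0 /\ Jn j i0 = 0.
  move=> ji; have ij : (i0 == j) = false by rewrite eq_sym (negbTE ji).
  by split; rewrite (mink_entry R (m := 3)) ?ij ?(negbTE ji).
have [s s1 df] := direct_frame_sign JJ sr gr Joff.
exists (- (s * H)); first by rewrite sqrrN exprMn s1 mul1r.
exists (fun p => s *: nf p) => p Dp.
  suff -> : (\matrix_(i < 4) nth 0 [:: unit_tangent Jn f (ex R) p; unit_tangent Jn f (ey R) p; s *: nf p; f p] i) =
     \matrix_(i < 4) (if i == i0 then s *: r i p else r i p) by exact: df.
  apply/row_matrixP => i; rewrite !rowK; case: i => -[|[|[|[|//]]]] Hi.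
  - exact: (model_unit_tangent JT (@isoHC R) LM ht fE _ Dp).
  - exact: (model_unit_tangent JT (@isoHC R) LM ht fE _ Dp).
  - exact: erefl.
  - exact: erefl.
rewrite (mean_curvature_scale (R := R) Jn f (N0 := nf) (c := s)); last exact: erefl.
rewrite (model_mean_curvature JT (@isoHC R) LM ht fE Dp) hH//.
by rewrite -rmorphM mulrN.
Qed.
End ModelH3.

Section Vectors.
Variable R : realType.
Local Notation mk := (sprod (minkowski_gram R 4)).
Local Notation eS := (eS R).
Local Notation eR := (eR R).
Local Notation eH := (eH R).

Lemma mk_eSS : mk eS eS = -1. Proof. by rewrite mk_eS !mxE eqxx mulr1n. Qed.
Lemma mk_eHH : mk eH eH = 1. Proof. by rewrite mk_eH !mxE eqxx mulr1n. Qed.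
Lemma mk_eRR : mk eR eR = 0. Proof. by rewrite mk_eR !mxE eqxx mulr1n subrr. Qed.

Lemma row4_split (m : 'rV[R]_4) : m = row_mx (lsubmx (m : 'rV[R]_(3 + 1))) (m 0 ord_max)%:M.
Proof.
have Emax : (ord_max : 'I_4) = rshift 3 (0 : 'I_1) by apply: val_inj.
apply: etrans (esym (@hsubmxK _ 1 3 1 m)) _.
congr (row_mx _ _).
by apply/rowP => j; rewrite (ord1 j) !mxE eqxx mulr1n Emax.
Qed.

Lemma null_lift_vec5 (m : 'rV[R]_4) : null_lift m = vec5 (lsubmx (m : 'rV[R]_(3 + 1))) (m 0 ord_max)%:M 1%:M.
Proof. by rewrite /null_lift {1}(row4_split m). Qed.

Lemma row4_max (w : 'rV[R]_3) (a : 'rV[R]_1) : (row_mx w a : 'rV[R]_4) 0 ord_max = a 0 0.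
Proof.
have -> : (ord_max : 'I_4) = rshift 3 (0 : 'I_1) by apply: val_inj.
by rewrite (@row_mxEr _ 1 3 1).
Qed.

Lemma null_lift_stereo y : let q := sprod 1%:M y y in
  null_lift (stereo_inv (Some y)) = vec5 ((1 + q)^-1 *: (2 *: y)) ((1 + q)^-1 *: (q - 1)%:M) (1%:M : 'rV[R]_1).
Proof. by rewrite /null_lift /vec5 /= (@scale_row_mx _ 1 3 1). Qed.

Lemma sprod1_ge0 n (y : 'rV[R]_n) : 0 <= sprod 1%:M y y.
Proof. by rewrite sprod1E; apply: sumr_ge0 => i _; rewrite -expr2 sqr_ge0. Qed.

(** If [v] is not orthogonal to [eR], then [v - eR] is not null and its reflection maps [v] to [eR].
    Otherwise the two orthogonal null vectors are proportional, and the factor [k] suffices. *)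
Lemma null_to_eR (v : 'rV[R]_(4 + 1)) : mk v v = 0 -> v != 0 ->
  exists k M, [/\ k != 0, lorentz M & (k *: v) *m M = eR].
Proof.
move=> vv v0; have [d0|d0] := eqVneq (mk v eR) 0; last first.
  have aa : mk (v - eR) (v - eR) = - 2 * mk v eR.
    rewrite !(sprodDl, sprodDr, sprodNl, sprodNr) vv mk_eRR (mkC eR v); ring.
  exists 1, (reflection (v - eR)); split; first exact: oner_neq0.
    by apply: lorentz_reflection; rewrite aa mulf_neq0// oppr_eq0 pnatr_eq0.
  rewrite scale1r reflectionE aa sprodDr sprodNr vv sub0r.
  have -> : 2 / (- 2 * mk v eR) * - mk v eR = 1 by move: (mk v eR) d0 => d d0; field.
  by rewrite scale1r opprB addrC subrK.
move: vv v0 d0; have [w [a [b ->]]] := vec5P v.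
rewrite mk_eR mk_vec5 => vv v0 /eqP; rewrite subr_eq0 => /eqP ab.
rewrite ab addrK in vv.
have w0 : w = 0 by apply/eqP; apply: contraTT isT => /sprod1_sqr_gt0; rewrite vv ltxx.
have {}ab : a = b by apply/rowP => j; rewrite (ord1 j).
have vE : vec5 w a b = b 0 0 *: eR.
  rewrite w0 ab /eR /vec5 scale_row_mx (@scale_row_mx _ 1 3 1) scaler0.
  have -> // : b 0 0 *: (1%:M : 'rV[R]_1) = b.
  by apply/rowP => j; rewrite (ord1 j) !mxE eqxx mulr1.
have b0 : b 0 0 != 0 by apply: contraNneq v0 => b0; rewrite vE b0 scale0r.
exists (b 0 0)^-1, 1%:M; split; first by rewrite invr_eq0.
  by rewrite /lorentz mul1mx trmx1 mulmx1.
by rewrite mulmx1 vE scalerA mulVf// scale1r.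
Qed.

Lemma lorentz_mul (M1 M2 : 'M[R]_(4 + 1)) : lorentz M1 -> lorentz M2 -> lorentz (M1 *m M2).
Proof. by move=> L1 L2; apply: lorentz_ext => u v; rewrite !mulmxA !lorentz_sprod. Qed.

(** The reflection changes the sign of [model_scale] and keeps the last coordinate, so it moves a
    surface from one sheet of the hyperboloid to the other. *)
Lemma reflection_eH u : mk (u *m reflection eH) eH = - mk u eH /\
  (u *m reflection eH) 0 (rshift 4 0) = u 0 (rshift 4 0).
Proof.
rewrite reflectionE mk_eHH divr1; split.
  by rewrite sprodDl sprodNl sprodZl mk_eHH; ring.
have e5 : eH 0 (rshift 4 0) = 0 by rewrite /eH /vec5 row_mxEr mxE.
have L c (w : 'rV[R]_(4 + 1)) : (u - c *: w) 0 (rshift 4 0) = u 0 (rshift 4 0) - c * w 0 (rshift 4 0) by rewrite !mxE.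
by rewrite L e5 mulr0 subr0.
Qed.
End Vectors.

(** * Conformal transformations and constant vectors *)

Section Glue.
Variables (R : realType) (X N : 'rV[R]_2 -> 'rV[R]_4) (Phi : 'rV[R]_2 -> option 'rV[R]_3).
Context {sXN : surface X N}.
Local Notation D := (@unit_disk R).
Local Notation oD := (@open_disk R).
Local Notation mk := (sprod (minkowski_gram R 4)).
Local Notation YR := (real_gauss X N).
Local Notation eS := (eS R).
Local Notation eR := (eR R).
Local Notation eH := (eH R).
Hypothesis PhiE : forall p, D p -> Phi p = stereo (X p).

Let XS p : D p -> S3 (X p). Proof. exact: surface_S3. Qed.

Section Lorentz.
Variable M : 'M[R]_(4 + 1).
Hypothesis LM : lorentz M.
Let k p : R := (null_lift (X p) *m M) 0 (rshift 4 0).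
Let k0 p : D p -> k p != 0. Proof. by move=> Dp; exact: lift_unit LM (XS Dp). Qed.
Let lm p : D p -> null_lift (X p) *m M = k p *: null_lift (mob M (X p)).
Proof. by move=> Dp; exact: lift_mob LM (XS Dp). Qed.

Lemma model_cone_mob e p : D p -> mk (null_lift (mob M (X p))) e != 0 ->
  model_cone X e M p = - (mk (null_lift (mob M (X p))) e)^-1 *: null_lift (mob M (X p)).
Proof.
move=> Dp; rewrite /model_cone /cone_surface /model_scale (lm Dp) sprodZl scalerA.
move: (k p) (k0 Dp) (mk _ e) => c c0 h h0; congr (_ *: _); by field; rewrite ?c0 ?h0.
Qed.

Lemma mob_height_neq0 e p : D p -> (mk (null_lift (X p) *m M) e != 0) = (mk (null_lift (mob M (X p))) e != 0).
Proof. by move=> Dp; rewrite (lm Dp) sprodZl mulf_eq0 negb_or (k0 Dp). Qed.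

Lemma mob_S3_height p : D p -> mk (null_lift (X p) *m M) eS != 0.
Proof.
by move=> Dp; rewrite (mob_height_neq0 _ Dp) null_lift_vec5 mk_eS !mxE eqxx mulr1n oppr_eq0 oner_neq0.
Qed.

Lemma mob_S3_model p : D p -> mob M (X p) = model_cone X eS M p *m PS R.
Proof.
move=> Dp; have h1 : mk (null_lift (mob M (X p))) eS = -1 by rewrite null_lift_vec5 mk_eS !mxE eqxx mulr1n.
rewrite (model_cone_mob Dp) h1 ?oppr_eq0 ?oner_neq0// invrN1 opprK scale1r null_lift_vec5 mul_PS.
exact: row4_split.
Qed.

Lemma conformal_diffeo_R3hat_mob : conformal_diffeo_R3hat (fun u => stereo (mob M (stereo_inv u))).
Proof.
apply: (eq_conformal_diffeo (f := mob M)) (conformal_diffeo_mob LM) => x x1.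
by rewrite (stereo_invK x1) stereo_invK//; exact: mob_S3.
Qed.

Lemma mob_stereo p : D p -> mob M (X p) 0 ord_max != 1 ->
  stereo (mob M (stereo_inv (Phi p))) = Some ((1 - mob M (X p) 0 ord_max)^-1 *: lsubmx (mob M (X p) : 'rV[R]_(3 + 1))).
Proof. by move=> Dp m1; rewrite PhiE// (stereo_invK (XS Dp)) /stereo (negbTE m1). Qed.
End Lorentz.

(** By Liouville's theorem the transformation is some [mob M], and the vector is the preimage of
    [eS] under [M]. The analogues for R^3 and H^3 replace [eS] by [eR] and [eH]. *)
Lemma conformally_cmc_S3_vector c : conformally_cmc_S3 X c ->
  exists2 v, mk v v = -1 & forall p, D p -> mk (YR p) v ^+ 2 = c ^+ 2.
Proof.
move=> [phi cphi cm]; have [M LM phiE] := liouville cphi.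
have fE p : D p -> phi (X p) = model_cone X eS M p *m PS R.
  by move=> Dp; rewrite (phiE _ (XS Dp)); exact: (mob_S3_model LM Dp).
exists (eS *m lorentz_inv M); first by rewrite lorentz_sprod ?mk_eSS//; exact: lorentz_invP.
exact: cmc_S3_height LM (mob_S3_height LM) fE c cm.
Qed.

Lemma conformally_cmc_R3_vector c : conformally_cmc_R3 Phi c ->
  exists v, [/\ v != 0, mk v v = 0 & forall p, D p -> mk (YR p) v ^+ 2 = c ^+ 2].
Proof.
move=> [phi [Psi [cphi phiPsi cm]]]; have [M LM phiE] := liouville cphi.
have mE p : D p -> mob M (X p) = stereo_inv (Some (Psi p)).
  by move=> Dp; rewrite -(phiE _ (XS Dp)) -(PhiE Dp) phiPsi.
(* This height is nonzero because [Psi] is finite: only the pole, whose null lift is [eR] itself,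
   has a lift orthogonal to [eR]. *)
have h1 p : D p -> mk (null_lift (mob M (X p))) eR = - (2 / (1 + sprod 1%:M (Psi p) (Psi p))).
  move=> Dp; rewrite (mE _ Dp) null_lift_stereo mk_eR !mxE eqxx !mulr1n.
  by move: (sprod _ _ _) (sprod1_ge0 (Psi p)) => q q0; field; rewrite gt_eqF// ltr_pwDl.
have q0 p : 1 + sprod 1%:M (Psi p) (Psi p) != 0 by rewrite gt_eqF// ltr_pwDl// sprod1_ge0.
have h0 p : D p -> mk (null_lift (mob M (X p))) eR != 0.
  by move=> Dp; rewrite h1// oppr_eq0 mulf_neq0// invr_eq0.
have ht p : D p -> mk (null_lift (X p) *m M) eR != 0 by move=> Dp; rewrite mob_height_neq0// h0.
have fE p : D p -> Psi p = model_cone X eR M p *m PR R.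
  move=> Dp; rewrite (model_cone_mob LM Dp (h0 _ Dp)) (h1 _ Dp) (mE _ Dp) null_lift_stereo -scalemxAl mul_PR !scalerA.
  have -> : - (- (2 / (1 + sprod 1%:M (Psi p) (Psi p))))^-1 * (1 + sprod 1%:M (Psi p) (Psi p))^-1 * 2 = 1.
    by move: (1 + sprod _ _ _) (q0 p) => q q1; field.
  by rewrite scale1r.
exists (eR *m lorentz_inv M); split.
- apply/eqP => /(congr1 (fun v => v *m M)); rewrite -mulmxA lorentz_mulVl// mulmx1 mul0mx.
  move=> /(congr1 (fun v : 'rV[R]_(4 + 1) => v 0 (rshift 4 0))); rewrite row_mxEr !mxE eqxx => /eqP.
  by rewrite oner_eq0.
- by rewrite lorentz_sprod ?mk_eRR//; exact: lorentz_invP.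
- exact: cmc_R3_height LM ht fE c cm.
Qed.

Lemma conformally_cmc_H3_vector c : conformally_cmc_H3 Phi c ->
  exists2 v, mk v v = 1 & forall p, D p -> mk (YR p) v ^+ 2 = c ^+ 2.
Proof.
move=> [phi [W [cphi phiW cm]]]; have [M LM phiE] := liouville cphi.
have mE p : D p -> mob M (X p) = stereo_inv (Some (hstereo (W p))).
  by move=> Dp; rewrite -(phiE _ (XS Dp)) -(PhiE Dp); have [_ ->] := phiW p Dp.
(* With [t] the last coordinate of [W p], the equation of the hyperboloid makes [t] nonzero, hence
   positive, and gives the square norm [(t - 1) / (t + 1)] in the ball model. *)
have tq p : D p -> 0 < W p 0 ord_max /\ sprod 1%:M (hstereo (W p)) (hstereo (W p)) = (W p 0 ord_max - 1) / (W p 0 ord_max + 1).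
  move=> Dp; have [[WW t0] _] := phiW p Dp; rewrite /hstereo sprodZl sprodZr; move: WW.
  have -> : sprod (minkowski_gram R 3) (W p) (W p) = sprod 1%:M (lsubmx (W p : 'rV[R]_(3 + 1))) (lsubmx (W p : 'rV[R]_(3 + 1))) - W p 0 ord_max * W p 0 ord_max.
    by rewrite {1 2}(row4_split (W p)) minkE !mxE eqxx !mulr1n.
  move: (W p 0 ord_max) t0 (sprod _ _ _) (sprod1_ge0 (lsubmx (W p : 'rV[R]_(3 + 1)))) => t t0 s s0 E.
  have tt : t != 0 by apply: contraTneq s0 => tz; rewrite tz mulr0 subr0 in E; rewrite -ltNge; lra.
  have {}t0 : 0 < t by rewrite lt_def tt.
  split=> //; have -> : s = (t - 1) * (t + 1) by move: E => /eqP; rewrite addrAC addr_eq0 => /eqP E; move: E; lra.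
  by field; rewrite gt_eqF// ltr_wpDl// ltW.
have h1 p : D p -> mk (null_lift (mob M (X p))) eH = - (W p 0 ord_max)^-1.
  move=> Dp; have [t0 qE] := tq p Dp; rewrite (mE _ Dp) null_lift_stereo mk_eH !mxE eqxx !mulr1n qE.
  move: (W p 0 ord_max) t0 => t t0; have t1 : t + 1 != 0 by rewrite gt_eqF// addr_gt0.
  have -> : 1 + (t - 1) / (t + 1) = 2 * t / (t + 1) by field.
  by field; rewrite t1 gt_eqF.
have h0 p : D p -> mk (null_lift (mob M (X p))) eH != 0.
  by move=> Dp; have [t0 _] := tq p Dp; rewrite h1// oppr_eq0 invr_eq0 gt_eqF.
have ht p : D p -> mk (null_lift (X p) *m M) eH != 0 by move=> Dp; rewrite mob_height_neq0// h0.
have fE p : D p -> W p = model_cone X eH M p *m PH R.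
  move=> Dp; have [t0 qE] := tq p Dp.
  rewrite (model_cone_mob LM Dp (h0 _ Dp)) (h1 _ Dp) (mE _ Dp) null_lift_stereo -scalemxAl mul_PH (@scale_row_mx _ 1 3 1) qE.
  rewrite /hstereo !scalerA invrN opprK invrK.
  have -> : W p 0 ord_max * (1 + (W p 0 ord_max - 1) / (W p 0 ord_max + 1))^-1 * 2 * (1 + W p 0 ord_max)^-1 = 1.
    move: (W p 0 ord_max) t0 => t t0; have t1 : t + 1 != 0 by rewrite gt_eqF// addr_gt0.
    have -> : 1 + (t - 1) / (t + 1) = 2 * t / (t + 1) by field.
    by field; rewrite addrC t1 gt_eqF.
  rewrite scale1r scale_scalar_mx mulr1; exact: row4_split.
exists (eH *m lorentz_inv M); first by rewrite lorentz_sprod ?mk_eHH//; exact: lorentz_invP.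
exact: cmc_H3_height LM ht fE c cm.
Qed.

Section FromVector.
Variables (v : 'rV[R]_(4 + 1)) (H : R).
Hypothesis v_tau : forall p, D p -> mk (null_lift (X p)) v != 0.
Hypothesis v_height : forall p, D p -> mk (YR p) v = H.

Let sqr_eq0 (c H' : R) : c ^+ 2 = H' ^+ 2 -> H' = 0 -> c = 0.
Proof. by move=> + h0; rewrite h0 expr0n => /eqP; rewrite sqrf_eq0 => /eqP. Qed.

Let pull (M : 'M[R]_(4 + 1)) (e u : 'rV[R]_(4 + 1)) : lorentz M -> u *m M = e -> e *m lorentz_inv M = u.
Proof. by move=> LM <-; rewrite -mulmxA lorentz_mulV// mulmx1. Qed.

Lemma vector_conformally_cmc_S3 : mk v v = -1 -> exists2 c, H = 0 -> c = 0 & conformally_cmc_S3 X c.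
Proof.
move=> vv; have [|M LM vM] := @lorentz_transitive R v eS (etrans vv (esym (mk_eSS R))).
  by rewrite mk_eSS oppr_eq0 oner_neq0.
have hH p : D p -> curvature_height X N eS M p = H by move=> Dp; rewrite /curvature_height (pull LM vM) v_height.
have [c cH cm] := height_cmc_S3 LM (mob_S3_height LM) (mob_S3_model LM) hH.
exists c; first exact: sqr_eq0.
by exists (mob M) => //; exact: conformal_diffeo_mob.
Qed.

Lemma vector_conformally_cmc_R3 : mk v v = 0 -> v != 0 -> exists2 c, H = 0 -> c = 0 & conformally_cmc_R3 Phi c.
Proof.
move=> vv v0; have [k [M [k0 LM vM]]] := null_to_eR vv v0.
have hH p : D p -> curvature_height X N eR M p = k * H.
  by move=> Dp; rewrite /curvature_height (pull LM vM) sprodZr v_height.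
have ht p : D p -> mk (null_lift (X p) *m M) eR != 0.
  by move=> Dp; rewrite (lorentz_adjoint _ _ LM) (pull LM vM) sprodZr mulf_neq0// v_tau.
have h0 p : D p -> mk (null_lift (mob M (X p))) eR != 0 by move=> Dp; rewrite -mob_height_neq0// ht.
have h1 p : mk (null_lift (mob M (X p))) eR = mob M (X p) 0 ord_max - 1.
  by rewrite null_lift_vec5 mk_eR !mxE eqxx !mulr1n.
pose Psi p := (1 - mob M (X p) 0 ord_max)^-1 *: lsubmx (mob M (X p) : 'rV[R]_(3 + 1)).
have fE p : D p -> Psi p = model_cone X eR M p *m PR R.
  move=> Dp; rewrite (model_cone_mob LM Dp (h0 _ Dp)) h1 null_lift_vec5 -scalemxAl mul_PR.
  by rewrite -invrN opprB.
have [c cH cm] := height_cmc_R3 LM ht fE hH.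
exists c; first by move=> H0; apply: (sqr_eq0 cH); rewrite H0 mulr0.
exists (fun u => stereo (mob M (stereo_inv u))), Psi; split => //; first exact: conformal_diffeo_R3hat_mob.
by move=> p Dp; apply: mob_stereo => //; have := h0 _ Dp; rewrite h1 subr_eq0.
Qed.

(** Positivity of the last coordinate places the model surface on the upper sheet of the
    hyperboloid, which is [H3]. *)
Lemma positive_conformally_cmc_H3 M K : lorentz M -> (forall p, D p -> mk (null_lift (X p) *m M) eH != 0) ->
  (forall p, D p -> 0 < model_cone X eH M p 0 (rshift 4 0)) ->
  (forall p, D p -> curvature_height X N eH M p = K) -> exists2 c, K = 0 -> c = 0 & conformally_cmc_H3 Phi c.
Proof.
move=> LM ht pos hK.
have h0 p : D p -> mk (null_lift (mob M (X p))) eH != 0 by move=> Dp; rewrite -mob_height_neq0// ht.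
have h1 p : mk (null_lift (mob M (X p))) eH = mob M (X p) 0 ord_max.
  by rewrite null_lift_vec5 mk_eH !mxE eqxx !mulr1n.
pose W p := model_cone X eH M p *m PH R.
have fE p : D p -> W p = model_cone X eH M p *m PH R by [].
have [c cK cm] := height_cmc_H3 LM ht fE hK.
pose t p := - (mob M (X p) 0 ord_max)^-1.
have coneE p : D p -> model_cone X eH M p = t p *: null_lift (mob M (X p)).
  by move=> Dp; rewrite (model_cone_mob LM Dp (h0 _ Dp)) h1.
have t0 p : D p -> 0 < t p.
  by move=> Dp; have := pos p Dp; rewrite (coneE _ Dp) mxE row_mxEr mxE eqxx mulr1.
have WE p : D p -> W p = row_mx (t p *: lsubmx (mob M (X p) : 'rV[R]_(3 + 1))) (t p)%:M.
  by move=> Dp; rewrite /W (coneE _ Dp) null_lift_vec5 -scalemxAl mul_PH (@scale_row_mx _ 1 3 1) scale_scalar_mx mulr1.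
exists c; first exact: sqr_eq0.
exists (fun u => stereo (mob M (stereo_inv u))), W; split => //; first exact: conformal_diffeo_R3hat_mob.
move=> p Dp; have tp := t0 _ Dp; split.
  have eP : eH *m PH R = 0 by rewrite mul_PH row_mx0.
  have ae : 1 * mk eH eH = 1 by rewrite mk_eHH mulr1.
  have [q0 _ _ _] := model_position_gram (mink_tr R 3) (@isoHC R) LM ht fE Dp ae eP.
  split; first by rewrite q0 addNr.
  by rewrite (WE _ Dp) row4_max mxE eqxx mulr1n ltW.
have m0 : mob M (X p) 0 ord_max != 0 by rewrite -h1 h0.
have m1 : mob M (X p) 0 ord_max < 0 by move: tp; rewrite /t oppr_gt0 invr_lt0.
rewrite mob_stereo//; last by rewrite lt_eqF// (lt_trans m1).
have tE : ((t p)%:M : 'rV[R]_1) 0 0 = t p by rewrite mxE eqxx mulr1n.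
congr Some; rewrite /hstereo (WE _ Dp) row4_max (@row_mxKl _ 1 3 1) scalerA tE; congr (_ *: _).
rewrite /t; move: (mob M (X p) 0 ord_max) m0 m1 => a a0 a1.
have h2 : a - 1 != 0 by rewrite subr_eq0 lt_eqF// (lt_trans a1).
have h3 : 1 - a != 0 by rewrite -opprB oppr_eq0.
have -> : 1 + - a^-1 = (a - 1) / a by field.
by field; rewrite ?a0 ?h2 ?h3.
Qed.

(** The section for [eH] has two sheets, and the surface does not change sheet over the disk. If it
    lies on the lower one, [M] is followed by the reflection in [eH], which only changes the sign of
    the height. *)
Lemma vector_conformally_cmc_H3 : mk v v = 1 -> exists2 c, H = 0 -> c = 0 & conformally_cmc_H3 Phi c.
Proof.
move=> vv; have [|M LM vM] := @lorentz_transitive R v eH (etrans vv (esym (mk_eHH R))).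
  by rewrite mk_eHH oner_neq0.
have ht p : D p -> mk (null_lift (X p) *m M) eH != 0.
  by move=> Dp; rewrite (lorentz_adjoint _ _ LM) (pull LM vM) v_tau.
have hH p : D p -> curvature_height X N eH M p = H by move=> Dp; rewrite /curvature_height (pull LM vM) v_height.
pose d p := model_cone X eH M p 0 (rshift 4 0).
have dE p : d p = - (mk (null_lift (X p) *m M) eH)^-1 * (null_lift (X p) *m M) 0 (rshift 4 0).
  by rewrite /d /model_cone /cone_surface mxE.
have sd : smooth D d by apply: smooth_coord oD _; exact: smooth_cone_surface (smooth_model_scale ht).
have d0 p : D p -> d p != 0.
  by move=> Dp; rewrite dE mulf_neq0 ?oppr_eq0 ?invr_eq0 ?ht//; exact: lift_unit LM (XS Dp).
have sg := smooth_sign_const sd d0.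
have [dp|dn] := boolP (0 < d 0).
  by apply: (positive_conformally_cmc_H3 LM ht) => // p Dp; rewrite -/(d p) sg.
have Lr : lorentz (reflection eH) by apply: lorentz_reflection; rewrite mk_eHH oner_neq0.
pose M' := M *m reflection eH; have LM' : lorentz M' by exact: lorentz_mul.
have mkM' u : mk (u *m M') eH = - mk (u *m M) eH by rewrite mulmxA; have [-> _] := reflection_eH (u *m M).
have ht' p : D p -> mk (null_lift (X p) *m M') eH != 0 by move=> Dp; rewrite mkM' oppr_eq0 ht.
have [||c cH cm] := @positive_conformally_cmc_H3 M' (- H) LM' ht'.
- move=> p Dp; rewrite /model_cone /cone_surface mxE /model_scale mkM' mulmxA.
  have [_ ->] := reflection_eH (null_lift (X p) *m M).
  have -> : - (- mk (null_lift (X p) *m M) eH)^-1 * (null_lift (X p) *m M) 0 (rshift 4 0) = - d p by rewrite dE invrN; ring.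
  by rewrite oppr_gt0 lt_neqAle d0//= leNgt sg.
- move=> p Dp; rewrite /curvature_height -(lorentz_adjoint _ _ LM') mkM' (lorentz_adjoint _ _ LM).
  by rewrite (pull LM vM) v_height.
by exists c => // H0; apply: cH; rewrite H0 oppr0.
Qed.
End FromVector.
End Glue.

Lemma conj_fixed (R : realType) (a : R[i]) : conjc a = a -> a = (complex.Re a)%:C.
Proof. by case: a => x y [] yy; have -> : y = 0 by lra. Qed.

Lemma mk_height (K : comNzRingType) (h s : K) (x n w : 'rV[K]_4) :
  sprod (minkowski_gram K 4) (h *: row_mx x 1%:M + row_mx n 0) (row_mx w s%:M)
  = h * (sprod 1%:M x w - s) + sprod 1%:M n w.
Proof. by rewrite sprodDl sprodZl !minkE !mxE eqxx !mulr1n mul1r mul0r subr0. Qed.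

(** * Causal type of the constant vector, discriminant and Willmore operator *)

Section Heights.
Variables (R : realType) (X N : 'rV[R]_2 -> 'rV[R]_4) (Phi : 'rV[R]_2 -> option 'rV[R]_3).
Context {sXN : surface X N}.
Local Notation C := R[i].
Local Notation D := (@unit_disk R).
Local Notation oD := (@open_disk R).
Local Notation rc := (real_complex R).
Local Notation mk := (sprod (minkowski_gram R 4)).
Local Notation YR := (real_gauss X N).
Local Notation om := (tracefree_curvature X N).
Hypothesis PhiE : forall p, D p -> Phi p = stereo (X p).

Definition gauss_height (v : 'rV[R]_(4 + 1)) (H : R) : Prop :=
  v != 0 /\ forall p, D p -> mk (YR p) v = H.

(** A smooth function of constant nonzero square keeps its sign on the disk. *)
Lemma sqr_gauss_height v c : v != 0 -> (forall p, D p -> mk (YR p) v ^+ 2 = c ^+ 2) ->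
  exists2 H, gauss_height v H & H ^+ 2 = c ^+ 2.
Proof.
move=> v0 hc; have d0 := @disk0 R; exists (mk (YR 0) v); last exact: hc.
split=> // p Dp; have [c0|c0] := eqVneq c 0.
  have z q : D q -> mk (YR q) v = 0 by move=> Dq; apply/eqP; rewrite -sqrf_eq0 hc// c0 expr0n.
  by rewrite !z.
have sd : smooth D (fun q => mk (YR q) v * c^-1).
  apply: (smooth_mul oD); last exact: smooth_cst oD.
  by apply: (smooth_sprod oD); [exact: smooth_real_gauss|exact: smooth_cst oD].
have s1 q : D q -> (mk (YR q) v * c^-1) ^+ 2 = 1.
  by move=> Dq; rewrite exprMn hc// -exprMn divff// expr1n.
by apply: (mulIf (invr_neq0 c0)); exact: (smooth_sqr1_const sd s1 Dp).
Qed.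

Section Height.
Variables (v : 'rV[R]_(4 + 1)) (H : R).
Let w : 'rV[C]_4 := map_mx rc (lsubmx v).
Let s : C := (rsubmx v 0 0)%:C.

Let map_v : map_mx rc v = row_mx w s%:M.
Proof.
rewrite -{1}(hsubmxK v) map_row_mx; congr (row_mx _ _).
by apply/rowP => j; rewrite (ord1 j) [LHS]mxE [RHS]mxE eqxx mulr1n.
Qed.

Let wr : map_mx conjc w = w.
Proof. by apply/rowP => j; rewrite !mxE; exact: conjc_real. Qed.

Let sr : conjc s = s. Proof. exact: conjc_real. Qed.

Let tauE p : tauv X w s p = (mk (null_lift (X p)) v)%:C.
Proof.
rewrite -mk_map map_v /null_lift map_row_mx map_mx1 minkE /tauv !mxE.
by rewrite eqxx !mulr1n mul1r.
Qed.

Let heightE p : D p -> mean_curvature 1%:M X N p * tauv X w s p + etav N w p = (mk (YR p) v)%:C.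
Proof.
move=> Dp; rewrite -mk_map (cplx_real_gauss Dp) map_v; exact: esym (mk_height _ _ _ _ _).
Qed.

Let vvE : sprod 1%:M w w - s ^+ 2 = (mk v v)%:C.
Proof. by rewrite -mk_map map_v minkE !mxE eqxx !mulr1n expr2. Qed.

Hypothesis vH : gauss_height v H.

Let HY q : D q -> mean_curvature 1%:M X N q * tauv X w s q + etav N w q = H%:C.
Proof. by move=> Dq; rewrite heightE//; have [_ ->] := vH. Qed.

Let ws : w != 0 \/ s != 0.
Proof.
have [w0|] := eqVneq w 0; last by left.
right; have [v0 _] := vH; apply: contraNneq v0 => s0.
by rewrite -(map_mx_eq0 rc) map_v w0 s0 raddf0 row_mx0.
Qed.

Lemma gauss_height_tau p : D p -> mk (null_lift (X p)) v != 0.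
Proof.
move=> Dp; apply/eqP => t0; case/eqP: (tau_neq0 (sXN := sXN) wr HY ws Dp).
by rewrite tauE t0.
Qed.

Let factor p : D p -> exists2 z : R, z != 0 & sqnorm_dz 1%:M X p * ucoef X N p * conjc (ucoef X N p) = z%:C.
Proof.
move=> Dp; have E0 := sqnorm_neq0 (sXN := sXN) Dp; have u0 := u_neq0 (sXN := sXN) Dp; have Er := conj_sqnorm (sXN := sXN) Dp.
move: (sqnorm_dz 1%:M X p) (ucoef X N p) E0 u0 Er => E u E0 u0 Er.
have uc : conjc u != 0.
  apply/eqP => h; case/eqP: u0; rewrite -[u]conjcK h; apply: complexP => /=; by rewrite ?oppr0.
have Z0 : E * u * conjc u != 0 by exact: mulf_neq0 (mulf_neq0 E0 u0) uc.
have ZE : E * u * conjc u = (complex.Re (E * u * conjc u))%:C.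
  by apply: conj_fixed; rewrite conjcM conjcM conjcK Er -!mulrA [conjc u * _]mulrC.
exists (complex.Re (E * u * conjc u)) => //.
apply/eqP => z0; case/eqP: Z0; by rewrite ZE z0.
Qed.

Lemma gauss_height_discriminant p : D p -> exists2 k : R, 0 < k & bryant_discriminant X N p = (k * mk v v)%:C.
Proof.
move=> Dp; have t0 := gauss_height_tau Dp; have [z z0 zE] := factor Dp.
have := discriminant_tau HY Dp; rewrite zE tauE vvE; move: (bryant_discriminant X N p) => d E.
move: (mk (null_lift (X p)) v) (mk v v) t0 E => t m t0 E.
(* This is [discriminant_tau] divided by the square of tau, with [z = E |u|^2]. *)
exists ((z / t) ^+ 2); first by rewrite lt_def sqr_ge0 sqrf_eq0 mulf_neq0// invr_eq0.
have tc : (t%:C : C) ^+ 2 != 0 by rewrite expf_neq0// fmorph_eq0.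
apply: (mulfI tc); rewrite E -!rmorphXn -!rmorphM; congr (_%:C); by field.
Qed.

Lemma gauss_height_willmore p : D p -> willmore X N p = 0 <-> H = 0.
Proof.
move=> Dp; have t0 := gauss_height_tau Dp; have [z z0 zE] := factor Dp.
have := willmore_tau HY Dp; rewrite zE tauE.
have tc : ((mk (null_lift (X p)) v)%:C : C) != 0 by rewrite fmorph_eq0.
have zc : (z%:C : C) != 0 by rewrite fmorph_eq0.
move: ((mk (null_lift (X p)) v)%:C) (willmore X N p) tc => t W tc E; split=> [W0|H0].
  have /eqP : (z%:C : C) * H%:C = 0 by rewrite -E W0 mul0r.
  by rewrite mulf_eq0 (negbTE zc) fmorph_eq0 => /eqP.
by apply: (mulIf tc); rewrite E H0 mulr0 mul0r.
Qed.

Lemma gauss_height_bryant : holomorphic_on D (bryant X N).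
Proof.
move=> p Dp; have sQ : csmooth D (bryant X N) by exact: bryant_smooth.
exact: (holomorphic_dzbar sQ Dp).2 (bryant_holo wr HY ws sr Dp).
Qed.

(** In the chart of [holomorphic_chart] for [tau / omega], the square of the derivative of [psi] is
    [c tau / omega], so the transformed omega is the real function [c tau]. *)
Lemma gauss_height_isothermic : isothermic X N.
Proof.
move=> p Dp; have o0 q : D q -> om q != 0 by move=> Dq; exact: surface_umb.
have sV : csmooth D (fun q => (om q)^-1) by exact: csmooth_inv.
have sg : csmooth D (fun q => tauv X w s q * (om q)^-1) by exact: csmooth_mul.
have g0 q : D q -> tauv X w s q * (om q)^-1 != 0.
  by move=> Dq; rewrite mulf_neq0 ?invr_eq0 ?o0//; exact: (tau_neq0 wr HY ws Dq).
have [U [psi [c [oU sp ip [UD pU] HU]]]] := holomorphic_chart sg (fun q Dq => tau_om_holo HY Dq) g0 Dp.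
have H1 q : U q -> speed psi (ey R) q = 1 * ('i * speed psi (ex R) q).
  by move=> Uq; rewrite mul1r; have [] := HU q Uq.
exists U, psi; split; [exact: oU| |exact: ip| |].
- split=> [|q Uq]; first exact: sp.
  have [h1 h2 _] := HU q Uq; move: h1 h2; rewrite /speed.
  move: ('D_(ex R) psi q) ('D_(ey R) psi q) => a b; rewrite /of_plane => h1 h2.
  have e0 := congr1 (@complex.Re R) h1; have e1 := congr1 (@complex.Im R) h1.
  rewrite /= in e0 e1; rewrite !sprod1E !big_ord_recl !big_ord0 !addr0.
  have l0 : lift ord0 (ord0 : 'I_1) = 1 :> 'I_2 by apply: val_inj.
  rewrite l0 -[ord0]/(0 : 'I_2) e0 e1.
  have a0 : 0 < a 0 0 * a 0 0 + a 0 1 * a 0 1.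
    rewrite -!expr2 lt_def addr_ge0 ?sqr_ge0// andbT; apply: contraNneq h2 => /eqP.
    by rewrite paddr_eq0 ?sqr_ge0// !sqrf_eq0 => /andP[/eqP -> /eqP ->].
  move: a0; move: (a 0 0) (a 0 1) => x y a0; split=> //; ring.
- by split=> [_ [q Uq <-]|]; [exact: UD|exact: pU].
- move=> q Uq; have [_ _ h3] := HU q Uq; have Dq := UD _ Uq.
  rewrite (tracefree_hol oU sp UD H1 erefl Uq) h3 tauE.
  have o1 := o0 _ Dq; move: (om (psi q)) (mk _ v) o1 => o t o1.
  have -> : o * (c%:C * (t%:C * o^-1)) = c%:C * t%:C by move: (c%:C) (t%:C) => c' t'; field.
  by apply/complex_realP; exists (c * t); rewrite rmorphM.
Qed.
End Height.

(** The components given by [exists_const_vector] are complex numbers fixed by conjugation; their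
    real parts form the vector. *)
Lemma exists_gauss_height : holomorphic_on D (bryant X N) -> isothermic X N -> exists v H, gauss_height v H.
Proof.
move=> hQ iso; have sQ : csmooth D (bryant X N) by exact: bryant_smooth.
have [w [s [H [wr sr Hr ws HY]]]] := exists_const_vector (fun q Dq => (holomorphic_dzbar sQ Dq).1 (hQ q Dq)) (isothermic_theta iso).
pose v : 'rV[R]_(4 + 1) := row_mx (map_mx (@complex.Re R) w) ((complex.Re s)%:M).
have mv : map_mx rc v = row_mx w s%:M.
  rewrite map_row_mx; congr (row_mx _ _); apply/rowP => j.
    rewrite !mxE; apply/esym/conj_fixed.
    by have := congr1 (fun w : 'rV[C]_4 => w 0 j) wr; rewrite mxE.
  by rewrite (ord1 j) !mxE eqxx !mulr1n -conj_fixed.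
exists v, (complex.Re H); split.
  apply: contraTneq isT => v0; move: mv; rewrite v0 map_mx0 => mv.
  have w0 : w = 0 by have := congr1 lsubmx mv; rewrite row_mxKl linear0.
  have s0 : s = 0.
    have := congr1 (fun u : 'rV[C]_(4 + 1) => u 0 (rshift 4 0)) mv.
    by rewrite row_mxEr !mxE eqxx mulr1n.
  by case: ws; rewrite ?w0 ?s0 eqxx.
move=> p Dp; apply: (fmorph_inj rc); rewrite /= -(conj_fixed Hr) -(HY p Dp).
rewrite -[LHS]mk_map (cplx_real_gauss Dp) mv; exact: mk_height.
Qed.

Lemma gauss_heightZ k v H : k != 0 -> gauss_height v H -> gauss_height (k *: v) (k * H).
Proof.
move=> k0 [v0 vH]; split=> [|p Dp]; first by rewrite scaler_eq0 negb_or k0.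
by rewrite sprodZr vH.
Qed.

Lemma cmc_S3_gauss_height c : conformally_cmc_S3 X c ->
  exists v H, [/\ gauss_height v H, mk v v < 0 & H ^+ 2 = c ^+ 2].
Proof.
move=> /conformally_cmc_S3_vector[v vv vc].
have v0 : v != 0 by apply: contra_eq_neq vv => ->; rewrite sprod0l eq_sym oppr_eq0 oner_neq0.
have [H vH Hc] := sqr_gauss_height v0 vc.
by exists v, H; split=> //; rewrite vv ltrN10.
Qed.

Lemma cmc_R3_gauss_height c : conformally_cmc_R3 Phi c ->
  exists v H, [/\ gauss_height v H, mk v v = 0 & H ^+ 2 = c ^+ 2].
Proof.
move=> /(conformally_cmc_R3_vector PhiE)[v [v0 vv vc]].
by have [H vH Hc] := sqr_gauss_height v0 vc; exists v, H.
Qed.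

Lemma cmc_H3_gauss_height c : conformally_cmc_H3 Phi c ->
  exists v H, [/\ gauss_height v H, 0 < mk v v & H ^+ 2 = c ^+ 2].
Proof.
move=> /(conformally_cmc_H3_vector PhiE)[v vv vc].
have v0 : v != 0 by apply: contra_eq_neq vv => ->; rewrite sprod0l eq_sym oner_neq0.
have [H vH Hc] := sqr_gauss_height v0 vc.
by exists v, H; split=> //; rewrite vv ltr01.
Qed.

Lemma gauss_height_cmc_R3 v H : gauss_height v H -> mk v v = 0 ->
  exists2 c, H = 0 -> c = 0 & conformally_cmc_R3 Phi c.
Proof.
move=> vH vv; have [v0 hH] := vH.
exact: (vector_conformally_cmc_R3 PhiE (fun p Dp => gauss_height_tau vH Dp) hH vv v0).
Qed.

Lemma gauss_height_cmc_S3 v H : gauss_height v H -> mk v v < 0 ->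
  exists2 c, H = 0 -> c = 0 & conformally_cmc_S3 X c.
Proof.
move=> vH vv; pose r := Num.sqrt (- mk v v).
have r0 : r != 0 by rewrite gt_eqF// sqrtr_gt0 oppr_gt0.
have rr : r * r = - mk v v by rewrite -expr2 sqr_sqrtr// oppr_ge0 ltW.
have r1 := invr_neq0 r0; have vH' := gauss_heightZ r1 vH; have [_ hH'] := vH'.
have vv' : mk (r^-1 *: v) (r^-1 *: v) = -1.
  rewrite sprodZl sprodZr -[mk v v]opprK -rr; by field.
have [c Hc cm] := vector_conformally_cmc_S3 hH' vv'.
by exists c => // H0; apply: Hc; rewrite H0 mulr0.
Qed.

Lemma gauss_height_cmc_H3 v H : gauss_height v H -> 0 < mk v v ->
  exists2 c, H = 0 -> c = 0 & conformally_cmc_H3 Phi c.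
Proof.
move=> vH vv; pose r := Num.sqrt (mk v v).
have r0 : r != 0 by rewrite gt_eqF// sqrtr_gt0.
have rr : r * r = mk v v by rewrite -expr2 sqr_sqrtr// ltW.
have r1 := invr_neq0 r0; have vH' := gauss_heightZ r1 vH; have [_ hH'] := vH'.
have vv' : mk (r^-1 *: v) (r^-1 *: v) = 1 by rewrite sprodZl sprodZr -rr; field.
have [c Hc cm] := vector_conformally_cmc_H3 PhiE (fun p Dp => gauss_height_tau vH' Dp) hH' vv'.
by exists c => // H0; apply: Hc; rewrite H0 mulr0.
Qed.

(** Common to the three geometries: [P] is the causal type and [PC] the matching condition on the
    discriminant. The discriminant is a positive multiple of [<u, u>] for every admissible [u].
    Hence the condition at the origin decides the type of the given vector, and the type of any
    admissible vector gives the condition everywhere. The vanishing of the height is read off the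
    Willmore operator in the same way. *)
Lemma cmc_iff_discriminant (conf : R -> Prop) (P : R -> Prop) (PC : C -> Prop) :
  (forall c, conf c -> exists v H, [/\ gauss_height v H, P (mk v v) & H ^+ 2 = c ^+ 2]) ->
  (forall v H, gauss_height v H -> P (mk v v) -> exists2 c, H = 0 -> c = 0 & conf c) ->
  (forall k x, 0 < k -> PC (k * x)%:C <-> P x) ->
  (exists v H, gauss_height v H) ->
  ((exists c, conf c) <-> forall p, D p -> PC (bryant_discriminant X N p)) /\
  (conf 0 <-> forall p, D p -> PC (bryant_discriminant X N p) /\ willmore X N p = 0).
Proof.
move=> confv vconf PCE [v [H vH]]; have d0 := @disk0 R.
have disc p u K : D p -> gauss_height u K -> PC (bryant_discriminant X N p) <-> P (mk u u).
  by move=> Dp uK; have [k k0 ->] := gauss_height_discriminant uK Dp; exact: PCE.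
split; split.
- by move=> [c /confv[u [K [uK Pu _]]]] p Dp; apply/(disc _ _ _ Dp uK).
- by move=> hp; have [c _ cc] := vconf v H vH ((disc _ _ _ d0 vH).1 (hp _ d0)); exists c.
- move=> /confv[u [K [uK Pu K0]]] p Dp; split; first by apply/(disc _ _ _ Dp uK).
  apply/(gauss_height_willmore uK Dp); apply/eqP; rewrite -sqrf_eq0 K0 expr0n; exact: eqxx.
- move=> hp; have [h1 h2] := hp _ d0.
  have [c cH cc] := vconf v H vH ((disc _ _ _ d0 vH).1 h1).
  by rewrite -(cH ((gauss_height_willmore vH d0).1 h2)).
Qed.
End Heights.

Theorem theorem1p5 (R : realType) (X N : 'rV[R]_2 -> 'rV[R]_4)
    (Phi : 'rV[R]_2 -> option 'rV[R]_3)
    (X_S3 : forall p, unit_disk p -> S3 (X p))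
    (X_conf : conformal_immersion 1%:M (@unit_disk R) X)
    (N_gauss : gauss_map_S3 X N)
    (Phi_rep : forall p, unit_disk p -> Phi p = stereo (X p))
    (no_umbilic : forall p, unit_disk p -> tracefree_curvature X N p != 0) :
  [/\ (conformally_CMC_R3 Phi \/ conformally_CMC_S3 X \/ conformally_CMC_H3 Phi)
        <-> (holomorphic_on (@unit_disk R) (bryant X N) /\ isothermic X N),
      (holomorphic_on (@unit_disk R) (bryant X N) /\ isothermic X N ->
        [/\ forall p, unit_disk p -> bryant_discriminant X N p \is Num.real,
            (conformally_CMC_R3 Phi <->
               forall p, unit_disk p -> bryant_discriminant X N p = 0) /\
            (conformally_minimal_R3 Phi <->
               forall p, unit_disk p ->
                 bryant_discriminant X N p = 0 /\ willmore X N p = 0),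
            (conformally_CMC_S3 X <->
               forall p, unit_disk p -> bryant_discriminant X N p < 0) /\
            (conformally_minimal_S3 X <->
               forall p, unit_disk p ->
                 bryant_discriminant X N p < 0 /\ willmore X N p = 0) &
            (conformally_CMC_H3 Phi <->
               forall p, unit_disk p -> 0 < bryant_discriminant X N p) /\
            (conformally_minimal_H3 Phi <->
               forall p, unit_disk p ->
                 0 < bryant_discriminant X N p /\ willmore X N p = 0)]) &
      (conformally_minimal_R3 Phi \/ conformally_minimal_S3 X \/
         conformally_minimal_H3 Phi ->
       forall p, unit_disk p -> willmore X N p = 0)].
Proof.
have sXN : surface X N by split.
have cR := cmc_R3_gauss_height (sXN := sXN) Phi_rep; have cS := cmc_S3_gauss_height (sXN := sXN); have cH := cmc_H3_gauss_height (sXN := sXN) Phi_rep.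
have holo v H : gauss_height X N v H -> holomorphic_on (@unit_disk R) (bryant X N) /\ isothermic X N.
  by move=> vH; split; [exact: gauss_height_bryant vH|exact: gauss_height_isothermic vH].
have minW v H : gauss_height X N v H -> H ^+ 2 = 0 ^+ 2 -> forall p, unit_disk p -> willmore X N p = 0.
  move=> vH H0 p Dp.
  have H1 : H = 0 by apply/eqP; rewrite -sqrf_eq0 H0 expr0n.
  exact: (gauss_height_willmore vH Dp).2 H1.
split.
- split; first by move=> [[c /cR[v [H [vH _ _]]]]|[[c /cS[v [H [vH _ _]]]]|[c /cH[v [H [vH _ _]]]]]]; exact: holo vH.
  move=> [hQ iso]; have [v [H vH]] := exists_gauss_height (sXN := sXN) hQ iso.
  (* The causal type of the vector selects the ambient space. *)
  case: (ltgtP (sprod (minkowski_gram R 4) v v) 0) => vv.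
  + by right; left; have [c _ cc] := gauss_height_cmc_S3 vH vv; exists c.
  + by right; right; have [c _ cc] := gauss_height_cmc_H3 (sXN := sXN) Phi_rep vH vv; exists c.
  + by left; have [c _ cc] := gauss_height_cmc_R3 (sXN := sXN) Phi_rep vH vv; exists c.
- move=> [hQ iso]; have hv := exists_gauss_height (sXN := sXN) hQ iso; split.
  + move=> p Dp; have [v [H vH]] := hv; have [k _ ->] := gauss_height_discriminant vH Dp.
    by apply/complex_realP; exists (k * sprod (minkowski_gram R 4) v v).
  + apply: (cmc_iff_discriminant (sXN := sXN) (P := fun x => x = 0) (PC := fun z => z = 0) cR (gauss_height_cmc_R3 (sXN := sXN) Phi_rep)) hv.
    move=> k x k0; split=> [/eqP|->]; last by rewrite mulr0.
    by rewrite fmorph_eq0 mulf_eq0 gt_eqF//= => /eqP.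
  + apply: (cmc_iff_discriminant (sXN := sXN) (P := fun x => x < 0) (PC := fun z => z < 0) cS (gauss_height_cmc_S3 (sXN := sXN))) hv.
    by move=> k x k0; rewrite ltcR pmulr_rlt0.
  + apply: (cmc_iff_discriminant (sXN := sXN) (P := fun x => 0 < x) (PC := fun z => 0 < z) cH (gauss_height_cmc_H3 (sXN := sXN) Phi_rep)) hv.
    by move=> k x k0; rewrite ltcR pmulr_rgt0.
- by move=> [/cR[v [H [vH _ H0]]]|[/cS[v [H [vH _ H0]]]|/cH[v [H [vH _ H0]]]]]; exact: minW vH H0.
Qed.
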